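(* Let $f(z)=\eta(z)^2\eta(2z)^2\eta(3z)^2\eta(6z)^2$, where $\eta$ is the Dedekind eta function; $f$ is the newform of weight $4$ and level $\Gamma_0(6)$. Let $\pi$ be the cuspidal automorphic representation of $\mathrm{PGL}_2(\mathbb{A})$ generated by $f$. Then for every imaginary quadratic field $E$ such that $-\Delta_E$ is a prime number and $\varepsilon(\tfrac12,\pi\otimes\eta_E)=1$, we have $L(\tfrac12,\pi\otimes\eta_E)\neq 0$.
   Context: $\mathbb{A}$ is the ring of adèles of $\mathbb{Q}$. For a quadratic field $E$, $\Delta_E$ is its fundamental discriminant and $\eta_E$ is the quadratic idèle class character of $\mathbb{Q}$ attached to $E/\mathbb{Q}$. $L(s,\pi\otimes\eta_E)$ is the automorphic $L$-function of the twist, normalized so that the center is $s=\tfrac12$, and $\varepsilon(\tfrac12,\pi\otimes\eta_E)\in\{\pm1\}$ is its global root number. *)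

(* Defs.v *)
From Stdlib Require Import Reals ZArith Znumtheory.
From Coquelicot Require Import Coquelicot.
From mathcomp Require Import ssreflect ssrbool ssrnat seq prime.

(* Imaginary quadratic fields via their fundamental discriminants.     *)

Definition squarefreeZ (m : Z) : Prop :=
  forall k : Z, Z.divide (k * k) m -> k = 1%Z \/ k = (-1)%Z.

Definition fund_disc (D : Z) : Prop :=
  D <> 1%Z /\
  ((Z.modulo D 4 = 1%Z /\ squarefreeZ D) \/
   (exists m : Z, D = (4 * m)%Z /\
      (Z.modulo m 4 = 2%Z \/ Z.modulo m 4 = 3%Z) /\ squarefreeZ m)).

Definition kron_prime (D : Z) (l : nat) : Z :=
  if Nat.eqb l 2 then
    (if Z.even D then 0%Z
     else if orb (Z.eqb (Z.modulo D 8) 1) (Z.eqb (Z.modulo D 8) 7) then 1%Z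
     else (-1)%Z)
  else
    (if Z.eqb (Z.modulo D (Z.of_nat l)) 0 then 0%Z
     else if has (fun x : nat => Z.eqb (Z.modulo (Z.of_nat x * Z.of_nat x - D)
                                          (Z.of_nat l)) 0) (iota 0 l)
          then 1%Z else (-1)%Z).

(* Kronecker symbol (D / n) for n >= 1, extended completely multiplicatively.
   For a fundamental discriminant D = Delta_E this is the Dirichlet character
   corresponding to the quadratic idele class character eta_E. *)
Definition eta_char (D : Z) (n : nat) : Z :=
  foldr (fun pe acc => (Z.pow (kron_prime D (fst pe)) (Z.of_nat (snd pe)) * acc)%Z)
        1%Z (prime_decomp n).

(* The q-expansion of f = eta(z)^2 eta(2z)^2 eta(3z)^2 eta(6z)^2       *)
(*   = q * prod_{m>=1} (1-q^m)^2 (1-q^{2m})^2 (1-q^{3m})^2 (1-q^{6m})^2 *)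
(* (eta(z) = q^{1/24} prod (1-q^m), q = e^{2 pi i z}).                 *)

Definition coefZ (p : seq Z) (i : nat) : Z := nth 0%Z p i.

Definition mul_trunc (N : nat) (p q : seq Z) : seq Z :=
  mkseq (fun k => foldr Z.add 0%Z
          (map (fun i => (coefZ p i * coefZ q (k - i))%Z) (iota 0 k.+1))) N.+1.

Definition one_minus_qpow (N m : nat) : seq Z :=
  mkseq (fun k => if Nat.eqb k 0 then 1%Z else if Nat.eqb k m then (-1)%Z else 0%Z) N.+1.

Definition sq_trunc (N : nat) (p : seq Z) := mul_trunc N p p.

Definition eta_prod_trunc (N : nat) : seq Z :=
  foldr (fun m acc =>
     mul_trunc N acc
       (mul_trunc N (mul_trunc N (sq_trunc N (one_minus_qpow N m))
                                 (sq_trunc N (one_minus_qpow N (2 * m))))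
                    (mul_trunc N (sq_trunc N (one_minus_qpow N (3 * m)))
                                 (sq_trunc N (one_minus_qpow N (6 * m))))))
   [:: 1%Z] (iota 1 N).

Definition f_coef (n : nat) : Z :=
  match n with O => 0%Z | S n' => coefZ (eta_prod_trunc n) n' end.

Definition cpow (x : R) (s : C) : C :=
  (exp (Re s * ln x) * cos (Im s * ln x), exp (Re s * ln x) * sin (Im s * ln x))%R.

Definition entire (F : C -> C) : Prop :=
  forall s : C, ex_derive (K := C_AbsRing) (V := C_NormedModule) F s.

Definition gauss_seq (s : C) (n : nat) : C :=
  Cdiv (Cmult (RtoC (INR (fact n))) (cpow (INR n) s))
       (foldr (fun k acc => Cmult (Cplus s (RtoC (INR k))) acc) (RtoC 1) (iota 0 n.+1)).

Definition is_Gamma (s g : C) : Prop :=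
  filterlim (gauss_seq s) eventually (locally g).

Definition GammaC_of (s g : C) : C :=
  Cmult (RtoC 2) (Cmult (cpow (2 * PI) (Copp s)) g).

(* L(s, pi (x) eta_E), analytic normalisation (centre 1/2).            *)

(* n-th term of the Dirichlet series sum_n lambda(n) eta_E(n) n^{-s},
   lambda(n) = a(n) / n^{3/2} (weight k = 4). *)
Definition Lterm (D : Z) (s : C) (n : nat) : C :=
  match n with
  | O => RtoC 0
  | _ => Cmult (RtoC (IZR (f_coef n) / Rpower (INR n) (3 / 2) * IZR (eta_char D n)))
               (cpow (INR n) (Copp s))
  end.

Definition is_twisted_L (D : Z) (F : C -> C) : Prop :=
  entire F /\
  forall s : C, (1 < Re s)%R -> is_series (Lterm D s) (F s).

Definition central_value_nonzero (D : Z) : Prop :=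
  forall F : C -> C, is_twisted_L D F -> F (RtoC (1 / 2)) <> RtoC 0.

(* eps(1/2, pi (x) eta_E) = +1 : the completed L-function
   Lambda(s) = Gamma_C(s + 3/2) L(s) satisfies Lambda(s) = N^{1/2-s} Lambda(1-s)
   for some (conductor) N > 0, i.e. the sign of the functional equation is +1.
   Checked on the strip -3/2 < Re s < 5/2 where both Gamma arguments are
   regular (this determines the identity everywhere). *)
Definition root_number_plus (D : Z) : Prop :=
  exists N : R, (0 < N)%R /\
  forall F : C -> C, is_twisted_L D F ->
  forall (s g1 g2 : C),
    (-3/2 < Re s < 5/2)%R ->
    is_Gamma (Cplus s (RtoC (3/2))) g1 ->
    is_Gamma (Cplus (Cminus (RtoC 1) s) (RtoC (3/2))) g2 ->
    Cmult (GammaC_of (Cplus s (RtoC (3/2))) g1) (F s) =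
    Cmult (cpow N (Cminus (RtoC (1/2)) s))
          (Cmult (GammaC_of (Cplus (Cminus (RtoC 1) s) (RtoC (3/2))) g2)
                 (F (Cminus (RtoC 1) s))).

(* Main.v *)
(** By Kronecker reciprocity [eta_char (-p)] is the Legendre symbol [chi] modulo
    the prime [p = 3 mod 4].  The Eichler integral [Ei z = sum a(n) n^-3 e(n z)]
    of [f] transforms under the group generated by [T], the Fricke involution
    [W = (0,-1;6,0)] and the Atkin-Lehner element [e3 = (3,-2;6,-3)] with a
    cocycle of quadratic polynomials whose real parts are integral multiples of a
    single period [om], nonzero because [f] is positive on the axes [Re z = 0]
    and [Re z = 1/2].  Summing [Im (Ei (A/p + i y))] over the residues with
    [chi A = 1] and using the Gauss sum gives, for [E y = sum a(n) chi(n) n^-3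
    exp (- 2 pi n y)], a functional equation
    [E y + eps N y^2 E (1/(N y)) = q0 + q1 y + q2 y^2], and the Mellin
    transform shows that [q1 = 0] if [eps = 1] and [L (1/2) = 0].  The integer
    [q1 p / om] (up to an explicit factor) is nonzero by a congruence modulo 8:
    a descent over the group compares the cocycle with the shifts of
    [kappa = Re ((24 / (- 2 pi i)) log (eta (z) / eta (2 z)))], whose residues at
    the cusps are known.  If [eps = -1] then a functional equation with sign [+1]
    would force [L = 0] near [1/2], hence [a(1) = 0]. *)

Require Import Defs.
From Stdlib Require Import Reals ZArith Znumtheory.
From Coquelicot Require Import Coquelicot.
From Stdlib Require Import Lra Lia Psatz Classical ClassicalEpsilon List Permutation.

(** * The Kronecker symbol *)

(** The obstacle is that the integer [b], which governs [q1], is produced letter by letter along a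
    word in the generators. What becomes tractable is [b + l], with [l] the shift of [K4]: modulo 8
    it depends only on residues of the matrix entries, so each generator is settled by a finite
    check. The shift is then removed through a second description, the radial limit of [K4] at the
    cusp; conjugation and multiplication by 3 control the sum of these limits over the residues. The
    element [e3] serves twice. It brings in the period [om], and it closes the gap in the descent:
    translations and [W] shrink the lower row only for cusps at distance less than 1/sqrt 6 from an
    integer. The analysis is arranged to need little. Identities are proved on a half line or a
    segment, where only real series and proper integrals occur, and are continued by the identity
    theorem; the Gamma integral is never evaluated, only its scaling is used; the inversion of eta
    is a limit of finite trigonometric identities. *)

Module Residue.
From mathcomp Require Import all_boot all_algebra zify ring.
Set Implicit Arguments. Unset Strict Implicit. Unset Printing Implicit Defensive.
Import GRing.Theory.
Local Open Scope nat_scope.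
Delimit Scope Z_scope with Z.

Definition neg (p a j : nat) : bool := p./2 < (a * j) %% p.
(* The sign of Gauss' lemma: the parity of the number of [j <= (p-1)/2] such that [a j] has a negative absolutely least residue. *)
Definition mu (p a : nat) : bool := \big[addb/false]_(j < p./2) neg p a j.+1.
Definition absres (p a j : nat) : nat := if neg p a j then p - (a * j) %% p else (a * j) %% p.

Lemma modn_opp p x y : 0 < p -> p %| x + y -> ~~ (p %| x) -> y %% p = p - x %% p.
Proof.
move=> p0 d nx; have lx := ltn_pmod x p0; have ly := ltn_pmod y p0.
have : p %| x %% p + y %% p by rewrite /dvdn modnDm.
have x0 : 0 < x %% p by rewrite lt0n; apply: contra nx; rewrite /dvdn.
case/dvdnP => k hk; have : k = 1 by nia. move=> k1; lia.
Qed.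

Lemma neg_opp p x y : odd p -> p %| x + y -> ~~ (p %| x) -> (p./2 < y %% p) = ~~ (p./2 < x %% p).
Proof.
move=> po d nx; have p0 : 0 < p by case: (p) po.
rewrite (modn_opp p0 d nx). have := ltn_pmod x p0. have := odd_double_half p. rewrite po -muln2. lia.
Qed.

Lemma absres_cong p a j : 0 < p -> p %| (if neg p a j then a * j + absres p a j else a * j + (p - absres p a j)).
Proof.
move=> p0; rewrite /absres; have l := ltn_pmod (a * j) p0; have e := divn_eq (a * j) p.
by case: (neg p a j); [rewrite {1}e -addnA subnKC ?(ltnW l) //|rewrite {1}e -addnA subnKC ?(ltnW l) //]; rewrite dvdn_addr ?dvdn_mull.
Qed.

Lemma dvdn_lt p x : p %| x -> x < p -> x = 0.
Proof. by move=> d l; apply/eqP; move: d; rewrite /dvdn modn_small. Qed.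

Lemma absres_range p a j : prime p -> odd p -> ~~ (p %| a) -> 0 < j <= p./2 -> 0 < absres p a j <= p./2.
Proof.
move=> pp po na /andP[j0 jh]; have p0 := prime_gt0 pp.
have nj : ~~ (p %| a * j).
 rewrite Euclid_dvdM // negb_or na /=; apply/negP => d.
 have h : p./2 < p by rewrite ltn_half_double -addnn; lia.
 by have := dvdn_lt d (leq_ltn_trans jh h); lia.
have x0 : 0 < (a * j) %% p by rewrite lt0n; apply: contra nj; rewrite /dvdn.
have l := ltn_pmod (a * j) p0. have := odd_double_half p; rewrite po -muln2 /absres /neg => e.
by case: ifP => c; lia.
Qed.

(** Equal values make [a i] and [a j] congruent up to sign, so [p] divides [i + j] or the difference
    of [i] and [j], both smaller than [p]. Hence [absres] permutes the half system
    [1, ..., (p-1)/2], on which multiplicativity, Gauss' lemma and the square criterion all rest. *)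
Lemma absres_inj p a i j : prime p -> odd p -> ~~ (p %| a) -> 0 < i <= p./2 -> 0 < j <= p./2 -> absres p a i = absres p a j -> i = j.
Proof.
move=> pp po na /andP[i0 ih] /andP[j0 jh] e; have p0 := prime_gt0 pp.
have := odd_double_half p; rewrite po -muln2 => eh.
have ci := absres_cong a i p0; have cj := absres_cong a j p0.
have ri := absres_range pp po na (_ : 0 < i <= p./2); have rj := absres_range pp po na (_ : 0 < j <= p./2).
rewrite -e in cj rj; have {}ri := ri _; set r := absres p a i in ci cj ri rj.
have {}ri : 0 < r <= p./2 by apply: ri; rewrite i0.
have D : p %| a * (i + j) \/ p %| a * (maxn i j - minn i j).
 case: (neg p a i) ci; case: (neg p a j) cj => cj ci.
 - right. have : p %| (a * maxn i j + r) - (a * minn i j + r).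
   by apply: dvdn_sub; rewrite /maxn /minn; case: ifP.
  by rewrite subnDr mulnBr.
 - left. have : p %| (a * i + r) + (a * j + (p - r)) by apply: dvdn_add.
  have -> : (a * i + r) + (a * j + (p - r)) = a * (i + j) + p by rewrite mulnDr; lia.
  by rewrite dvdn_addl // dvdnn.
 - left. have : p %| (a * i + (p - r)) + (a * j + r) by apply: dvdn_add.
  have -> : (a * i + (p - r)) + (a * j + r) = a * (i + j) + p by rewrite mulnDr; lia.
  by rewrite dvdn_addl // dvdnn.
 - right. have : p %| (a * maxn i j + (p - r)) - (a * minn i j + (p - r)).
   by apply: dvdn_sub; rewrite /maxn /minn; case: ifP.
  by rewrite subnDr mulnBr.
case: D; rewrite Euclid_dvdM // (negbTE na) /= => d.
- have : i + j < p by lia.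
 by move/(dvdn_lt d); lia.
- have : maxn i j - minn i j < p by rewrite /maxn /minn; case: ifP; lia.
 by move/(dvdn_lt d); rewrite /maxn /minn; case: ifP; lia.
Qed.

Lemma half_ord p (j : 'I_p./2) : 0 < j.+1 <= p./2.
Proof. by rewrite ltn_ord. Qed.

Section Perm.
Variables (p b : nat) (pp : prime p) (po : odd p) (nb : ~~ (p %| b)).

Lemma sigma_lt (j : 'I_p./2) : (absres p b j.+1).-1 < p./2.
Proof. by have := absres_range pp po nb (half_ord j); lia. Qed.
Definition sigma (j : 'I_p./2) : 'I_p./2 := Ordinal (sigma_lt j).

Lemma sigmaE j : (sigma j).+1 = absres p b j.+1.
Proof. by rewrite /=; have := absres_range pp po nb (half_ord j); lia. Qed.

Lemma sigma_inj : injective sigma.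
Proof.
move=> i j e; apply: val_inj; have := absres_inj pp po nb (half_ord i) (half_ord j).
by rewrite -!sigmaE e => /(_ erefl) [].
Qed.

Lemma sigma_bij : {on [pred _ | true], bijective sigma}.
Proof. by apply: onW_bij; apply: injF_bij sigma_inj. Qed.
End Perm.

(** The sum for [a] is reindexed by the permutation that [b] induces on the half system: the sign of
    [a b j] is the sign of [b j] times the sign of [a] at the absolute residue of [b j]. *)
Lemma mu_mul p a b : prime p -> odd p -> ~~ (p %| a) -> ~~ (p %| b) -> mu p (a * b) = mu p a (+) mu p b.
Proof.
move=> pp po na nb; have p0 := prime_gt0 pp.
rewrite {2}/mu (reindex (sigma pp po nb)) /=; last exact: sigma_bij.
rewrite -big_split /=; apply: eq_bigr => j _.
rewrite -[(absres p b j.+1).-1.+1]/((sigma pp po nb j).+1) sigmaE.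
have c := absres_cong b j.+1 p0. have r := absres_range pp po nb (half_ord j).
have h : p./2 < p by have := odd_double_half p; rewrite po -muln2; lia.
have nr : ~~ (p %| a * absres p b j.+1).
 by rewrite Euclid_dvdM // negb_or na /=; apply/negP => /dvdn_lt; lia.
case E : (neg p b j.+1) c => c.
- rewrite addbT {1 2}/neg. apply: neg_opp => //. rewrite -mulnA -mulnDr addnC. exact: dvdn_mull.
- rewrite addbF /neg. congr (_ < _). apply/eqP. rewrite -mulnA.
 rewrite -(eqn_modDr (a * (p - absres p b j.+1))) -!mulnDr subnKC; last by lia.
 by rewrite modnMl; exact: dvdn_mull.
Qed.

Lemma mu_mod p a b : a = b %[mod p] -> mu p a = mu p b.
Proof. by move=> e; apply: eq_bigr => j _; rewrite /neg -modnMml e modnMml. Qed.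

Lemma mu_pred p : prime p -> odd p -> mu p p.-1 = odd p./2.
Proof.
move=> pp po; have p0 := prime_gt0 pp.
have -> : mu p p.-1 = \big[addb/false]_(j < p./2) true.
 apply: eq_bigr => j _; rewrite /neg.
 have nj : ~~ (p %| j.+1).
  apply/negP => /dvdn_lt; have := ltn_ord j; have := odd_double_half p; rewrite po -muln2; lia.
 rewrite (@neg_opp p j.+1) //; last by rewrite -[X in X + _]mul1n -mulnDl add1n prednK // dvdn_mulr.
 rewrite modn_small; have := ltn_ord j; have := odd_double_half p; rewrite po -muln2; lia.
rewrite big_const cardT size_enum_ord; by elim: (p./2) => //= n ->.
Qed.

(** Multiply the relations [a j = +- absres] over the half system. The absolute residues run through
    the half system again, so its product cancels. *)
Lemma gauss_lemma p a : prime p -> odd p -> ~~ (p %| a) -> ((a%:R : 'F_p) ^+ p./2 = (-1) ^+ mu p a)%R.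
Proof.
move=> pp po na; have p0 := prime_gt0 pp.
have chp : p \in [pchar 'F_p]%R by apply: pchar_Fp.
have dv0 n : ((n%:R : 'F_p) == 0)%R = (p %| n) by rewrite -(dvdn_pcharf chp).
have E j : ((a * j)%:R = (-1) ^+ neg p a j * (absres p a j)%:R :> 'F_p)%R.
 apply/eqP; have := absres_cong a j p0. rewrite -dv0 => /eqP.
 have l : absres p a j <= p.
  by rewrite /absres; case: ifP => _; rewrite ?leq_subr // ltnW // ltn_pmod.
 case: (neg p a j); rewrite natrD ?natrB //= ?expr1 ?expr0 ?mul1r ?mulN1r.
 - by move/eqP; rewrite addr_eq0.
 - by rewrite (pcharf0 chp) add0r => /eqP; rewrite addr_eq0 opprK.
have P : (\prod_(j < p./2) ((a * j.+1)%:R : 'F_p) = (-1) ^+ mu p a * \prod_(j < p./2) (j.+1%:R : 'F_p))%R.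
 rewrite (eq_bigr (fun j : 'I_p./2 => (-1) ^+ neg p a j.+1 * (absres p a j.+1)%:R : 'F_p)%R); last by move=> j _; apply: E.
 rewrite big_split /=; congr (_ * _)%R.
 - by rewrite /mu; elim/big_rec2: _ => [|j y1 y2 _ ->]; rewrite ?expr0 // signr_addb.
 - rewrite [RHS](reindex (sigma pp po na)) /=; last exact: sigma_bij.
  by apply: eq_bigr => j _; rewrite -sigmaE.
have N : (\prod_(j < p./2) (j.+1%:R : 'F_p) != 0)%R.
 apply/prodf_neq0 => j _; rewrite dv0; apply/negP => /dvdn_lt.
 by have := ltn_ord j; have := odd_double_half p; rewrite po -muln2; lia.
apply: (mulIf N); rewrite -P.
rewrite [RHS](eq_bigr (fun j : 'I_p./2 => (a%:R * j.+1%:R : 'F_p)%R)); last by move=> j _; rewrite natrM.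
by rewrite big_split /= prodr_const card_ord.
Qed.

(** The summand [p - a mod p] stands for [-a] inside the natural numbers. A square has trivial sign
    by multiplicativity. Conversely, with [h = (p-1)/2] the squares of [1, ..., h] are [h] distinct
    roots of [X^h - 1], and by Gauss' lemma [a] is a root as well; were it not among them, there
    would be one root too many. *)
Lemma mu_square p a : prime p -> odd p -> ~~ (p %| a) -> (exists x : nat, p %| x * x + (p - a %% p)) <-> mu p a = false.
Proof.
move=> pp po na; have p0 := prime_gt0 pp; have p1 := prime_gt1 pp.
have chp : p \in [pchar 'F_p]%R by apply: pchar_Fp.
have dv0 n : ((n%:R : 'F_p) == 0)%R = (p %| n) by rewrite -(dvdn_pcharf chp).
have la : a %% p <= p by apply/ltnW/ltn_pmod.
have sqE x : (p %| x * x + (p - a %% p)) = (x * x == a %[mod p]).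
 rewrite -[RHS](eqn_modDr (p - a %% p)). rewrite -(modnDml a) subnKC // modnn. by rewrite /dvdn.
split=> [[x]|m].
- rewrite sqE => /eqP e. rewrite -(mu_mod e). have nx : ~~ (p %| x).
  apply: contra na => d; have: p %| x * x by apply: dvdn_mulr. by rewrite /dvdn e.
 by rewrite mu_mul // addbb.
- have := gauss_lemma pp po na; rewrite m expr0 => G.
 set h := p./2 in G. have hp : p = h.*2.+1 by rewrite -[LHS]odd_double_half po.
 have h0 : 0 < h by move: p1 po; rewrite hp; case: (h).
 pose sqs : seq 'F_p := [seq ((j.+1)%:R ^+ 2)%R | j <- iota 0 h].
 have small j : j < h -> ~~ (p %| j.+1) by move=> jh; apply/negP => /dvdn_lt; lia.
 have U : uniq sqs.
  rewrite map_inj_in_uniq ?iota_uniq // => i j; rewrite !mem_iota /= !add0n => ih jh /eqP.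
  rewrite eqf_sqr => /orP[/eqP e|/eqP e].
  - have : (((maxn i j - minn i j)%:R : 'F_p) == 0)%R.
    rewrite natrB; last by rewrite /maxn /minn; case: ifP; lia.
    rewrite subr_eq0; move: e; rewrite -addn1 -[j.+1]addn1 !natrD => /addIr e.
    by rewrite /maxn /minn; case: ifP => _; rewrite e.
   rewrite dv0 => /dvdn_lt; rewrite /maxn /minn; case: ifP; lia.
  - have : (((i.+1 + j.+1)%:R : 'F_p) == 0)%R by rewrite natrD e addNr.
   by rewrite dv0 => /dvdn_lt; lia.
 case Ea : ((a%:R : 'F_p)%R \in sqs).
 - case/mapP: Ea => j _ e; exists j.+1; rewrite sqE.
  have : (((j.+1 * j.+1)%:R : 'F_p) == a%:R)%R by rewrite e natrM expr2.
  by move=> /eqP /(congr1 (fun x : 'F_p => nat_of_ord x)); rewrite !(val_Fp_nat pp) => ->.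
 - exfalso. pose q : {poly 'F_p} := ('X^h - 1)%R.
  have sq : size q = h.+1 by rewrite /q size_XnsubC.
  have q0 : q != 0%R by rewrite -size_poly_eq0 sq.
  have R n : ~~ (p %| n) -> ((n%:R : 'F_p) ^+ h ^+ 2 = 1)%R by move=> nn; rewrite gauss_lemma // sqrr_sign.
  have A : all (root q) ((a%:R)%R :: sqs).
   rewrite /= /root /q !hornerE G subrr eqxx /=.
   apply/allP => y /mapP[j]; rewrite mem_iota add0n => jh ->. rewrite !hornerE -exprM mulnC exprM R ?subrr //. exact: small.
  have := max_poly_roots q0 A _. rewrite /= Ea U sq size_map size_iota => /(_ isT). by rewrite ltnn.
Qed.

(** * Quadratic reciprocity and the Legendre symbol of [-p] *)

Lemma odd_sum_addb (n : nat) (f : nat -> bool) : odd (\sum_(j < n) f j) = \big[addb/false]_(j < n) f j.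
Proof. by elim/big_rec2: _ => // j y1 y2 _ <-; rewrite oddD oddb. Qed.

(** The lattice points of the box with sides [(p-1)/2] and [(l-1)/2] are sorted by the size of
    [p j - l i]: two strips along the diagonal, counted by the two signs of Gauss' lemma, and two
    corners [A], [B] exchanged by the central symmetry of the box. Modulo 2 only the strips
    remain. *)
Lemma reciprocity p l : prime p -> prime l -> odd p -> odd l -> p != l -> mu p l (+) mu l p = odd (p./2 * l./2).
Proof.
move=> pp pl po lo npl.
have p0 := prime_gt0 pp; have l0 := prime_gt0 pl.
have ep : p = (p./2).*2.+1 by rewrite -[LHS]odd_double_half po.
have el : l = (l./2).*2.+1 by rewrite -[LHS]odd_double_half lo.
set h := p./2 in ep *. set k := l./2 in el *.
have npl' : ~~ (p %| l) by rewrite dvdn_prime2.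
have nlp' : ~~ (l %| p) by rewrite dvdn_prime2 // eq_sym.
pose N1 (i j : nat) : bool := (l * i.+1 < p * j.+1) && (p * j.+1 <= l * i.+1 + h).
pose N2 (i j : nat) : bool := (p * j.+1 < l * i.+1) && (l * i.+1 <= p * j.+1 + k).
pose A (i j : nat) : bool := l * i.+1 + h < p * j.+1.
pose B (i j : nat) : bool := p * j.+1 + k < l * i.+1.
have one i j : i < h -> j < k -> N1 i j + N2 i j + A i j + B i j = 1.
 move=> ih jk; rewrite /N1 /N2 /A /B.
 have : l * i.+1 != p * j.+1.
  apply/eqP => e; have : p %| l * i.+1 by rewrite e dvdn_mulr.
  by rewrite Euclid_dvdM // (negbTE npl') /= => /dvdn_lt; lia.
 move: (l * i.+1) (p * j.+1) => x y; lia.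
have lh : l * h = h * k * 2 + h by rewrite {1}el -muln2; ring.
have pk : p * k = h * k * 2 + k by rewrite {1}ep -muln2; ring.
(* For [x = 2 y + 1] the [y] integers following [z] contain a multiple of [x] exactly when
   [z mod x > y], and then it is the next multiple after [z]. This identifies [neg] with the number
   of points of a strip in one row or column, once for each strip. *)
have gen (x y a b z : nat) : x = y.*2.+1 -> z <= b * y -> b * y = y * a * 2 + y -> forall q, q = z %/ x ->
  (if y < z %% x then q < a else true) /\ forall j, ((z < x * j.+1) && (x * j.+1 <= z + y)) = (j == q) && (y < z %% x).
 move=> ex zb eb q eq; have x0 : 0 < x by rewrite ex.
 have e := divn_eq z x; rewrite -eq in e; have r := ltn_pmod z x0. move: (z %% x) e r => w e r; split.
  case: ifP => // yw; rewrite ltnNge; apply/negP => aq.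
  have := leq_mul aq (leqnn x). have -> : a * x = y * a * 2 + a by rewrite ex -muln2; ring.
  lia.
 move=> j; have ej : x * j.+1 = j * x + x by rewrite mulnS mulnC addnC.
 rewrite ej. case: (ltngtP j q) => c /=.
 - have := leq_mul c (leqnn x); rewrite mulSn; lia.
 - have := leq_mul c (leqnn x); rewrite mulSn; lia.
 - subst j; lia.
have M1 i : i < h -> neg p l i.+1 = \sum_(j < k) N1 i j :> nat.
 move=> ih. have hi : l * i.+1 <= l * h by rewrite leq_mul2l ih orbT.
 case: (gen p h k l (l * i.+1) ep hi lh _ erefl) => qk E.
 rewrite (eq_bigr (fun j : 'I_k => ((nat_of_ord j == (l * i.+1) %/ p) && (h < (l * i.+1) %% p)) : nat)); last by move=> j _; rewrite /N1 E.
 rewrite /neg -/h. case c : (h < (l * i.+1) %% p) qk => qk.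
 - rewrite (bigD1 (Ordinal qk)) //= eqxx big1 ?addn0 // => j nj; rewrite andbT; apply/eqP; rewrite eqb0.
  by apply: contra nj => /eqP E'; apply/eqP/val_inj.
 - by rewrite big1 // => j _; rewrite andbF.
have pk' : p * k = k * h * 2 + k by rewrite pk (mulnC k h).
have M2 j : j < k -> neg l p j.+1 = \sum_(i < h) N2 i j :> nat.
 move=> jk. have hj : p * j.+1 <= p * k by rewrite leq_mul2l jk orbT.
 case: (gen l k h p (p * j.+1) el hj pk' _ erefl) => qk E.
 rewrite (eq_bigr (fun i : 'I_h => ((nat_of_ord i == (p * j.+1) %/ l) && (k < (p * j.+1) %% l)) : nat)); last by move=> i _; rewrite /N2 E.
 rewrite /neg -/k. case c : (k < (p * j.+1) %% l) qk => qk.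
 - rewrite (bigD1 (Ordinal qk)) //= eqxx big1 ?addn0 // => i ni; rewrite andbT; apply/eqP; rewrite eqb0.
  by apply: contra ni => /eqP E'; apply/eqP/val_inj.
 - by rewrite big1 // => i _; rewrite andbF.
have S1 : mu p l = odd (\sum_(i < h) \sum_(j < k) N1 i j).
 rewrite /mu -(odd_sum_addb h (fun i => neg p l i.+1)). by congr odd; apply: eq_bigr => i _; apply: M1.
have S2 : mu l p = odd (\sum_(i < h) \sum_(j < k) N2 i j).
 rewrite /mu -(odd_sum_addb k (fun i => neg l p i.+1)) exchange_big. by congr odd; apply: eq_bigr => i _; apply: M2.
have AB : \sum_(i < h) \sum_(j < k) A i j = \sum_(i < h) \sum_(j < k) B i j.
 rewrite (reindex_inj rev_ord_inj) /=; apply: eq_bigr => i _. rewrite (reindex_inj rev_ord_inj) /=; apply: eq_bigr => j _.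
 congr nat_of_bool. rewrite /A /B. have ih := ltn_ord i; have jk := ltn_ord j. rewrite !subnSK // !mulnBr lh pk.
 have := leq_mul (leqnn l) (ltnW ih); have := leq_mul (leqnn p) (ltnW jk). rewrite lh pk !mulnS.
 have {1}-> : l + l * i = k * 2 + 1 + l * i by rewrite {1}el -muln2; lia.
 have {1}-> : p + p * j = h * 2 + 1 + p * j by rewrite {1}ep -muln2; lia.
 move: (l * i) (p * j) (h * k) => x y z; lia.
rewrite S1 S2 -oddD. have : \sum_(i < h) \sum_(j < k) (N1 i j + N2 i j + A i j + B i j) = h * k.
 rewrite (eq_bigr (fun=> k)); first by rewrite sum_nat_const card_ord.
 move=> i _. rewrite (eq_bigr (fun=> 1)); first by rewrite sum_nat_const card_ord muln1.
 by move=> j _; apply: one.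
move=> <-. under [X in _ = odd X]eq_bigr do rewrite !big_split /=. by rewrite !big_split /= AB -addnA [in RHS]oddD addnn odd_double addbF.
Qed.

(** The Legendre symbol modulo [p], defined by the sign of Gauss' lemma so that it is multiplicative
    before any link with squares is made. *)
Definition J (p a : nat) : Z := if p %| a then 0%Z else if mu p a then (-1)%Z else 1%Z.

Lemma J_mul p a b : prime p -> odd p -> J p (a * b) = (J p a * J p b)%Z.
Proof.
move=> pp po; rewrite /J Euclid_dvdM //. case: (boolP (p %| a)) => //= na.
case: (boolP (p %| b)) => /= nb; first by rewrite Z.mul_0_r.
by rewrite mu_mul //; case: (mu p a); case: (mu p b).
Qed.

Lemma J_mod p a b : a = b %[mod p] -> J p a = J p b.
Proof. by move=> e; rewrite /J (mu_mod e) /dvdn e. Qed.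

Lemma J_one p : prime p -> odd p -> J p 1 = 1%Z.
Proof.
move=> pp po; have := J_mul 1 1 pp po. rewrite mul1n /J. have -> : p %| 1 = false by rewrite dvdn1; case: p pp {po} => [|[]].
by case: (mu p 1).
Qed.

Lemma odd_half3 p : p %% 4 = 3 -> odd p /\ odd p./2.
Proof. by move=> e; rewrite (divn_eq p 4) e; split; lia. Qed.

Lemma J_pred p : prime p -> p %% 4 = 3 -> J p p.-1 = (-1)%Z.
Proof.
move=> pp /odd_half3[po ph]; rewrite /J mu_pred // ph.
case: ifP => // d. by have := dvdn_lt d; have := prime_gt1 pp; lia.
Qed.

Lemma J_opp p a b : prime p -> p %% 4 = 3 -> p %| a + b -> J p b = (- J p a)%Z.
Proof.
move=> pp p3 d; have [po _] := odd_half3 p3. have p0 := prime_gt0 pp.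
have -> : J p b = J p (p.-1 * a).
 apply: J_mod; apply/eqP; rewrite -(eqn_modDl a) -{2}[a]mul1n -mulnDl add1n prednK // modnMr. by [].
rewrite J_mul // J_pred //; lia.
Qed.

Lemma sum_half h n : \sum_(j < n) (h < (2 * j.+1)) = n - minn n h./2.
Proof.
elim: n => [|n IH]; first by rewrite big_ord0.
rewrite big_ord_recr /= IH. have := odd_double_half h; rewrite -muln2. by lia.
Qed.

(** All the products [2 j] lie below [p], so the sign is the parity of the number of [j <= (p-1)/2]
    with [2 j > (p-1)/2]. *)
Lemma J_two p : prime p -> p %% 4 = 3 -> J p 2 = if p %% 8 == 7 then 1%Z else (-1)%Z.
Proof.
move=> pp p3; have [po ph] := odd_half3 p3.
have n2 : (p %| 2) = false by apply/negP => /dvdn_leq; move: p3; case: p {pp po ph} => [|[|[|p]]] //=; lia.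
rewrite /J n2.
have -> : mu p 2 = odd (\sum_(j < p./2) (p./2 < (2 * j.+1))).
 rewrite (odd_sum_addb p./2 (fun j => p./2 < 2 * j.+1)); apply: eq_bigr => j _. rewrite /neg modn_small //.
 by have := ltn_ord j; have := odd_double_half p; rewrite po -muln2; lia.
rewrite sum_half. have -> : minn p./2 p./2./2 = p./2./2 by lia.
have e := divn_eq p 8. have r := ltn_pmod p (isT : 0 < 8).
have c : p %% 8 = 3 \/ p %% 8 = 7 by lia.
by case: c => c; rewrite c /=; case: ifP => //; lia.
Qed.

Lemma sq_nat_Z (y p k l : nat) : (y * y + p = k * l) <-> (Z.of_nat y * Z.of_nat y - - Z.of_nat p = Z.of_nat k * Z.of_nat l)%Z.
Proof. split; lia. Qed.

(** For odd [l] the left side is the symbol of [-p] modulo [l], with [(l-1) p] standing for [-p].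
    Because [(p-1)/2] is odd, the sign in the reciprocity law is the symbol of [-1] modulo [l], and
    the two cancel. The prime 2 and the case [l = p] are compared directly. *)
Lemma kron_J (p l : nat) : prime p -> p %% 4 = 3 -> prime l -> kron_prime (- Z.of_nat p) l = J p l.
Proof.
move=> pp p3 pl; have [po ph] := odd_half3 p3; have p0 := prime_gt0 pp; have l0 := prime_gt0 pl.
rewrite /kron_prime; case: (Nat.eqb_spec l 2) => [->|l2].
 rewrite J_two //. have -> : Z.even (- Z.of_nat p) = false.
  have -> : (- Z.of_nat p = 1 + 2 * (- Z.of_nat (p./2) - 1))%Z by have := odd_double_half p; rewrite po -muln2; lia.
  by rewrite Z.even_add_mul_2.
 have e := divn_eq p 8; have r := ltn_pmod p (isT : 0 < 8).
 have c : p %% 8 = 3 \/ p %% 8 = 7 by lia.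
 case: c => c; rewrite c /=.
 - have -> : Z.modulo (- Z.of_nat p) 8 = 5%Z by apply/esym/(Z.mod_unique _ _ (- Z.of_nat (p %/ 8) - 1)%Z); lia. by [].
 - have -> : Z.modulo (- Z.of_nat p) 8 = 1%Z by apply/esym/(Z.mod_unique _ _ (- Z.of_nat (p %/ 8) - 1)%Z); lia. by [].
have lo : odd l by case: (even_prime pl) => // e; lia.
have dvdZ x : Z.eqb (Z.modulo x (Z.of_nat l)) 0 = true <-> exists k, x = (k * Z.of_nat l)%Z.
 split; first by move/Z.eqb_spec/Z.mod_divide => [|k ->]; [lia|exists k].
 by move=> [k ->]; rewrite Z_mod_mult.
case: (boolP (l == p)) => [/eqP ->|nlp].
 have -> : Z.eqb (Z.modulo (- Z.of_nat p) (Z.of_nat p)) 0 = true by apply/Z.eqb_spec/Z.mod_divide; [lia|exists (-1)%Z; lia].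
 by rewrite /J dvdnn.
have nlp' : ~~ (l %| p) by rewrite dvdn_prime2.
have npl : ~~ (p %| l) by rewrite dvdn_prime2 // eq_sym.
have -> : Z.eqb (Z.modulo (- Z.of_nat p) (Z.of_nat l)) 0 = false.
 apply/negbTE/negP => /dvdZ[k e]. apply: (negP nlp'). apply/dvdnP; exists (Z.to_nat (- k)).
 have k0 : (0 <= - k)%Z.
  case: (Z.lt_ge_cases (- k) 0) => // kk. have := Z.mul_neg_pos (- k) (Z.of_nat l) kk. rewrite Z.mul_opp_l -e. lia.
 have {}e : (Z.of_nat p = (- k) * Z.of_nat l)%Z by rewrite Z.mul_opp_l -e; lia.
 move: e; rewrite -{1}(Z2Nat.id (- k) k0). move: (Z.to_nat (- k)) => m' e. lia.
rewrite /J (negbTE npl).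
have nl1 : ~~ (l %| l.-1) by apply/negP => /dvdn_lt; have := prime_gt1 pl; lia.
have na : ~~ (l %| l.-1 * p) by rewrite Euclid_dvdM // negb_or nl1.
have ma : mu l (l.-1 * p) = mu p l.
 rewrite mu_mul // mu_pred //. have := reciprocity pp pl po lo; rewrite eq_sym => /(_ nlp); rewrite oddM ph /= => <-.
 by case: (mu p l); case: (mu l p).
have key x : (l %| x * x + (l - (l.-1 * p) %% l)) = (l %| x * x + p).
 have e : l - (l.-1 * p) %% l = p %[mod l].
  apply/eqP; rewrite -(eqn_modDl (l.-1 * p)) -(modnDml (l.-1 * p)) subnKC; last exact/ltnW/ltn_pmod.
  by rewrite modnn -{2}[p]mul1n -mulnDl addn1 prednK // modnMr.
 by rewrite /dvdn -(modnDmr (x * x) (l - _)) e modnDmr.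
have hasP' : has (fun x => Z.eqb (Z.modulo (Z.of_nat x * Z.of_nat x - - Z.of_nat p) (Z.of_nat l)) 0) (iota 0 l) = ~~ mu p l.
 apply/idP/idP.
 - case/hasP => x _ /dvdZ[k e]. rewrite -ma. apply/negP => m.
  have : mu l (l.-1 * p) = false.
   apply/(mu_square pl lo na); exists x; rewrite key; apply/dvdnP; exists (Z.to_nat k).
   have k0 : (0 <= k)%Z.
    case: (Z.lt_ge_cases k 0) => // kk. have := Z.mul_neg_pos k (Z.of_nat l) kk. rewrite -e. lia.
   move: e; rewrite -{1}(Z2Nat.id k k0) => e; exact/sq_nat_Z.
  by rewrite m.
 - move/negbTE; rewrite -ma => /(mu_square pl lo na)[x]; rewrite key => d.
  apply/hasP; exists (x %% l); first by rewrite mem_iota /= add0n ltn_pmod.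
  apply/dvdZ. have : l %| (x %% l) * (x %% l) + p by rewrite /dvdn -modnDml modnMml modnMmr modnDml.
  by case/dvdnP => k e; exists (Z.of_nat k); apply/sq_nat_Z.
by rewrite hasP'; case: (mu p l).
Qed.

Theorem eta_char_J (p n : nat) : prime p -> p %% 4 = 3 -> 0 < n -> eta_char (- Z.of_nat p) n = J p n.
Proof.
move=> pp p3 n0; have [po _] := odd_half3 p3.
have Jexp l e : J p (l ^ e) = (J p l ^ Z.of_nat e)%Z.
 elim: e => [|e IH]; first by rewrite expn0 J_one.
 by rewrite expnS J_mul // IH Nat2Z.inj_succ Z.pow_succ_r //; lia.
rewrite {2}(prod_prime_decomp n0) /eta_char.
have : all (fun f => prime f.1) (prime_decomp n) by apply/allP => -[l e] /mem_prime_decomp[].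
elim: (prime_decomp n) => [|[l e] s IH] /=; first by rewrite big_nil J_one.
case/andP => pl ps. by rewrite big_cons J_mul // Jexp -kron_J // -IH.
Qed.

Lemma J_three p : prime p -> p %% 4 = 3 -> p != 3 -> J p 3 = if p %% 3 == 2 then 1%Z else (-1)%Z.
Proof.
move=> pp p3 n3; rewrite -kron_J // /kron_prime; cbn [Nat.eqb has iota].
have c : p %% 3 = 1 \/ p %% 3 = 2.
 have := ltn_pmod p (isT : 0 < 3). have : p %% 3 != 0 by rewrite -/(_ %| _) dvdn_prime2 // eq_sym. lia.
have e := divn_eq p 3.
case: c => c; rewrite c.
- have E k : Z.modulo (k - - Z.of_nat p) 3 = Z.modulo (k + 1) 3.
  have -> : (k - - Z.of_nat p = k + 1 + Z.of_nat (p %/ 3) * 3)%Z by lia. exact: Z_mod_plus_full.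
 have -> : Z.modulo (- Z.of_nat p) 3 = 2%Z by apply/esym/(Z.mod_unique _ _ (- Z.of_nat (p %/ 3) - 1)%Z); lia.
 by rewrite [Z.of_nat 3]/= !E.
- have E k : Z.modulo (k - - Z.of_nat p) 3 = Z.modulo (k + 2) 3.
  have -> : (k - - Z.of_nat p = k + 2 + Z.of_nat (p %/ 3) * 3)%Z by lia. exact: Z_mod_plus_full.
 have -> : Z.modulo (- Z.of_nat p) 3 = 1%Z by apply/esym/(Z.mod_unique _ _ (- Z.of_nat (p %/ 3) - 1)%Z); lia.
 by rewrite [Z.of_nat 3]/= !E.
Qed.

Lemma prime_of_Z p : Znumtheory.prime (Z.of_nat p) -> prime p.
Proof.
move=> H; have p2 := prime_ge_2 _ H. apply/primeP; split; first lia.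
move=> d /dvdnP[k e]. have : (Z.of_nat d | Z.of_nat p)%Z by exists (Z.of_nat k); lia.
move/(prime_divisors _ H) => [|[|[|]]] h; apply/orP; [lia|left; apply/eqP; lia|right; apply/eqP; lia|lia].
Qed.

(** The interface to everything that follows, phrased with the arithmetic of the standard library.
    The last four clauses, the values at 2 and 3, decide the sign of the functional equation and
    enter the congruence modulo 8. *)
Definition character (p : nat) (chi : nat -> Z) : Prop :=
 (forall a b, chi (Nat.mul a b) = Z.mul (chi a) (chi b)) /\
 (forall a b, Nat.modulo a p = Nat.modulo b p -> chi a = chi b) /\
 chi 1 = 1%Z /\ (forall a b, (exists k, Nat.add a b = Nat.mul k p) -> chi b = Z.opp (chi a)) /\
 (forall a, Nat.modulo a p = 0 -> chi a = 0%Z) /\ (forall a, Nat.modulo a p <> 0 -> chi a = 1%Z \/ chi a = (-1)%Z) /\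
 (forall n, Nat.lt 0 n -> eta_char (- Z.of_nat p) n = chi n) /\
 (Nat.modulo p 8 = 7 -> chi 2 = 1%Z) /\ (Nat.modulo p 8 = 3 -> chi 2 = (-1)%Z) /\
 (p <> 3 -> Nat.modulo p 3 = 2 -> chi 3 = 1%Z) /\ (p <> 3 -> Nat.modulo p 3 = 1 -> chi 3 = (-1)%Z).

Theorem character_J p : Znumtheory.prime (Z.of_nat p) -> Nat.modulo p 4 = 3 -> character p (J p).
Proof.
have md a b : Nat.modulo a b = a %% b.
 case: b => [|b]; first by rewrite modn0.
 have e := divn_eq a b.+1; have l := ltn_pmod a (isT : 0 < b.+1). apply/esym/(Nat.mod_unique _ _ (a %/ b.+1)); lia.
move=> /prime_of_Z pp p3. have p4 : p %% 4 = 3 by rewrite -md. have [po ph] := odd_half3 p4. have p0 := prime_gt0 pp.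
split; first by move=> a b; apply: J_mul.
split; first by move=> a b; rewrite !md; apply: J_mod.
split; first exact: J_one.
split; first by move=> a b [k e]; apply: J_opp => //; apply/dvdnP; exists k; exact: e.
split; first by move=> a; rewrite md => e; rewrite /J /dvdn e.
split.
 move=> a; rewrite md => /eqP/negbTE e; rewrite /J /dvdn e; case: (mu p a); [by right|by left].
split; first by move=> n n0; apply: eta_char_J => //; lia.
have J2 := J_two pp p4.
split; first by rewrite md => e; rewrite J2 e.
split; first by rewrite md => e; rewrite J2 e.
have J3 := J_three pp p4.
split; move=> n3; rewrite md => e; rewrite J3 ?e //; exact/eqP.
Qed.

End Residue.
Import Residue(character, character_J).

Open Scope R_scope.

(** * Holomorphic functions and the identity theorem *)

Ltac pos := solve [repeat first [assumption | lra | apply Rmult_lt_0_compat | apply Rdiv_lt_0_compat | apply Rinv_0_lt_compat | apply Rplus_lt_0_compat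
 | apply pow_lt | apply exp_pos | apply PI_RGT_0 | apply lt_0_INR; lia | apply INR_fact_lt_0 | apply sqrt_lt_R0 | apply Rmult_le_pos | apply Rplus_le_le_0_compat
 | apply Rabs_pos | apply Cmod_ge_0 | apply pow_le | apply pos_INR | apply Rlt_le | apply Rgt_not_eq]].

Ltac Cring := unfold Cminus, Cplus, Copp, Cmult, Ci, RtoC, Cconj; simpl; f_equal; ring.

Tactic Notation "via" uconstr(H) := eapply Rle_trans; [apply H|].

(** An explicit epsilon-delta derivative. The filters behind [entire] are translated once, in
    [entire_holo], and do not occur in the complex analysis afterwards. *)
Definition cderiv (F : C -> C) (z l : C) : Prop :=
 forall eps : R, 0 < eps -> exists d : R, 0 < d /\
 forall w : C, Cmod (w - z) < d -> Cmod (F w - F z - l * (w - z)) <= eps * Cmod (w - z).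

Definition holo (F : C -> C) (z : C) : Prop := exists l, cderiv F z l.

Lemma entire_holo (F : C -> C) (z : C) :
 ex_derive (K := C_AbsRing) (V := C_NormedModule) F z -> holo F z.
Proof.
intros [l Hl]. exists l. destruct Hl as [_ Hl].
intros eps He.
specialize (Hl z (fun P H => H) (mkposreal eps He)).
apply locally_C in Hl. destruct Hl as [d Hd].
exists d. split; [apply cond_pos|].
intros w Hw. specialize (Hd w (C_NormedModule_mixin_compat1 z w d Hw)).
replace (F w - F z - l * (w - z))%C with (F w - F z - (w - z) * l)%C by ring.
exact Hd.
Qed.

Lemma cderiv_cont (F : C -> C) (z l : C) : cderiv F z l ->
 forall eps, 0 < eps -> exists d, 0 < d /\ forall w, Cmod (w - z) < d -> Cmod (F w - F z) < eps.
Proof.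
intros H eps He. destruct (H 1 Rlt_0_1) as [d [Hd H1]].
set (K := 1 + Cmod l). assert (HK : 0 < K) by (unfold K; pose proof (Cmod_ge_0 l); lra).
exists (Rmin d (eps / K)). split.
{ apply Rmin_pos; pos. }
intros w Hw.
assert (Hw1 : Cmod (w - z) < d) by (eapply Rlt_le_trans; [eauto| apply Rmin_l]).
assert (Hw2 : Cmod (w - z) < eps / K) by (eapply Rlt_le_trans; [exact Hw| apply Rmin_r]).
specialize (H1 w Hw1).
replace (F w - F z)%C with ((F w - F z - l * (w - z)) + l * (w - z))%C by ring.
eapply Rle_lt_trans; [apply Cmod_triangle|]. rewrite Cmod_mult.
apply Rle_lt_trans with (K * Cmod (w - z)); [unfold K; lra|].
apply Rmult_lt_compat_l with (r := K) in Hw2; auto.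
replace (K * (eps / K)) with eps in Hw2 by (field; lra). exact Hw2.
Qed.

Lemma cderiv_ext_loc (F G : C -> C) (z l : C) (d0 : R) : 0 < d0 ->
 (forall w, Cmod (w - z) < d0 -> F w = G w) -> cderiv F z l -> cderiv G z l.
Proof.
intros H0 E H eps He. destruct (H eps He) as [d [Hd H1]].
exists (Rmin d d0). split; [apply Rmin_pos; assumption|].
intros w Hw.
assert (Hw1 : Cmod (w - z) < d) by (eapply Rlt_le_trans; [eauto| apply Rmin_l]).
assert (Hw2 : Cmod (w - z) < d0) by (eapply Rlt_le_trans; [exact Hw| apply Rmin_r]).
rewrite <- (E w Hw2), <- (E z); auto.
replace (z - z)%C with (RtoC 0) by ring. rewrite Cmod_0. exact H0.
Qed.

Lemma cderiv_const (k z : C) : cderiv (fun _ => k) z 0.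
Proof.
intros eps He. exists 1. split; [lra|]. intros w _.
replace (k - k - 0 * (w - z))%C with (RtoC 0) by ring. rewrite Cmod_0.
apply Rmult_le_pos; pos.
Qed.

Lemma cderiv_id (z : C) : cderiv (fun w => w) z 1.
Proof.
intros eps He. exists 1. split; [lra|]. intros w _.
replace (w - z - 1 * (w - z))%C with (RtoC 0) by ring. rewrite Cmod_0.
apply Rmult_le_pos; pos.
Qed.

Lemma cderiv_plus (F G : C -> C) (z l m : C) : cderiv F z l -> cderiv G z m ->
 cderiv (fun w => F w + G w)%C z (l + m).
Proof.
intros HF HG eps He.
destruct (HF (eps/2)) as [d1 [Hd1 H1]]; [lra|].
destruct (HG (eps/2)) as [d2 [Hd2 H2]]; [lra|].
exists (Rmin d1 d2). split; [apply Rmin_pos; assumption|]. intros w Hw.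
specialize (H1 w (Rlt_le_trans _ _ _ Hw (Rmin_l _ _))).
specialize (H2 w (Rlt_le_trans _ _ _ Hw (Rmin_r _ _))).
replace (F w + G w - (F z + G z) - (l + m) * (w - z))%C with
 ((F w - F z - l * (w - z)) + (G w - G z - m * (w - z)))%C by ring.
via Cmod_triangle. lra.
Qed.

Lemma cderiv_mult (F G : C -> C) (z l m : C) : cderiv F z l -> cderiv G z m ->
 cderiv (fun w => F w * G w)%C z (l * G z + F z * m).
Proof.
intros HF HG eps He.
set (B := Cmod (G z) + Cmod l + Cmod (F z) + 1).
assert (HB : 0 < B) by (unfold B; pose proof (Cmod_ge_0 (G z)); pose proof (Cmod_ge_0 l); pose proof (Cmod_ge_0 (F z)); lra).
set (e := Rmin 1 (eps / (3 * B))).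
assert (He0 : 0 < e) by (apply Rmin_pos; pos).
assert (HeB : 3 * e * B <= eps).
{ assert (e <= eps / (3 * B)) by apply Rmin_r.
 apply Rmult_le_compat_r with (r := 3 * B) in H; [|lra].
 replace (eps / (3 * B) * (3 * B)) with eps in H by (field; lra). lra. }
assert (He1 : e <= 1) by apply Rmin_l.
destruct (HF e He0) as [d1 [Hd1 H1]].
destruct (HG e He0) as [d2 [Hd2 H2]].
destruct (cderiv_cont _ _ _ HG e He0) as [d3 [Hd3 H3]].
exists (Rmin d1 (Rmin d2 d3)). split; [repeat apply Rmin_pos; assumption|]. intros w Hw.
assert (Hw1 := Rlt_le_trans _ _ _ Hw (Rmin_l _ _)).
assert (Hw23 := Rlt_le_trans _ _ _ Hw (Rmin_r _ _)).
assert (Hw2 := Rlt_le_trans _ _ _ Hw23 (Rmin_l _ _)).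
assert (Hw3 := Rlt_le_trans _ _ _ Hw23 (Rmin_r _ _)).
specialize (H1 w Hw1). specialize (H2 w Hw2). specialize (H3 w Hw3).
replace (F w * G w - F z * G z - (l * G z + F z * m) * (w - z))%C with
 ((F w - F z - l * (w - z)) * (G z + (G w - G z)) + (l * (w - z)) * (G w - G z)
  + F z * (G w - G z - m * (w - z)))%C by ring.
via Cmod_triangle.
eapply Rle_trans; [apply Rplus_le_compat_r, Cmod_triangle|].
rewrite !Cmod_mult.
pose proof (Cmod_triangle (G z) (G w - G z)) as H4.
set (D := Cmod (w - z)) in *.
assert (HD : 0 <= D) by pos.
pose proof (Cmod_ge_0 (G z)); pose proof (Cmod_ge_0 l); pose proof (Cmod_ge_0 (F z)).
pose proof (Cmod_ge_0 (G w - G z)). pose proof (Cmod_ge_0 (F w - F z - l * (w - z))).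
assert (I1 : Cmod (F w - F z - l * (w - z)) * Cmod (G z + (G w - G z)) <= (e * D) * B).
{ apply Rmult_le_compat; try assumption; [pos|]. unfold B. lra. }
assert (I2 : Cmod l * D * Cmod (G w - G z) <= (B * D) * e).
{ apply Rmult_le_compat; try lra; [pos|].
 apply Rmult_le_compat_r; [assumption|unfold B; lra]. }
assert (I3 : Cmod (F z) * Cmod (G w - G z - m * (w - z)) <= B * (e * D)).
{ apply Rmult_le_compat; try assumption; [pos|unfold B; lra]. } nra.
Qed.

Lemma cderiv_comp (F G : C -> C) (z l m : C) : cderiv G z m -> cderiv F (G z) l ->
 cderiv (fun w => F (G w)) z (l * m).
Proof.
intros HG HF eps He.
set (B := Cmod l + Cmod m + 2).
assert (HB : 2 <= B) by (unfold B; pose proof (Cmod_ge_0 m); pose proof (Cmod_ge_0 l); lra).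
set (e := Rmin 1 (eps / (2 * B))).
assert (He0 : 0 < e) by (apply Rmin_pos; pos).
assert (HeB : 2 * e * B <= eps).
{ assert (e <= eps / (2 * B)) by apply Rmin_r.
 apply Rmult_le_compat_r with (r := 2 * B) in H; [|lra].
 replace (eps / (2 * B) * (2 * B)) with eps in H by (field; lra). lra. }
assert (He1 : e <= 1) by apply Rmin_l.
destruct (HF e He0) as [d1 [Hd1 H1]].
destruct (HG e He0) as [d2 [Hd2 H2]].
destruct (cderiv_cont _ _ _ HG d1 Hd1) as [d3 [Hd3 H3]].
exists (Rmin d2 d3). split; [apply Rmin_pos; assumption|]. intros w Hw.
assert (Hw2 := Rlt_le_trans _ _ _ Hw (Rmin_l _ _)).
assert (Hw3 := Rlt_le_trans _ _ _ Hw (Rmin_r _ _)).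
specialize (H2 w Hw2).
replace (F (G w) - F (G z) - l * m * (w - z))%C with
 ((F (G w) - F (G z) - l * (G w - G z)) + l * (G w - G z - m * (w - z)))%C by ring.
via Cmod_triangle. rewrite Cmod_mult.
set (D := Cmod (w - z)) in *.
assert (HD : 0 <= D) by pos.
assert (H4 : Cmod (G w - G z) <= (Cmod m + 1) * D).
{ replace (G w - G z)%C with ((G w - G z - m * (w - z)) + m * (w - z))%C by ring.
 via Cmod_triangle. rewrite Cmod_mult. fold D. nra. }
pose proof (Cmod_ge_0 l). pose proof (Cmod_ge_0 m).
assert (I1 : Cmod (F (G w) - F (G z) - l * (G w - G z)) <= e * (B * D)).
{ eapply Rle_trans; eauto. apply Rmult_le_compat_l; [lra|].
 eapply Rle_trans; eauto. apply Rmult_le_compat_r; [assumption|unfold B; lra]. }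
assert (I2 : Cmod l * Cmod (G w - G z - m * (w - z)) <= B * (e * D)).
{ apply Rmult_le_compat; try assumption; [pos|unfold B; lra]. } nra.
Qed.

Lemma Cminus_eq_0 (z w : C) : (z - w = 0)%C -> z = w.
Proof. intros E. replace z with ((z - w) + w)%C by ring. rewrite E. ring. Qed.

Lemma Cmult_0_r_inv (z w : C) : (z * w = 0)%C -> (z <> 0)%C -> w = RtoC 0.
Proof. intros E Hz. replace w with (/ z * (z * w))%C by (field; exact Hz). rewrite E. ring. Qed.

Lemma Cmod_minus_sym (z w : C) : Cmod (z - w) = Cmod (w - z).
Proof. rewrite <- Cmod_opp. f_equal. ring. Qed.

Lemma Cmod_rev_triangle (z w : C) : Cmod z - Cmod w <= Cmod (z - w).
Proof.
pose proof (Cmod_triangle (z - w) w) as H.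
replace (z - w + w)%C with z in H by ring. lra.
Qed.

Lemma cderiv_inv (z : C) : z <> RtoC 0 -> cderiv (fun w => / w)%C z (- / (z * z)).
Proof.
intros Hz eps He.
assert (Hm : 0 < Cmod z) by (apply Cmod_gt_0; exact Hz).
set (m := Cmod z) in *.
exists (Rmin (m / 2) (eps * m ^ 3 / 2)). split.
{ apply Rmin_pos; [lra|]. pos. }
intros w Hw.
assert (Hw1 := Rlt_le_trans _ _ _ Hw (Rmin_l _ _)).
assert (Hw2 := Rlt_le_trans _ _ _ Hw (Rmin_r _ _)).
assert (Hwm : m / 2 < Cmod w).
{ pose proof (Cmod_rev_triangle z w). rewrite Cmod_minus_sym in H. fold m in H. lra. }
assert (Hw0 : w <> RtoC 0) by (apply Cmod_gt_0; lra).
replace (/ w - / z - - / (z * z) * (w - z))%C with ((w - z) * ((w - z) / (z * z * w)))%C by (field; split; assumption).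
rewrite Cmod_mult, Rmult_comm. apply Rmult_le_compat_r; [pos|].
rewrite Cmod_div by (repeat apply Cmult_neq_0; assumption).
rewrite !Cmod_mult.
apply Rmult_le_reg_r with (m * m * Cmod w); [pos|].
unfold Rdiv. rewrite Rmult_assoc, Rinv_l by pos.
apply Rle_trans with (eps * m ^ 3 / 2); [lra|].
replace (eps * m ^ 3 / 2) with (eps * (m * m) * (m / 2)) by lra.
replace (eps * (m * m * Cmod w)) with (eps * (m * m) * Cmod w) by ring.
apply Rmult_le_compat_l; [|lra].
apply Rmult_le_pos; pos.
Qed.

Lemma holo_const k z : holo (fun _ => k) z.
Proof. eexists; apply cderiv_const. Qed.
Lemma holo_id z : holo (fun w => w) z.
Proof. eexists; apply cderiv_id. Qed.
Lemma holo_plus F G z : holo F z -> holo G z -> holo (fun w => F w + G w)%C z.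
Proof. intros [l Hl] [m Hm]. eexists; apply cderiv_plus; eassumption. Qed.
Lemma holo_mult F G z : holo F z -> holo G z -> holo (fun w => F w * G w)%C z.
Proof. intros [l Hl] [m Hm]. eexists; apply cderiv_mult; eassumption. Qed.
Lemma holo_comp F G z : holo G z -> holo F (G z) -> holo (fun w => F (G w)) z.
Proof. intros [l Hl] [m Hm]. eexists; eapply cderiv_comp; eassumption. Qed.
Lemma holo_inv F z : holo F z -> F z <> RtoC 0 -> holo (fun w => / F w)%C z.
Proof. intros HF H0. apply (holo_comp (fun w => / w)%C F); [pos|eexists; apply cderiv_inv; exact H0]. Qed.
Lemma holo_opp F z : holo F z -> holo (fun w => - F w)%C z.
Proof.
intros [l Hl]. exists (- l)%C. intros eps He. destruct (Hl eps He) as [d [Hd H]].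
exists d. split; eauto. intros w Hw. rewrite <- Cmod_opp.
replace (- (- F w - - F z - - l * (w - z)))%C with (F w - F z - l * (w - z))%C by ring. apply H; exact Hw.
Qed.
Lemma holo_minus F G z : holo F z -> holo G z -> holo (fun w => F w - G w)%C z.
Proof. intros H1 H2. apply (holo_plus F (fun w => - G w)%C); [pos|apply holo_opp; exact H2]. Qed.
Lemma holo_ext_loc (F G : C -> C) (z : C) (d0 : R) : 0 < d0 ->
 (forall w, Cmod (w - z) < d0 -> F w = G w) -> holo F z -> holo G z.
Proof. intros H0 E [l Hl]. exists l. eapply cderiv_ext_loc; eassumption. Qed.
Lemma holo_pow F n z : holo F z -> holo (fun w => (F w) ^ n)%C z.
Proof.
intros H. induction n as [|n IH]; [exact (holo_const (RtoC 1) z)|].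
apply (holo_mult F (fun w => (F w) ^ n)%C); assumption.
Qed.

(** A compactness principle: a property that passes from the four quarters to the rectangle, and
    holds for small rectangles around each point, holds for the whole. It replaces covering
    arguments both in Goursat's lemma and for the boundedness of continuous functions. The index [n]
    records that the sides are [l / 2^n] and [w / 2^n]. *)
Lemma bisection (P : R -> R -> nat -> Prop) (x0 y0 l w : R) : 0 <= l -> 0 <= w ->
 (forall x y n, P x y (S n) -> P (x + l / 2 ^ S n) y (S n) -> P x (y + w / 2 ^ S n) (S n) ->
   P (x + l / 2 ^ S n) (y + w / 2 ^ S n) (S n) -> P x y n) ->
 (forall u v, x0 <= u <= x0 + l -> y0 <= v <= y0 + w -> exists N, forall n x y, (N <= n)%nat ->
   x0 <= x -> x + l / 2 ^ n <= x0 + l -> y0 <= y -> y + w / 2 ^ n <= y0 + w ->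
   x <= u <= x + l / 2 ^ n -> y <= v <= y + w / 2 ^ n -> P x y n) ->
 P x0 y0 0%nat.
Proof.
intros Hl Hw Hstep Hloc. apply NNPP. intros Hn.
(* A rectangle where [P] fails has a quarter where it fails; choice makes this a nested sequence of
   bad rectangles shrinking to a point. *)
assert (Hch : forall n (q : {q : R * R | ~ P (fst q) (snd q) n}),
 {q' : {q : R * R | ~ P (fst q) (snd q) (S n)} |
  (fst (proj1_sig q') = fst (proj1_sig q) \/ fst (proj1_sig q') = fst (proj1_sig q) + l / 2 ^ S n) /\
  (snd (proj1_sig q') = snd (proj1_sig q) \/ snd (proj1_sig q') = snd (proj1_sig q) + w / 2 ^ S n)}).
{ intros n [[x y] Hq]. apply constructive_indefinite_description, NNPP. intros HN. apply Hq, Hstep; apply NNPP; intros H; apply HN.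
 - exists (exist _ (x, y) H). auto.
 - exists (exist _ (x + l / 2 ^ S n, y) H). auto.
 - exists (exist _ (x, y + w / 2 ^ S n) H). auto.
 - exists (exist _ (x + l / 2 ^ S n, y + w / 2 ^ S n) H). auto. }
set (seq := fix seq n : {q : R * R | ~ P (fst q) (snd q) n} :=
 match n with O => exist _ (x0, y0) Hn | S m => proj1_sig (Hch m (seq m)) end).
set (X := fun n => fst (proj1_sig (seq n))). set (Y := fun n => snd (proj1_sig (seq n))).
assert (HnP : forall n, ~ P (X n) (Y n) n) by (intros n; exact (proj2_sig (seq n))).
assert (HX : forall n, X (S n) = X n \/ X (S n) = X n + l / 2 ^ S n)
 by (intros n; exact (proj1 (proj2_sig (Hch n (seq n))))).
assert (HY : forall n, Y (S n) = Y n \/ Y (S n) = Y n + w / 2 ^ S n)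
 by (intros n; exact (proj2 (proj2_sig (Hch n (seq n))))).
assert (Gen : forall (Z : nat -> R) z0 m, 0 <= m -> Z 0%nat = z0 ->
 (forall n, Z (S n) = Z n \/ Z (S n) = Z n + m / 2 ^ S n) ->
 exists u, forall n, Z n <= u <= Z n + m / 2 ^ n /\ z0 <= Z n /\ Z n + m / 2 ^ n <= z0 + m).
{ intros Z z0 m Hm HZ0 HZ.
 assert (Hp : forall n, 0 <= m / 2 ^ n) by (intros n; apply Rdiv_le_0_compat; pos).
 assert (Hh : forall n, m / 2 ^ n = 2 * (m / 2 ^ S n)) by (intros n; simpl; field; apply pow_nonzero; lra).
 assert (Hmon : forall n k, Z n <= Z (n + k)%nat /\ Z (n + k)%nat + m / 2 ^ (n + k) <= Z n + m / 2 ^ n).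
 { intros n k. induction k as [|k IH]; [rewrite Nat.add_0_r; lra|].
  replace (n + S k)%nat with (S (n + k)) by lia.
  specialize (Hh (n + k)%nat). pose proof (Hp (S (n + k))). destruct (HZ (n + k)%nat); lra. }
 destruct (completeness (fun z => exists n, z = Z n)) as [u [Hu1 Hu2]].
 - exists (z0 + m). intros z [n ->]. destruct (Hmon 0%nat n) as [_ H]. simpl in H. pose proof (Hp n). lra.
 - exists (Z 0%nat), 0%nat. reflexivity.
 - exists u. intros n. repeat split.
  + eauto.
  + apply Hu2. intros z [k ->]. destruct (le_lt_dec n k).
   * destruct (Hmon n (k - n)%nat) as [_ H]. replace (n + (k - n))%nat with k in H by lia. pose proof (Hp k). lra.
   * destruct (Hmon k (n - k)%nat) as [H _]. replace (k + (n - k))%nat with n in H by lia. pose proof (Hp n). lra.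
  + destruct (Hmon 0%nat n) as [H _]. simpl in H. lra.
  + destruct (Hmon 0%nat n) as [_ H]. simpl in H. lra. }
destruct (Gen X x0 l Hl eq_refl HX) as [u Hu]. destruct (Gen Y y0 w Hw eq_refl HY) as [v Hv].
destruct (Hloc u v) as [N HN].
{ specialize (Hu 0%nat). lra. }
{ specialize (Hv 0%nat). lra. }
apply (HnP N). specialize (Hu N). specialize (Hv N). apply (HN N); lra || lia.
Qed.

Lemma pow2_small (m e : R) : 0 <= m -> 0 < e -> exists N, forall n, (N <= n)%nat -> m / 2 ^ n < e.
Proof.
intros Hm He. destruct (nfloor_ex (m / e)) as [N HN]; [pos|]. exists (S N). intros n Hn.
assert (H2n : INR n < 2 ^ n).
{ clear. induction n as [|n IH]; [pos|]. rewrite S_INR. simpl.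
 assert (1 <= 2 ^ n) by (apply pow_R1_Rle; lra). lra. }
apply le_INR in Hn. rewrite S_INR in Hn. assert (Hp : 0 < 2 ^ n) by pos.
apply (Rmult_lt_reg_r (2 ^ n * / e)); [pos|].
replace (m / 2 ^ n * (2 ^ n * / e)) with (m / e) by (field; lra). replace (e * (2 ^ n * / e)) with (2 ^ n) by (field; lra). lra.
Qed.

(** * Integrals along segments and boundaries of rectangles *)

Definition CInt (f : R -> C) (a b : R) : C := RInt (V := C_R_CompleteNormedModule) f a b.

Definition ccont (f : R -> C) (a b : R) : Prop :=
 forall t, Rmin a b <= t <= Rmax a b -> continuous (U := C_UniformSpace) f t.

Lemma continuous_C_eps (f : R -> C) (t : R) :
 (forall eps, 0 < eps -> exists d, 0 < d /\ forall s, Rabs (s - t) < d -> Cmod (f s - f t) < eps) ->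
 continuous (U := C_UniformSpace) f t.
Proof.
intros H. apply filterlim_locally. intros eps.
destruct (H eps (cond_pos eps)) as [d [Hd H1]].
exists (mkposreal d Hd). intros s Hs.
apply C_NormedModule_mixin_compat1. auto.
Qed.

Lemma ccont_ex (f : R -> C) a b : ccont f a b -> ex_RInt (V := C_R_CompleteNormedModule) f a b.
Proof. intros H. apply (ex_RInt_continuous (V := C_R_CompleteNormedModule)). exact H. Qed.

Lemma norm_C_R (z : C) : norm (V := C_R_NormedModule) z = Cmod z.
Proof.
destruct z as [x y].
change (sqrt (Rabs x ^ 2 + Rabs y ^ 2) = sqrt (x ^ 2 + y ^ 2)).
rewrite <- !Rsqr_pow2, <- !Rsqr_abs. reflexivity.
Qed.

Lemma CInt_norm (f : R -> C) a b M : a <= b -> ccont f a b ->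
 (forall t, a <= t <= b -> Cmod (f t) <= M) -> Cmod (CInt f a b) <= (b - a) * M.
Proof.
intros Hab Hc HM. rewrite <- norm_C_R.
apply (norm_RInt_le_const (V := C_R_NormedModule) f a b (CInt f a b) M Hab).
- intros x Hx. rewrite norm_C_R. auto.
- apply (RInt_correct (V := C_R_CompleteNormedModule)), ccont_ex, Hc.
Qed.

Lemma CInt_plus (f g : R -> C) a b : ccont f a b -> ccont g a b ->
 CInt (fun t => f t + g t)%C a b = (CInt f a b + CInt g a b)%C.
Proof. intros Hf Hg. apply (RInt_plus (V := C_R_CompleteNormedModule)); apply ccont_ex; assumption. Qed.

Lemma CInt_minus (f g : R -> C) a b : ccont f a b -> ccont g a b ->
 CInt (fun t => f t - g t)%C a b = (CInt f a b - CInt g a b)%C.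
Proof. intros Hf Hg. apply (RInt_minus (V := C_R_CompleteNormedModule)); apply ccont_ex; assumption. Qed.

Lemma is_CInt_pair (f : R -> C) a b (u v : R) :
 is_RInt (fun t => Re (f t)) a b u -> is_RInt (fun t => Im (f t)) a b v ->
 CInt f a b = (u, v).
Proof.
intros Hu Hv. apply (is_RInt_unique (V := C_R_CompleteNormedModule)), (is_RInt_ext (V := C_R_NormedModule) (fun t => (Re (f t), Im (f t)))).
- intros x _. destruct (f x). reflexivity.
- apply (is_RInt_fct_extend_pair (U := R_NormedModule) (V := R_NormedModule) (fun t => (Re (f t), Im (f t)))); assumption.
Qed.

Lemma CInt_parts (f : R -> C) a b : ccont f a b ->
 is_RInt (fun t => Re (f t)) a b (Re (CInt f a b)) /\ is_RInt (fun t => Im (f t)) a b (Im (CInt f a b)).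
Proof.
intros H. apply ccont_ex in H. apply (RInt_correct (V := C_R_CompleteNormedModule)) in H.
split.
- exact (is_RInt_fct_extend_fst (U := R_NormedModule) (V := R_NormedModule) f a b _ H).
- exact (is_RInt_fct_extend_snd (U := R_NormedModule) (V := R_NormedModule) f a b _ H).
Qed.

Lemma CInt_scal (k : C) (f : R -> C) a b : ccont f a b ->
 CInt (fun t => k * f t)%C a b = (k * CInt f a b)%C.
Proof.
intros H. destruct (CInt_parts f a b H) as [H1 H2]. destruct k as [kr ki].
apply is_CInt_pair.
- apply (is_RInt_minus (V := R_NormedModule) (fun t => kr * Re (f t)) (fun t => ki * Im (f t)));
 apply (is_RInt_scal (V := R_NormedModule)); assumption.
- apply (is_RInt_plus (V := R_NormedModule) (fun t => kr * Im (f t)) (fun t => ki * Re (f t)));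
 apply (is_RInt_scal (V := R_NormedModule)); assumption.
Qed.

Lemma CInt_Chasles (f : R -> C) a b c : a <= b <= c -> ccont f a c ->
 (CInt f a b + CInt f b c)%C = CInt f a c.
Proof.
intros Hb H. apply (RInt_Chasles (V := C_R_CompleteNormedModule)); apply ccont_ex; intros t Ht; apply H;
rewrite Rmin_left, Rmax_right in Ht by lra; rewrite Rmin_left, Rmax_right by lra; lra.
Qed.

Lemma CInt_ext (f g : R -> C) a b : a <= b -> (forall t, a <= t <= b -> f t = g t) -> CInt f a b = CInt g a b.
Proof.
intros Hab H. apply (RInt_ext (V := C_R_CompleteNormedModule)). intros t Ht. apply H.
rewrite Rmin_left, Rmax_right in Ht by lra. lra.
Qed.

(** The contour integral over the boundary of the rectangle, counterclockwise; on the vertical sides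
    [dz = i dy] accounts for the factor [Ci]. *)
Definition Rect (F : C -> C) a b c d : C :=
 (CInt (fun x => F (x, c)) a b + CInt (fun y => Ci * F (b, y))%C c d
  - CInt (fun x => F (x, d)) a b - CInt (fun y => Ci * F (a, y))%C c d)%C.

Definition cont_on (F : C -> C) a b c d : Prop :=
 forall x y, a <= x <= b -> c <= y <= d -> forall eps, 0 < eps -> exists dl, 0 < dl /\
 forall w, Cmod (w - (x, y)) < dl -> Cmod (F w - F (x, y)) < eps.

Lemma Cmod_horiz (s t y : R) : Cmod ((s, y) - (t, y)) = Rabs (s - t).
Proof.
replace ((s, y) - (t, y))%C with (RtoC (s - t)) by Cring.
apply Cmod_R.
Qed.
Lemma Cmod_vert (s t x : R) : Cmod ((x, s) - (x, t)) = Rabs (s - t).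
Proof.
replace ((x, s) - (x, t))%C with (Ci * RtoC (s - t))%C by Cring.
rewrite Cmod_mult, Cmod_Ci, Cmod_R. ring.
Qed.

Lemma cont_on_h F a b c d y : a <= b -> cont_on F a b c d -> c <= y <= d -> ccont (fun x => F (x, y)) a b.
Proof.
intros Hab H Hy t Ht. rewrite Rmin_left, Rmax_right in Ht by lra.
apply continuous_C_eps. intros eps He. destruct (H t y Ht Hy eps He) as [dl [Hd H1]].
exists dl. split; eauto. intros s Hs. apply H1. rewrite Cmod_horiz. exact Hs.
Qed.
Lemma cont_on_v F a b c d x : c <= d -> cont_on F a b c d -> a <= x <= b -> ccont (fun y => Ci * F (x, y))%C c d.
Proof.
intros Hab H Hy t Ht. rewrite Rmin_left, Rmax_right in Ht by lra.
apply continuous_C_eps. intros eps He. destruct (H x t Hy Ht eps He) as [dl [Hd H1]].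
exists dl. split; auto. intros s Hs.
replace (Ci * F (x, s) - Ci * F (x, t))%C with (Ci * (F (x, s) - F (x, t)))%C by ring.
rewrite Cmod_mult, Cmod_Ci, Rmult_1_l. apply H1. rewrite Cmod_vert. exact Hs.
Qed.

Lemma cont_on_sub F a b c d a' b' c' d' : cont_on F a b c d -> a <= a' -> b' <= b -> c <= c' -> d' <= d ->
 cont_on F a' b' c' d'.
Proof. intros H Ha Hb Hc Hd x y Hx Hy. apply H; lra. Qed.

Lemma Rect_split_v F a b c d m : a <= m <= b -> c <= d -> cont_on F a b c d ->
 Rect F a b c d = (Rect F a m c d + Rect F m b c d)%C.
Proof.
intros Hm Hcd H. unfold Rect.
rewrite <- (CInt_Chasles (fun x => F (x, c)) a m b), <- (CInt_Chasles (fun x => F (x, d)) a m b);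
 try lra; try (eapply cont_on_h; [lra|eauto|lra]). ring.
Qed.
Lemma Rect_split_h F a b c d m : a <= b -> c <= m <= d -> cont_on F a b c d ->
 Rect F a b c d = (Rect F a b c m + Rect F a b m d)%C.
Proof.
intros Hm Hcd H. unfold Rect.
rewrite <- (CInt_Chasles (fun x => Ci * F (a, x))%C c m d), <- (CInt_Chasles (fun x => Ci * F (b, x))%C c m d);
 try lra; try (eapply cont_on_v; [lra|eauto|lra]). ring.
Qed.

(** Continuity at boundary points only, because the integrands of Cauchy's formula have a pole
    inside the rectangle. *)
Definition cont_bd (F : C -> C) a b c d : Prop :=
 forall x y, a <= x <= b -> c <= y <= d -> (x = a \/ x = b) \/ (y = c \/ y = d) ->
 forall eps, 0 < eps -> exists dl, 0 < dl /\
 forall w, Cmod (w - (x, y)) < dl -> Cmod (F w - F (x, y)) < eps.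

Lemma cont_on_bd F a b c d : cont_on F a b c d -> cont_bd F a b c d.
Proof. intros H x y Hx Hy _. apply H; assumption. Qed.

Lemma cont_bd_h F a b c d y : a <= b -> c <= d -> cont_bd F a b c d -> y = c \/ y = d -> ccont (fun x => F (x, y)) a b.
Proof.
intros Hab Hcd H Hy. apply (cont_on_h F a b y y); [lra| |lra].
intros x' y' Hx' Hy'. apply H; [lra| |right].
- lra.
- lra.
Qed.
Lemma cont_bd_v F a b c d x : a <= b -> c <= d -> cont_bd F a b c d -> x = a \/ x = b -> ccont (fun y => Ci * F (x, y))%C c d.
Proof.
intros Hab Hcd H Hx. apply (cont_on_v F x x c d); [lra| |lra].
intros x' y' Hx' Hy'. apply H; [|lra|left].
- lra.
- lra.
Qed.

Ltac bdc F H := lazymatch goal with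
 | |- ccont (fun _ => Cmult Ci _) _ _ => refine (cont_bd_v F _ _ _ _ _ _ _ H _)
 | |- _ => refine (cont_bd_h F _ _ _ _ _ _ _ H _) end; [lra|lra|tauto].

Lemma Rect_bound F a b c d M : a <= b -> c <= d -> cont_bd F a b c d ->
 (forall x y, a <= x <= b -> c <= y <= d -> (x = a \/ x = b) \/ (y = c \/ y = d) -> Cmod (F (x, y)) <= M) ->
 Cmod (Rect F a b c d) <= 2 * (b - a + (d - c)) * M.
Proof.
intros Hab Hcd H HM.
assert (H1 := CInt_norm (fun x => F (x, c)) a b M Hab ltac:(bdc F H) ltac:(intros; apply HM; tauto || lra)).
assert (H2 := CInt_norm (fun x => F (x, d)) a b M Hab ltac:(bdc F H) ltac:(intros; apply HM; tauto || lra)).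
assert (H3 := CInt_norm (fun y => Ci * F (a, y))%C c d M Hcd ltac:(bdc F H)
 ltac:(intros; cbv beta; rewrite Cmod_mult, Cmod_Ci, Rmult_1_l; apply HM; tauto || lra)).
assert (H4 := CInt_norm (fun y => Ci * F (b, y))%C c d M Hcd ltac:(bdc F H)
 ltac:(intros; cbv beta; rewrite Cmod_mult, Cmod_Ci, Rmult_1_l; apply HM; tauto || lra)).
via Cmod_triangle. rewrite Cmod_opp.
eapply Rle_trans; [apply Rplus_le_compat_r, Cmod_triangle|]. rewrite Cmod_opp.
eapply Rle_trans; [apply Rplus_le_compat_r, Rplus_le_compat_r, Cmod_triangle|]. lra.
Qed.

Lemma Rect_ext F G a b c d : a <= b -> c <= d ->
 (forall x y, a <= x <= b -> c <= y <= d -> (x = a \/ x = b) \/ (y = c \/ y = d) -> F (x, y) = G (x, y)) ->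
 Rect F a b c d = Rect G a b c d.
Proof.
intros Hab Hcd H. unfold Rect.
rewrite (CInt_ext (fun x => F (x, c)) (fun x => G (x, c))), (CInt_ext (fun x => F (x, d)) (fun x => G (x, d))),
 (CInt_ext (fun y => Ci * F (a, y))%C (fun y => Ci * G (a, y))%C), (CInt_ext (fun y => Ci * F (b, y))%C (fun y => Ci * G (b, y))%C);
 try lra; intros; first [apply H; tauto || lra | f_equal; apply H; tauto || lra].
Qed.

Lemma Rect_plus F G a b c d : a <= b -> c <= d -> cont_bd F a b c d -> cont_bd G a b c d ->
 Rect (fun z => F z + G z)%C a b c d = (Rect F a b c d + Rect G a b c d)%C.
Proof.
intros Hab Hcd HF HG. unfold Rect.
rewrite (CInt_plus (fun x => F (x, c)) (fun x => G (x, c))), (CInt_plus (fun x => F (x, d)) (fun x => G (x, d)));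
 try first [bdc F HF | bdc G HG].
rewrite (CInt_ext (fun y => Ci * (F (b, y) + G (b, y)))%C (fun y => Ci * F (b, y) + Ci * G (b, y))%C) by (lra || (intros; ring)).
rewrite (CInt_ext (fun y => Ci * (F (a, y) + G (a, y)))%C (fun y => Ci * F (a, y) + Ci * G (a, y))%C) by (lra || (intros; ring)).
rewrite (CInt_plus (fun x => Ci * F (a, x))%C (fun x => Ci * G (a, x))%C), (CInt_plus (fun x => Ci * F (b, x))%C (fun x => Ci * G (b, x))%C);
 try first [bdc F HF | bdc G HG].
ring.
Qed.

Lemma Rect_scal k F a b c d : a <= b -> c <= d -> cont_bd F a b c d ->
 Rect (fun z => k * F z)%C a b c d = (k * Rect F a b c d)%C.
Proof.
intros Hab Hcd HF. unfold Rect.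
rewrite (CInt_scal k (fun x => F (x, c))), (CInt_scal k (fun x => F (x, d))); try bdc F HF.
rewrite (CInt_ext (fun y => Ci * (k * F (b, y)))%C (fun y => k * (Ci * F (b, y)))%C) by (lra || (intros; ring)).
rewrite (CInt_ext (fun y => Ci * (k * F (a, y)))%C (fun y => k * (Ci * F (a, y)))%C) by (lra || (intros; ring)).
rewrite (CInt_scal k (fun x => Ci * F (a, x))%C), (CInt_scal k (fun x => Ci * F (b, x))%C); try bdc F HF.
ring.
Qed.

Lemma cont_bd_scal k F a b c d : cont_bd F a b c d -> cont_bd (fun z => k * F z)%C a b c d.
Proof.
intros H x y Hx Hy Hb eps He.
pose proof (Cmod_ge_0 k).
destruct (H x y Hx Hy Hb (eps / (Cmod k + 1))) as [dl [Hd H1]]; [pos|].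
exists dl. split; auto. intros w Hw. specialize (H1 w Hw).
replace (k * F w - k * F (x, y))%C with (k * (F w - F (x, y)))%C by ring. rewrite Cmod_mult.
apply Rle_lt_trans with ((Cmod k + 1) * Cmod (F w - F (x, y))).
- apply Rmult_le_compat_r; pos.
- apply Rmult_lt_compat_l with (r := Cmod k + 1) in H1; [|lra].
 replace ((Cmod k + 1) * (eps / (Cmod k + 1))) with eps in H1 by (field; lra). exact H1.
Qed.

Lemma Rect_minus F G a b c d : a <= b -> c <= d -> cont_bd F a b c d -> cont_bd G a b c d ->
 Rect (fun z => F z - G z)%C a b c d = (Rect F a b c d - Rect G a b c d)%C.
Proof.
intros Hab Hcd HF HG.
rewrite (Rect_ext _ (fun z => F z + (- (1)) * G z)%C) by (assumption || (intros; ring)).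
rewrite (Rect_plus F (fun z => (- (1)) * G z)%C), Rect_scal; try assumption; [ring|].
apply cont_bd_scal. exact HG.
Qed.

Lemma is_derive_C_eps (f : R -> C) (t : R) (l : C) :
 (forall eps, 0 < eps -> exists d, 0 < d /\ forall s, Rabs (s - t) < d ->
   Cmod (f s - f t - RtoC (s - t) * l) <= eps * Rabs (s - t)) ->
 is_derive (V := C_R_NormedModule) f t l.
Proof.
intros H. split; [apply (is_linear_scal_l (V := C_R_NormedModule))|].
intros x Hx eps. assert (E := is_filter_lim_locally_unique (V := AbsRing_NormedModule R_AbsRing) t x Hx). rewrite <- E.
destruct (H eps (cond_pos eps)) as [d [Hd H1]].
exists (mkposreal d Hd). intros s Hs. rewrite norm_C_R.
match goal with |- Cmod ?X <= _ => replace X with (f s - f t - RtoC (s - t) * l)%C; auto end.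
destruct (f s), (f t), l. unfold Cminus, Cplus, Copp, RtoC, minus, plus, opp, scal; simpl.
unfold prod_plus, prod_opp, prod_scal, plus, opp, scal, mult; simpl. unfold mult; simpl. f_equal; ring.
Qed.

Lemma cderiv_horiz P x c l : cderiv P (x, c) l -> is_derive (V := C_R_NormedModule) (fun s => P (s, c)) x l.
Proof.
intros H. apply is_derive_C_eps. intros eps He. destruct (H eps He) as [d [Hd H1]].
exists d. split; auto. intros s Hs. specialize (H1 (s, c)). rewrite Cmod_horiz in H1.
replace (RtoC (s - x) * l)%C with (l * ((s, c) - (x, c)))%C; auto. Cring.
Qed.
Lemma cderiv_vert P x c l : cderiv P (x, c) l -> is_derive (V := C_R_NormedModule) (fun s => P (x, s)) c (Ci * l)%C.
Proof.
intros H. apply is_derive_C_eps. intros eps He. destruct (H eps He) as [d [Hd H1]].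
exists d. split; auto. intros s Hs. specialize (H1 (x, s)). rewrite Cmod_vert in H1.
replace (RtoC (s - c) * (Ci * l))%C with (l * ((x, s) - (x, c)))%C; auto. Cring.
Qed.

Lemma CInt_prim (P f : R -> C) a b : a <= b ->
 (forall t, a <= t <= b -> is_derive (V := C_R_NormedModule) P t (f t)) ->
 ccont f a b -> CInt f a b = (P b - P a)%C.
Proof.
intros Hab HP Hc. apply (is_RInt_unique (V := C_R_CompleteNormedModule)), (is_RInt_derive (V := C_R_CompleteNormedModule) P f a b).
- intros t Ht. rewrite Rmin_left, Rmax_right in Ht by lra. apply HP; exact Ht.
- pos.
Qed.

Lemma Rect_prim P F a b c d : a <= b -> c <= d -> cont_on F a b c d ->
 (forall x y, a <= x <= b -> c <= y <= d -> cderiv P (x, y) (F (x, y))) -> Rect F a b c d = RtoC 0.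
Proof.
intros Hab Hcd HF HP. unfold Rect.
rewrite (CInt_prim (fun x => P (x, c)) (fun x => F (x, c))), (CInt_prim (fun x => P (x, d)) (fun x => F (x, d))),
 (CInt_prim (fun y => P (a, y)) (fun y => Ci * F (a, y))%C), (CInt_prim (fun y => P (b, y)) (fun y => Ci * F (b, y))%C);
 try lra;
 try lazymatch goal with
 | |- ccont (fun _ => Cmult Ci _) _ _ => refine (cont_on_v F _ _ _ _ _ _ HF _); lra
 | |- ccont _ _ _ => refine (cont_on_h F _ _ _ _ _ _ HF _); lra end.
- ring.
- intros t Ht. apply cderiv_vert, HP; lra.
- intros t Ht. apply cderiv_vert, HP; lra.
- intros t Ht. apply cderiv_horiz, HP; lra.
- intros t Ht. apply cderiv_horiz, HP; lra.
Qed.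

Lemma holo_cont_on F a b c d : (forall x y, a <= x <= b -> c <= y <= d -> holo F (x, y)) -> cont_on F a b c d.
Proof. intros H x y Hx Hy. destruct (H x y Hx Hy) as [l Hl]. apply (cderiv_cont _ _ _ Hl). Qed.

Lemma Cmod_le_l1 (z : C) : Cmod z <= Rabs (Re z) + Rabs (Im z).
Proof.
destruct z as [x y]. simpl.
replace ((x, y) : C) with (RtoC x + Ci * RtoC y)%C by Cring.
via Cmod_triangle. rewrite Cmod_mult, Cmod_Ci, !Cmod_R. lra.
Qed.

(** The bound [eps (l + w)^2] is compatible with quartering, since halving the sides divides it by
    4. Near a point the integrand may be replaced by its deviation from an affine function, which is
    small of first order on a contour whose length is small as well. *)
Lemma Goursat F a b c d : a <= b -> c <= d ->
 (forall x y, a <= x <= b -> c <= y <= d -> holo F (x, y)) -> Rect F a b c d = RtoC 0.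
Proof.
intros Hab Hcd HF. assert (Hcont := holo_cont_on _ _ _ _ _ HF).
set (l := b - a). set (w := d - c).
assert (Hl : 0 <= l) by (unfold l; lra). assert (Hw : 0 <= w) by (unfold w; lra).
assert (Key : forall eps, 0 < eps -> Cmod (Rect F a b c d) <= eps * (l + w) ^ 2).
{ intros eps He.
 assert (Hp : forall m n, 0 <= m -> 0 <= m / 2 ^ n) by (intros m n Hm; apply Rdiv_le_0_compat; pos).
 assert (Hh : forall m n, m / 2 ^ n = m / 2 ^ S n + m / 2 ^ S n) by (intros m n; simpl; field; apply pow_nonzero; lra).
 set (P := fun x y n => a <= x -> x + l / 2 ^ n <= b -> c <= y -> y + w / 2 ^ n <= d ->
  Cmod (Rect F x (x + l / 2 ^ n) y (y + w / 2 ^ n)) <= eps * ((l / 2 ^ n + w / 2 ^ n) ^ 2)).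
 assert (HP : P a c 0%nat).
 { apply (bisection P a c l w Hl Hw).
  - intros x y n H1 H2 H3 H4 Hx1 Hx2 Hy1 Hy2.
   assert (Hl1 := Hp l (S n) Hl). assert (Hw1 := Hp w (S n) Hw).
   rewrite (Hh l n), (Hh w n) in *.
   set (ll := l / 2 ^ S n) in *. set (ww := w / 2 ^ S n) in *.
   rewrite (Rect_split_v F x (x + (ll + ll)) y (y + (ww + ww)) (x + ll)); try lra; [|eapply cont_on_sub; eauto].
   rewrite (Rect_split_h F x (x + ll) y (y + (ww + ww)) (y + ww)); try lra; [|eapply cont_on_sub; [eauto|lra..]].
   rewrite (Rect_split_h F (x + ll) (x + (ll + ll)) y (y + (ww + ww)) (y + ww)); try lra; [|eapply cont_on_sub; [eauto|lra..]].
   unfold P in H1, H2, H3, H4. fold ll ww in H1, H2, H3, H4.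
   assert (G2 := H2 ltac:(lra) ltac:(lra) ltac:(lra) ltac:(lra)).
   assert (G3 := H3 ltac:(lra) ltac:(lra) ltac:(lra) ltac:(lra)).
   assert (G4 := H4 ltac:(lra) ltac:(lra) ltac:(lra) ltac:(lra)).
   replace (x + ll + ll) with (x + (ll + ll)) in G2, G4 by ring.
   replace (y + ww + ww) with (y + (ww + ww)) in G3, G4 by ring.
   via Cmod_triangle.
   eapply Rle_trans; [apply Rplus_le_compat; apply Cmod_triangle|]. lra.
  - intros u v Hu Hv.
   destruct (HF u v) as [D HD]; [unfold l in Hu; lra|unfold w in Hv; lra|].
   destruct (HD (eps / 2)) as [dl [Hdl H1]]; [lra|].
   destruct (pow2_small (l + w) dl) as [N HN]; [lra..|].
   exists N. intros n x y Hn Hx1 Hx2 Hy1 Hy2 Hxu Hyv _ _ _ _. specialize (HN n Hn).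
   assert (Hsmall : l / 2 ^ n + w / 2 ^ n < dl) by lra.
   set (ll := l / 2 ^ n) in *. set (ww := w / 2 ^ n) in *.
   (* The affine approximation at [(u, v)] has a quadratic primitive, so it integrates to zero over
      every rectangle. *)
   set (Aff := fun z : C => ((F (u, v) - D * (u, v)) + D * z)%C).
   assert (HA : forall z, holo Aff z).
   { intros z. apply holo_plus; [apply holo_const|]. apply (holo_mult (fun _ => D) (fun z => z)); [apply holo_const|apply holo_id]. }
   assert (HA0 : Rect Aff x (x + ll) y (y + ww) = RtoC 0).
   { apply (Rect_prim (fun z => (F (u, v) - D * (u, v)) * z + D * / 2 * (z * z))%C); try lra.
    - apply holo_cont_on. intros; apply HA.
    - intros x' y' _ _. set (zz := (x', y')).
     assert (E1 := cderiv_mult (fun _ => (F (u, v) - D * (u, v))%C) (fun z => z) zz _ _ (cderiv_const _ zz) (cderiv_id zz)).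
     assert (E2 := cderiv_mult (fun _ => (D * / 2)%C) (fun z => z * z)%C zz _ _ (cderiv_const _ zz) (cderiv_mult _ _ zz _ _ (cderiv_id zz) (cderiv_id zz))).
     assert (E3 := cderiv_plus _ _ zz _ _ E1 E2). cbv beta in E3.
     unfold Aff. eapply eq_rect; eauto. field. }
   assert (Hc1 : cont_on F x (x + ll) y (y + ww)) by (eapply cont_on_sub; [eauto|unfold l, w in *; lra..]).
   assert (Hc2 : cont_on Aff x (x + ll) y (y + ww)) by (apply holo_cont_on; intros; apply HA).
   replace (Rect F x (x + ll) y (y + ww)) with (Rect (fun z => F z - Aff z)%C x (x + ll) y (y + ww)).
   2:{ rewrite Rect_minus by (assumption || lra || (apply cont_on_bd; assumption)). rewrite HA0. ring. }
   replace (eps * (ll + ww) ^ 2) with (2 * (x + ll - x + (y + ww - y)) * (eps / 2 * (ll + ww))) by field.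
   apply Rect_bound; try lra.
   + intros x' y' Hx' Hy' _ e He'.
    assert (HH : holo (fun z => F z - Aff z)%C (x', y')).
    { apply holo_minus; [apply HF; unfold l, w in *; lra|easy]. }
    destruct HH as [q Hq]. exact (cderiv_cont _ _ _ Hq e He').
   + intros x' y' Hx' Hy' _. unfold Aff.
    replace (F (x', y') - (F (u, v) - D * (u, v) + D * (x', y')))%C with (F (x', y') - F (u, v) - D * ((x', y') - (u, v)))%C by ring.
    assert (HC : Cmod ((x', y') - (u, v)) <= ll + ww).
    { via Cmod_le_l1. simpl. apply Rplus_le_compat; apply Rabs_le; lra. }
    eapply Rle_trans; [apply H1; lra|]. apply Rmult_le_compat_l; lra. }
 unfold P in HP. simpl in HP.
 replace (a + l / 1) with b in HP by (unfold l; field). replace (c + w / 1) with d in HP by (unfold w; field). lra. }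
apply Cmod_eq_0, Rle_antisym; [|pos].
apply le_epsilon. intros e He.
set (B := (l + w) ^ 2 + 1). assert (HB : 0 < B) by (unfold B; pose proof (pow2_ge_0 (l + w)); lra).
eapply Rle_trans; [apply (Key (e / B)); apply Rdiv_lt_0_compat; assumption|].
apply Rle_trans with (e / B * B); [|right; field; apply Rgt_not_eq; exact HB].
apply Rmult_le_compat_l; [pos|unfold B; lra].
Qed.

(** Four of the five pieces around a small square centred at [(u, v)] avoid the exceptional point.
    The square itself contributes at most a multiple of its side, by continuity alone. *)
Lemma Goursat_except F a b c d u v : a < u < b -> c < v < d -> cont_on F a b c d ->
 (forall x y, a <= x <= b -> c <= y <= d -> (x, y) <> (u, v) -> holo F (x, y)) -> Rect F a b c d = RtoC 0.
Proof.
intros Hu Hv Hc HF.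
destruct (Hc u v ltac:(lra) ltac:(lra) 1 Rlt_0_1) as [dl [Hdl H1]].
set (M := Cmod (F (u, v)) + 1).
assert (HM : 0 < M) by (unfold M; pose proof (Cmod_ge_0 (F (u, v))); lra).
assert (Hsub : forall a' b' c' d', a <= a' -> b' <= b -> c <= c' -> d' <= d -> cont_on F a' b' c' d')
 by (intros; eapply cont_on_sub; eauto).
assert (Key : forall e, 0 < e -> e < dl / 2 -> e < u - a -> e < b - u -> e < v - c -> e < d - v ->
  Cmod (Rect F a b c d) <= 8 * M * e).
{ intros e He He1 He2 He3 He4 He5.
 rewrite (Rect_split_v F a b c d (u - e)) by pos.
 rewrite (Rect_split_v F (u - e) b c d (u + e)) by (lra || apply Hsub; lra).
 rewrite (Rect_split_h F (u - e) (u + e) c d (v - e)) by (lra || apply Hsub; lra).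
 rewrite (Rect_split_h F (u - e) (u + e) (v - e) d (v + e)) by (lra || apply Hsub; lra).
 rewrite (Goursat F a (u - e)), (Goursat F (u + e) b), (Goursat F (u - e) (u + e) c), (Goursat F (u - e) (u + e) (v + e));
  try lra; try (intros; apply HF; try lra; intros E; injection E; lra).
 match goal with |- Cmod ?X <= _ => replace X with (Rect F (u - e) (u + e) (v - e) (v + e)) by ring end.
 replace (8 * M * e) with (2 * (u + e - (u - e) + (v + e - (v - e))) * M) by ring.
 apply Rect_bound; try lra; [apply cont_on_bd, Hsub; lra|].
 intros x y Hx Hy _. unfold M.
 assert (Hd : Cmod ((x, y) - (u, v)) < dl).
 { eapply Rle_lt_trans; [apply Cmod_le_l1|]. simpl.
  assert (Rabs (x + - u) <= e) by (apply Rabs_le; lra). assert (Rabs (y + - v) <= e) by (apply Rabs_le; lra). lra. }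
 specialize (H1 _ Hd). pose proof (Cmod_rev_triangle (F (x, y)) (F (u, v))). lra. }
apply Cmod_eq_0, Rle_antisym; [|pos].
apply le_epsilon. intros ep Hep. rewrite Rplus_0_l.
set (m := Rmin (dl / 2) (Rmin (Rmin (u - a) (b - u)) (Rmin (v - c) (d - v)))).
assert (Hm : 0 < m) by (repeat apply Rmin_pos; lra).
set (e := Rmin (m / 2) (ep / (8 * M))).
assert (He : 0 < e) by (apply Rmin_pos; pos).
assert (Hem : e < m) by (apply Rle_lt_trans with (m / 2); [apply Rmin_l|lra]).
assert (m <= dl / 2) by apply Rmin_l.
assert (Hm2 : m <= Rmin (Rmin (u - a) (b - u)) (Rmin (v - c) (d - v))) by apply Rmin_r.
assert (Hm3 := Rle_trans _ _ _ Hm2 (Rmin_l _ _)). assert (Hm4 := Rle_trans _ _ _ Hm2 (Rmin_r _ _)).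
assert (m <= u - a) by (eapply Rle_trans; [exact Hm3|apply Rmin_l]).
assert (m <= b - u) by (eapply Rle_trans; [exact Hm3|apply Rmin_r]).
assert (m <= v - c) by (eapply Rle_trans; [exact Hm4|apply Rmin_l]).
assert (m <= d - v) by (eapply Rle_trans; [exact Hm4|apply Rmin_r]).
eapply Rle_trans; [apply (Key e); lra|].
assert (He2 : e <= ep / (8 * M)) by apply Rmin_r.
apply Rmult_le_compat_l with (r := 8 * M) in He2; [|lra].
replace (8 * M * (ep / (8 * M))) with ep in He2 by (field; lra). exact He2.
Qed.

Lemma cont_on_bounded F a b c d : a <= b -> c <= d -> cont_on F a b c d ->
 exists M, 0 < M /\ forall x y, a <= x <= b -> c <= y <= d -> Cmod (F (x, y)) <= M.
Proof.
intros Hab Hcd H.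
assert (HP := bisection (fun x y n => exists M, 0 < M /\ forall x' y', a <= x' <= b -> c <= y' <= d ->
  x <= x' <= x + (b - a) / 2 ^ n -> y <= y' <= y + (d - c) / 2 ^ n -> Cmod (F (x', y')) <= M) a c (b - a) (d - c) ltac:(lra) ltac:(lra)).
destruct HP as [M [HM0 HM]].
- intros x y n [M1 [P1 H1]] [M2 [P2 H2]] [M3 [P3 H3]] [M4 [P4 H4]].
 exists (M1 + M2 + M3 + M4). split; [lra|]. intros x' y' Hx' Hy' Hx Hy.
 assert (Eh : forall m, m / 2 ^ n = m / 2 ^ S n + m / 2 ^ S n) by (intros m; simpl; field; apply pow_nonzero; lra).
 rewrite Eh in Hx, Hy.
 destruct (Rle_dec x' (x + (b - a) / 2 ^ S n)); destruct (Rle_dec y' (y + (d - c) / 2 ^ S n)).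
 + apply Rle_trans with M1; [apply H1; lra|lra].
 + apply Rle_trans with M3; [apply H3; lra|lra].
 + apply Rle_trans with M2; [apply H2; lra|lra].
 + apply Rle_trans with M4; [apply H4; lra|lra].
- intros u v Hu Hv. destruct (H u v ltac:(lra) ltac:(lra) 1 Rlt_0_1) as [dl [Hdl H1]].
 destruct (pow2_small (b - a + (d - c)) dl) as [N HN]; [lra..|].
 exists N. intros n x y Hn _ _ _ _ Hxu Hyv. specialize (HN n Hn).
 exists (Cmod (F (u, v)) + 1). split; [pose proof (Cmod_ge_0 (F (u, v))); lra|].
 intros x' y' _ _ Hx' Hy'.
 assert (Hd : Cmod ((x', y') - (u, v)) < dl).
 { eapply Rle_lt_trans; [apply Cmod_le_l1|]. simpl.
  assert (Rabs (x' + - u) <= (b - a) / 2 ^ n) by (apply Rabs_le; lra).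
  assert (Rabs (y' + - v) <= (d - c) / 2 ^ n) by (apply Rabs_le; lra). lra. }
 specialize (H1 _ Hd). pose proof (Cmod_rev_triangle (F (x', y')) (F (u, v))). lra.
- exists M. split; auto. intros x y Hx Hy. apply HM; lra.
Qed.

(** * Cauchy's formula and the identity theorem *)

Lemma CInt_Im_pos (f : R -> C) a b : a < b -> ccont f a b -> (forall t, a <= t <= b -> 0 < Im (f t)) ->
 0 < Im (CInt f a b).
Proof.
intros Hab Hc Hp. destruct (CInt_parts f a b Hc) as [_ H].
rewrite <- (is_RInt_unique _ _ _ _ H). apply RInt_gt_0; [lra|intros; apply Hp; lra|].
intros t Ht. apply (continuous_comp f Im); [apply Hc; rewrite Rmin_left, Rmax_right; lra|].
apply (continuous_snd (U := R_UniformSpace) (V := R_UniformSpace)).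
Qed.

Lemma holo_cauchy_kernel w z : z <> w -> holo (fun z => / (z - w))%C z.
Proof.
intros H. apply holo_inv; [apply holo_minus; [apply holo_id|apply holo_const]|].
intros E. apply H, Cminus_eq_0, E.
Qed.

Lemma holo_cont F z : holo F z -> forall eps, 0 < eps -> exists dl, 0 < dl /\
 forall w, Cmod (w - z) < dl -> Cmod (F w - F z) < eps.
Proof. intros [l Hl]. exact (cderiv_cont _ _ _ Hl). Qed.

Lemma bd_ne a b c d u v x y : a < u < b -> c < v < d -> (x = a \/ x = b) \/ (y = c \/ y = d) -> (x, y) <> (u, v).
Proof. intros Hu Hv H E. injection E as -> ->. lra. Qed.

(** The value [2 pi i] is not computed. On each of the four oriented sides the kernel times [dz] has
    positive imaginary part, so the imaginary part of the whole integral is positive. *)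
Lemma cauchy_kernel_nonzero a b c d u v : a < u < b -> c < v < d ->
 Rect (fun z => / (z - (u, v)))%C a b c d <> RtoC 0.
Proof.
intros Hu Hv E.
assert (Hbd : cont_bd (fun z => / (z - (u, v)))%C a b c d).
{ intros x y Hx Hy Hb. apply (holo_cont (fun z => / (z - (u, v)))%C), holo_cauchy_kernel. eapply bd_ne; eassumption. }
apply (f_equal Im) in E. unfold Rect in E.
assert (H1 : 0 < Im (CInt (fun x => / ((x, c) - (u, v)))%C a b)).
{ apply CInt_Im_pos; [lra|apply (cont_bd_h (fun z => / (z - (u, v)))%C a b c d c); tauto || lra|].
 intros t Ht. change (0 < - (c + - v) / ((t + - u) ^ 2 + (c + - v) ^ 2)). apply Rdiv_lt_0_compat; [lra|].
 pose proof (pow2_ge_0 (t + - u)). nra. }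
assert (H2 : 0 < Im (CInt (fun y => Ci * / ((b, y) - (u, v)))%C c d)).
{ apply CInt_Im_pos; [lra|apply (cont_bd_v (fun z => / (z - (u, v)))%C a b c d b); tauto || lra|].
 intros t Ht. change (0 < 0 * (- (t + - v) / ((b + - u) ^ 2 + (t + - v) ^ 2)) + 1 * ((b + - u) / ((b + - u) ^ 2 + (t + - v) ^ 2))).
 rewrite Rmult_0_l, Rplus_0_l, Rmult_1_l. apply Rdiv_lt_0_compat; [lra|].
 pose proof (pow2_ge_0 (t + - v)). nra. }
assert (Hd : ccont (fun x => / ((x, d) - (u, v)))%C a b) by (apply (cont_bd_h (fun z => / (z - (u, v)))%C a b c d d); tauto || lra).
assert (Ha : ccont (fun y => Ci * / ((a, y) - (u, v)))%C c d) by (apply (cont_bd_v (fun z => / (z - (u, v)))%C a b c d a); tauto || lra).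
assert (Hneg : forall f p q, ccont f p q -> ccont (fun t => (- (1)) * f t)%C p q).
{ intros f p q Hf t Ht. apply (continuous_ext (U := C_UniformSpace) (fun t => opp (f t) : C_R_NormedModule)).
 - intros x. change (- f x = - (1) * f x)%C. ring.
 - apply (continuous_opp (V := C_R_NormedModule)), Hf, Ht. }
assert (H3 : 0 < Im (CInt (fun x => (- (1)) * / ((x, d) - (u, v)))%C a b)).
{ apply CInt_Im_pos; [lra|eauto|].
 intros t Ht.
 replace (- (1) * / ((t, d) - (u, v)))%C with (- / ((t, d) - (u, v)))%C by ring.
 change (0 < - (- (d + - v) / ((t + - u) ^ 2 + (d + - v) ^ 2))).
 replace (- (- (d + - v) / ((t + - u) ^ 2 + (d + - v) ^ 2))) with ((d + - v) / ((t + - u) ^ 2 + (d + - v) ^ 2)) by lra.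
 apply Rdiv_lt_0_compat; [lra|].
 pose proof (pow2_ge_0 (t + - u)). nra. }
assert (H4 : 0 < Im (CInt (fun y => (- (1)) * (Ci * / ((a, y) - (u, v))))%C c d)).
{ apply CInt_Im_pos; [lra|auto|].
 intros t Ht.
 replace (- (1) * (Ci * / ((a, t) - (u, v))))%C with (- (Ci * / ((a, t) - (u, v))))%C by ring.
 change (0 < - (0 * (- (t + - v) / ((a + - u) ^ 2 + (t + - v) ^ 2)) + 1 * ((a + - u) / ((a + - u) ^ 2 + (t + - v) ^ 2)))).
 replace (- (0 * (- (t + - v) / ((a + - u) ^ 2 + (t + - v) ^ 2)) + 1 * ((a + - u) / ((a + - u) ^ 2 + (t + - v) ^ 2))))
  with ((u - a) / ((a + - u) ^ 2 + (t + - v) ^ 2)) by lra.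
 apply Rdiv_lt_0_compat; [lra|].
 pose proof (pow2_ge_0 (t + - v)). nra. }
rewrite CInt_scal in H3, H4 by assumption.
set (I1 := CInt _ a b) in H1. set (I2 := CInt _ c d) in H2.
match type of H3 with context [CInt ?f a b] => set (I3 := CInt f a b) in * end.
match type of H4 with context [CInt ?f c d] => set (I4 := CInt f c d) in * end.
fold I1 I2 in E. destruct I1, I2, I3, I4. simpl in *. lra.
Qed.

(** Goursat's lemma with an exceptional point is applied to the difference quotient, completed by
    the derivative at [w]. The integral of the kernel stays as an unevaluated factor; it matters
    only that it is not zero. *)
Lemma Cauchy_formula F a b c d u v : a < u < b -> c < v < d ->
 (forall x y, a <= x <= b -> c <= y <= d -> holo F (x, y)) ->
 Rect (fun z => F z * / (z - (u, v)))%C a b c d = (F (u, v) * Rect (fun z => / (z - (u, v)))%C a b c d)%C.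
Proof.
intros Hu Hv HF. set (w := (u, v) : C).
destruct (HF u v ltac:(lra) ltac:(lra)) as [D HD].
set (G := fun z : C => if excluded_middle_informative (z = w) then D else ((F z - F w) * / (z - w))%C).
assert (HGne : forall z, z <> w -> G z = ((F z - F w) * / (z - w))%C).
{ intros z Hz. unfold G. destruct (excluded_middle_informative (z = w)); easy. }
assert (HGw : G w = D) by (unfold G; destruct (excluded_middle_informative (w = w)); easy).
assert (HGh : forall x y, a <= x <= b -> c <= y <= d -> (x, y) <> w -> holo G (x, y)).
{ intros x y Hx Hy Hne. set (z := (x, y) : C) in *.
 apply (holo_ext_loc (fun z => (F z - F w) * / (z - w))%C G z (Cmod (z - w))).
 - apply Cmod_gt_0. intros E. apply Hne, Cminus_eq_0, E.
 - intros q Hq. symmetry. apply HGne. intros ->. rewrite Cmod_minus_sym in Hq. lra.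
 - apply holo_mult; [apply holo_minus; [eauto|apply holo_const]|apply holo_cauchy_kernel; exact Hne]. }
assert (HGc : cont_on G a b c d).
{ intros x y Hx Hy. destruct (excluded_middle_informative ((x, y) = w)) as [E|E].
 - rewrite E. intros eps He. destruct (HD (eps / 2)) as [dl [Hdl H1]]; [lra|].
  exists dl. split; auto. intros q Hq. rewrite HGw.
  destruct (excluded_middle_informative (q = w)) as [->|Hqw].
  + rewrite HGw. replace (D - D)%C with (RtoC 0) by ring. rewrite Cmod_0. exact He.
  + rewrite (HGne q Hqw).
   assert (Hqw' : (q - w)%C <> RtoC 0) by (intros E'; apply Hqw, Cminus_eq_0, E').
   replace ((F q - F w) * / (q - w) - D)%C with ((F q - F w - D * (q - w)) / (q - w))%C by (field; exact Hqw').
   rewrite Cmod_div by pos. specialize (H1 q Hq).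
   assert (0 < Cmod (q - w)) by (apply Cmod_gt_0; exact Hqw').
   apply Rle_lt_trans with (eps / 2); [|lra].
   apply Rmult_le_reg_r with (Cmod (q - w)); auto.
   unfold Rdiv at 1. rewrite Rmult_assoc, Rinv_l, Rmult_1_r by lra. exact H1.
 - apply holo_cont, HGh; assumption. }
assert (HK : cont_bd (fun z => / (z - w))%C a b c d).
{ intros x y Hx Hy Hb. apply (holo_cont (fun z => / (z - w))%C), holo_cauchy_kernel. eapply bd_ne; eassumption. }
assert (HFK : cont_bd (fun z => F z * / (z - w))%C a b c d).
{ intros x y Hx Hy Hb. apply (holo_cont (fun z => F z * / (z - w))%C), holo_mult; auto. apply holo_cauchy_kernel. eapply bd_ne; eassumption. }
assert (H0 := Goursat_except G a b c d u v Hu Hv HGc HGh).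
rewrite (Rect_ext G (fun z => F z * / (z - w) - F w * / (z - w))%C) in H0; try lra.
2:{ intros x y Hx Hy Hb. rewrite HGne by (eapply bd_ne; eassumption). ring. }
rewrite Rect_minus, Rect_scal in H0; try lra; try assumption; [|apply cont_bd_scal; assumption].
match goal with |- ?X = ?Y => replace X with ((X - Y) + Y)%C by ring end. rewrite H0. ring.
Qed.

Lemma Rle_0_of_small (x B : R) (tau : R) : 0 < tau -> (forall t, 0 < t < tau -> x <= t * B) -> x <= 0.
Proof.
intros Ht H. apply Rnot_lt_le. intros Hx.
assert (HB : 0 < B).
{ specialize (H (tau / 2) ltac:(lra)). nra. }
set (t := Rmin (tau / 2) (x / (2 * B))).
assert (Ht0 : 0 < t) by (apply Rmin_pos; pos).
assert (t <= tau / 2) by apply Rmin_l. assert (Ht2 : t <= x / (2 * B)) by apply Rmin_r.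
specialize (H t ltac:(lra)). apply Rmult_le_compat_r with (r := B) in Ht2; [|lra].
replace (x / (2 * B) * B) with (x / 2) in Ht2 by (field; lra). lra.
Qed.

Lemma Cmod_ge_Re (z : C) : Rabs (Re z) <= Cmod z.
Proof. eapply Rle_trans; [apply Rmax_l|apply Rmax_Cmod]. Qed.
Lemma Cmod_ge_Im (z : C) : Rabs (Im z) <= Cmod z.
Proof. eapply Rle_trans; [apply Rmax_r|apply Rmax_Cmod]. Qed.

(** Taylor's formula in integral form. Up to the factor from the kernel, [T k w0] is the k-th Taylor
    coefficient at [w0] and [T k w] a remainder. Zeros on a segment issuing from [w0] in direction
    [e] kill the coefficients one after another, and the remainders tend to 0 geometrically on the
    disc because the boundary is at distance at least [R0] from [w0]. *)
Theorem identity_theorem (F : C -> C) (w0 e : C) (R0 tau : R) : 0 < R0 -> 0 < tau -> Cmod e = 1 ->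
 (forall z, Rabs (Re z - Re w0) <= R0 -> Rabs (Im z - Im w0) <= R0 -> holo F z) ->
 (forall t, 0 < t < tau -> F (w0 + t * e)%C = RtoC 0) ->
 forall w, Cmod (w - w0) < R0 -> F w = RtoC 0.
Proof.
intros HR Htau He HF HZ.
destruct w0 as [x0 y0].
set (w0 := (x0, y0) : C) in *.
set (a := x0 - R0). set (b := x0 + R0). set (c := y0 - R0). set (d := y0 + R0).
assert (HF' : forall x y, a <= x <= b -> c <= y <= d -> holo F (x, y)).
{ intros x y Hx Hy. unfold a, b, c, d in *. apply HF; simpl; apply Rabs_le; lra. }
destruct (cont_on_bounded F a b c d) as [M [HM0 HM]]; try (unfold a, b, c, d; lra); [apply holo_cont_on, HF'|].
assert (Hin : forall w : C, Cmod (w - w0) < R0 -> a < Re w < b /\ c < Im w < d).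
{ intros [u v] Hw. pose proof (Cmod_ge_Re ((u, v) - w0)) as H1. pose proof (Cmod_ge_Im ((u, v) - w0)) as H2. simpl in *.
 assert (Rabs (u + - x0) < R0) as H3 by lra. assert (Rabs (v + - y0) < R0) as H4 by lra.
 apply Rabs_def2 in H3, H4. unfold a, b, c, d. lra. }
assert (Hbd : forall x y, a <= x <= b -> c <= y <= d -> (x = a \/ x = b) \/ (y = c \/ y = d) -> R0 <= Cmod ((x, y) - w0)).
{ intros x y Hx Hy Hb. destruct Hb as [Hb|Hb].
 - eapply Rle_trans; [|apply Cmod_ge_Re]. simpl. unfold a, b in *. destruct Hb as [->| ->].
  + rewrite Rabs_left1 by lra. lra.
  + rewrite Rabs_right by lra. lra.
 - eapply Rle_trans; [|apply Cmod_ge_Im]. simpl. unfold c, d in *. destruct Hb as [->| ->].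
  + rewrite Rabs_left1 by lra. lra.
  + rewrite Rabs_right by lra. lra. }
assert (Hab : a <= b) by (unfold a, b; lra). assert (Hcd : c <= d) by (unfold c, d; lra).
assert (H00 : Cmod (w0 - w0) < R0) by (replace (w0 - w0)%C with (RtoC 0) by ring; rewrite Cmod_0; exact HR).
set (g := fun (w : C) k (z : C) => (F z * / (z - w) * (/ (z - w0)) ^ k)%C).
set (T := fun k w => Rect (g w k) a b c d).
assert (Hgh : forall w k x y, Cmod (w - w0) < R0 -> a <= x <= b -> c <= y <= d -> (x = a \/ x = b) \/ (y = c \/ y = d) ->
  holo (g w k) (x, y)).
{ intros w k x y Hw Hx Hy Hb.
 apply (holo_mult (fun z => F z * / (z - w))%C (fun z => (/ (z - w0)) ^ k)%C).
 - apply holo_mult; auto. apply holo_cauchy_kernel. destruct (Hin w Hw). destruct w as [u v]. eapply bd_ne; eassumption.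
 - apply (holo_pow (fun z => / (z - w0))%C), holo_cauchy_kernel. destruct (Hin w0 H00). eapply bd_ne; eassumption. }
assert (Hgc : forall w k, Cmod (w - w0) < R0 -> cont_bd (g w k) a b c d).
{ intros w k Hw x y Hx Hy Hb. apply holo_cont, Hgh; assumption. }
(* This is [1/(z-w) = 1/(z-w0) + (w-w0) / ((z-w)(z-w0))] under the integral. *)
assert (HTrec : forall k w, Cmod (w - w0) < R0 -> T k w = (T k w0 + (w - w0) * T (S k) w)%C).
{ intros k w Hw. unfold T. rewrite <- Rect_scal, <- Rect_plus; try lra; try (apply cont_bd_scal); try (apply Hgc; assumption).
 apply Rect_ext; try lra. intros x y Hx Hy Hb. unfold g.
 set (z := (x, y) : C).
 assert (z - w <> 0)%C.
 { intros E. apply Cminus_eq_0 in E. destruct (Hin w Hw). destruct w as [u v]. revert E. eapply bd_ne; eassumption. }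
 assert (z - w0 <> 0)%C.
 { intros E. apply Cminus_eq_0 in E. destruct (Hin w0 H00). revert E. eapply bd_ne; eassumption. }
 simpl Cpow. field. split; assumption. }
assert (HTb : forall k w, Cmod (w - w0) < R0 -> Cmod (T k w) <= 8 * R0 * (M / (R0 - Cmod (w - w0)) * (/ R0) ^ k)).
{ intros k w Hw. unfold T. replace (8 * R0) with (2 * (b - a + (d - c))) by (unfold a, b, c, d; ring).
 apply Rect_bound; auto.
 intros x y Hx Hy Hb. unfold g. set (z := (x, y) : C).
 assert (H1 := Hbd x y Hx Hy Hb). fold z in H1.
 assert (Hz0 : (z - w0 <> 0)%C) by (apply Cmod_gt_0; lra).
 assert (H2 : R0 - Cmod (w - w0) <= Cmod (z - w)).
 { pose proof (Cmod_triangle (z - w) (w - w0)) as H3. replace (z - w + (w - w0))%C with (z - w0)%C in H3 by ring. lra. }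
 assert (Hz : (z - w <> 0)%C) by (apply Cmod_gt_0; lra).
 rewrite !Cmod_mult, Cmod_pow, !Cmod_inv by assumption.
 apply Rmult_le_compat.
 - apply Rmult_le_pos; [pos|pos].
 - pos.
 - apply Rmult_le_compat; [pos|pos|eauto|apply Rinv_le_contravar; lra].
 - apply pow_incr. split; [pos|apply Rinv_le_contravar; lra]. }
assert (HT0 : forall w, Cmod (w - w0) < R0 -> T 0%nat w = (F w * Rect (fun z => / (z - w))%C a b c d)%C).
{ intros [u v] Hw. destruct (Hin _ Hw) as [H1 H2].
 rewrite <- (Cauchy_formula F a b c d u v H1 H2 HF'). unfold T. apply Rect_ext; try lra. intros. unfold g. ring. }
assert (Hline : forall t, 0 < t -> Cmod (w0 + t * e - w0) = t).
{ intros t Ht. replace (w0 + t * e - w0)%C with (t * e)%C by ring. rewrite Cmod_mult, Cmod_R, He, Rabs_right by lra. ring. }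
assert (Hck : forall k, T k w0 = RtoC 0 /\ forall w, Cmod (w - w0) < R0 -> T 0%nat w = ((w - w0) ^ (S k) * T (S k) w)%C).
{ intros k.
 (* At points [w] of the segment [T k w = 0], so the recursion gives
    [T k w0 = - (w - w0) T (S k) w]; the right side tends to 0 as [w] tends to [w0]. *)
 assert (Step : forall k, (forall w, Cmod (w - w0) < R0 -> T 0%nat w = ((w - w0) ^ k * T k w)%C) -> T k w0 = RtoC 0).
 { clear k. intros k Hk. apply Cmod_eq_0, Rle_antisym; [|pos].
  apply (Rle_0_of_small _ (8 * R0 * (M / (R0 / 2) * (/ R0) ^ S k)) (Rmin tau (R0 / 2))); [apply Rmin_pos; lra|].
  intros t [Ht1 Ht2].
  assert (Ht3 := Rlt_le_trans _ _ _ Ht2 (Rmin_l _ _)). assert (Ht4 := Rlt_le_trans _ _ _ Ht2 (Rmin_r _ _)).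
  set (w := (w0 + t * e)%C).
  assert (Hw : Cmod (w - w0) = t) by eauto.
  assert (Hw0 : Cmod (w - w0) < R0) by lra.
  assert (HTk : T k w = RtoC 0).
  { specialize (Hk w Hw0). rewrite HT0 in Hk by lra. unfold w at 1 in Hk. rewrite HZ in Hk by lra.
   assert (Hp : ((w - w0) ^ k <> 0)%C) by (apply Cpow_nz, Cmod_gt_0; lra).
   apply (Cmult_0_r_inv ((w - w0) ^ k)%C); auto. rewrite <- Hk. ring. }
  rewrite HTrec in HTk by lra.
  replace (T k w0) with (- ((w - w0) * T (S k) w))%C by (apply Cminus_eq_0; rewrite <- Copp_0, <- HTk; ring).
  rewrite Cmod_opp, Cmod_mult, Hw. apply Rmult_le_compat_l; [lra|].
  eapply Rle_trans; auto. apply Rmult_le_compat_l; [lra|]. apply Rmult_le_compat_r.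
  - pos.
  - apply Rmult_le_compat_l; [lra|]. apply Rinv_le_contravar; [lra|]. lra. }
 induction k as [|k [IH1 IH2]].
 - assert (H0 : T 0%nat w0 = RtoC 0) by (apply Step; intros w _; simpl Cpow; ring).
  split; [easy|]. intros w Hw. rewrite (HTrec 0%nat w Hw) at 1. rewrite H0. ring.
 - assert (H0 : T (S k) w0 = RtoC 0) by auto.
  split; [pos|]. intros w Hw. rewrite IH2 by lra. rewrite (HTrec (S k) w Hw) at 1. rewrite H0. Cring. }
intros w Hw.
assert (HTw : T 0%nat w = RtoC 0).
{ apply Cmod_eq_0, Rle_antisym; [|pos].
 set (q := Cmod (w - w0) / R0). set (B := 8 * R0 * (M / (R0 - Cmod (w - w0)))).
 assert (Hq : Rabs q < 1).
 { unfold q. rewrite Rabs_right; [|apply Rle_ge; pos].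
  apply Rmult_lt_reg_r with R0; auto. unfold Rdiv. rewrite Rmult_assoc, Rinv_l by lra. lra. }
 assert (HB : 0 < B) by pos.
 apply le_epsilon. intros ep Hep.
 destruct (pow_lt_1_zero q Hq (ep / B)) as [N HN]; [pos|].
 specialize (HN (S N) ltac:(lia)).
 rewrite (proj2 (Hck N) w Hw), Cmod_mult, Cmod_pow.
 apply Rle_trans with (Cmod (w - w0) ^ S N * (8 * R0 * (M / (R0 - Cmod (w - w0)) * (/ R0) ^ S N))).
 { apply Rmult_le_compat_l; [pos|auto]. }
 replace (Cmod (w - w0) ^ S N * (8 * R0 * (M / (R0 - Cmod (w - w0)) * (/ R0) ^ S N))) with (B * q ^ S N).
 2:{ unfold B, q, Rdiv. rewrite Rpow_mult_distr. ring. }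
 apply Rle_trans with (B * (ep / B)); [|right; field; lra].
 apply Rmult_le_compat_l; [lra|]. eapply Rle_trans; [apply Rle_abs|lra]. }
rewrite HT0 in HTw by lra.
destruct (Hin w Hw) as [H1 H2]. destruct w as [u v].
assert (Hk := cauchy_kernel_nonzero a b c d u v H1 H2).
apply (Cmult_0_r_inv (Rect (fun z => / (z - (u, v)))%C a b c d)); auto. rewrite <- HTw. ring.
Qed.

(** * The transformation law of the eta function *)

(** Dominated convergence for series: beyond an index [N] both tails are bounded by the tail of [b],
    and the terms up to [N] converge one by one. *)
Lemma Tannery (a : nat -> nat -> R) (l b : nat -> R) :
 ex_series b -> (forall k i, Rabs (a k i) <= b i) -> (forall i, is_lim_seq (fun k => a k i) (l i)) ->
 is_lim_seq (fun k => Series (a k)) (Series l).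
Proof.
intros Hb Hab Hlim.
assert (Hlb : forall i, Rabs (l i) <= b i).
{ intros i. apply (is_lim_seq_le (fun k => Rabs (a k i)) (fun _ => b i) (Rabs (l i)) (b i)).
 - easy.
 - apply (is_lim_seq_abs (fun k => a k i) (l i)), Hlim.
 - apply is_lim_seq_const. }
assert (Hex : forall k, ex_series (a k)) by (intros k; apply (ex_series_le (V := R_CompleteNormedModule) (a k) b); easy).
assert (Hexl : ex_series l) by (apply (ex_series_le (V := R_CompleteNormedModule) l b); easy).
apply is_lim_seq_spec. intros eps.
assert (Htail : is_lim_seq (sum_n b) (Series b)) by exact (Series_correct b Hb).
apply is_lim_seq_spec in Htail. destruct (Htail (mkposreal (eps / 4) ltac:(destruct eps; simpl; lra))) as [N HN]. simpl in HN.
assert (Hfin : is_lim_seq (fun k => sum_n (a k) N) (sum_n l N)).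
{ clear -Hlim. induction N as [|N IH].
 - apply is_lim_seq_ext with (fun k => a k 0%nat); [intros k; rewrite sum_O; reflexivity|]. rewrite sum_O. apply Hlim.
 - apply is_lim_seq_ext with (fun k => sum_n (a k) N + a k (S N)); [intros k; rewrite sum_Sn; reflexivity|].
  rewrite sum_Sn. apply is_lim_seq_plus'; easy. }
apply is_lim_seq_spec in Hfin. destruct (Hfin (mkposreal (eps / 4) ltac:(destruct eps; simpl; lra))) as [K HK]. simpl in HK.
exists K. intros k Hk.
assert (Ht : forall c : nat -> R, ex_series c -> (forall i, Rabs (c i) <= b i) -> Rabs (Series c - sum_n c N) <= eps / 4).
{ intros c Hc Hcb.
 assert (Es : forall e : nat -> R, ex_series e -> Series e - sum_n e N = Series (fun i => e (S N + i)%nat)).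
 { intros e He. rewrite (Series_incr_n e (S N)) by (lia || exact He). rewrite sum_n_Reals. Cring. }
 rewrite (Es c Hc).
 assert (HbN : ex_series (fun i => b (S N + i)%nat)) by (apply (ex_series_incr_n b (S N)); exact Hb).
 apply Rle_trans with (Series (fun i => b (S N + i)%nat)).
 - via Series_Rabs.
  + apply (ex_series_le (V := R_CompleteNormedModule) _ (fun i => b (S N + i)%nat)); auto.
   intros i. rewrite Rabs_Rabsolu. apply Hcb.
  + apply Series_le; auto. intros i. split; [pos|easy].
 - rewrite <- (Es b Hb). specialize (HN N (le_n N)). apply Rabs_def2 in HN. lra. }
assert (H1 := Ht (a k) (Hex k) (Hab k)). assert (H2 := Ht l Hexl Hlb). specialize (HK k Hk).
apply Rabs_le_between in H1. apply Rabs_le_between in H2. apply Rabs_def2 in HK. apply Rabs_def1; lra.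
Qed.

(* [walk m d] is the coefficient of [t^d] in [(t + 2 + 1/t)^m], that is the binomial coefficient [(2m, m+d)]. *)
Fixpoint walk (m : nat) (d : Z) : R :=
 match m with
 | O => if Z.eqb d 0 then 1 else 0
 | S m' => walk m' (d - 1) + 2 * walk m' d + walk m' (d + 1)
 end.

Lemma walk_nonneg m d : 0 <= walk m d.
Proof.
revert d. induction m as [|m IH]; intros d; simpl; [destruct (Z.eqb d 0); lra|].
pose proof (IH (d - 1)%Z). pose proof (IH d). pose proof (IH (d + 1)%Z). lra.
Qed.

Lemma walk_sym m d : walk m (- d) = walk m d.
Proof.
revert d. induction m as [|m IH]; intros d; simpl.
- destruct (Z.eqb_spec d 0); destruct (Z.eqb_spec (- d) 0); lia || reflexivity.
- rewrite <- (IH (d - 1)%Z), <- (IH (d + 1)%Z), IH.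
 replace (- (d - 1))%Z with (- d + 1)%Z by ring. replace (- (d + 1))%Z with (- d - 1)%Z by ring. ring.
Qed.

(** The quotient of neighbouring binomial coefficients, cleared of denominators so that it also
    holds where they vanish. It is read off from the recursion of [walk] by induction, without
    factorials. *)
Lemma walk_ratio m d : (INR m + IZR d + 1) * walk m (d + 1) = (INR m - IZR d) * walk m d.
Proof.
revert d. induction m as [|m IH]; intros d.
- simpl. destruct (Z.eqb_spec (d + 1) 0) as [E|E]; destruct (Z.eqb_spec d 0) as [E'|E']; try lia.
 + assert (Hd : d = (-1)%Z) by lia. rewrite Hd. lra.
 + rewrite E'. ring.
 + ring.
- rewrite S_INR. cbn [walk].
 assert (H0 := IH d). assert (H1 := IH (d + 1)%Z). assert (H2 := IH (d - 1)%Z).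
 replace (d - 1 + 1)%Z with d in H2 by ring. replace (d + 1 - 1)%Z with d by ring.
 rewrite plus_IZR in H1. rewrite minus_IZR in H2. lra.
Qed.

Lemma walk0_pos m : 0 < walk m 0.
Proof.
induction m as [|m IH]; simpl; [lra|].
pose proof (walk_nonneg m (-1)%Z). pose proof (walk_nonneg m 1%Z). lra.
Qed.

Lemma walk0_rec m : walk (S m) 0 = 4 * walk m 0 * ((2 * INR m + 1) / (2 * INR m + 2)).
Proof.
cbn [walk]. change (0 + 1)%Z with 1%Z. rewrite walk_sym.
pose proof (walk_ratio m 0) as H. change (0 + 1)%Z with 1%Z in H.
pose proof (pos_INR m).
replace (walk m 1) with (INR m / (INR m + 1) * walk m 0); [field; lra|].
apply Rmult_eq_reg_l with (INR m + 1); [|lra].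
replace ((INR m + 1) * walk m 1) with ((INR m + 0 + 1) * walk m 1) by ring. rewrite H. field. lra.
Qed.

(* The value of the limit is irrelevant: it cancels when the functional equation is specialised at y = 1. *)
Lemma walk0_asymp : exists kap : R, 0 < kap /\ is_lim_seq (fun m => sqrt (INR m) * (walk m 0 / 4 ^ m)) kap.
Proof.
set (w := fun m => sqrt (INR m) * (walk m 0 / 4 ^ m)).
assert (Hrec : forall m, walk (S m) 0 / 4 ^ S m = walk m 0 / 4 ^ m * ((2 * INR m + 1) / (2 * INR m + 2))).
{ intros m. rewrite walk0_rec. pose proof (pos_INR m). simpl. field. split; pos. }
assert (Hpos : forall m, 0 < walk m 0 / 4 ^ m) by (intros m; apply Rdiv_lt_0_compat; [apply walk0_pos|pos]).
(* The normalised central coefficient decreases after multiplication by [sqrt (m + 1/2)] and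
   increases after multiplication by [sqrt m]. These two monotonicities replace Stirling's
   formula. *)
assert (Hb : forall m, sqrt (INR m + 1/2) * (walk m 0 / 4 ^ m) <= 1).
{ intros m. induction m as [|m IH].
 - simpl. replace (1 / 1) with 1 by lra. rewrite Rmult_1_r. rewrite <- sqrt_1 at 2. apply sqrt_le_1_alt. lra.
 - eapply Rle_trans; [|exact IH]. rewrite Hrec, S_INR. pose proof (pos_INR m) as Hm. set (M := INR m) in *.
  rewrite (Rmult_comm (walk m 0 / 4 ^ m)), <- Rmult_assoc. apply Rmult_le_compat_r; [left; apply Hpos|].
  replace ((2 * M + 1) / (2 * M + 2)) with (sqrt (((2 * M + 1) / (2 * M + 2)) ^ 2)) by (apply sqrt_pow2; apply Rdiv_le_0_compat; lra).
  rewrite <- sqrt_mult by nra. apply sqrt_le_1_alt, Rmult_le_reg_r with ((2 * M + 2) ^ 2); [nra|].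
  replace ((M + 1 + 1 / 2) * ((2 * M + 1) / (2 * M + 2)) ^ 2 * (2 * M + 2) ^ 2) with ((M + 1 + 1 / 2) * (2 * M + 1) ^ 2) by (field; lra).
  nra. }
assert (Hinc : forall m, w m <= w (S m)).
{ intros m. unfold w. rewrite Hrec, S_INR. pose proof (pos_INR m) as Hm. set (M := INR m) in *.
 rewrite (Rmult_comm (walk m 0 / 4 ^ m) ((2 * M + 1) / (2 * M + 2))), <- (Rmult_assoc (sqrt (M + 1))). apply Rmult_le_compat_r; [left; apply Hpos|].
 replace ((2 * M + 1) / (2 * M + 2)) with (sqrt (((2 * M + 1) / (2 * M + 2)) ^ 2)) by (apply sqrt_pow2; apply Rdiv_le_0_compat; lra).
 rewrite <- sqrt_mult by nra. apply sqrt_le_1_alt, Rmult_le_reg_r with ((2 * M + 2) ^ 2); [nra|].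
 replace ((M + 1) * ((2 * M + 1) / (2 * M + 2)) ^ 2 * (2 * M + 2) ^ 2) with ((M + 1) * (2 * M + 1) ^ 2) by (field; lra).
 nra. }
assert (Hub : forall m, w m <= 1).
{ intros m. eapply Rle_trans; [|apply (Hb m)]. apply Rmult_le_compat_r; [left; apply Hpos|]. apply sqrt_le_1_alt. lra. }
assert (Hex := ex_finite_lim_seq_incr w 1 Hinc Hub). destruct Hex as [kap Hk].
exists kap. split; auto.
apply Rlt_le_trans with (w 1%nat).
- apply Rmult_lt_0_compat; [pos|easy].
- apply (is_lim_seq_incr_compare w kap Hk Hinc 1%nat).
Qed.

(** * Finite sums and Polya's trigonometric identity *)

Definition rsum (u : nat -> R) (N : nat) : R := sum_n u N.

Lemma rsum_scal (c : R) (u : nat -> R) N : c * rsum u N = rsum (fun i => c * u i) N.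
Proof. symmetry. exact (sum_n_mult_l (K := R_Ring) c u N). Qed.
Lemma rsum_plus (u v : nat -> R) N : rsum u N + rsum v N = rsum (fun i => u i + v i) N.
Proof. symmetry. exact (sum_n_plus (G := R_AbelianMonoid) u v N). Qed.
Lemma rsum_ext (u v : nat -> R) N : (forall i, (i <= N)%nat -> u i = v i) -> rsum u N = rsum v N.
Proof. exact (sum_n_ext_loc u v N). Qed.
Lemma rsum_S (u : nat -> R) N : rsum u (S N) = rsum u N + u (S N).
Proof. exact (sum_Sn u N). Qed.
Lemma rsum_O (u : nat -> R) : rsum u 0 = u 0%nat.
Proof. exact (sum_O u). Qed.

(** Multiplication by [2 sin (pi n / l)] makes the sum telescope to [sin (2 pi n) = 0]. If [l]
    divides [n] that factor vanishes, but then every term equals the sign of the parity of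
    [n / l]. *)
Lemma sum_cos_odd (l : nat) (n : Z) : (0 < l)%nat ->
 rsum (fun v => cos (PI * IZR n * (2 * INR v + 1) / INR l)) (pred l) =
 if Z.eqb (n mod Z.of_nat l) 0 then INR l * (if Z.even (n / Z.of_nat l) then 1 else -1) else 0.
Proof.
intros Hl. assert (HlR : 0 < INR l) by pos.
destruct (Z.eqb_spec (n mod Z.of_nat l) 0) as [E|E].
- assert (En : n = (Z.of_nat l * (n / Z.of_nat l))%Z) by (pose proof (Z.div_mod n (Z.of_nat l)); lia).
 set (J := (n / Z.of_nat l)%Z) in *.
 rewrite (rsum_ext _ (fun _ => if Z.even J then 1 else -1)).
 + rewrite sum_n_const. replace (S (pred l)) with l by lia. reflexivity.
 + intros v _. rewrite En, mult_IZR, <- INR_IZR_INZ.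
  replace (PI * (INR l * IZR J) * (2 * INR v + 1) / INR l) with (IZR J * (2 * INR v + 1) * PI) by (field; lra).
  assert (Eo : IZR J * (2 * INR v + 1) = IZR (J * (2 * Z.of_nat v + 1))) by (rewrite mult_IZR, plus_IZR, mult_IZR, <- INR_IZR_INZ; reflexivity).
  rewrite Eo.
  destruct (Z.even J) eqn:EJ.
  * apply Z.even_spec in EJ. destruct EJ as [q ->].
   replace (2 * q * (2 * Z.of_nat v + 1))%Z with (2 * (q * (2 * Z.of_nat v + 1)))%Z by ring.
   rewrite mult_IZR. set (y := IZR (q * _)).
   replace (IZR 2 * y * PI) with (2 * (y * PI)) by ring.
   rewrite cos_2a_sin. assert (Hs : sin (y * PI) = 0) by (apply sin_eq_0_1; eexists; reflexivity). nra.
  * assert (EO : Z.odd J = true) by (rewrite <- Z.negb_even, EJ; reflexivity). apply Z.odd_spec in EO. destruct EO as [q ->].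
   replace ((2 * q + 1) * (2 * Z.of_nat v + 1))%Z with (2 * (q * (2 * Z.of_nat v + 1) + Z.of_nat v) + 1)%Z by ring.
   rewrite plus_IZR, mult_IZR. set (y := IZR (q * _ + _)).
   replace ((2 * y + 1) * PI) with (2 * (y * PI) + PI) by ring.
   rewrite neg_cos, cos_2a_sin. assert (Hs : sin (y * PI) = 0) by (apply sin_eq_0_1; eexists; reflexivity). nra.
- set (a := PI * IZR n / INR l).
 assert (Hs : sin a <> 0).
 { intros H. apply sin_eq_0_0 in H. destruct H as [q Hq]. apply E.
  assert (IZR n = IZR (q * Z.of_nat l)).
  { rewrite mult_IZR, <- INR_IZR_INZ. unfold a in Hq. apply Rmult_eq_reg_l with (PI / INR l); [|apply Rgt_not_eq, Rdiv_lt_0_compat; [apply PI_RGT_0|lra]].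
   transitivity (PI * IZR n / INR l); [lra|]. rewrite Hq. field. lra. }
  apply eq_IZR in H. rewrite H. apply Z_mod_mult. }
 assert (Tel : forall N, 2 * sin a * rsum (fun v => cos (PI * IZR n * (2 * INR v + 1) / INR l)) N = sin (a * (2 * INR (S N)))).
 { induction N as [|N IH].
  - rewrite rsum_O. simpl INR. replace (PI * IZR n * (2 * 0 + 1) / INR l) with a by (unfold a; field; lra).
   replace (a * (2 * 1)) with (2 * a) by ring. rewrite sin_2a. ring.
  - rewrite rsum_S, Rmult_plus_distr_l, IH.
   set (b := a * (2 * INR (S N) + 1)).
   replace (PI * IZR n * (2 * INR (S N) + 1) / INR l) with b by (unfold b, a; field; lra).
   replace (a * (2 * INR (S N))) with (b - a) by (unfold b; ring).
   replace (a * (2 * INR (S (S N)))) with (b + a) by (unfold b; rewrite (S_INR (S N)); ring).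
   rewrite sin_plus, sin_minus. ring. }
 specialize (Tel (pred l)). replace (S (pred l)) with l in Tel by lia.
 replace (a * (2 * INR l)) with (2 * (IZR n * PI)) in Tel by (unfold a; field; lra).
 rewrite sin_2a in Tel. assert (H0 : sin (IZR n * PI) = 0) by (apply sin_eq_0_1; eexists; reflexivity). nra.
Qed.

Lemma rsum_zero (u : nat -> R) N : (forall i, (i <= N)%nat -> u i = 0) -> rsum u N = 0.
Proof.
intros H. rewrite (rsum_ext u (fun _ => 0)) by easy. rewrite sum_n_const. apply Rmult_0_r.
Qed.

Lemma rsum_single (u : nat -> R) N q : (q <= N)%nat -> (forall i, (i <= N)%nat -> i <> q -> u i = 0) ->
 rsum u N = u q.
Proof.
intros Hq H. induction N as [|N IH].
- rewrite rsum_O. f_equal. lia.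
- rewrite rsum_S.
 destruct (Nat.eq_dec q (S N)) as [->|Hne].
 + rewrite rsum_zero; [ring|]. intros i Hi. apply H; lia.
 + rewrite IH; [|lia|auto]. rewrite (H (S N)) by lia. ring.
Qed.

Section Polya.
Variable l : nat.
Hypothesis Hl : (0 < l)%nat.

Let th v := PI * (2 * INR v + 1) / (2 * INR l).
Let Phi m (s : Z) := rsum (fun v => (2 * cos (th v)) ^ (2 * m) * cos (2 * IZR s * th v)) (pred l).
Let sg (i : nat) := (-1) ^ i.
Let Psi N m (s : Z) := INR l * rsum (fun i => sg i * (walk m (Z.of_nat l * Z.of_nat i + s) - walk m (s - Z.of_nat l * (Z.of_nat i + 1)))) N.

Let Phi_rec m s : Phi (S m) s = Phi m (s - 1) + 2 * Phi m s + Phi m (s + 1).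
Proof.
unfold Phi. rewrite rsum_scal, !rsum_plus. apply rsum_ext. intros v _.
rewrite minus_IZR, plus_IZR.
replace (2 * (IZR s - 1) * th v) with (2 * IZR s * th v - 2 * th v) by ring.
replace (2 * (IZR s + 1) * th v) with (2 * IZR s * th v + 2 * th v) by ring.
rewrite cos_minus, cos_plus.
replace (2 * S m)%nat with (2 + 2 * m)%nat by lia. rewrite pow_add, (cos_2a_cos (th v)).
ring.
Qed.

Let Psi_rec N m s : Psi N (S m) s = Psi N m (s - 1) + 2 * Psi N m s + Psi N m (s + 1).
Proof.
unfold Psi. rewrite !rsum_scal, !rsum_plus. apply rsum_ext. intros i _. cbn [walk].
replace (Z.of_nat l * Z.of_nat i + (s - 1))%Z with (Z.of_nat l * Z.of_nat i + s - 1)%Z by ring.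
replace (Z.of_nat l * Z.of_nat i + (s + 1))%Z with (Z.of_nat l * Z.of_nat i + s + 1)%Z by ring.
replace (s - 1 - Z.of_nat l * (Z.of_nat i + 1))%Z with (s - Z.of_nat l * (Z.of_nat i + 1) - 1)%Z by ring.
replace (s + 1 - Z.of_nat l * (Z.of_nat i + 1))%Z with (s - Z.of_nat l * (Z.of_nat i + 1) + 1)%Z by ring.
ring.
Qed.

Let sg_even q : (0 <= q)%Z -> sg (Z.to_nat q) = if Z.even q then 1 else -1.
Proof.
intros Hq. unfold sg. rewrite <- (Z2Nat.id q Hq) at 2. generalize (Z.to_nat q) as n. induction n as [|n IH]; auto.
rewrite Nat2Z.inj_succ, Z.even_succ, <- Z.negb_even. simpl. rewrite IH. destruct (Z.even (Z.of_nat n)); simpl; ring.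
Qed.

(** At [m = 0] the walk is the indicator of 0, so at most one index contributes to [Psi], and only
    when [l] divides [s]. The condition on [N] puts that index inside the range of summation. *)
Let base N s : (Z.abs s <= Z.of_nat l * Z.of_nat N)%Z -> Phi 0 s = Psi N 0 s.
Proof.
intros Hs.
assert (HlR : 0 < INR l) by pos.
transitivity (rsum (fun v => cos (PI * IZR s * (2 * INR v + 1) / INR l)) (pred l)).
{ apply rsum_ext. intros v _. rewrite Rmult_1_l. f_equal. unfold th. field. lra. }
rewrite sum_cos_odd by lia. unfold Psi. simpl walk.
destruct (Z.eqb_spec (s mod Z.of_nat l) 0) as [E|E].
- assert (Es : s = (Z.of_nat l * (s / Z.of_nat l))%Z) by (pose proof (Z.div_mod s (Z.of_nat l)); lia).
 set (q := (s / Z.of_nat l)%Z) in *. set (L := Z.of_nat l) in *.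
 destruct (Z_le_gt_dec q 0) as [Hq|Hq].
 + rewrite (rsum_single _ N (Z.to_nat (- q))).
  * rewrite sg_even by lia. rewrite Z2Nat.id by lia. rewrite Z.even_opp.
   replace (L * - q + s)%Z with 0%Z by lia. simpl Z.eqb.
   destruct (Z.eqb_spec (s - L * (- q + 1)) 0) as [E'|_]; [nia|]. destruct (Z.even q); ring.
  * nia.
  * intros i Hi Hne. destruct (Z.eqb_spec (L * Z.of_nat i + s) 0) as [E'|_].
   -- nia.
   -- destruct (Z.eqb_spec (s - L * (Z.of_nat i + 1)) 0) as [E'|_]; [nia|ring].
 + rewrite (rsum_single _ N (Z.to_nat (q - 1))).
  * rewrite sg_even by lia. rewrite Z2Nat.id by lia.
   destruct (Z.eqb_spec (L * (q - 1) + s) 0) as [E'|_]; [nia|].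
   replace (s - L * (q - 1 + 1))%Z with 0%Z by lia.
   replace (q - 1)%Z with (Z.pred q) by lia. rewrite Z.even_pred, <- Z.negb_even. destruct (Z.even q); simpl; ring.
  * nia.
  * intros i Hi Hne. destruct (Z.eqb_spec (L * Z.of_nat i + s) 0) as [E'|_]; [nia|].
   destruct (Z.eqb_spec (s - L * (Z.of_nat i + 1)) 0) as [E'|_]; [|ring]. nia.
- rewrite rsum_zero; [ring|]. intros i Hi.
 destruct (Z.eqb_spec (Z.of_nat l * Z.of_nat i + s) 0) as [E'|_].
 { exfalso. apply E. replace s with ((- Z.of_nat i) * Z.of_nat l)%Z by lia. apply Z_mod_mult. }
 destruct (Z.eqb_spec (s - Z.of_nat l * (Z.of_nat i + 1)) 0) as [E'|_]; [|ring].
 exfalso. apply E. replace s with ((Z.of_nat i + 1) * Z.of_nat l)%Z by lia. apply Z_mod_mult.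
Qed.

(* Both sides satisfy the recursion of [walk] in [(m, s)], so they are compared at [m = 0]. Dividing by the central binomial
   coefficient and letting [m] and [l] grow with [m ~ l^2] turns the identity into the transformation law. *)
Lemma Polya_identity N m s : (Z.abs s + Z.of_nat m <= Z.of_nat l * Z.of_nat N)%Z ->
 rsum (fun v => (2 * cos (PI * (2 * INR v + 1) / (2 * INR l))) ^ (2 * m) * cos (2 * IZR s * (PI * (2 * INR v + 1) / (2 * INR l)))) (pred l)
 = INR l * rsum (fun i => (-1) ^ i * (walk m (Z.of_nat l * Z.of_nat i + s) - walk m (s - Z.of_nat l * (Z.of_nat i + 1)))) N.
Proof.
change ((Z.abs s + Z.of_nat m <= Z.of_nat l * Z.of_nat N)%Z -> Phi m s = Psi N m s).
revert s. induction m as [|m IH]; intros s H.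
- apply base. lia.
- rewrite Phi_rec, Psi_rec, !IH by lia. reflexivity.
Qed.
End Polya.

Lemma rsum_split (u : nat -> R) a b : rsum u (a + S b) = rsum u a + rsum (fun i => u (S a + i)%nat) b.
Proof.
induction b as [|b IH].
- replace (a + 1)%nat with (S a) by lia. rewrite rsum_S, rsum_O, Nat.add_0_r. reflexivity.
- replace (a + S (S b))%nat with (S (a + S b)) by lia. rewrite !rsum_S, IH.
 replace (S a + S b)%nat with (S (a + S b)) by lia. ring.
Qed.

Lemma rsum_rev (u : nat -> R) n : rsum u n = rsum (fun i => u (n - i)%nat) n.
Proof.
induction n as [|n IH]; auto.
rewrite rsum_S, IH.
assert (H : rsum (fun i => u (S n - i)%nat) (S n) = u (S n) + rsum (fun i => u (n - i)%nat) n).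
{ transitivity (rsum (fun i => u (S n - i)%nat) (0 + S n)); auto. rewrite rsum_split, rsum_O. f_equal. } lra.
Qed.

(** With [l = 6 k] and [s = k] the second cosine becomes [cos (pi (2 v + 1) / 6)], which vanishes
    for [v = 1] modulo 3 and is [+- sqrt 3 / 2] otherwise. This is where the numbers [6 i + 1] and
    [6 i + 5] of the pentagonal series come from. *)
Lemma Polya_identity_6 (k N m : nat) : (0 < k)%nat -> (k + m <= 6 * k * N)%nat ->
 sqrt 3 * 4 ^ m * rsum (fun i => (-1) ^ i * (cos (PI * (6 * INR i + 1) / (12 * INR k)) ^ (2 * m)
    - cos (PI * (6 * INR i + 5) / (12 * INR k)) ^ (2 * m))) (pred k)
 = 6 * INR k * rsum (fun i => (-1) ^ i * (walk m (Z.of_nat (k * (6 * i + 1))) - walk m (Z.of_nat (k * (6 * i + 5))))) N.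
Proof.
intros Hk HN.
assert (HkR : 0 < INR k) by pos.
assert (H := Polya_identity (6 * k) ltac:(lia) N m (Z.of_nat k) ltac:(lia)).
replace (INR (6 * k)) with (6 * INR k) in H by (rewrite mult_INR; simpl; ring).
rewrite (rsum_ext (fun i => (-1) ^ i * (walk m (Z.of_nat (6 * k) * Z.of_nat i + Z.of_nat k) - walk m (Z.of_nat k - Z.of_nat (6 * k) * (Z.of_nat i + 1))))
 (fun i => (-1) ^ i * (walk m (Z.of_nat (k * (6 * i + 1))) - walk m (Z.of_nat (k * (6 * i + 5)))))) in H.
2:{ intros i _. rewrite <- (walk_sym m (Z.of_nat k - _)). do 3 f_equal; lia. }
rewrite <- H.
set (w := fun v => (2 * cos (PI * (2 * INR v + 1) / (2 * (6 * INR k)))) ^ (2 * m) * cos (2 * IZR (Z.of_nat k) * (PI * (2 * INR v + 1) / (2 * (6 * INR k))))).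
assert (Hw : forall v, w v = 4 ^ m * cos (PI * (2 * INR v + 1) / (12 * INR k)) ^ (2 * m) * cos (PI * (2 * INR v + 1) / 6)).
{ intros v. unfold w. rewrite <- INR_IZR_INZ.
 replace (PI * (2 * INR v + 1) / (2 * (6 * INR k))) with (PI * (2 * INR v + 1) / (12 * INR k)) by Cring.
 replace (2 * INR k * (PI * (2 * INR v + 1) / (12 * INR k))) with (PI * (2 * INR v + 1) / 6) by (field; lra).
 rewrite Rpow_mult_distr, (pow_mult 2 2 m). replace (2 ^ 2) with 4 by ring. reflexivity. }
(* The reflection [v -> 6 k - 1 - v] replaces the first angle by its supplement, harmless in an even
   power, and the second by its negative up to full turns. It halves the sum, which is then grouped
   in threes. *)
assert (Hsym : forall v, (v <= pred (3 * k))%nat -> w (pred (6 * k) - v)%nat = w v).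
{ intros v Hv. rewrite !Hw.
 assert (E : INR (pred (6 * k) - v) = 6 * INR k - 1 - INR v).
 { rewrite minus_INR by lia. rewrite <- Nat.sub_1_r, minus_INR by lia. rewrite mult_INR. Cring. }
 rewrite E.
 replace (PI * (2 * (6 * INR k - 1 - INR v) + 1) / (12 * INR k)) with (PI - PI * (2 * INR v + 1) / (12 * INR k)) by (field; lra).
 replace (PI * (2 * (6 * INR k - 1 - INR v) + 1) / 6) with (- (PI * (2 * INR v + 1) / 6) + 2 * INR k * PI) by lra.
 rewrite cos_period, cos_neg, Rtrigo_facts.cos_pi_minus, !pow_mult, <- !Rsqr_pow2, <- Rsqr_neg. reflexivity. }
assert (Hhalf : rsum w (pred (6 * k)) = 2 * rsum w (pred (3 * k))).
{ replace (pred (6 * k)) with (pred (3 * k) + S (pred (3 * k)))%nat at 1 by lia. rewrite rsum_split, (rsum_rev (fun i => w (S (pred (3 * k)) + i)%nat)), (rsum_ext (fun i => w (S (pred (3 * k)) + (pred (3 * k) - i))%nat) w).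
 - ring.
 - intros v Hv. rewrite <- (Hsym v Hv). f_equal. lia. }
rewrite Hhalf.
assert (Hthree : forall q, rsum w (3 * q + 2) = rsum (fun i => w (3 * i)%nat + w (3 * i + 1)%nat + w (3 * i + 2)%nat) q).
{ induction q as [|q IH].
 - rewrite rsum_O. simpl Nat.add. rewrite !rsum_S, rsum_O. reflexivity.
 - replace (3 * S q + 2)%nat with (S (S (S (3 * q + 2)))) by lia. rewrite !rsum_S, IH.
  replace (S (3 * q + 2))%nat with (3 * S q)%nat by lia. replace (S (3 * S q)) with (3 * S q + 1)%nat by lia.
  replace (S (3 * S q + 1)) with (3 * S q + 2)%nat by lia. ring. }
replace (pred (3 * k)) with (3 * pred k + 2)%nat by lia. rewrite Hthree, !rsum_scal. apply rsum_ext. intros i _. rewrite !Hw, !plus_INR, mult_INR. simpl (INR 3). simpl (INR 1). simpl (INR 2).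
replace (2 * ((1 + 1 + 1) * INR i) + 1) with (6 * INR i + 1) by ring.
replace (2 * ((1 + 1 + 1) * INR i + (1 + 1)) + 1) with (6 * INR i + 5) by ring.
assert (Hc : forall x, cos (INR i * PI + x) = (-1) ^ i * cos x).
{ intros x. induction i as [|i IH]; [rewrite Rmult_0_l, Rplus_0_l; ring|].
 rewrite S_INR. replace ((INR i + 1) * PI + x) with (INR i * PI + x + PI) by ring. rewrite neg_cos, IH. Cring. }
replace (PI * (6 * INR i + 1) / 6) with (INR i * PI + PI / 6) by lra.
replace (PI * (6 * INR i + 5) / 6) with (INR i * PI + (PI - PI / 6)) by lra.
replace (PI * (2 * ((1 + 1 + 1) * INR i + 1) + 1) / 6) with (INR i * PI + PI / 2) by lra.
rewrite !Hc, Rtrigo_facts.cos_pi_minus, cos_PI2, cos_PI6. field.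
Qed.

(** * Gaussian limits of powers of the cosine and of binomial coefficients *)

Lemma exp_lower (u : R) : 0 <= u <= 1/4 -> exp (- u - u * u) <= 1 - u.
Proof.
intros [H0 H1]. set (x := u + u * u). replace (- u - u * u) with (- x) by (unfold x; ring).
assert (Hx : 0 <= x) by pos.
assert (He : (1 + x / 2) ^ 2 <= exp x).
{ replace x with (x / 2 + x / 2) at 2 by lra. rewrite exp_plus.
 assert (1 + x / 2 <= exp (x / 2)) by (destruct (Req_dec x 0) as [->|]; [replace (0/2) with 0 by lra; rewrite exp_0; lra|left; apply exp_ineq1; lra]).
 apply Rmult_le_compat; lra. }
rewrite exp_Ropp. apply Rmult_le_reg_l with (exp x); [nra|]. rewrite Rinv_r by nra.
apply Rle_trans with ((1 + x / 2) ^ 2 * (1 - u)); [|nra].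
unfold x. nra.
Qed.

Lemma exp_upper (u : R) : 1 - u <= exp (- u).
Proof. pose proof (exp_ineq1_le (- u)). lra. Qed.

(** The derivative of [exp (t^2 / 2) cos t] has the sign of [t cos t - sin t], which is not positive
    on this interval. *)
Lemma cos_le_exp (t : R) : 0 <= t <= PI / 2 -> cos t <= exp (- (t ^ 2 / 2)).
Proof.
intros Ht.
assert (H1 : forall s, 0 <= s <= PI / 2 -> s * cos s <= sin s).
{ intros s Hs.
 destruct (MVT_gen (fun s => sin s - s * cos s) 0 s (fun s => s * sin s)) as [c [Hc1 Hc2]].
 - intros x Hx. auto_derive; [lra|ring].
 - intros x Hx. reg.
 - rewrite Rmin_left, Rmax_right in Hc1 by lra. rewrite sin_0 in Hc2.
  assert (0 <= sin c) by (apply sin_ge_0; pose proof PI_RGT_0; lra).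
  assert (0 <= c * sin c * (s - 0)) by pos. lra. }
destruct (MVT_gen (fun s => exp (s ^ 2 / 2) * cos s) 0 t (fun s => exp (s ^ 2 / 2) * (s * cos s - sin s))) as [c [Hc1 Hc2]].
- intros x Hx. auto_derive; auto. change (x ^ 2 / 2) with (x * (x * 1) * / 2). field.
- intros x Hx. reg.
- rewrite Rmin_left, Rmax_right in Hc1 by lra.
 specialize (H1 c ltac:(lra)).
 assert (H2 : exp (c ^ 2 / 2) * (c * cos c - sin c) * (t - 0) <= 0).
 { assert (0 <= exp (c ^ 2 / 2) * ((sin c - c * cos c) * (t - 0))) by pos. lra. }
 replace (0 ^ 2 / 2) with 0 in Hc2 by lra. rewrite exp_0, cos_0 in Hc2.
 rewrite exp_Ropp. apply Rmult_le_reg_l with (exp (t ^ 2 / 2)); [pos|].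
 rewrite Rinv_r by pos. lra.
Qed.

Lemma exp_pow_INR x n : exp x ^ n = exp (INR n * x).
Proof.
induction n as [|n IH]; [rewrite Rmult_0_l, exp_0; reflexivity|].
rewrite S_INR. simpl pow. rewrite IH, <- exp_plus. Cring.
Qed.

Lemma exp_le a b : a <= b -> exp a <= exp b.
Proof. intros [H| ->]; [left; apply exp_increasing, H|lra]. Qed.

Lemma cos_pow_le (t : R) m : 0 <= t <= PI / 2 -> 0 <= cos t ^ (2 * m) <= exp (- (INR m * t ^ 2)).
Proof.
intros Ht. assert (Hc : 0 <= cos t) by (apply cos_ge_0; lra).
split; [pos|].
replace (- (INR m * t ^ 2)) with (INR (2 * m) * (- (t ^ 2 / 2))) by (rewrite mult_INR; simpl; field).
rewrite <- exp_pow_INR. apply pow_incr. split; [lra|apply cos_le_exp, Ht].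
Qed.

(** With [u = t^2 / 2] the cosine lies between [1 - u >= exp (- u - u^2)] and [exp (- u)]. In the
    power [2 m] the correction [u^2] becomes [m t^2] times [t^2 / 2] and disappears in the limit. *)
Lemma cos_pow_lim (m : nat -> nat) (t : nat -> R) (X : R) : (forall k, 0 <= t k <= 1/2) -> is_lim_seq t 0 ->
 is_lim_seq (fun k => INR (m k) * t k ^ 2) X -> is_lim_seq (fun k => cos (t k) ^ (2 * m k)) (exp (- X)).
Proof.
intros Ht Ht0 HX.
apply (is_lim_seq_le_le (fun k => exp (- (INR (m k) * t k ^ 2) - (INR (m k) * t k ^ 2) * (t k ^ 2 / 2))) _ (fun k => exp (- (INR (m k) * t k ^ 2)))).
- intros k. split.
 + assert (H1 : 1 - t k ^ 2 / 2 <= cos (t k)).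
  { assert (HP : 3 < PI) by (pose proof PI2_3_2; lra). specialize (Ht k).
   pose proof (cos_bound (t k) 0 ltac:(lra) ltac:(lra)) as [Hb _]. unfold cos_approx, cos_term in Hb. simpl in Hb. lra. }
  assert (Hu : 0 <= t k ^ 2 / 2 <= 1/4) by (specialize (Ht k); nra).
  assert (H2 := exp_lower _ Hu).
  replace (- (INR (m k) * t k ^ 2) - INR (m k) * t k ^ 2 * (t k ^ 2 / 2)) with
   (INR (2 * m k) * (- (t k ^ 2 / 2) - t k ^ 2 / 2 * (t k ^ 2 / 2))) by (rewrite mult_INR; simpl; field).
  rewrite <- exp_pow_INR. apply pow_incr. split; [pos|lra].
 + apply cos_pow_le. assert (HP : 3 < PI) by (pose proof PI2_3_2; lra). specialize (Ht k). lra.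
- apply is_lim_seq_continuous; [apply derivable_continuous_pt, derivable_pt_exp|].
 replace (- X) with (- X - X * (0 ^ 2 / 2)) by lra.
 apply is_lim_seq_minus'; [apply (is_lim_seq_opp _ X), HX|].
 apply is_lim_seq_mult'; auto.
 apply (is_lim_seq_continuous (fun s => s ^ 2 / 2)); [reg|easy].
- apply is_lim_seq_continuous; [apply derivable_continuous_pt, derivable_pt_exp|]. apply (is_lim_seq_opp _ X), HX.
Qed.

(** The binomial coefficient [(2m, m+d)] divided by the central one: a discrete Gaussian in [d] with
    variance about [m / 2]. *)
Definition rho (m d : nat) : R := walk m (Z.of_nat d) / walk m 0.

Lemma rho_0 m : rho m 0 = 1.
Proof. unfold rho. simpl Z.of_nat. field. apply Rgt_not_eq, walk0_pos. Qed.
Lemma rho_nonneg m d : 0 <= rho m d.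
Proof. apply Rdiv_le_0_compat; [apply walk_nonneg|apply walk0_pos]. Qed.
Lemma rho_S m d : rho m (S d) = rho m d * (1 - (2 * INR d + 1) / (INR m + INR d + 1)).
Proof.
pose proof (walk_ratio m (Z.of_nat d)) as H. pose proof (walk0_pos m). pose proof (pos_INR m). pose proof (pos_INR d).
unfold rho. replace (Z.of_nat (S d)) with (Z.of_nat d + 1)%Z by lia. rewrite <- INR_IZR_INZ in H.
apply Rmult_eq_reg_l with ((INR m + INR d + 1) * walk m 0); [|nra].
transitivity ((INR m + INR d + 1) * walk m (Z.of_nat d + 1)); [field; lra|]. rewrite H. field. lra.
Qed.
Lemma rho_zero m d : (m < d)%nat -> rho m d = 0.
Proof.
intros H. assert (Hm : rho m (S m) = 0).
{ rewrite rho_S. pose proof (pos_INR m). replace (1 - (2 * INR m + 1) / (INR m + INR m + 1)) with 0 by (field; lra). ring. }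
induction H as [|d H IH]; auto. rewrite rho_S, IH. ring.
Qed.

(** Each factor of the product for [rho] is at most [exp (- (2 i + 1) / q)], and the odd numbers
    below [2 d] add up to [d^2]. A negative factor is covered too, as it makes the product at most
    0. *)
Lemma rho_le_gen m d q : 0 < q -> (forall i, (i < d)%nat -> INR m + INR i + 1 <= q) -> rho m d <= exp (- (INR d ^ 2 / q)).
Proof.
intros Hq. induction d as [|d IH]; intros H.
- rewrite rho_0. simpl. replace (- (0 * (0 * 1) / q)) with 0 by lra. rewrite exp_0. lra.
- rewrite rho_S. pose proof (pos_INR m). pose proof (pos_INR d).
 assert (Hd := H d ltac:(lia)).
 replace (- (INR (S d) ^ 2 / q)) with (- (INR d ^ 2 / q) + - ((2 * INR d + 1) / q)) by (rewrite S_INR; field; lra).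
 rewrite exp_plus.
 destruct (Rle_dec 0 (1 - (2 * INR d + 1) / (INR m + INR d + 1))) as [Hf|Hf].
 + apply Rmult_le_compat; [apply rho_nonneg|lra|auto|].
  via exp_upper. apply exp_le, Ropp_le_contravar, Rmult_le_compat_l; [lra|]. apply Rinv_le_contravar; lra.
 + apply Rle_trans with 0; [|pos].
  pose proof (rho_nonneg m d). nra.
Qed.

Lemma rho_le m d : (0 < m)%nat -> rho m d <= exp (- (INR d ^ 2 / (2 * INR m))).
Proof.
intros Hm. assert (0 < INR m) by pos.
destruct (le_lt_dec d m) as [H1|H1].
- apply rho_le_gen; [lra|]. intros i Hi. assert (INR (S i) <= INR m) by (apply le_INR; lia). rewrite S_INR in H0. lra.
- rewrite rho_zero by lia. left; apply exp_pos.
Qed.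

Lemma rho_ge m d : (0 < m)%nat -> 8 * INR d <= INR m ->
 exp (- (INR d ^ 2 / INR m) - 4 * INR d ^ 3 / INR m ^ 2) <= rho m d.
Proof.
intros Hm Hd. assert (Hm' : 0 < INR m) by pos.
set (D := INR d) in *.
assert (Gen : forall i, (i <= d)%nat -> exp (- (INR i ^ 2 / INR m) - INR i * (4 * D ^ 2 / INR m ^ 2)) <= rho m i).
{ induction i as [|i IH]; intros Hi.
 - rewrite rho_0. simpl. replace (- (0 * (0 * 1) / INR m) - _) with 0 by lra. rewrite exp_0. lra.
 - rewrite rho_S. assert (Hi' : INR (S i) <= D) by (apply le_INR; exact Hi). rewrite S_INR in Hi'. pose proof (pos_INR i) as Hi0.
  set (v := (2 * INR i + 1) / (INR m + INR i + 1)).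
  assert (Hv0 : 0 <= v) by pos.
  assert (Hv1 : v <= (2 * INR i + 1) / INR m) by (apply Rmult_le_compat_l; [lra|apply Rinv_le_contravar; lra]).
  assert (Hv2 : v <= 2 * D / INR m) by nra.
  assert (Hv3 : 2 * D / INR m <= 1/4) by (apply Rmult_le_reg_r with (INR m); auto; unfold Rdiv at 1; rewrite Rmult_assoc, Rinv_l by lra; lra).
  assert (Hv4 : v * v <= 4 * D ^ 2 / INR m ^ 2).
  { replace (4 * D ^ 2 / INR m ^ 2) with ((2 * D / INR m) * (2 * D / INR m)) by (field; lra). apply Rmult_le_compat; lra. }
  replace (- (INR (S i) ^ 2 / INR m) - INR (S i) * (4 * D ^ 2 / INR m ^ 2)) with
   ((- (INR i ^ 2 / INR m) - INR i * (4 * D ^ 2 / INR m ^ 2)) + (- ((2 * INR i + 1) / INR m) - 4 * D ^ 2 / INR m ^ 2)) by (rewrite S_INR; field; lra).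
  rewrite exp_plus. apply Rmult_le_compat; try (left; apply exp_pos); [apply IH; lia|].
  eapply Rle_trans; [|apply exp_lower; lra]. apply exp_le. lra. }
replace (- (D ^ 2 / INR m) - 4 * D ^ 3 / INR m ^ 2) with (- (INR d ^ 2 / INR m) - INR d * (4 * D ^ 2 / INR m ^ 2)) by (unfold D; field; lra). auto.
Qed.

(** The local limit theorem of de Moivre and Laplace relative to the central coefficient. The lower
    bound for [rho] needs [8 d <= m], which holds from some index on because [d / m] tends to 0. *)
Lemma rho_lim (m d : nat -> nat) (X : R) : (forall k, (0 < m k)%nat) -> is_lim_seq (fun k => INR (d k) / INR (m k)) 0 ->
 is_lim_seq (fun k => INR (d k) ^ 2 / INR (m k)) X -> is_lim_seq (fun k => rho (m k) (d k)) (exp (- X)).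
Proof.
intros Hm H0 HX.
assert (Hmp : forall k, 0 < INR (m k)) by (intros k; apply lt_0_INR, Hm).
assert (Hc : continuity_pt exp (- X)) by (apply derivable_continuous_pt, derivable_pt_exp).
apply (is_lim_seq_le_le_loc (fun k => exp (- (INR (d k) ^ 2 / INR (m k)) - 4 * (INR (d k) ^ 2 / INR (m k)) * (INR (d k) / INR (m k)))) _
  (fun k => exp (- (INR (d k) ^ 2 / INR (m k) * / (1 + INR (d k) / INR (m k)))))).
- apply is_lim_seq_spec in H0. destruct (H0 (mkposreal (1/8) ltac:(lra))) as [K HK]. simpl in HK.
 exists K. intros k Hk. specialize (HK k Hk). specialize (Hmp k). pose proof (pos_INR (d k)) as Hd.
 rewrite Rminus_0_r, Rabs_right in HK by (apply Rle_ge, Rdiv_le_0_compat; lra).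
 split.
 + eapply Rle_trans; [|apply rho_ge; auto].
  * right. f_equal. field. lra.
  * apply Rmult_lt_compat_r with (r := INR (m k)) in HK; auto. unfold Rdiv in HK. rewrite Rmult_assoc, Rinv_l in HK by lra. lra.
 + eapply Rle_trans; [apply (rho_le_gen (m k) (d k) (INR (m k) + INR (d k))); [lra|]|].
  * intros i Hi. assert (INR (S i) <= INR (d k)) by (apply le_INR; lia). rewrite S_INR in H. lra.
  * right. f_equal. field. lra.
- apply is_lim_seq_continuous; eauto. replace (- X) with (- X - 4 * X * 0) by ring.
 apply is_lim_seq_minus'; [apply (is_lim_seq_opp _ X), HX|].
 apply is_lim_seq_mult'; eauto. apply (is_lim_seq_scal_l _ 4 X), HX.
- apply is_lim_seq_continuous; auto. replace (- X) with (- (X * / (1 + 0))) by lra.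
 apply (is_lim_seq_opp _ (X * / (1 + 0))), is_lim_seq_mult'; auto.
 apply (is_lim_seq_inv _ (1 + 0)); [|intros E; apply Rbar_finite_eq in E || injection E; lra].
 apply is_lim_seq_plus'; [apply is_lim_seq_const|easy].
Qed.

Lemma is_series_geom_pos (q : R) : 0 <= q < 1 -> ex_series (fun i => q ^ i).
Proof. intros H. exists (/ (1 - q)). apply is_series_geom. rewrite Rabs_right; lra. Qed.

Lemma Series_finite (u : nat -> R) N : (forall i, (N < i)%nat -> u i = 0) -> Series u = rsum u N.
Proof.
intros H. apply is_series_unique. assert (L : is_lim_seq (sum_n u) (rsum u N)); auto.
apply is_lim_seq_ext_loc with (fun _ => rsum u N); [|apply is_lim_seq_const].
exists N. intros n Hn. induction Hn as [|n Hn IH]; auto. rewrite rsum_S, (H (S n)) by lia. rewrite Rplus_0_r. exact IH.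
Qed.

Lemma exp_small (c : R) : 0 < c -> 0 <= exp (- c) < 1.
Proof. intros H. split; [pos|]. rewrite <- exp_0. apply exp_increasing. lra. Qed.

(* By Euler's pentagonal number theorem this is the Dedekind function on the axis, [eta y = eta (i y)]. *)
Definition eta_term (y : R) (i : nat) : R :=
 (-1) ^ i * (exp (- (PI * y * (6 * INR i + 1) ^ 2 / 12)) - exp (- (PI * y * (6 * INR i + 5) ^ 2 / 12))).
Definition eta (y : R) : R := Series (eta_term y).

Lemma Rabs_sign i x : Rabs ((-1) ^ i * x) = Rabs x.
Proof. rewrite Rabs_mult, pow_1_abs. ring. Qed.

Lemma nfloor_pos_ratio (c : R) : 0 < c ->
 exists m : nat -> nat, forall k, INR (m k) <= c * INR k ^ 2 < INR (m k) + 1.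
Proof.
intros Hc. assert (H : forall k, 0 <= c * INR k ^ 2) by (intros k; apply Rmult_le_pos; nra).
exists (fun k => proj1_sig (nfloor_ex _ (H k))). intros k. exact (proj2_sig (nfloor_ex _ (H k))).
Qed.

Lemma is_lim_seq_inv_n : is_lim_seq (fun k => / INR k) 0.
Proof. apply (is_lim_seq_inv INR p_infty); [apply is_lim_seq_INR|easy]. Qed.

(** Let [k] grow and take [m] close to [c k^2]. The powers of cosines then tend to the Gaussians at
    [y], the quotients of binomial coefficients to those at [1/y], and the prefactor to a constant
    times [1 / sqrt y]. *)
Theorem eta_inv_aux : exists C : R, forall y, 0 < y -> sqrt y * eta y = C * eta (/ y).
Proof.
destruct walk0_asymp as [kap [Hkap Hasy]].
exists (6 * sqrt (PI / 12) * kap / sqrt 3). intros y Hy.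
assert (HPI := PI_RGT_0).
(* The value that gives [c (pi u / 12)^2 = pi y u^2 / 12] on the cosine side and
   [u^2 / c = pi u^2 / (12 y)] on the binomial side. *)
set (c := 12 * y / PI). assert (Hc : 0 < c) by pos.
destruct (nfloor_pos_ratio c Hc) as [m0 Hm0].
destruct (nfloor_ex (2 / c)) as [K0 HK0]; [pos|].
(* Starting at [K] makes [k >= 2] and [k >= 2 / c]; then [c k^2 >= 2], so that rounding down still
   leaves [m >= c k^2 / 2 > 0]. *)
set (K := S (S K0)). set (kk := fun j => (K + j)%nat). assert (Hkk : forall j, kk j = (K + j)%nat) by easy.
clearbody kk. set (m := fun j => m0 (kk j)).
assert (Hk1 : forall j, 2 <= INR (kk j)).
{ intros j. replace 2 with (INR 2) by easy. apply le_INR. rewrite Hkk; unfold K. lia. }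
assert (Hkc : forall j, 2 / c <= INR (kk j)).
{ intros j. apply Rle_trans with (INR (S K0)); [rewrite S_INR; lra|apply le_INR; rewrite Hkk; lia]. }
assert (Hm1 : forall j, c / 2 * INR (kk j) ^ 2 <= INR (m j) <= c * INR (kk j) ^ 2).
{ intros j. unfold m. specialize (Hm0 (kk j)). specialize (Hk1 j). specialize (Hkc j).
 assert (1 <= c / 2 * INR (kk j) ^ 2); [|lra].
 apply Rle_trans with (c / 2 * (2 / c)); [right; field; lra|]. apply Rmult_le_compat_l; [lra|]. nra. }
assert (Hmpos : forall j, (0 < m j)%nat).
{ intros j. apply INR_lt. simpl. destruct (Hm1 j) as [H _]. specialize (Hk1 j).
 assert (0 < c / 2 * INR (kk j) ^ 2) by pos. lra. }
assert (Lk : is_lim_seq (fun j => / INR (kk j)) 0).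
{ apply is_lim_seq_ext with (fun j => / INR (j + K)); [intros j; rewrite Hkk; f_equal; f_equal; lia|].
 apply (is_lim_seq_incr_n (fun k => / INR k) K 0), is_lim_seq_inv_n. }
assert (Lm : is_lim_seq (fun j => INR (m j) / INR (kk j) ^ 2) c).
{ apply (is_lim_seq_le_le (fun j => c - / INR (kk j) * / INR (kk j)) _ (fun _ => c)).
 - intros j. specialize (Hk1 j). destruct (Hm0 (kk j)) as [H1 H2]. unfold m.
  set (k := INR (kk j)) in *. split.
  + apply Rmult_le_reg_r with (k ^ 2); [nra|]. replace ((c - / k * / k) * k ^ 2) with (c * k ^ 2 - 1) by (field; lra).
   unfold Rdiv. rewrite Rmult_assoc, Rinv_l by nra. lra.
  + apply Rmult_le_reg_r with (k ^ 2); [nra|].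
   unfold Rdiv. rewrite Rmult_assoc, Rinv_l by nra. lra.
 - replace (Finite c) with (Finite (c - 0 * 0)) by Cring. apply is_lim_seq_minus'; [apply is_lim_seq_const|]. apply is_lim_seq_mult'; exact Lk.
 - apply is_lim_seq_const. }
assert (Lminv : is_lim_seq (fun j => INR (kk j) ^ 2 / INR (m j)) (/ c)).
{ apply is_lim_seq_ext with (fun j => / (INR (m j) / INR (kk j) ^ 2)).
 - intros j. specialize (Hk1 j). specialize (Hmpos j). apply lt_INR in Hmpos. simpl in Hmpos. field. split; [lra|lra].
 - apply (is_lim_seq_inv _ c); [easy|intros E; injection E; lra]. }
(* The cosine sum is padded by zeros beyond [k], so that dominated convergence for series applies.
   The sum [B] needs no padding: [rho] vanishes as soon as the distance exceeds [m]. *)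
set (A := fun j i => if (i <? kk j)%nat then (-1) ^ i * (cos (PI * (6 * INR i + 1) / (12 * INR (kk j))) ^ (2 * m j)
    - cos (PI * (6 * INR i + 5) / (12 * INR (kk j))) ^ (2 * m j)) else 0).
set (B := fun j i => (-1) ^ i * (rho (m j) (kk j * (6 * i + 1)) - rho (m j) (kk j * (6 * i + 5)))).
assert (LA : is_lim_seq (fun j => Series (A j)) (eta y)).
{ set (q := exp (- (PI * y / 24))).
 assert (Hq : 0 <= q < 1) by (apply exp_small; apply Rdiv_lt_0_compat; nra; lra).
 assert (Hth : forall j u, 0 <= u -> u <= 6 * INR (kk j) -> 0 <= PI * u / (12 * INR (kk j)) <= PI / 2).
 { intros j u Hu Hu2. specialize (Hk1 j). split; [apply Rdiv_le_0_compat; nra; lra|].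
  apply Rmult_le_reg_r with (12 * INR (kk j)); [lra|]. unfold Rdiv at 1. rewrite Rmult_assoc, Rinv_l by lra. nra. }
 assert (Hb : forall j i u, INR i <= u -> 1 <= u -> u <= 6 * INR (kk j) ->
   0 <= cos (PI * u / (12 * INR (kk j))) ^ (2 * m j) <= q ^ i).
 { intros j i u Hiu Hu1 Hu2. destruct (cos_pow_le _ (m j) (Hth j u ltac:(lra) Hu2)) as [H1 H2]. split; [exact H1|].
  eapply Rle_trans; eauto. unfold q. rewrite exp_pow_INR. apply exp_le. destruct (Hm1 j) as [Hmj _]. set (k := INR (kk j)) in *.
  assert (H3 : c / 2 * k ^ 2 * (PI * u / (12 * k)) ^ 2 <= INR (m j) * (PI * u / (12 * k)) ^ 2) by (apply Rmult_le_compat_r; nra).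
  replace (c / 2 * k ^ 2 * (PI * u / (12 * k)) ^ 2) with (PI * y / 24 * u ^ 2) in H3 by (unfold c; field; lra).
  assert (H4 : PI * y / 24 * INR i <= PI * y / 24 * u ^ 2) by (apply Rmult_le_compat_l; nra).
  lra. }
 assert (Hl : forall u, 0 < u -> is_lim_seq (fun j => cos (PI * u / (12 * INR (kk j))) ^ (2 * m j)) (exp (- (PI * y * u ^ 2 / 12)))).
 { intros u Hu.
  assert (L0 : is_lim_seq (fun j => PI * u / (12 * INR (kk j))) 0).
  { apply is_lim_seq_ext with (fun j => PI * u / 12 * / INR (kk j)); [intros j; specialize (Hk1 j); field; lra|].
   replace 0 with (PI * u / 12 * 0) by ring. apply (is_lim_seq_scal_l _ _ 0), Lk. }
  apply is_lim_seq_spec in L0. destruct (L0 (mkposreal (1/2) ltac:(lra))) as [J HJ]. simpl in HJ. apply is_lim_seq_spec in L0.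
  apply (is_lim_seq_incr_n _ J), (cos_pow_lim (fun n => m (n + J)%nat) (fun n => PI * u / (12 * INR (kk (n + J)%nat)))).
  - intros n. specialize (HJ (n + J)%nat ltac:(lia)). specialize (Hk1 (n + J)%nat).
   assert (0 <= PI * u / (12 * INR (kk (n + J)%nat))) by pos.
   rewrite Rabs_right in HJ by lra. lra.
  - apply (is_lim_seq_incr_n (fun j => PI * u / (12 * INR (kk j))) J), L0.
  - apply (is_lim_seq_incr_n (fun j => INR (m j) * (PI * u / (12 * INR (kk j))) ^ 2) J), is_lim_seq_ext with (fun j => INR (m j) / INR (kk j) ^ 2 * ((PI * u) ^ 2 / 144)); [intros j; specialize (Hk1 j); field; lra|].
   replace (PI * y * u ^ 2 / 12) with (c * ((PI * u) ^ 2 / 144)) by (unfold c; field; lra).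
   apply is_lim_seq_mult'; [easy|apply is_lim_seq_const]. }
 apply (Tannery A (eta_term y) (fun i => q ^ i)).
 - apply is_series_geom_pos, Hq.
 - intros j i. unfold A. destruct (Nat.ltb_spec i (kk j)) as [Hi|Hi].
  + rewrite Rabs_sign. assert (Hi' : INR (S i) <= INR (kk j)) by (apply le_INR; lia). rewrite S_INR in Hi'. pose proof (pos_INR i).
   assert (H1 := Hb j i (6 * INR i + 1) ltac:(lra) ltac:(lra) ltac:(lra)).
   assert (H2 := Hb j i (6 * INR i + 5) ltac:(lra) ltac:(lra) ltac:(lra)). apply Rabs_le. lra.
  + rewrite Rabs_R0. apply pow_le, Hq.
 - intros i. pose proof (pos_INR i).
  apply is_lim_seq_ext_loc with (fun j => (-1) ^ i * (cos (PI * (6 * INR i + 1) / (12 * INR (kk j))) ^ (2 * m j)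
    - cos (PI * (6 * INR i + 5) / (12 * INR (kk j))) ^ (2 * m j))).
  + exists i. intros j Hj. unfold A. destruct (Nat.ltb_spec i (kk j)) as [Hi|Hi]; [lra|rewrite Hkk in Hi; lia].
  + apply (is_lim_seq_scal_l _ ((-1) ^ i) (_ - _)), is_lim_seq_minus'; apply Hl; lra. }
assert (LB : is_lim_seq (fun j => Series (B j)) (eta (/ y))).
{ set (q := exp (- (PI / (24 * y)))).
 assert (Hq : 0 <= q < 1) by (apply exp_small; apply Rdiv_lt_0_compat; lra).
 assert (Hb : forall j i u, (i <= u)%nat -> (1 <= u)%nat -> 0 <= rho (m j) (kk j * u) <= q ^ i).
 { intros j i u Hiu Hu1. split; [apply rho_nonneg|]. eapply Rle_trans; [apply rho_le, Hmpos|].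
  unfold q. rewrite exp_pow_INR. apply exp_le. rewrite mult_INR.
  apply le_INR in Hiu, Hu1. simpl in Hu1. pose proof (pos_INR i). specialize (Hk1 j). destruct (Hm1 j) as [_ Hmj]. specialize (Hmpos j). apply lt_INR in Hmpos. simpl in Hmpos.
  set (k := INR (kk j)) in *. set (M := INR (m j)) in *. set (U := INR u) in *.
  assert (H3 : k ^ 2 * (PI / (24 * y)) <= (k ^ 2) * (k ^ 2 / (2 * M))).
  { apply Rmult_le_compat_l; [nra|].
   apply Rle_trans with (k ^ 2 / (2 * (c * k ^ 2))); [right; unfold c; field; lra|].
   apply Rmult_le_compat_l; [nra|]. apply Rinv_le_contravar; lra. }
  assert (H4 : PI / (24 * y) <= k ^ 2 / (2 * M)) by nra.
  assert (H5 : PI / (24 * y) * INR i <= k ^ 2 / (2 * M) * U ^ 2); [|lra].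
  apply Rmult_le_compat; [pos|lra|lra|nra]. }
 assert (Hl : forall u : nat, is_lim_seq (fun j => rho (m j) (kk j * u)) (exp (- (PI * / y * INR u ^ 2 / 12)))).
 { intros u. apply (rho_lim m (fun j => (kk j * u)%nat)); [easy| |].
  - apply is_lim_seq_ext with (fun j => INR (kk j) ^ 2 / INR (m j) * / INR (kk j) * INR u).
   + intros j. rewrite mult_INR. specialize (Hk1 j). specialize (Hmpos j). apply lt_INR in Hmpos. simpl in Hmpos. field. lra.
   + replace 0 with (/ c * 0 * INR u) by ring. apply is_lim_seq_mult'; [|apply is_lim_seq_const]. apply is_lim_seq_mult'; assumption.
  - apply is_lim_seq_ext with (fun j => INR (kk j) ^ 2 / INR (m j) * INR u ^ 2).
   + intros j. rewrite mult_INR. lra.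
   + replace (PI * / y * INR u ^ 2 / 12) with (/ c * INR u ^ 2) by (unfold c; field; lra).
    apply is_lim_seq_mult'; [easy|apply is_lim_seq_const]. }
 apply (Tannery B (eta_term (/ y)) (fun i => q ^ i)).
 - apply is_series_geom_pos, Hq.
 - intros j i. unfold B. rewrite Rabs_sign.
  assert (H1 := Hb j i (6 * i + 1)%nat ltac:(lia) ltac:(lia)). assert (H2 := Hb j i (6 * i + 5)%nat ltac:(lia) ltac:(lia)). apply Rabs_le. lra.
 - intros i. apply (is_lim_seq_scal_l _ ((-1) ^ i) (_ - _)).
  replace (6 * INR i + 1) with (INR (6 * i + 1)) by (rewrite plus_INR, mult_INR; simpl; ring).
  replace (6 * INR i + 5) with (INR (6 * i + 5)) by (rewrite plus_INR, mult_INR; simpl; ring).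
  apply is_lim_seq_minus'; apply Hl. }
assert (Hid : forall j, sqrt 3 * Series (A j) = 6 * INR (kk j) * (walk (m j) 0 / 4 ^ m j) * Series (B j)).
{ intros j. assert (Hkp : (0 < kk j)%nat) by (rewrite Hkk; lia).
 set (N := (1 + m j)%nat).
 assert (H := Polya_identity_6 (kk j) N (m j) Hkp ltac:(unfold N; nia)).
 rewrite (Series_finite (A j) (pred (kk j))), (Series_finite (B j) N).
 - assert (EA : rsum (A j) (pred (kk j)) = rsum (fun i => (-1) ^ i * (cos (PI * (6 * INR i + 1) / (12 * INR (kk j))) ^ (2 * m j)
    - cos (PI * (6 * INR i + 5) / (12 * INR (kk j))) ^ (2 * m j))) (pred (kk j))).
  { apply rsum_ext. intros i Hi. unfold A. destruct (Nat.ltb_spec i (kk j)); [lra|lia]. }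
  rewrite EA.
  assert (EB : rsum (fun i => (-1) ^ i * (walk (m j) (Z.of_nat (kk j * (6 * i + 1))) - walk (m j) (Z.of_nat (kk j * (6 * i + 5))))) N = walk (m j) 0 * rsum (B j) N).
  { rewrite rsum_scal. apply rsum_ext. intros i _. unfold B, rho. field. apply Rgt_not_eq, walk0_pos. }
  rewrite EB in H. assert (H4 : 0 < 4 ^ m j) by pos.
  apply Rmult_eq_reg_l with (4 ^ m j); [|lra].
  rewrite <- Rmult_assoc, (Rmult_comm (4 ^ m j)), H. field. lra.
 - intros i Hi. unfold B. rewrite !rho_zero; [ring| |]; unfold N in Hi; nia.
 - intros i Hi. unfold A. destruct (Nat.ltb_spec i (kk j)); [lia|lra]. }
assert (Lc : is_lim_seq (fun j => 6 * INR (kk j) * (walk (m j) 0 / 4 ^ m j)) (6 * sqrt (/ c) * kap)).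
{ apply is_lim_seq_ext with (fun j => 6 * sqrt (INR (kk j) ^ 2 / INR (m j)) * (sqrt (INR (m j)) * (walk (m j) 0 / 4 ^ m j))).
 - intros j. specialize (Hk1 j). specialize (Hmpos j). apply lt_INR in Hmpos. simpl in Hmpos.
  rewrite sqrt_div by nra. rewrite sqrt_pow2 by lra.
  assert (0 < sqrt (INR (m j))) by pos. field. split; [pos|lra].
 - apply is_lim_seq_mult'.
  + apply (is_lim_seq_scal_l _ 6 (sqrt (/ c))), (is_lim_seq_continuous sqrt); auto.
   apply continuity_pt_sqrt. pos.
  + apply (is_lim_seq_subseq (fun n => sqrt (INR n) * (walk n 0 / 4 ^ n)) kap m); auto.
   intros P [N HN]. destruct (nfloor_ex ((INR N + 1) / (c / 2))) as [J HJ]; [pos|].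
   exists (S J). intros j Hj. apply HN, INR_le.
   destruct (Hm1 j) as [H1 _]. specialize (Hk1 j).
   assert (H2 : INR (S J) <= INR (kk j)) by (apply le_INR; rewrite Hkk; lia). rewrite S_INR in H2.
   assert (H3 : INR N + 1 <= c / 2 * INR (kk j)).
   { apply Rmult_le_reg_r with (/ (c / 2)); [pos|].
    replace (c / 2 * INR (kk j) * / (c / 2)) with (INR (kk j)) by (field; lra). lra. }
   assert (c / 2 * INR (kk j) <= c / 2 * INR (kk j) ^ 2) by (apply Rmult_le_compat_l; nra; replace (INR (kk j) ^ 2) with (INR (kk j) * INR (kk j)) by ring; nra). lra. }
assert (Hfin : sqrt 3 * eta y = 6 * sqrt (/ c) * kap * eta (/ y)).
{ assert (L1 : is_lim_seq (fun j => sqrt 3 * Series (A j)) (sqrt 3 * eta y)) by (apply (is_lim_seq_scal_l _ (sqrt 3) (eta y)), LA).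
 assert (L2 : is_lim_seq (fun j => sqrt 3 * Series (A j)) (6 * sqrt (/ c) * kap * eta (/ y))).
 { apply is_lim_seq_ext with (fun j => 6 * INR (kk j) * (walk (m j) 0 / 4 ^ m j) * Series (B j)); auto.
  apply is_lim_seq_mult'; assumption. }
 apply is_lim_seq_unique in L1, L2. rewrite L1 in L2. injection L2 as L2. exact L2. }
assert (H3 : 0 < sqrt 3) by pos.
assert (Hsy : 0 < sqrt y) by pos.
replace (sqrt (/ c)) with (sqrt (PI / 12) / sqrt y) in Hfin.
2:{ rewrite <- sqrt_div by lra. f_equal. unfold c. field. lra. }
apply Rmult_eq_reg_l with (sqrt 3 / sqrt y); [|pos].
transitivity (sqrt 3 * eta y); [field; lra|]. rewrite Hfin. field. lra.
Qed.

(** * Euler's product and the pentagonal number theorem *)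

Fixpoint eprod (x : R) (n : nat) : R :=
 match n with O => 1 | S m => eprod x m * (1 - x ^ S m) end.

Fixpoint tri (n : nat) : nat := match n with O => O | S m => (tri m + S m)%nat end.

Lemma pow_lt_1' x n : 0 < x < 1 -> 0 < x ^ S n < 1.
Proof.
intros H. induction n as [|n IH]; [lra|].
change (x ^ S (S n)) with (x * x ^ S n). nra.
Qed.

Lemma eprod_pos x n : 0 < x < 1 -> 0 < eprod x n.
Proof.
intros H. induction n as [|n IH]; simpl; [lra|]. apply Rmult_lt_0_compat; auto.
pose proof (pow_lt_1' x n H). simpl in H0. lra.
Qed.

Lemma eprod_decr x n : 0 < x < 1 -> eprod x (S n) <= eprod x n.
Proof.
intros H. simpl. pose proof (eprod_pos x n H). pose proof (pow_lt_1' x n H) as H1. simpl in H1. nra.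
Qed.

Definition E (x : R) : R := real (Lim_seq (eprod x)).

(** Existence of the limit is monotonicity. For its positivity, take [N] with [x^N < (1 - x) / 2]:
    the later factors multiply to at least 1 minus a geometric tail, that is at least 1/2. *)
Lemma eprod_cv x : 0 < x < 1 -> is_lim_seq (eprod x) (E x) /\ 0 < E x.
Proof.
intros H.
assert (Hex : ex_finite_lim_seq (eprod x)).
{ apply (ex_finite_lim_seq_decr _ 0); intros n; [apply eprod_decr, H|left; apply eprod_pos, H]. }
assert (HL : is_lim_seq (eprod x) (E x)) by (apply Lim_seq_correct'; exact Hex).
split; auto.
assert (Hp : Rabs x < 1) by (rewrite Rabs_right; lra).
destruct (pow_lt_1_zero x Hp ((1 - x) / 2)) as [N HN]; [lra|].
specialize (HN N (le_n N)). rewrite Rabs_right in HN by (apply Rle_ge, pow_le; lra).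
assert (Gen : forall n, eprod x (N + n) >= eprod x N * (1 - (x ^ S N - x ^ S (N + n)) / (1 - x))).
{ induction n as [|n IH].
 - rewrite Nat.add_0_r. lra.
 - replace (N + S n)%nat with (S (N + n)) by lia. cbn [eprod]. assert (H3 := pow_lt_1' x (N + n) H).
  set (t := x ^ S (N + n)) in *. replace (x ^ S (S (N + n))) with (x * t) by easy.
  assert (H4 : eprod x (N + n) <= eprod x N).
  { clear -H. induction n as [|n IH]; [rewrite Nat.add_0_r; lra|]. replace (N + S n)%nat with (S (N + n)) by lia.
   eapply Rle_trans; [apply eprod_decr, H|lra]. }
  replace (1 - (x ^ S N - x * t) / (1 - x)) with (1 - (x ^ S N - t) / (1 - x) - t) by (field; lra). nra. }
apply Rlt_le_trans with (eprod x N / 2); [pose proof (eprod_pos x N H); lra|].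
apply (is_lim_seq_le (fun _ => eprod x N / 2) (fun n => eprod x (N + n)) (eprod x N / 2) (E x)).
- intros n. specialize (Gen n). assert (H1 := eprod_pos x N H). assert (H3 := pow_lt_1' x (N + n) H).
 assert (H5 : (x ^ S N - x ^ S (N + n)) / (1 - x) <= 1 / 2).
 { apply Rmult_le_reg_r with (1 - x); [lra|]. unfold Rdiv at 1. rewrite Rmult_assoc, Rinv_l by lra.
  assert (x ^ S N <= x ^ N) by (simpl; pose proof (pow_le x N ltac:(lra)); nra). lra. }
 nra.
- apply is_lim_seq_const.
- apply is_lim_seq_ext with (fun n => eprod x (n + N)); [intros n; f_equal; lia|]. apply (proj1 (is_lim_seq_incr_n (eprod x) N (E x))), HL.
Qed.

(* Shanks' finite form of the pentagonal number theorem. *)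
Lemma Shanks x n : (forall k, eprod x k <> 0) ->
 rsum (fun s => (-1) ^ s * (eprod x n / eprod x s) * x ^ (s * n + tri s)) n =
 rsum (fun i => (-1) ^ i * (x ^ (i * i + tri i) - x ^ (S i * S i + tri i))) n + (-1) ^ n * x ^ (S n * S n + tri n).
Proof.
intros H. induction n as [|n IH].
- rewrite !rsum_O. simpl. field.
- rewrite rsum_S, (rsum_S _ n).
 (* Passing from [n] to [n + 1] changes each partial sum by one explicit term only. At [k = n] this
    term and the additional summand [s = n + 1] are the new pentagonal pair. *)
 assert (Tel : forall k, (k <= n)%nat -> rsum (fun s => (-1) ^ s * (eprod x (S n) / eprod x s) * x ^ (s * S n + tri s)) k =
   rsum (fun s => (-1) ^ s * (eprod x n / eprod x s) * x ^ (s * n + tri s)) k - (-1) ^ k * (eprod x n / eprod x k) * x ^ (k * S n + S n + tri k)).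
 { induction k as [|k IHk]; intros Hk.
  - rewrite !rsum_O. simpl. rewrite Nat.add_0_r. field.
  - rewrite !rsum_S, IHk by lia. assert (Hk0 := H k). assert (Hk1 := H (S k)). cbn [eprod] in *.
   assert (Hx : 1 - x ^ S k <> 0) by nra.
   set (X := (S k * n + tri k)%nat).
   replace (S k * S n + tri (S k))%nat with (S k + (S k + X))%nat by (simpl; lia).
   replace (S k * S n + S n + tri (S k))%nat with (S n + (S k + (S k + X)))%nat by (simpl; lia).
   replace (S k * n + tri (S k))%nat with (S k + X)%nat by (simpl; lia).
   replace (k * S n + S n + tri k)%nat with (S k + X)%nat by lia.
   rewrite (pow_add x (S n) (S k + _)), (pow_add x (S k) (S k + _)), (pow_add x (S k) X). change ((-1) ^ S k) with (-1 * (-1) ^ k).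
   field. split; assumption. }
 rewrite Tel, IH by lia.
 replace (n * S n + S n + tri n)%nat with (S n * S n + tri n)%nat by lia.
 unfold Rdiv. rewrite !Rinv_r by easy. ring.
Qed.

Lemma pow_tri_small x : 0 < x < 1 -> forall i, x ^ (i * i + tri i) <= x ^ i /\ x ^ (S i * S i + tri i) <= x ^ i.
Proof.
intros H i.
assert (Hm : forall a b, (b <= a)%nat -> x ^ a <= x ^ b).
{ intros a b Hab. replace a with (b + (a - b))%nat by lia. rewrite pow_add.
 assert (x ^ (a - b) <= 1) by (rewrite <- (pow1 (a - b)); apply pow_incr; lra). pose proof (pow_le x b ltac:(lra)). nra. }
split; apply Hm; nia.
Qed.

(** In Shanks' identity the summand [s = 0] is the finite product and the others are together of
    order [x^n], while the other side is a partial sum of the series plus a vanishing term. *)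
Lemma pentagonal x : 0 < x < 1 ->
 E x = Series (fun i => (-1) ^ i * (x ^ (i * i + tri i) - x ^ (S i * S i + tri i))).
Proof.
intros H.
destruct (eprod_cv x H) as [HL HE].
set (u := fun i => (-1) ^ i * (x ^ (i * i + tri i) - x ^ (S i * S i + tri i))).
assert (Hex : ex_series u).
{ apply (ex_series_le (V := R_CompleteNormedModule) u (fun i => x ^ i)); [|apply is_series_geom_pos; lra].
 intros i. unfold u. rewrite Rabs_sign.
 destruct (pow_tri_small x H i). pose proof (pow_le x (i * i + tri i) ltac:(lra)). pose proof (pow_le x (S i * S i + tri i) ltac:(lra)). apply Rabs_le; lra. }
assert (Hu : is_lim_seq (rsum u) (Series u)) by exact (Series_correct u Hex).
assert (Hx0 : is_lim_seq (fun n => x ^ n) 0) by (apply is_lim_seq_geom; rewrite Rabs_right; lra).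
assert (Hne : forall k, eprod x k <> 0) by (intros k; apply Rgt_not_eq, eprod_pos, H).
assert (Hd : is_lim_seq (fun n => rsum u n + (-1) ^ n * x ^ (S n * S n + tri n)) (Series u + 0)).
{ apply is_lim_seq_plus'; [easy|]. apply is_lim_seq_abs_0, (is_lim_seq_le_le (fun _ => 0) _ (fun n => x ^ n)); [|apply is_lim_seq_const|easy].
 intros n. rewrite Rabs_sign. destruct (pow_tri_small x H n). pose proof (pow_le x (S n * S n + tri n) ltac:(lra)).
 rewrite Rabs_right by lra. lra. }
assert (HS : is_lim_seq (fun n => rsum (fun s => (-1) ^ s * (eprod x n / eprod x s) * x ^ (s * n + tri s)) n) (E x)).
{ assert (HB : forall n, Rabs (rsum (fun s => (-1) ^ s * (eprod x n / eprod x s) * x ^ (s * n + tri s)) n - eprod x n) <= x ^ n * (/ E x * / (1 - x))).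
 { intros n. assert (Hdec : forall k, E x <= eprod x k).
  { intros k. apply (is_lim_seq_decr_compare (eprod x) (E x) HL). intros; apply eprod_decr, H. }
  assert (H1 : forall k, (k <= n)%nat -> Rabs (rsum (fun s => (-1) ^ s * (eprod x n / eprod x s) * x ^ (s * n + tri s)) k - eprod x n) <= x ^ n * (/ E x * ((1 - x ^ S k) / (1 - x)))).
  { induction k as [|k IHk]; intros Hk.
   - rewrite rsum_O. simpl. replace (_ - _) with 0 by lra. rewrite Rabs_R0. pos.
   - rewrite rsum_S.
    match goal with |- Rabs (?a + ?b - ?c) <= _ => replace (a + b - c) with ((a - c) + b) by ring end.
    via Rabs_triang. specialize (IHk ltac:(lia)).
    assert (H2 : Rabs ((-1) ^ S k * (eprod x n / eprod x (S k)) * x ^ (S k * n + tri (S k))) <= x ^ n * (/ E x * x ^ S k)).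
    { rewrite Rmult_assoc, Rabs_sign. pose proof (eprod_pos x n H). pose proof (eprod_pos x (S k) H).
     rewrite Rabs_right. 2:{ apply Rle_ge, Rmult_le_pos; pos. }
     replace (S k * n + tri (S k))%nat with (n + S k + (k * n + tri k))%nat by (simpl; lia). rewrite !pow_add.
     assert (H5 : eprod x n / eprod x (S k) <= / E x).
     { rewrite <- (Rmult_1_l (/ E x)). apply Rmult_le_compat; [lra|left; apply Rinv_0_lt_compat; lra| |].
      - clear -H. induction n as [|n IH]; [easy|]. eapply Rle_trans; [apply eprod_decr, H|lra].
      - apply Rinv_le_contravar; easy. }
     assert (H6 : x ^ (k * n) * x ^ tri k <= 1).
     { rewrite <- pow_add, <- (pow1 (k * n + tri k)). apply pow_incr. lra. }
     pose proof (pow_le x n ltac:(lra)). pose proof (pow_le x (S k) ltac:(lra)).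
     apply Rle_trans with (/ E x * (x ^ n * x ^ S k * 1)).
     - apply Rmult_le_compat; [pos| |lra|apply Rmult_le_compat_l; nra].
      apply Rmult_le_pos; pos.
     - lra. }
    eapply Rle_trans; [apply Rplus_le_compat; [exact IHk|exact H2]|]. right.
    change (x ^ S (S k)) with (x * x ^ S k). field. split; lra. }
  eapply Rle_trans; auto. apply Rmult_le_compat_l; [pos|].
  apply Rmult_le_compat_l; [pos|].
  unfold Rdiv. rewrite <- (Rmult_1_l (/ (1 - x))) at 2. apply Rmult_le_compat_r; [pos|].
  pose proof (pow_le x (S n) ltac:(lra)). lra. }
 apply is_lim_seq_ext with (fun n => eprod x n + (rsum (fun s => (-1) ^ s * (eprod x n / eprod x s) * x ^ (s * n + tri s)) n - eprod x n)); [intros n; ring|].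
 replace (Finite (E x)) with (Finite (E x + 0)) by Cring. apply is_lim_seq_plus'; eauto.
 apply is_lim_seq_abs_0. eapply is_lim_seq_le_le; [split; [pos|apply HB]|apply is_lim_seq_const|].
 replace (Finite 0) with (Finite (0 * (/ E x * / (1 - x)))) by Cring.
 apply is_lim_seq_mult'; [easy|apply is_lim_seq_const]. }
apply is_lim_seq_ext with (v := fun n => rsum u n + (-1) ^ n * x ^ (S n * S n + tri n)) in HS; [|intros n; apply Shanks, Hne].
apply is_lim_seq_unique in HS, Hd. rewrite HS in Hd. injection Hd as Hd. lra.
Qed.

Lemma tri_INR i : INR (tri i) = INR i * (INR i + 1) / 2.
Proof. induction i as [|i IH]; [simpl; field|]. cbn [tri]. rewrite plus_INR, IH, S_INR. field. Qed.

Lemma eta_prod y : 0 < y -> eta y = exp (- (PI * y / 12)) * E (exp (- (2 * PI * y))).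
Proof.
intros Hy. assert (HPI := PI_RGT_0).
assert (Hx : 0 < exp (- (2 * PI * y)) < 1).
{ split; [pos|]. apply exp_small, Rmult_lt_0_compat; lra. }
rewrite pentagonal by lra. rewrite <- Series_scal_l. apply Series_ext. intros i. unfold eta_term.
rewrite !exp_pow_INR, !plus_INR, !mult_INR, tri_INR, S_INR.
match goal with |- _ * (exp ?a - exp ?b) = exp ?e * (_ * (exp ?c - exp ?d)) =>
 replace (exp a) with (exp e * exp c); [replace (exp b) with (exp e * exp d); [ring|]|] end;
rewrite <- exp_plus; f_equal; field.
Qed.

Lemma eta_pos y : 0 < y -> 0 < eta y.
Proof.
intros Hy. rewrite eta_prod by lra. apply Rmult_lt_0_compat; [pos|].
apply eprod_cv. split; [pos|]. apply exp_small. pose proof PI_RGT_0. apply Rmult_lt_0_compat; lra.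
Qed.

(** At [y = 1] the unknown constant only multiplies [eta 1], which is positive by the product
    formula; hence it is 1. *)
Theorem eta_inv y : 0 < y -> eta (/ y) = sqrt y * eta y.
Proof.
intros Hy. destruct eta_inv_aux as [C HC].
assert (H1 := HC 1 Rlt_0_1). rewrite Rinv_1, sqrt_1 in H1. pose proof (eta_pos 1 Rlt_0_1).
assert (C = 1) by nra. rewrite (HC y Hy), H0. ring.
Qed.

(** * The Fourier coefficients of f *)

Definition agree (n : nat) (u v : nat -> R) : Prop := forall k, (k <= n)%nat -> u k = v k.

Lemma PS_mult_agree n u u' v v' : agree n u u' -> agree n v v' -> agree n (PS_mult u v) (PS_mult u' v').
Proof.
intros Hu Hv k Hk. apply sum_eq. intros i Hi. rewrite Hu, Hv by lia. reflexivity.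
Qed.

Definition coefR (p : list Z) (k : nat) : R := IZR (coefZ p k).

Lemma iota_S a n : seq.iota a (S n) = cons a (seq.iota (S a) n).
Proof. reflexivity. Qed.

Lemma iota_rcons a n : seq.iota a (S n) = (seq.iota a n ++ cons (a + n)%nat nil)%list.
Proof.
revert a. induction n as [|n IH]; intros a; [Cring|].
rewrite iota_S, IH. simpl. repeat f_equal. lia.
Qed.

Lemma foldr_map_sum (g : nat -> Z) k : IZR (seq.foldr Z.add 0%Z (seq.map g (seq.iota 0 (S k)))) = sum_f_R0 (fun i => IZR (g i)) k.
Proof.
assert (Happ : forall l1 l2, seq.foldr Z.add 0%Z (l1 ++ l2)%list = (seq.foldr Z.add 0%Z l1 + seq.foldr Z.add 0%Z l2)%Z).
{ induction l1 as [|h l1 IHl]; intros l2; simpl; eauto. rewrite IHl. ring. }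
assert (Hmap : forall l1 l2, seq.map g (l1 ++ l2)%list = (seq.map g l1 ++ seq.map g l2)%list).
{ induction l1 as [|h l1 IHl]; intros l2; simpl; auto. rewrite IHl. reflexivity. }
induction k as [|k IH]; [Cring|].
rewrite iota_rcons, Hmap, Happ, plus_IZR, IH. simpl. f_equal. Cring.
Qed.

Lemma coef_mul_trunc N p q : agree N (coefR (mul_trunc N p q)) (PS_mult (coefR p) (coefR q)).
Proof.
intros k Hk. unfold coefR at 1, coefZ, mul_trunc.
rewrite seq.nth_mkseq.
2:{ apply (ssrbool.introT ssrnat.ltP). lia. }
rewrite foldr_map_sum. apply sum_eq. intros i Hi. rewrite mult_IZR. reflexivity.
Qed.

(** The polynomial [1 + s q^m] for [m > 0]; in particular [lin 0 1] is the constant series 1. *)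
Definition lin (s : R) (m k : nat) : R := if Nat.eqb k 0 then 1 else if Nat.eqb k m then s else 0.

Lemma coef_one_minus N m : agree N (coefR (one_minus_qpow N m)) (lin (-1) m).
Proof.
intros k Hk. unfold coefR, coefZ, one_minus_qpow, lin.
rewrite seq.nth_mkseq; [|apply (ssrbool.introT ssrnat.ltP); lia].
destruct (Nat.eqb k 0); auto. destruct (Nat.eqb k m); reflexivity.
Qed.

Definition sq (u : nat -> R) := PS_mult u u.
(** With [s = -1] this is a factor of the product defining [f]; with [s = 1] it is the corresponding
    factor of a majorant with non-negative coefficients. *)
Definition Fac (s : R) (m : nat) : nat -> R :=
 PS_mult (PS_mult (sq (lin s m)) (sq (lin s (2 * m)))) (PS_mult (sq (lin s (3 * m))) (sq (lin s (6 * m)))).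
Definition PP (s : R) (l : list nat) (u : nat -> R) : nat -> R := seq.foldr (fun m acc => PS_mult acc (Fac s m)) u l.

Lemma agree_trans N u v w : agree N u v -> agree N v w -> agree N u w.
Proof. intros H1 H2 k Hk. rewrite H1, H2 by assumption. reflexivity. Qed.

Lemma coef_mul N p q u v : agree N (coefR p) u -> agree N (coefR q) v -> agree N (coefR (mul_trunc N p q)) (PS_mult u v).
Proof. intros Hp Hq. eapply agree_trans; [apply coef_mul_trunc|]. apply PS_mult_agree; assumption. Qed.

Lemma coef_eta_prod N : agree N (coefR (eta_prod_trunc N)) (PP (-1) (seq.iota 1 N) (lin 0 1)).
Proof.
unfold eta_prod_trunc, PP. induction (seq.iota 1 N) as [|m l IH].
- intros k Hk. destruct k as [|k]; auto.
 destruct k; reflexivity.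
- apply coef_mul; auto.
 repeat apply coef_mul; apply coef_one_minus.
Qed.

Lemma PS_mult_lin_low N u v : agree N v (lin 0 1) -> agree N (PS_mult u v) u.
Proof.
intros H k Hk. unfold PS_mult. destruct k as [|k].
- simpl. rewrite H by lia. unfold lin. Cring.
- rewrite (sum_eq _ (fun i => if Nat.eqb i (S k) then u (S k) else 0)).
 +
  rewrite tech5, Nat.eqb_refl, (sum_eq _ (fun _ => 0)).
  * rewrite sum_cte. ring.
  * intros i Hi. destruct (Nat.eqb_spec i (S k)); [lia|lra].
 + intros i Hi. rewrite H by lia. unfold lin. destruct (Nat.eqb_spec i (S k)) as [->|Hne].
  * rewrite Nat.sub_diag. Cring.
  * destruct (Nat.eqb_spec (S k - i) 0); [lia|]. destruct (Nat.eqb (S k - i) 1); ring.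
Qed.

Lemma lin_low s m N : (N < m)%nat -> agree N (lin s m) (lin 0 1).
Proof.
intros H k Hk. unfold lin. destruct (Nat.eqb k 0); auto.
destruct (Nat.eqb_spec k m); [lia|]. destruct (Nat.eqb k 1); reflexivity.
Qed.

Lemma mult_low N u v : agree N u (lin 0 1) -> agree N v (lin 0 1) -> agree N (PS_mult u v) (lin 0 1).
Proof. intros Hu Hv. eapply agree_trans; [apply PS_mult_lin_low; exact Hv|easy]. Qed.

Lemma Fac_low s m N : (N < m)%nat -> agree N (Fac s m) (lin 0 1).
Proof. intros H. repeat apply mult_low; apply lin_low; lia. Qed.

Definition pN (s : R) (N : nat) : nat -> R := PP s (seq.iota 1 N) (lin 0 1).

Lemma PP_app s l1 l2 u : PP s (l1 ++ l2)%list u = PP s l1 (PP s l2 u).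
Proof. induction l1 as [|m l1 IH]; simpl; auto. rewrite IH. reflexivity. Qed.

Lemma PP_agree s l N u v : agree N u v -> agree N (PP s l u) (PP s l v).
Proof.
intros H. induction l as [|m l IH]; simpl; auto. apply PS_mult_agree; easy.
Qed.

(** The factors with index above [n] are 1 up to order [n], so truncations of different lengths have
    the same low coefficients. *)
Lemma pN_stable s n N : (n <= N)%nat -> agree n (pN s N) (pN s n).
Proof.
intros H. induction H as [|N H IH]; [easy|].
eapply agree_trans; eauto. unfold pN. rewrite iota_rcons, PP_app. apply PP_agree, mult_low; [easy|]. apply Fac_low. lia.
Qed.

Lemma f_coef_pN k N : (k < N)%nat -> IZR (f_coef (S k)) = pN (-1) N k.
Proof.
intros H. transitivity (pN (-1) (S k) k).
- exact (coef_eta_prod (S k) k ltac:(lia)).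
- symmetry. apply (pN_stable (-1) (S k) N); lia.
Qed.

Definition fin_supp (u : nat -> R) : Prop := exists N, forall k, (N < k)%nat -> u k = 0.

Lemma lin_fin s m : fin_supp (lin s m).
Proof.
exists m. intros k Hk. unfold lin. destruct (Nat.eqb_spec k 0); [lia|]. destruct (Nat.eqb_spec k m); [lia|lra].
Qed.

Lemma mult_fin u v : fin_supp u -> fin_supp v -> fin_supp (PS_mult u v).
Proof.
intros [N HN] [M HM]. exists (N + M)%nat. intros k Hk. unfold PS_mult.
rewrite (sum_eq _ (fun _ => 0)); [rewrite sum_cte; ring|].
intros i Hi. destruct (le_lt_dec i N); [rewrite HM by lia|rewrite HN by lia]; ring.
Qed.

Lemma radius_bounded (a : nat -> R) (r M : R) : (forall n, Rabs (a n * r ^ n) <= M) -> Rbar_le r (CV_radius a).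
Proof. intros H. apply (proj1 (CV_radius_bounded a)). eauto. Qed.

Lemma radius_ge_1 (a : nat -> R) : (forall r, 0 < r < 1 -> exists M, forall n, Rabs (a n * r ^ n) <= M) -> Rbar_le 1 (CV_radius a).
Proof.
intros H. apply Rbar_not_lt_le. intros Hlt.
pose proof (CV_radius_ge_0 a) as H0.
destruct (CV_radius a) as [R0| |] eqn:E; simpl in Hlt, H0; try contradiction.
destruct (H ((R0 + 1) / 2)) as [M HM]; [lra|]. apply radius_bounded in HM. rewrite E in HM. simpl in HM. lra.
Qed.

Lemma radius_lt (a : nat -> R) (x : R) : Rbar_le 1 (CV_radius a) -> Rabs x < 1 -> Rbar_lt (Rabs x) (CV_radius a).
Proof. intros H Hx. eapply Rbar_lt_le_trans; eauto. exact Hx. Qed.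

Lemma fin_radius u : fin_supp u -> CV_radius u = p_infty.
Proof.
intros [N HN].
assert (H : forall r : R, Rbar_le r (CV_radius u)).
{ intros r. apply (radius_bounded _ _ (rsum (fun k => Rabs (u k * r ^ k)) N)). intros n.
 assert (Hm : forall m, Rabs (u n * r ^ n) <= rsum (fun k => Rabs (u k * r ^ k)) m \/ (m < n)%nat).
 { induction m as [|m [IH|IH]].
  - destruct n; [left; rewrite rsum_O; lra|lia].
  - rewrite rsum_S. pose proof (Rabs_pos (u (S m) * r ^ S m)). lra.
  - destruct (Nat.eq_dec (S m) n) as [<-|]; [|lia]. rewrite rsum_S.
   assert (0 <= rsum (fun k => Rabs (u k * r ^ k)) m); [|lra].
   clear. induction m as [|m IH]; [rewrite rsum_O; apply Rabs_pos|rewrite rsum_S]. pos. }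
 destruct (Hm N) as [H|H]; auto. rewrite HN by lia. rewrite Rmult_0_l, Rabs_R0.
 clear. induction N as [|m IH]; [rewrite rsum_O; apply Rabs_pos|rewrite rsum_S]. pos. }
destruct (CV_radius u) as [r| |] eqn:Er; [|easy|].
- specialize (H (r + 1)). simpl in H. lra.
- specialize (H 0). destruct H.
Qed.

Lemma PSeries_mult_fin u v x : fin_supp u -> fin_supp v -> PSeries (PS_mult u v) x = PSeries u x * PSeries v x.
Proof. intros Hu Hv. apply PSeries_mult; rewrite fin_radius by assumption; exact I. Qed.

Lemma PSeries_lin s m x : PSeries (lin s (S m)) x = 1 + s * x ^ S m.
Proof.
unfold PSeries. rewrite (Series_finite _ (S m)).
2:{ intros n Hn. unfold lin. destruct (Nat.eqb_spec n 0); [lia|]. destruct (Nat.eqb_spec n (S m)); [lia|ring]. }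
rewrite rsum_S. unfold lin at 2. rewrite Nat.eqb_refl. f_equal.
assert (H : forall n, (n <= m)%nat -> rsum (fun k => lin s (S m) k * x ^ k) n = 1).
{ induction n as [|n IH]; intros Hn; [rewrite rsum_O; unfold lin; simpl; ring|].
 rewrite rsum_S, IH by lia. unfold lin. destruct (Nat.eqb_spec (S n) 0); [lia|]. destruct (Nat.eqb_spec (S n) (S m)); [lia|ring]. } auto.
Qed.

Lemma Fac_fin s m : fin_supp (Fac s m).
Proof. repeat first [apply lin_fin | apply mult_fin]. Qed.

Lemma PP_fin s l u : fin_supp u -> fin_supp (PP s l u).
Proof. intros H. induction l as [|m l IH]; auto. apply mult_fin; [easy|apply Fac_fin]. Qed.

Definition fac (s x : R) (m : nat) : R :=
 ((1 + s * x ^ m) * (1 + s * x ^ (2 * m)) * ((1 + s * x ^ (3 * m)) * (1 + s * x ^ (6 * m)))) ^ 2.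

Fixpoint gprod (f : nat -> R) (n : nat) : R := match n with O => 1 | S m => gprod f m * f (S m) end.

Lemma PSeries_Fac s m x : (0 < m)%nat -> PSeries (Fac s m) x = fac s x m.
Proof.
intros H. unfold Fac, fac, sq. rewrite !PSeries_mult_fin by (repeat first [apply lin_fin | apply mult_fin]).
destruct m as [|m]; [lia|]. replace (2 * S m)%nat with (S (2 * m + 1)) by lia.
replace (3 * S m)%nat with (S (3 * m + 2)) by lia. replace (6 * S m)%nat with (S (6 * m + 5)) by lia.
rewrite !PSeries_lin. ring.
Qed.

Lemma PSeries_one x : PSeries (lin 0 1) x = 1.
Proof. rewrite PSeries_lin. ring. Qed.

Lemma PSeries_PP s l u x : fin_supp u -> seq.all (fun m => Nat.ltb 0 m) l = true ->
 PSeries (PP s l u) x = PSeries u x * seq.foldr (fun m acc => acc * fac s x m) 1 l.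
Proof.
intros Hu. induction l as [|m l IH]; intros Hl.
- Cring.
- apply andb_prop in Hl. destruct Hl as [Hm Hl]. apply Nat.ltb_lt in Hm.
 change (PP s (m :: l)%list u) with (PS_mult (PP s l u) (Fac s m)).
 rewrite PSeries_mult_fin; [|apply PP_fin, Hu|apply Fac_fin]. rewrite IH, PSeries_Fac by assumption. simpl. ring.
Qed.

Lemma PSeries_pN s N x : PSeries (pN s N) x = gprod (fac s x) N.
Proof.
unfold pN. induction N as [|N IH]; [apply PSeries_one|].
rewrite iota_rcons, PP_app. simpl PP.
assert (Ha : forall n a, seq.all (fun m => Nat.ltb 0 m) (seq.iota (S a) n) = true)
 by (induction n as [|n IHn]; intros a; [easy|apply IHn]).
rewrite PSeries_PP in IH by (apply lin_fin || apply Ha).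
rewrite PSeries_PP; [|apply mult_fin; [apply lin_fin|apply Fac_fin]|easy].
rewrite PSeries_one in IH. rewrite PSeries_mult_fin by (apply lin_fin || apply Fac_fin).
rewrite PSeries_one, PSeries_Fac by lia. simpl gprod. nra.
Qed.

(** * Majorants uniform in the number of factors *)

Definition dom (u v : nat -> R) : Prop := forall k, Rabs (u k) <= v k.

Lemma PS_mult_dom u u' v v' : dom u u' -> dom v v' -> dom (PS_mult u v) (PS_mult u' v').
Proof.
intros Hu Hv k. via Rabs_triang_gen. apply sum_Rle. intros i _.
rewrite Rabs_mult. apply Rmult_le_compat; try apply Rabs_pos; easy.
Qed.

Lemma lin_dom s m : Rabs s <= 1 -> dom (lin s m) (lin 1 m).
Proof.
intros Hs k. unfold lin. destruct (Nat.eqb k 0); [rewrite Rabs_R1; lra|].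
destruct (Nat.eqb k m); [lra|rewrite Rabs_R0; lra].
Qed.

Lemma pN_dom s N : Rabs s <= 1 -> dom (pN s N) (pN 1 N).
Proof.
intros Hs. unfold pN, PP. induction (seq.iota 1 N) as [|m l IH]; simpl.
- intros k. unfold lin. destruct (Nat.eqb k 0); [rewrite Rabs_R1; lra|]. destruct (Nat.eqb k 1); rewrite Rabs_R0; lra.
- apply PS_mult_dom; auto. repeat apply PS_mult_dom; apply lin_dom, Hs.
Qed.

(** A factor consists of four binomials, squared, each at most [exp (r^n)]: this is the 8. The
    exponents form a geometric sum, kept in closed form for the induction. *)
Lemma gprod_fac_bound r N : 0 < r < 1 -> 0 < gprod (fac 1 r) N <= exp (8 * (r - r ^ S N) / (1 - r)).
Proof.
intros Hr. induction N as [|N IH].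
- simpl gprod. rewrite pow_1. replace (8 * (r - r) / (1 - r)) with 0 by lra. rewrite exp_0. lra.
- simpl gprod. set (t := r ^ S N).
 assert (Ht : 0 < t) by pos.
 assert (Hj : forall j, (1 <= j)%nat -> 0 < r ^ (j * S N) <= t).
 { intros j Hj. replace (j * S N)%nat with (S N + (j - 1) * S N)%nat by nia.
  rewrite pow_add. fold t. assert (0 < r ^ ((j - 1) * S N) <= 1); [|nra].
  split; [apply pow_lt; lra|]. rewrite <- (pow1 ((j - 1) * S N)). apply pow_incr. lra. }
 assert (Hf : 0 < fac 1 r (S N) <= exp (8 * t)).
 { unfold fac. fold t.
  assert (He : forall u, 0 < u <= t -> 0 < 1 + 1 * u <= exp t).
  { intros u Hu. pose proof (exp_ineq1_le t). lra. }
  pose proof (He t ltac:(lra)) as H1. pose proof (He _ (Hj 2%nat ltac:(lia))) as H2.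
  pose proof (He _ (Hj 3%nat ltac:(lia))) as H3. pose proof (He _ (Hj 6%nat ltac:(lia))) as H6.
  replace (exp (8 * t)) with ((exp t * exp t * (exp t * exp t)) ^ 2).
  2:{ rewrite <- !exp_plus, exp_pow_INR. Cring. }
  split; [pos|].
  apply pow_incr. split; [pos|].
  repeat (apply Rmult_le_compat; try lra); (left; apply Rmult_lt_0_compat; lra). }
 split; [nra|].
 replace (8 * (r - r ^ S (S N)) / (1 - r)) with (8 * (r - t) / (1 - r) + 8 * t).
 2:{ unfold t. change (r ^ S (S N)) with (r * r ^ S N). field. lra. }
 rewrite exp_plus. fold t in IH. apply Rmult_le_compat; lra.
Qed.

(** Shifted by one index: [fc] belongs to [f / q], which is the infinite product itself. *)
Definition fc (k : nat) : R := IZR (f_coef (S k)).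

Lemma Series_term_le (u : nat -> R) k : (forall n, 0 <= u n) -> ex_series u -> u k <= Series u.
Proof.
intros Hu Hex.
assert (L : is_lim_seq (sum_n u) (Series u)) by exact (Series_correct _ Hex).
apply Rle_trans with (rsum u k).
- unfold rsum. destruct k as [|k]; [rewrite sum_O; lra|]. rewrite rsum_S.
 assert (0 <= rsum u k); [|lra]. induction k as [|k IHk]; [rewrite rsum_O; apply Hu|rewrite rsum_S; pose proof (Hu (S k)); lra].
- apply (is_lim_seq_incr_compare (sum_n u) (Series u) L). intros n.
 change (rsum u n <= rsum u (S n)). rewrite rsum_S. pose proof (Hu (S n)). lra.
Qed.

(** Independence of [N] is the point, since it permits the limit in the number of factors. A
    non-negative coefficient times [r^k] is at most the value of the majorant at [r]. *)
Lemma pN_bound r N k : 0 < r < 1 -> Rabs (pN (-1) N k) * r ^ k <= exp (8 * r / (1 - r)).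
Proof.
intros Hr. apply Rle_trans with (pN 1 N k * r ^ k).
- apply Rmult_le_compat_r; [pos|]. apply pN_dom. rewrite Rabs_left; lra.
- apply Rle_trans with (PSeries (pN 1 N) r).
 + apply (Series_term_le (fun k => pN 1 N k * r ^ k)).
  * intros n. apply Rmult_le_pos; [|pos]. eapply Rle_trans; [apply Rabs_pos|apply (pN_dom 1 N)]. rewrite Rabs_R1. lra.
  * assert (H : ex_series (fun n => Rabs (pN 1 N n * r ^ n))).
   { apply CV_disk_inside. rewrite fin_radius; [easy|apply PP_fin, lin_fin]. }
   apply ex_series_Rabs in H. exact H.
 + rewrite PSeries_pN. eapply Rle_trans; [apply gprod_fac_bound, Hr|]. apply exp_le, Rmult_le_compat_r; [pos|]. pose proof (pow_lt r (S N) ltac:(lra)). lra.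
Qed.

Lemma fc_bound r k : 0 < r < 1 -> Rabs (fc k) * r ^ k <= exp (8 * r / (1 - r)).
Proof. intros Hr. unfold fc. rewrite (f_coef_pN k (S k)) by lia. apply pN_bound, Hr. Qed.

Lemma fc_radius : Rbar_le 1 (CV_radius fc).
Proof.
apply radius_ge_1. intros r Hr. exists (exp (8 * r / (1 - r))). intros n.
rewrite Rabs_mult, <- RPow_abs, (Rabs_right r) by lra. apply fc_bound, Hr.
Qed.

Lemma fc_product x : Rabs x < 1 -> is_lim_seq (gprod (fac (-1) x)) (PSeries fc x).
Proof.
intros Hx. set (r := (Rabs x + 1) / 2). pose proof (Rabs_pos x) as Hx0.
assert (Hr : 0 < r < 1) by (unfold r; lra).
apply is_lim_seq_ext with (fun N => Series (fun k => pN (-1) N k * x ^ k)).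
{ intros N. exact (PSeries_pN (-1) N x). }
apply (Tannery (fun N k => pN (-1) N k * x ^ k) (fun k => fc k * x ^ k) (fun k => exp (8 * r / (1 - r)) * (Rabs x / r) ^ k)).
- apply (ex_series_scal_l (K := R_AbsRing) (V := R_NormedModule) (exp (8 * r / (1 - r))) (fun k => (Rabs x / r) ^ k)), ex_series_geom. rewrite Rabs_right.
 + apply Rmult_lt_reg_r with r; [lra|]. unfold Rdiv. rewrite Rmult_assoc, Rinv_l by lra. unfold r. lra.
 + apply Rle_ge, Rmult_le_pos; [lra|pos].
- intros N k. rewrite Rabs_mult, <- RPow_abs. unfold Rdiv at 2. rewrite Rpow_mult_distr, pow_inv.
 pose proof (pN_bound r N k Hr) as H. assert (0 < r ^ k) by pos.
 assert (H1 : Rabs (pN (-1) N k) <= exp (8 * r / (1 - r)) * / r ^ k).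
 { apply Rmult_le_reg_r with (r ^ k); auto. rewrite Rmult_assoc, Rinv_l by lra. lra. }
 pose proof (pow_le (Rabs x) k Hx0). nra.
- intros k. apply is_lim_seq_ext_loc with (fun _ => fc k * x ^ k); [|apply is_lim_seq_const].
 exists (S k). intros N HN. unfold fc. rewrite (f_coef_pN k N) by lia. reflexivity.
Qed.

Definition a (n : nat) : R := IZR (f_coef n).

Lemma a_incr n : a n = PS_incr_1 fc n.
Proof. destruct n; reflexivity. Qed.

Lemma a_radius : Rbar_le 1 (CV_radius a).
Proof. rewrite (CV_radius_ext _ _ a_incr), CV_radius_incr_1. apply fc_radius. Qed.

Lemma PSeries_a x : PSeries a x = x * PSeries fc x.
Proof. rewrite (PSeries_ext _ _ x a_incr). apply PSeries_incr_1. Qed.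

Lemma is_lim_seq_eq (u : nat -> R) (l1 l2 : R) : is_lim_seq u l1 -> is_lim_seq u l2 -> l1 = l2.
Proof. intros H1 H2. apply is_lim_seq_unique in H1. apply is_lim_seq_unique in H2. congruence. Qed.

(** * The form f on the lines Re z = 0 and Re z = 1/2 *)

Lemma gprod_fac x N : gprod (fac (-1) x) N = (eprod x N * eprod (x ^ 2) N * (eprod (x ^ 3) N * eprod (x ^ 6) N)) ^ 2.
Proof.
induction N as [|N IH]; [Cring|]. cbn [gprod eprod]. rewrite IH. unfold fac. rewrite <- !pow_mult. ring.
Qed.

Lemma pow_01 x n : 0 < x < 1 -> (0 < n)%nat -> 0 < x ^ n < 1.
Proof. intros Hx Hn. destruct n; [lia|apply pow_lt_1', Hx]. Qed.

Lemma fc_axis x : 0 < x < 1 -> PSeries fc x = (E x * E (x ^ 2) * (E (x ^ 3) * E (x ^ 6))) ^ 2.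
Proof.
intros Hx. apply (is_lim_seq_eq (gprod (fac (-1) x))); [apply fc_product; rewrite Rabs_right; lra|].
apply is_lim_seq_ext with (fun N => eprod x N * eprod (x ^ 2) N * (eprod (x ^ 3) N * eprod (x ^ 6) N) * (eprod x N * eprod (x ^ 2) N * (eprod (x ^ 3) N * eprod (x ^ 6) N))).
{ intros N. rewrite gprod_fac. ring. }
replace ((E x * E (x ^ 2) * (E (x ^ 3) * E (x ^ 6))) ^ 2) with ((E x * E (x ^ 2) * (E (x ^ 3) * E (x ^ 6))) * (E x * E (x ^ 2) * (E (x ^ 3) * E (x ^ 6)))) by ring.
assert (H : forall n, (0 < n)%nat -> is_lim_seq (eprod (x ^ n)) (E (x ^ n))) by (intros n Hn; apply eprod_cv, pow_01; assumption).
assert (H1 : is_lim_seq (eprod x) (E x)) by (apply eprod_cv, Hx).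
assert (H2 : is_lim_seq (fun N => eprod x N * eprod (x ^ 2) N * (eprod (x ^ 3) N * eprod (x ^ 6) N)) (E x * E (x ^ 2) * (E (x ^ 3) * E (x ^ 6)))).
{ repeat apply is_lim_seq_mult'; first [exact H1|apply H; lia]. }
apply is_lim_seq_mult'; exact H2.
Qed.

(** The finite counterpart of [eta (z + 1/2) = const eta (2z)^3 / (eta z eta (4z))]. Under [x -> -x]
    the factors with even exponent stay, and those with odd exponent [n] combine with the original
    ones to [1 - x^(2n)]. *)
Lemma eprod_neg x N : eprod x (2 * N) * eprod (- x) (2 * N) * eprod (x ^ 4) N = eprod (x ^ 2) (2 * N) * (eprod (x ^ 2) N) ^ 2.
Proof.
induction N as [|N IH]; [Cring|].
replace (2 * S N)%nat with (S (S (2 * N))) by lia. cbn [eprod].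
replace ((- x) ^ S (2 * N)) with (- x ^ S (2 * N)).
2:{ rewrite <- (Rmult_1_l x) at 2. rewrite Ropp_mult_distr_l, Rpow_mult_distr, pow_1_odd. ring. }
replace ((- x) ^ S (S (2 * N))) with (x ^ S (S (2 * N))).
2:{ replace (S (S (2 * N))) with (2 * S N)%nat by lia. rewrite !pow_mult. f_equal. ring. }
rewrite <- !pow_mult. replace (2 * S N)%nat with (S (S (2 * N))) by lia.
replace (2 * S (2 * N))%nat with (S (2 * N) + S (2 * N))%nat by lia. rewrite (pow_add x (S (2 * N)) (S (2 * N))).
replace (2 * S (S (2 * N)))%nat with (4 * S N)%nat by lia.
set (u := x ^ S (2 * N)). set (v := x ^ S (S (2 * N))). set (w := x ^ (4 * S N)).
transitivity ((eprod x (2 * N) * eprod (- x) (2 * N) * eprod (x ^ 4) N) * ((1 - u) * (1 + u) * (1 - v) ^ 2 * (1 - w))); [ring|].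
rewrite IH. ring.
Qed.

Definition Em (x : R) : R := E (x ^ 2) ^ 3 / (E x * E (x ^ 4)).

Lemma eprod_neg_cv x : 0 < x < 1 -> is_lim_seq (fun N => eprod (- x) (2 * N)) (Em x).
Proof.
intros Hx.
assert (Hp : forall n, (0 < n)%nat -> is_lim_seq (eprod (x ^ n)) (E (x ^ n)) /\ 0 < E (x ^ n)) by (intros n Hn; apply eprod_cv, pow_01; assumption).
destruct (eprod_cv x Hx) as [H1 H1p]. destruct (Hp 2%nat) as [H2 H2p]; auto. destruct (Hp 4%nat) as [H4 H4p]; auto.
assert (Hsub : forall u l, is_lim_seq u l -> is_lim_seq (fun N => u (2 * N)%nat) l).
{ intros u l H. apply (is_lim_seq_subseq u l (fun N => (2 * N)%nat)); auto.
 intros P [N0 HP]. exists N0. intros n Hn. apply HP. lia. }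
apply is_lim_seq_ext with (fun N => (eprod (x ^ 2) (2 * N) * (eprod (x ^ 2) N * eprod (x ^ 2) N)) / (eprod x (2 * N) * eprod (x ^ 4) N)).
{ intros N. pose proof (eprod_neg x N) as H. pose proof (eprod_pos x (2 * N) Hx). pose proof (eprod_pos _ N (pow_01 x 4 Hx ltac:(lia))).
 apply Rmult_eq_reg_r with (eprod x (2 * N) * eprod (x ^ 4) N); [|nra]. unfold Rdiv. rewrite Rmult_assoc, Rinv_l by nra. nra. }
unfold Em. replace (E (x ^ 2) ^ 3) with (E (x ^ 2) * (E (x ^ 2) * E (x ^ 2))) by ring.
apply is_lim_seq_div'; [|apply is_lim_seq_mult'; auto|nra].
apply is_lim_seq_mult'; [auto|apply is_lim_seq_mult'; exact H2].
Qed.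

Lemma fc_half x : 0 < x < 1 -> PSeries fc (- x) = (Em x * E (x ^ 2) * (Em (x ^ 3) * E (x ^ 6))) ^ 2.
Proof.
intros Hx.
assert (Hsub : forall u l, is_lim_seq u l -> is_lim_seq (fun N => u (2 * N)%nat) l).
{ intros u l H. apply (is_lim_seq_subseq u l (fun N => (2 * N)%nat)); auto.
 intros P [N0 HP]. exists N0. intros n Hn. apply HP. lia. }
apply (is_lim_seq_eq (fun N => gprod (fac (-1) (- x)) (2 * N))).
{ apply (Hsub (gprod (fac (-1) (- x)))), fc_product. rewrite Rabs_Ropp, Rabs_right; lra. }
set (g := fun N => eprod (- x) (2 * N) * eprod (x ^ 2) (2 * N) * (eprod (- x ^ 3) (2 * N) * eprod (x ^ 6) (2 * N))).
apply is_lim_seq_ext with (fun N => g N * g N).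
{ intros N. rewrite gprod_fac. unfold g. replace ((- x) ^ 2) with (x ^ 2) by ring. replace ((- x) ^ 3) with (- x ^ 3) by ring.
 replace ((- x) ^ 6) with (x ^ 6) by ring. ring. }
replace ((Em x * E (x ^ 2) * (Em (x ^ 3) * E (x ^ 6))) ^ 2) with ((Em x * E (x ^ 2) * (Em (x ^ 3) * E (x ^ 6))) * (Em x * E (x ^ 2) * (Em (x ^ 3) * E (x ^ 6)))) by ring.
assert (Hg : is_lim_seq g (Em x * E (x ^ 2) * (Em (x ^ 3) * E (x ^ 6)))).
{ apply is_lim_seq_mult'; apply is_lim_seq_mult'.
 - apply eprod_neg_cv, Hx.
 - apply (Hsub (eprod (x ^ 2))), eprod_cv, pow_01; [exact Hx|lia].
 - apply eprod_neg_cv, pow_01; [exact Hx|lia].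
 - apply (Hsub (eprod (x ^ 6))), eprod_cv, pow_01; [lra|lia]. }
apply is_lim_seq_mult'; exact Hg.
Qed.

Lemma E_eta y n : 0 < y -> (0 < n)%nat -> E (exp (- (2 * PI * y)) ^ n) = exp (PI * (INR n * y) / 12) * eta (INR n * y).
Proof.
intros Hy Hn. assert (0 < INR n) by pos.
rewrite eta_prod by nra. rewrite exp_pow_INR, <- Rmult_assoc, <- exp_plus. replace (PI * (INR n * y) / 12 + - (PI * (INR n * y) / 12)) with 0 by ring.
rewrite exp_0, Rmult_1_l. f_equal. Cring.
Qed.

Lemma exp_2PI_01 y : 0 < y -> 0 < exp (- (2 * PI * y)) < 1.
Proof. intros Hy. split; [pos|]. apply exp_small. pose proof PI_RGT_0. apply Rmult_lt_0_compat; lra. Qed.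

Lemma a_axis y : 0 < y -> PSeries a (exp (- (2 * PI * y))) = (eta y * eta (2 * y) * (eta (3 * y) * eta (6 * y))) ^ 2.
Proof.
intros Hy. rewrite PSeries_a, fc_axis by (apply exp_2PI_01, Hy).
rewrite <- (pow_1 (exp (- (2 * PI * y)))) at 2.
rewrite !E_eta by (assumption || lia). simpl INR. rewrite !Rmult_1_l.
replace (1 + 1) with 2 by ring. replace (2 + 1) with 3 by ring. replace (3 + 1 + 1 + 1) with 6 by ring.
replace ((exp (PI * y / 12) * eta y * (exp (PI * (2 * y) / 12) * eta (2 * y)) * (exp (PI * (3 * y) / 12) * eta (3 * y) * (exp (PI * (6 * y) / 12) * eta (6 * y)))) ^ 2)
 with ((exp (PI * y / 12) * exp (PI * (2 * y) / 12) * exp (PI * (3 * y) / 12) * exp (PI * (6 * y) / 12)) ^ 2 * (eta y * eta (2 * y) * (eta (3 * y) * eta (6 * y))) ^ 2) by ring.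
rewrite <- !exp_plus, exp_pow_INR, <- Rmult_assoc, <- exp_plus.
match goal with |- exp ?u * _ = _ => replace u with 0 by (simpl; field) end. rewrite exp_0. ring.
Qed.

Lemma Em_eta y n : 0 < y -> (0 < n)%nat -> Em (exp (- (2 * PI * y)) ^ n) =
 exp (PI * (INR n * y) / 12) * (eta (2 * (INR n * y)) ^ 3 / (eta (INR n * y) * eta (4 * (INR n * y)))).
Proof.
intros Hy Hn. assert (0 < INR n) by pos. assert (0 < INR n * y) by nra.
unfold Em. rewrite <- !pow_mult, !E_eta by (assumption || lia). rewrite !mult_INR.
replace (INR 2) with 2 by easy. replace (INR 4) with 4 by Cring. set (t := INR n * y) in *.
replace (INR n * 2 * y) with (2 * t) by (unfold t; ring). replace (INR n * 4 * y) with (4 * t) by (unfold t; ring).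
pose proof (eta_pos t H0). pose proof (eta_pos (4 * t) ltac:(lra)).
rewrite Rpow_mult_distr, exp_pow_INR. replace (INR 3 * (PI * (2 * t) / 12)) with (PI * t / 12 + (PI * t / 12 + PI * (4 * t) / 12)) by (simpl; field).
rewrite !exp_plus. pose proof (exp_pos (PI * t / 12)). pose proof (exp_pos (PI * (4 * t) / 12)). field. split; lra.
Qed.

Lemma a_half y : 0 < y -> PSeries a (- exp (- (2 * PI * y))) =
 - ((eta (2 * y) * eta (6 * y)) ^ 4 / (eta y * eta (3 * y) * (eta (4 * y) * eta (12 * y)))) ^ 2.
Proof.
intros Hy. rewrite PSeries_a, fc_half by (apply exp_2PI_01, Hy).
rewrite <- (pow_1 (exp (- (2 * PI * y)))) at 2.
rewrite !Em_eta, !E_eta by (assumption || lia). rewrite !Rmult_1_l.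
replace (INR 2) with 2 by easy. replace (INR 3) with 3 by Cring. replace (INR 6) with 6 by Cring.
replace (2 * (3 * y)) with (6 * y) by ring. replace (4 * (3 * y)) with (12 * y) by ring.
pose proof (eta_pos y Hy). pose proof (eta_pos (3 * y) ltac:(lra)). pose proof (eta_pos (4 * y) ltac:(lra)). pose proof (eta_pos (12 * y) ltac:(lra)).
set (e1 := exp (PI * y / 12)). set (e2 := exp (PI * (2 * y) / 12)). set (e3 := exp (PI * (3 * y) / 12)). set (e6 := exp (PI * (6 * y) / 12)).
assert (He : exp (- (2 * PI * y)) * (e1 * e2 * e3 * e6) ^ 2 = 1).
{ unfold e1, e2, e3, e6. rewrite <- !exp_plus, exp_pow_INR, <- exp_plus, <- exp_0. f_equal. simpl. field. }
set (X := exp (- (2 * PI * y))) in *.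
transitivity (- (X * (e1 * e2 * e3 * e6) ^ 2) * ((eta (2 * y) * eta (6 * y)) ^ 4 / (eta y * eta (3 * y) * (eta (4 * y) * eta (12 * y)))) ^ 2); [field; split; lra|]. nra.
Qed.

Lemma eta_inv' c d y : 0 < y -> 0 < c -> d * c = 1 -> eta (d / y) = sqrt (c * y) * eta (c * y).
Proof.
intros Hy Hc Hd. rewrite <- eta_inv by nra. f_equal.
replace d with (/ c) by (apply Rmult_eq_reg_r with c; [rewrite Rinv_l; lra|lra]). field. lra.
Qed.

(** The Fricke involution permutes the four eta factors, and the squared square roots from the
    inversion multiply to [6y 3y 2y y = 36 y^4]. *)
Lemma a_axis_inv y : 0 < y -> PSeries a (exp (- (2 * PI * (/ (6 * y))))) = 1 * 6 ^ 2 * y ^ 4 * PSeries a (exp (- (2 * PI * y))).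
Proof.
intros Hy. assert (0 < / (6 * y)) by pos.
rewrite !a_axis by assumption.
replace (/ (6 * y)) with ((/ 6) / y) by (field; lra).
replace (2 * (/ 6 / y)) with ((/ 3) / y) by lra. replace (3 * (/ 6 / y)) with ((/ 2) / y) by lra.
replace (6 * (/ 6 / y)) with (1 / y) by lra.
rewrite (eta_inv' 6 (/ 6)), (eta_inv' 3 (/ 3)), (eta_inv' 2 (/ 2)), (eta_inv' 1 1) by lra.
rewrite !Rmult_1_l.
transitivity ((sqrt (6 * y)) ^ 2 * (sqrt (3 * y)) ^ 2 * (sqrt (2 * y)) ^ 2 * (sqrt y) ^ 2 * (eta y * eta (2 * y) * (eta (3 * y) * eta (6 * y))) ^ 2); [ring|].
rewrite !pow2_sqrt by lra. ring.
Qed.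

(** On the line [Re z = 1/2] the substitution [y -> 1/(12 y)] is the trace of the Atkin-Lehner
    element [e3]; again it permutes the eta factors of the quotient. *)
Lemma a_half_inv y : 0 < y -> PSeries a (- exp (- (2 * PI * (/ (12 * y))))) = 1 * 12 ^ 2 * y ^ 4 * PSeries a (- exp (- (2 * PI * y))).
Proof.
intros Hy. assert (0 < / (12 * y)) by pos.
rewrite !a_half by assumption.
replace (/ (12 * y)) with ((/ 12) / y) by (field; lra).
replace (2 * (/ 12 / y)) with ((/ 6) / y) by lra. replace (6 * (/ 12 / y)) with ((/ 2) / y) by lra.
replace (3 * (/ 12 / y)) with ((/ 4) / y) by lra. replace (4 * (/ 12 / y)) with ((/ 3) / y) by lra.
replace (12 * (/ 12 / y)) with (1 / y) by lra.
rewrite (eta_inv' 12 (/ 12)), (eta_inv' 6 (/ 6)), (eta_inv' 4 (/ 4)), (eta_inv' 3 (/ 3)), (eta_inv' 2 (/ 2)), (eta_inv' 1 1) by lra.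
rewrite !Rmult_1_l.
pose proof (eta_pos y Hy). pose proof (eta_pos (3 * y) ltac:(lra)). pose proof (eta_pos (4 * y) ltac:(lra)). pose proof (eta_pos (12 * y) ltac:(lra)).
assert (Hs : forall t, 0 < t -> 0 < sqrt t) by pos.
pose proof (Hs y Hy). pose proof (Hs (3 * y) ltac:(lra)). pose proof (Hs (4 * y) ltac:(lra)). pose proof (Hs (12 * y) ltac:(lra)).
transitivity (- (((sqrt (6 * y)) ^ 2) ^ 4 * (sqrt (2 * y) ^ 2) ^ 4) / ((sqrt (12 * y)) ^ 2 * (sqrt (4 * y)) ^ 2 * (sqrt (3 * y)) ^ 2 * (sqrt y) ^ 2) *
 ((eta (2 * y) * eta (6 * y)) ^ 4 / (eta y * eta (3 * y) * (eta (4 * y) * eta (12 * y)))) ^ 2); [field; split; lra|].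
rewrite !pow2_sqrt by lra. field. split; lra.
Qed.

(** * Eichler integrals on the axes *)

Lemma deriv0_const (f : R -> R) : (forall y, 0 < y -> is_derive f y 0) -> forall x y, 0 < x -> 0 < y -> f x = f y.
Proof.
intros H x y Hx Hy.
destruct (MVT_gen f x y (fun _ => 0)) as [c [_ Hc]].
- intros z Hz. apply H. pose proof (Rmin_glb_lt x y 0 Hx Hy). lra.
- intros z Hz. apply continuity_pt_filterlim, (ex_derive_continuous f z). exists 0. apply H.
 pose proof (Rmin_glb_lt x y 0 Hx Hy). lra.
- lra.
Qed.

(** The pattern of a series in [exp (- k y)] and its images under multiplying the n-th coefficient
    by [n]. For the Eichler integral, three steps lead back to the form of weight 4. *)
Definition tower (k : R) (e0 e1 e2 e3 : R -> R) : Prop := forall y, 0 < y ->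
 is_derive e0 y (- k * e1 y) /\ is_derive e1 y (- k * e2 y) /\ is_derive e2 y (- k * e3 y).

(* For [s = c] this is the symmetrisation of [e] under the weight [-2] action of [y |-> 1/(c y)]. *)
Definition hh (s c : R) (e : R -> R) (y : R) : R := e y + s * y ^ 2 * e (/ (c * y)).

Lemma is_derive_inv_comp (e : R -> R) c y l : 0 < c -> 0 < y -> is_derive e (/ (c * y)) l ->
 is_derive (fun y => e (/ (c * y))) y (- l / (c * y ^ 2)).
Proof.
intros Hc Hy H. evar_last.
- apply (is_derive_comp e (fun y => / (c * y))); eauto. auto_derive; auto. nra.
- unfold scal; simpl; unfold mult; simpl. field. split; lra.
Qed.

Section Bol.
Variables (k s c : R) (e0 e1 e2 e3 : R -> R).
Hypothesis Hc : 0 < c.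
Hypothesis Htow : tower k e0 e1 e2 e3.

Definition hh1 (y : R) : R := - k * e1 y + 2 * s * y * e0 (/ (c * y)) + s * k / c * e1 (/ (c * y)).
Definition hh2 (y : R) : R := k ^ 2 * e2 y + 2 * s * e0 (/ (c * y)) + 2 * s * k / (c * y) * e1 (/ (c * y)) + s * k ^ 2 / (c ^ 2 * y ^ 2) * e2 (/ (c * y)).
(** In the third derivative of [hh] all contributions of [e0], [e1] and [e2] at [1/(c y)] have
    cancelled: Bol's identity. What is left compares [e3] with its transform in weight 4. *)
Definition hh3 (y : R) : R := - k ^ 3 * (e3 y - s / (c ^ 3 * y ^ 4) * e3 (/ (c * y))).

Lemma inv_pos' y : 0 < y -> 0 < / (c * y).
Proof. intros Hy. apply Rinv_0_lt_compat, Rmult_lt_0_compat; assumption. Qed.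

Lemma is_derive_hh y : 0 < y -> is_derive (hh s c e0) y (hh1 y).
Proof.
intros Hy. destruct (Htow y Hy) as [D0 [D1 D2]]. destruct (Htow _ (inv_pos' y Hy)) as [D0' _].
apply (is_derive_inv_comp _ c y) in D0'; auto. evar_last.
- apply (is_derive_plus e0 (fun y => s * y ^ 2 * e0 (/ (c * y)))); eauto.
 apply (is_derive_mult (fun y => s * y ^ 2)); [auto_derive; easy|eauto|apply Rmult_comm].
- unfold hh1, plus, mult; simpl. field. split; lra.
Qed.

Lemma is_derive_hh1 y : 0 < y -> is_derive hh1 y (hh2 y).
Proof.
intros Hy. destruct (Htow y Hy) as [D0 [D1 D2]]. destruct (Htow _ (inv_pos' y Hy)) as [D0' [D1' _]].
apply (is_derive_inv_comp _ c y) in D0'; auto. apply (is_derive_inv_comp _ c y) in D1'; auto. evar_last.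
- apply (is_derive_plus (fun y => - k * e1 y + 2 * s * y * e0 (/ (c * y))) (fun y => s * k / c * e1 (/ (c * y)))).
 + apply (is_derive_plus (fun y => - k * e1 y) (fun y => 2 * s * y * e0 (/ (c * y)))).
  * apply (is_derive_scal e1 y (- k)). exact D1.
  * apply (is_derive_mult (fun y => 2 * s * y)); [auto_derive; easy|eauto|apply Rmult_comm].
 + apply (is_derive_scal (fun y => e1 (/ (c * y))) y (s * k / c)). exact D1'.
- unfold hh2, plus, mult; simpl. field. split; lra.
Qed.

Lemma is_derive_hh2 y : 0 < y -> is_derive hh2 y (hh3 y).
Proof.
intros Hy. destruct (Htow y Hy) as [D0 [D1 D2]]. destruct (Htow _ (inv_pos' y Hy)) as [D0' [D1' D2']].
apply (is_derive_inv_comp _ c y) in D0'; auto. apply (is_derive_inv_comp _ c y) in D1'; auto.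
apply (is_derive_inv_comp _ c y) in D2'; auto.
assert (Hcy : c * y <> 0) by nra. evar_last.
- apply (is_derive_plus (fun y => k ^ 2 * e2 y + 2 * s * e0 (/ (c * y)) + 2 * s * k / (c * y) * e1 (/ (c * y))) (fun y => s * k ^ 2 / (c ^ 2 * y ^ 2) * e2 (/ (c * y)))).
 + apply (is_derive_plus (fun y => k ^ 2 * e2 y + 2 * s * e0 (/ (c * y))) (fun y => 2 * s * k / (c * y) * e1 (/ (c * y)))).
  * apply (is_derive_plus (fun y => k ^ 2 * e2 y) (fun y => 2 * s * e0 (/ (c * y)))).
   -- apply (is_derive_scal e2 y (k ^ 2)). exact D2.
   -- apply (is_derive_scal (fun y => e0 (/ (c * y))) y (2 * s)). exact D0'.
  * apply (is_derive_mult (fun y => 2 * s * k / (c * y))); [auto_derive; easy|eauto|apply Rmult_comm].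
 + apply (is_derive_mult (fun y => s * k ^ 2 / (c ^ 2 * y ^ 2))); [auto_derive; [nra|easy]|eauto|apply Rmult_comm].
- unfold hh3, plus, mult; simpl. field. split; lra.
Qed.

Lemma hh_quadratic : (forall y, 0 < y -> hh3 y = 0) -> exists q0 q1 q2, forall y, 0 < y -> hh s c e0 y = q0 + q1 * y + q2 * y ^ 2.
Proof.
intros H0.
assert (C2 : forall y, 0 < y -> hh2 y = hh2 1).
{ intros y Hy. apply (deriv0_const hh2); [|lra|lra]. intros z Hz. rewrite <- (H0 z Hz). apply is_derive_hh2, Hz. }
assert (C1 : forall y, 0 < y -> hh1 y - hh2 1 * y = hh1 1 - hh2 1 * 1).
{ intros y Hy. apply (deriv0_const (fun y => hh1 y - hh2 1 * y)); [|lra|lra]. intros z Hz. evar_last.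
 - apply (is_derive_minus hh1 (fun y => hh2 1 * y)); [apply is_derive_hh1, Hz|auto_derive; easy].
 - rewrite (C2 z Hz). unfold minus, plus, opp; simpl. ring. }
set (q1 := hh1 1 - hh2 1 * 1). set (q2 := hh2 1 / 2).
assert (C0 : forall y, 0 < y -> hh s c e0 y - q1 * y - q2 * y ^ 2 = hh s c e0 1 - q1 * 1 - q2 * 1 ^ 2).
{ intros y Hy. apply (deriv0_const (fun y => hh s c e0 y - q1 * y - q2 * y ^ 2)); [|lra|lra]. intros z Hz. evar_last.
 - apply (is_derive_minus (fun y => hh s c e0 y - q1 * y) (fun y => q2 * y ^ 2)); [|auto_derive; easy].
  apply (is_derive_minus (hh s c e0) (fun y => q1 * y)); [apply is_derive_hh, Hz|auto_derive; easy].
 - specialize (C1 z Hz). unfold q1, q2. unfold minus, plus, opp; simpl. lra. }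
exists (hh s c e0 1 - q1 * 1 - q2 * 1 ^ 2), q1, q2. intros y Hy. rewrite <- (C0 y Hy). ring.
Qed.

(** The converse direction, for the twisted series: there the quadratic is known first, and it
    yields the weight 4 relation of the third derivative together with its own coefficients in terms
    of the tower. *)
Lemma hh_quadratic_rev q0 q1 q2 : (forall y, 0 < y -> hh s c e0 y = q0 + q1 * y + q2 * y ^ 2) ->
 forall y, 0 < y -> hh1 y = q1 + 2 * q2 * y /\ hh2 y = 2 * q2 /\ hh3 y = 0.
Proof.
intros H y Hy.
assert (Loc : forall z, 0 < z -> locally z (fun t => 0 < t)) by (intros z Hz; apply (open_gt 0 z), Hz).
assert (C1 : forall z, 0 < z -> hh1 z = q1 + 2 * q2 * z).
{ intros z Hz.
 assert (D : is_derive (hh s c e0) z (q1 + 2 * q2 * z)).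
 { apply is_derive_ext_loc with (fun y => q0 + q1 * y + q2 * y ^ 2).
  - generalize (Loc z Hz). apply filter_imp. intros t Ht. symmetry. apply H, Ht.
  - auto_derive; nra. }
 pose proof (is_derive_hh z Hz) as D'. apply is_derive_unique in D. apply is_derive_unique in D'. congruence. }
assert (C2 : forall z, 0 < z -> hh2 z = 2 * q2).
{ intros z Hz.
 assert (D : is_derive hh1 z (2 * q2)).
 { apply is_derive_ext_loc with (fun z => q1 + 2 * q2 * z).
  - generalize (Loc z Hz). apply filter_imp. intros t Ht. symmetry. apply C1, Ht.
  - auto_derive; lra. }
 pose proof (is_derive_hh1 z Hz) as D'. apply is_derive_unique in D. apply is_derive_unique in D'. congruence. }
assert (D : is_derive hh2 y 0).
{ apply is_derive_ext_loc with (fun z => 2 * q2).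
 - generalize (Loc y Hy). apply filter_imp. intros t Ht. symmetry. apply C2, Ht.
 - apply (is_derive_const (2 * q2) y). }
pose proof (is_derive_hh2 y Hy) as D'. apply is_derive_unique in D. apply is_derive_unique in D'.
split; [auto|split; [auto|lra]].
Qed.
End Bol.

(** A decreasing function with limit 0 is positive. Applied three times, this carries positivity of
    the form over to its Eichler integral. *)
Lemma decay_pos (k : R) (g g' : R -> R) : 0 < k -> (forall y, 0 < y -> is_derive g y (- k * g' y)) ->
 (forall y, 0 < y -> 0 < g' y) -> is_lim g p_infty 0 -> forall y, 0 < y -> 0 < g y /\ forall z, y < z -> g z < g y.
Proof.
intros Hk Hd Hp Hl.
assert (Hdec : forall y z, 0 < y -> y < z -> g z < g y).
{ intros y z Hy Hz. destruct (MVT_gen g y z (fun t => - k * g' t)) as [c [Hc1 Hc2]].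
 - intros t Ht. rewrite Rmin_left in Ht by lra. apply Hd. lra.
 - intros t Ht. rewrite Rmin_left in Ht by lra. apply continuity_pt_filterlim, (ex_derive_continuous g t).
  exists (- k * g' t). apply Hd. lra.
 - rewrite Rmin_left in Hc1 by lra. pose proof (Hp c ltac:(lra)). assert (0 < k * g' c) by nra. nra. }
intros y Hy. split; auto.
assert (H1 : 0 <= g (y + 1)).
{
 apply (is_lim_le_loc g (fun _ => g (y + 1)) p_infty 0 (g (y + 1))); [|easy|apply is_lim_const].
 exists (y + 1). intros t Ht. left. apply Hdec; lra. }
pose proof (Hdec y (y + 1) Hy ltac:(lra)). lra.
Qed.

Definition dn (e : nat -> R) (n : nat) : R := INR n * e n.

Lemma dn_incr e n : dn e n = PS_incr_1 (PS_derive e) n.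
Proof. destruct n; unfold dn; [simpl; unfold zero; simpl; ring|easy]. Qed.

Lemma dn_radius e : Rbar_le 1 (CV_radius e) -> Rbar_le 1 (CV_radius (dn e)).
Proof. intros H. rewrite (CV_radius_ext _ _ (dn_incr e)), CV_radius_incr_1, CV_radius_derive. exact H. Qed.

Lemma exp_neg_01 k y : 0 < k -> 0 < y -> Rabs (exp (- (k * y))) < 1.
Proof.
intros Hk Hy. pose proof (exp_small (k * y) ltac:(apply Rmult_lt_0_compat; assumption)). rewrite Rabs_right; lra.
Qed.

Lemma qs_deriv e k s y : s = 1 \/ s = -1 -> Rbar_le 1 (CV_radius e) -> 0 < k -> 0 < y ->
 is_derive (fun y => PSeries e (s * exp (- (k * y)))) y (- k * PSeries (dn e) (s * exp (- (k * y)))).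
Proof.
intros Hs He Hk Hy.
assert (Hx : Rabs (s * exp (- (k * y))) < 1).
{ rewrite Rabs_mult. replace (Rabs s) with 1; [rewrite Rmult_1_l; apply exp_neg_01; assumption|].
 destruct Hs as [-> | ->]; [rewrite Rabs_right; lra|rewrite Rabs_left; lra]. }
rewrite (PSeries_ext _ _ _ (dn_incr e)), PSeries_incr_1. evar_last.
- apply (is_derive_comp (PSeries e) (fun y => s * exp (- (k * y)))).
 + apply is_derive_PSeries, radius_lt; assumption.
 + auto_derive; [exact I|reflexivity].
- unfold scal; simpl; unfold mult; simpl. ring.
Qed.

Lemma qs_tower e k s : s = 1 \/ s = -1 -> Rbar_le 1 (CV_radius e) -> 0 < k ->
 tower k (fun y => PSeries e (s * exp (- (k * y)))) (fun y => PSeries (dn e) (s * exp (- (k * y))))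
  (fun y => PSeries (dn (dn e)) (s * exp (- (k * y)))) (fun y => PSeries (dn (dn (dn e))) (s * exp (- (k * y)))).
Proof. intros Hs He Hk y Hy. repeat split; apply qs_deriv; try assumption; repeat apply dn_radius; exact He. Qed.

Lemma qs_lim e k s : s = 1 \/ s = -1 -> Rbar_le 1 (CV_radius e) -> 0 < k -> is_lim (fun y => PSeries e (s * exp (- (k * y)))) p_infty (e 0%nat).
Proof.
intros Hs He Hk. rewrite <- (PSeries_0 e).
apply (is_lim_comp_continuous (fun y => s * exp (- (k * y))) (PSeries e) p_infty 0).
- replace (Finite 0) with (Rbar_mult s 0) by Cring. apply is_lim_scal_l, (is_lim_comp exp (fun y => - (k * y)) p_infty 0 m_infty); [apply is_lim_exp_m| |exists 0; discriminate].
 replace m_infty with (Rbar_opp p_infty) by easy. apply is_lim_opp.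
 replace p_infty with (Rbar_mult k p_infty) at 2.
 + apply is_lim_scal_l, is_lim_id.
 + simpl. destruct (Rle_dec 0 k); [|lra]. destruct (Rle_lt_or_eq_dec 0 k r); [easy|lra].
- apply continuity_pt_filterlim, PSeries_continuity, radius_lt; [easy|rewrite Rabs_R0; lra].
Qed.

Lemma radius_dom (u v : nat -> R) : (forall n, Rabs (u n) <= Rabs (v n)) -> Rbar_le 1 (CV_radius v) -> Rbar_le 1 (CV_radius u).
Proof.
intros H Hv. apply radius_ge_1. intros r Hr.
exists (Series (fun n => Rabs (v n * r ^ n))). intros n. apply Rle_trans with (Rabs (v n * r ^ n)).
- rewrite !Rabs_mult. apply Rmult_le_compat_r; [pos|easy].
- apply (Series_term_le (fun n => Rabs (v n * r ^ n))); [intros; apply Rabs_pos|].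
 apply CV_disk_inside, radius_lt; [easy|rewrite Rabs_right; lra].
Qed.

(* Bol's identity in weight 4: the third derivative of the symmetrised Eichler integral vanishes. The sign of the period [G] is
   obtained at the limit [y -> 0]. *)
Lemma Bol_period (k c s eta : R) (e : nat -> R) : 0 < k -> 0 < c -> s = 1 \/ s = -1 -> eta = 1 \/ eta = -1 ->
 Rbar_le 1 (CV_radius e) -> e 0%nat = 0 ->
 (forall y, 0 < y -> PSeries (dn (dn (dn e))) (s * exp (- (k * / (c * y)))) = 1 * c ^ 2 * y ^ 4 * PSeries (dn (dn (dn e))) (s * exp (- (k * y)))) ->
 (forall y, 0 < y -> 0 < eta * PSeries (dn (dn (dn e))) (s * exp (- (k * y)))) ->
 exists G B, 0 < eta * G /\ forall y, 0 < y ->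
  PSeries e (s * exp (- (k * y))) + c * y ^ 2 * PSeries e (s * exp (- (k * / (c * y)))) = G * (1 + c * y ^ 2) + B * y.
Proof.
intros Hk Hc Hs Heta He e0 HF Hpos.
set (f := fun y => PSeries e (s * exp (- (k * y)))).
assert (Htow := qs_tower e k s Hs He Hk).
assert (Hq : exists q0 q1 q2, forall y, 0 < y -> hh c c f y = q0 + q1 * y + q2 * y ^ 2).
{ apply (hh_quadratic k c c _ _ _ _ Hc Htow). intros y Hy. unfold hh3. rewrite HF by exact Hy. field. split; lra. }
destruct Hq as [q0 [q1 [q2 Hq]]].
(* The symmetrisation is invariant in weight -2 under [y -> 1/(c y)], so the quadratic is
   self-reciprocal. A single point may be fixed by the involution and give nothing, hence the
   comparison at both [y = 1] and [y = 2]. *)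
assert (Hsym : q2 = c * q0).
{ pose proof (Hq 1 ltac:(lra)) as H1. pose proof (Hq (/ c) ltac:(apply Rinv_0_lt_compat; lra)) as H2.
 pose proof (Hq (/ (2 * c)) ltac:(apply Rinv_0_lt_compat; lra)) as H3. pose proof (Hq 2 ltac:(lra)) as H4. unfold hh in *.
 replace (/ (c * 1)) with (/ c) in H1 by (field; lra). replace (/ (c * / c)) with 1 in H2 by (field; lra).
 replace (/ (c * / (2 * c))) with 2 in H3 by (field; lra). replace (/ (c * 2)) with (/ (2 * c)) in H4 by (field; lra).
 set (A1 := f 1) in *. set (A2 := f (/ c)) in *. set (A3 := f (/ (2 * c))) in *. set (A4 := f 2) in *.
 assert (E1 : A2 + / c * A1 = q0 + q1 * / c + q2 * (/ c) ^ 2) by (rewrite <- H2; field; lra).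
 assert (E3 : A3 + / (4 * c) * A4 = q0 + q1 * / (2 * c) + q2 * (/ (2 * c)) ^ 2) by (rewrite <- H3; field; lra).
 assert (E1' : c * A2 + A1 = c * q0 + q1 + q2 / c).
 { transitivity (c * (A2 + / c * A1)); [field; lra|rewrite E1; field; lra]. }
 assert (E3' : 4 * c * A3 + A4 = 4 * c * q0 + 2 * q1 + q2 / c).
 { transitivity (4 * c * (A3 + / (4 * c) * A4)); [field; lra|rewrite E3; field; lra]. }
 assert (E4 : q2 - c * q0 = (q2 - c * q0) / c * 1 /\ 4 * (q2 - c * q0) = (q2 - c * q0) / c).
 { replace ((q2 - c * q0) / c) with (q2 / c - q0) by (field; lra). split; lra. }
 lra. }
exists q0, q1. split.
2:{ intros y Hy. specialize (Hq y Hy). unfold hh, f in Hq. rewrite Hq, Hsym. ring. }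
assert (Hlim : forall e', Rbar_le 1 (CV_radius e') -> e' 0%nat = 0 -> is_lim (fun y => eta * PSeries e' (s * exp (- (k * y)))) p_infty 0).
{ intros e' He' H0. replace (Finite 0) with (Rbar_mult eta (e' 0%nat)) by (rewrite H0; simpl; f_equal; ring).
 apply is_lim_scal_l. apply qs_lim; assumption. }
assert (Hd : forall e' y, Rbar_le 1 (CV_radius e') -> 0 < y -> is_derive (fun y => eta * PSeries e' (s * exp (- (k * y)))) y (- k * (eta * PSeries (dn e') (s * exp (- (k * y)))))).
{ intros e' y He' Hy. evar_last; [apply (is_derive_scal (fun y => PSeries e' (s * exp (- (k * y)))) y eta); apply qs_deriv; assumption|ring]. }
assert (P2 : forall y, 0 < y -> 0 < eta * PSeries (dn (dn e)) (s * exp (- (k * y)))).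
{ intros y Hy. apply (decay_pos k (fun y => eta * PSeries (dn (dn e)) (s * exp (- (k * y)))) (fun y => eta * PSeries (dn (dn (dn e))) (s * exp (- (k * y)))) Hk).
 - intros z Hz. apply (Hd (dn (dn e))); [repeat apply dn_radius; exact He|exact Hz].
 - exact Hpos.
 - apply Hlim; [repeat apply dn_radius; exact He|unfold dn; simpl; ring].
 - exact Hy. }
assert (P1 : forall y, 0 < y -> 0 < eta * PSeries (dn e) (s * exp (- (k * y)))).
{ intros y Hy. apply (decay_pos k (fun y => eta * PSeries (dn e) (s * exp (- (k * y)))) (fun y => eta * PSeries (dn (dn e)) (s * exp (- (k * y)))) Hk).
 - intros z Hz. apply (Hd (dn e)); [repeat apply dn_radius; exact He|exact Hz].
 - exact P2.
 - apply Hlim; [repeat apply dn_radius; exact He|unfold dn; simpl; ring].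
 - exact Hy. }
assert (P0 : forall y, 0 < y -> 0 < eta * f y /\ forall z, y < z -> eta * f z < eta * f y).
{ apply (decay_pos k (fun y => eta * f y) (fun y => eta * PSeries (dn e) (s * exp (- (k * y)))) Hk).
 - intros z Hz. apply (Hd e); assumption.
 - exact P1.
 - apply Hlim; assumption. }
apply Rlt_le_trans with (eta * f 1); [apply P0; lra|].
assert (HL : Rbar_le (eta * f 1) (eta * q0)); [|exact HL].
(* letting [y] tend to [0], parametrised as [1/(c t)] *)
apply (is_lim_le_loc (fun t => eta * f 1) (fun t => eta * f (/ (c * t))) p_infty).
- exists (1 + / c). intros t Ht. assert (0 < / c) by (apply Rinv_0_lt_compat; lra). destruct (Rle_lt_or_eq_dec (/ (c * t)) 1) as [H1|H1].
 + rewrite <- Rinv_1. apply Rinv_le_contravar; [lra|]. apply Rmult_le_reg_l with (/ c); [assumption|]. rewrite <- Rmult_assoc, Rinv_l by lra. lra.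
 + left. apply P0; [apply Rinv_0_lt_compat; nra|exact H1].
 + rewrite H1. lra.
- apply is_lim_const.
- apply is_lim_ext_loc with (fun t => eta * (q0 + q1 * / (c * t) + q0 * / (c * t ^ 2) - f t * (/ (c * t ^ 2)))).
 + exists 1. intros t Ht. f_equal. assert (Ht0 : 0 < c * t) by nra. pose proof (Hq _ (Rinv_0_lt_compat _ Ht0)) as H. unfold hh in H.
  replace (/ (c * / (c * t))) with t in H by (field; lra).
  replace (f (/ (c * t))) with (q0 + q1 * / (c * t) + q2 * (/ (c * t)) ^ 2 - c * (/ (c * t)) ^ 2 * f t) by lra.
  rewrite Hsym. field. split; lra.
 + assert (L1 : is_lim (fun t => / (c * t)) p_infty 0).
  { apply (is_lim_comp Rinv (fun t => c * t) p_infty 0 p_infty).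
   - apply (is_lim_inv (fun y => y) p_infty p_infty); [apply is_lim_id|discriminate].
   - replace p_infty with (Rbar_mult c p_infty) at 2; [apply is_lim_scal_l, is_lim_id|].
    simpl. destruct (Rle_dec 0 c); [|lra]. destruct (Rle_lt_or_eq_dec 0 c r); [reflexivity|lra].
   - exists 0. intros; discriminate. }
  assert (L2 : is_lim (fun t => / (c * t ^ 2)) p_infty 0).
  { apply is_lim_ext_loc with (fun t => c * (/ (c * t) * / (c * t))).
   - exists 1. intros t Ht. field. split; lra.
   - replace (Finite 0) with (Rbar_mult c (Rbar_mult 0 0)) by (simpl; f_equal; ring). apply is_lim_scal_l.
    apply is_lim_mult; [exact L1|exact L1|exact I]. }
  assert (Lf : is_lim f p_infty 0) by (rewrite <- e0; apply qs_lim; assumption).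
  replace (Finite (eta * q0)) with (Rbar_mult eta (Finite (q0 + q1 * 0 + q0 * 0 - 0 * 0))) by (simpl; f_equal; ring).
  apply is_lim_scal_l. apply is_lim_minus'; [apply is_lim_plus'; [apply is_lim_plus'; [apply is_lim_const|]|]|].
  * apply (is_lim_scal_l (fun t => / (c * t)) q1 p_infty 0 L1).
  * apply (is_lim_scal_l (fun t => / (c * t ^ 2)) q0 p_infty 0 L2).
  * apply (is_lim_mult f (fun t => / (c * t ^ 2)) p_infty 0 0 Lf L2 I).
Qed.

Definition ei (n : nat) : R := a n / INR n ^ 3.

Lemma dn3_ei n : dn (dn (dn ei)) n = a n.
Proof.
unfold dn, ei. destruct n as [|n]; [unfold a; simpl; ring|]. assert (INR (S n) <> 0) by pos. field. assumption.
Qed.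

Lemma ei_radius : Rbar_le 1 (CV_radius ei).
Proof.
apply (radius_dom ei a); [|apply a_radius]. intros n. unfold ei.
destruct n as [|n]; [unfold a; simpl; unfold Rdiv; rewrite Rmult_0_l; lra|].
unfold Rdiv. rewrite Rabs_mult. rewrite <- (Rmult_1_r (Rabs (a (S n)))) at 2. apply Rmult_le_compat_l; [pos|].
assert (H : 1 <= INR (S n)) by (rewrite S_INR; pose proof (pos_INR n); lra).
assert (H1 : 1 <= INR (S n) ^ 3) by nra.
rewrite Rabs_right by (apply Rle_ge; left; apply Rinv_0_lt_compat; lra). rewrite <- Rinv_1. apply Rinv_le_contravar; lra.
Qed.

Lemma ei_axis : exists G B, 0 < G /\ forall y, 0 < y ->
 PSeries ei (exp (- (2 * PI * y))) + 6 * y ^ 2 * PSeries ei (exp (- (2 * PI * / (6 * y)))) = G * (1 + 6 * y ^ 2) + B * y.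
Proof.
assert (HPI := PI_RGT_0).
destruct (Bol_period (2 * PI) 6 1 1 ei) as [G [B [HG H]]]; try lra.
- apply ei_radius.
- unfold ei, a. simpl. lra.
- intros y Hy. rewrite !Rmult_1_l, !(PSeries_ext _ _ _ dn3_ei), a_axis_inv by lra. ring.
- intros y Hy. rewrite !Rmult_1_l, !(PSeries_ext _ _ _ dn3_ei), a_axis by lra. apply pow_lt.
 repeat apply Rmult_lt_0_compat; apply eta_pos; lra.
- exists G, B. split; [lra|]. intros y Hy. specialize (H y Hy). rewrite !Rmult_1_l in H. exact H.
Qed.

(** On this line [q] is negative and so is [f], which gives the sign opposite to that of [ei_axis].
    The two signs together make the difference of the two constants [G] positive, and this
    difference becomes [om]. *)
Lemma ei_half : exists G B, G < 0 /\ forall y, 0 < y ->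
 PSeries ei (- exp (- (2 * PI * y))) + 12 * y ^ 2 * PSeries ei (- exp (- (2 * PI * / (12 * y)))) = G * (1 + 12 * y ^ 2) + B * y.
Proof.
assert (HPI := PI_RGT_0).
assert (Hm : forall t, -1 * t = - t) by (intros; ring).
destruct (Bol_period (2 * PI) 12 (-1) (-1) ei) as [G [B [HG H]]]; try lra.
- apply ei_radius.
- unfold ei, a. simpl. lra.
- intros y Hy. rewrite !Hm, !(PSeries_ext _ _ _ dn3_ei), a_half_inv by lra. ring.
- intros y Hy. rewrite !Hm, !(PSeries_ext _ _ _ dn3_ei), a_half, Ropp_involutive by easy. apply pow_lt.
 pose proof (eta_pos y Hy). pose proof (eta_pos (3 * y) ltac:(lra)). pose proof (eta_pos (4 * y) ltac:(lra)). pose proof (eta_pos (12 * y) ltac:(lra)).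
 pose proof (eta_pos (2 * y) ltac:(lra)). pose proof (eta_pos (6 * y) ltac:(lra)).
 apply Rdiv_lt_0_compat; [apply pow_lt|]; repeat apply Rmult_lt_0_compat; assumption.
- exists G, B. split; [lra|]. intros y Hy. specialize (H y Hy). rewrite !Hm in H. exact H.
Qed.

(** * Fourier series on the upper half plane *)

(** Real and imaginary parts are summed separately, so that the theory of real series applies;
    convergence is always supplied by a majorant [cdom]. *)
Definition Csum (v : nat -> C) : C := (Series (fun n => Re (v n)), Series (fun n => Im (v n))).
Definition cdom (v : nat -> C) (b : nat -> R) : Prop := ex_series b /\ forall n, Cmod (v n) <= b n.

Lemma cdom_ex v b : cdom v b -> ex_series (fun n => Re (v n)) /\ ex_series (fun n => Im (v n)).
Proof.
intros [Hb H]. split; apply (ex_series_le (V := R_CompleteNormedModule) _ b); try exact Hb; intros n;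
 (eapply Rle_trans; auto); [apply Cmod_ge_Re|apply Cmod_ge_Im].
Qed.

Lemma Csum_ext v w : (forall n, v n = w n) -> Csum v = Csum w.
Proof. intros H. unfold Csum. f_equal; apply Series_ext; intros n; rewrite H; reflexivity. Qed.

Lemma Csum_plus v w b c : cdom v b -> cdom w c -> Csum (fun n => v n + w n)%C = (Csum v + Csum w)%C.
Proof.
intros Hv Hw. apply cdom_ex in Hv. apply cdom_ex in Hw. unfold Csum, Cplus; simpl. f_equal; apply Series_plus; tauto.
Qed.

Lemma Csum_scal k v b : cdom v b -> Csum (fun n => k * v n)%C = (k * Csum v)%C.
Proof.
intros Hv. apply cdom_ex in Hv. destruct Hv as [H1 H2]. unfold Csum, Cmult; simpl. rewrite <- !Series_scal_l.
assert (E1 : forall c, ex_series (fun n => c * Re (v n))) by (intros c; apply (ex_series_scal_l (K := R_AbsRing) (V := R_NormedModule) c (fun n => Re (v n))), H1).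
assert (E2 : forall c, ex_series (fun n => c * Im (v n))) by (intros c; apply (ex_series_scal_l (K := R_AbsRing) (V := R_NormedModule) c (fun n => Im (v n))), H2).
f_equal; [rewrite <- Series_minus by easy|rewrite <- Series_plus by easy]; reflexivity.
Qed.

Lemma Csum_bound v b : cdom v b -> Cmod (Csum v) <= 2 * Series b.
Proof.
intros [Hb H]. via Cmod_le_l1. unfold Csum; simpl.
assert (Hs : forall f : nat -> R, (forall n, Rabs (f n) <= b n) -> Rabs (Series f) <= Series b).
{ intros f Hf. assert (Hex : ex_series (fun n => Rabs (f n))).
 { apply (ex_series_le (V := R_CompleteNormedModule) _ b); auto. intros n.
  rewrite Rabs_Rabsolu. apply Hf. }
 eapply Rle_trans; [apply Series_Rabs, Hex|]. apply Series_le; auto. intros n. split; [pos|easy]. }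
assert (Rabs (Series (fun n => Re (v n))) <= Series b) by (apply Hs; intros n; eapply Rle_trans; [apply Cmod_ge_Re|easy]).
assert (Rabs (Series (fun n => Im (v n))) <= Series b) by (apply Hs; intros n; eapply Rle_trans; [apply Cmod_ge_Im|easy]).
lra.
Qed.

Definition Cps (u : nat -> R) (q : C) : C := Csum (fun n => RtoC (u n) * q ^ n)%C.

(** The derivative [n q^(n-1)], written by Leibniz' rule so that no predecessor occurs. *)
Fixpoint dpow (q : C) (n : nat) : C := match n with O => RtoC 0 | S m => (q * dpow q m + q ^ m)%C end.

Lemma Cmod_pow q n : Cmod (q ^ n)%C = Cmod q ^ n.
Proof. induction n as [|n IH]; [apply Cmod_1|]. simpl. rewrite Cmod_mult, IH. reflexivity. Qed.

Lemma dpow_bound q r n : Cmod q <= r -> r * Cmod (dpow q n) <= INR n * r ^ n.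
Proof.
intros Hq. pose proof (Cmod_ge_0 q) as H0. induction n as [|n IH]; [simpl; rewrite Cmod_0; lra|].
cbn [dpow]. pose proof (Cmod_triangle (q * dpow q n) (q ^ n)%C) as Ht. rewrite Cmod_mult, Cmod_pow in Ht.
assert (Hp : Cmod q ^ n <= r ^ n) by (apply pow_incr; lra). rewrite S_INR. simpl pow.
pose proof (Cmod_ge_0 (dpow q n)).
assert (Cmod q * (r * Cmod (dpow q n)) <= r * (INR n * r ^ n)).
{ apply Rmult_le_compat; try assumption; apply Rmult_le_pos; lra. }
nra.
Qed.

Lemma dpow_diff q w r n : Cmod q <= r -> Cmod w <= r -> r * Cmod (w ^ n - q ^ n)%C <= INR n * Cmod (w - q) * r ^ n.
Proof.
intros Hq Hw. pose proof (Cmod_ge_0 q) as H0. induction n as [|n IH].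
- simpl. replace (1 - 1)%C with (RtoC 0) by ring. rewrite Cmod_0. lra.
- cbn [Cpow]. replace (w * w ^ n - q * q ^ n)%C with (w * (w ^ n - q ^ n) + (w - q) * q ^ n)%C by ring.
 pose proof (Cmod_triangle (w * (w ^ n - q ^ n)) ((w - q) * q ^ n)%C) as Ht. rewrite !Cmod_mult, Cmod_pow in Ht.
 assert (Hp : Cmod q ^ n <= r ^ n) by (apply pow_incr; lra). rewrite S_INR. simpl pow.
 pose proof (Cmod_ge_0 (w - q)%C) as Hh. pose proof (Cmod_ge_0 w). pose proof (Cmod_ge_0 (w ^ n - q ^ n)%C).
 assert (Cmod w * (r * Cmod (w ^ n - q ^ n)) <= r * (INR n * Cmod (w - q) * r ^ n)) by (apply Rmult_le_compat; try assumption; apply Rmult_le_pos; lra).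
 assert (Cmod (w - q) * Cmod q ^ n <= Cmod (w - q) * r ^ n) by nra. nra.
Qed.

Lemma dpow_diff2 q w r n : Cmod q <= r -> Cmod w <= r ->
 r ^ 2 * Cmod (w ^ n - q ^ n - (w - q) * dpow q n)%C <= INR n * INR n * Cmod (w - q) ^ 2 * r ^ n.
Proof.
intros Hq Hw. pose proof (Cmod_ge_0 q) as H0. induction n as [|n IH].
- simpl. replace (1 - 1 - (w - q) * 0)%C with (RtoC 0) by ring. rewrite Cmod_0. lra.
- cbn [Cpow dpow]. replace (w * w ^ n - q * q ^ n - (w - q) * (q * dpow q n + q ^ n))%C with (q * (w ^ n - q ^ n - (w - q) * dpow q n) + (w - q) * (w ^ n - q ^ n))%C by ring.
 pose proof (Cmod_triangle (q * (w ^ n - q ^ n - (w - q) * dpow q n)) ((w - q) * (w ^ n - q ^ n))%C) as Ht. rewrite !Cmod_mult in Ht.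
 pose proof (dpow_diff q w r n Hq Hw) as Hd. set (e := Cmod (w ^ n - q ^ n - (w - q) * dpow q n)%C) in *. set (d := Cmod (w ^ n - q ^ n)%C) in *. set (h := Cmod (w - q)) in *.
 assert (H1 : Cmod q * (r ^ 2 * e) <= r * (INR n * INR n * h ^ 2 * r ^ n)) by (apply Rmult_le_compat; try assumption; apply Rmult_le_pos; pos).
 assert (H2 : (r * h) * (r * d) <= (r * h) * (INR n * h * r ^ n)) by (apply Rmult_le_compat_l; pos).
 rewrite S_INR. change (r ^ S n) with (r * r ^ n).
 assert (H3 : 0 <= (INR n + 1) * h ^ 2 * (r * r ^ n)) by pos. nra.
Qed.

Lemma Cps_dom u q : Rbar_le 1 (CV_radius u) -> Cmod q < 1 -> cdom (fun n => RtoC (u n) * q ^ n)%C (fun n => Rabs (u n * Cmod q ^ n)).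
Proof.
intros Hu Hq. split.
- apply CV_disk_inside, radius_lt; auto. rewrite Rabs_right; [lra|apply Rle_ge, Cmod_ge_0].
- intros n. rewrite Cmod_mult, Cmod_R, Cmod_pow, Rabs_mult, (Rabs_right (_ ^ _)); [lra|]. apply Rle_ge, pow_le, Cmod_ge_0.
Qed.

(** Termwise differentiation: for [|q|, |w| <= r < 1] the second-order remainder of [q^n] is at most
    [n^2 |w - q|^2 r^(n-2)], and these bounds are summable against the coefficients. *)
Lemma Cps_holo u q : Rbar_le 1 (CV_radius u) -> Cmod q < 1 -> holo (Cps u) q.
Proof.
intros Hu Hq. pose proof (Cmod_ge_0 q) as Hq0. set (r := (Cmod q + 1) / 2).
assert (Hr : Cmod q < r < 1) by (unfold r; lra).
assert (HD : ex_series (fun n => Rabs (dn u n * r ^ n))).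
{ apply CV_disk_inside, radius_lt; [apply dn_radius, Hu|rewrite Rabs_right; lra]. }
assert (HD2 : ex_series (fun n => Rabs (dn (dn u) n * r ^ n))).
{ apply CV_disk_inside, radius_lt; [apply dn_radius, dn_radius, Hu|rewrite Rabs_right; lra]. }
set (K := Series (fun n => Rabs (dn (dn u) n * r ^ n))).
assert (HK : 0 <= K).
{ via Rabs_pos. apply (Series_term_le (fun n => Rabs (dn (dn u) n * r ^ n)) 0); [intros; apply Rabs_pos|pos]. }
exists (Csum (fun n => RtoC (u n) * dpow q n)%C). intros eps Heps.
exists (Rmin (r - Cmod q) (eps * r ^ 2 / (2 * K + 1))).
assert (Hr2 : 0 < r ^ 2) by pos.
split; [apply Rmin_pos; pos|].
intros w Hw. pose proof (Rmin_l (r - Cmod q) (eps * r ^ 2 / (2 * K + 1))). pose proof (Rmin_r (r - Cmod q) (eps * r ^ 2 / (2 * K + 1))).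
assert (Hwr : Cmod w <= r). { replace w with (q + (w - q))%C by ring. pose proof (Cmod_triangle q (w - q)). lra. }
assert (Hd1 : cdom (fun n => RtoC (u n) * dpow q n)%C (fun n => Rabs (dn u n * r ^ n) * / r)).
{ split; [apply (ex_series_scal_r (/ r) (fun n => Rabs (dn u n * r ^ n))), HD|]. intros n. rewrite Cmod_mult, Cmod_R.
 unfold dn. rewrite !Rabs_mult, (Rabs_right (INR n)), (Rabs_right (r ^ n)); [|apply Rle_ge, pow_le; lra|apply Rle_ge, pos_INR].
 pose proof (dpow_bound q r n ltac:(lra)) as Hb. apply Rmult_le_reg_r with r; [lra|]. rewrite Rmult_assoc, (Rmult_assoc _ (/ r)), Rinv_l by lra.
 pose proof (Rabs_pos (u n)). nra. }
assert (Hdw := Cps_dom u w Hu ltac:(lra)). assert (Hdq := Cps_dom u q Hu Hq).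
assert (Hdm : forall v b c, cdom v b -> cdom (fun n => c * v n)%C (fun n => Cmod c * b n)).
{ intros v b c [H1 H2]. split; [apply (ex_series_scal_l (K := R_AbsRing) (V := R_NormedModule) (Cmod c) b), H1|]. intros n. rewrite Cmod_mult. apply Rmult_le_compat_l; [pos|easy]. }
assert (Eq : (Cps u w - Cps u q - Csum (fun n => RtoC (u n) * dpow q n) * (w - q))%C = Csum (fun n => RtoC (u n) * (w ^ n - q ^ n - (w - q) * dpow q n))%C).
{ unfold Cps.
 rewrite (Csum_ext (fun n => RtoC (u n) * (w ^ n - q ^ n - (w - q) * dpow q n))%C
   (fun n => RtoC (u n) * w ^ n + ((-(1)) * (RtoC (u n) * q ^ n) + (- (w - q)) * (RtoC (u n) * dpow q n)))%C) by (intros n; ring).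
 assert (Hp : forall v b v' b', cdom v b -> cdom v' b' -> cdom (fun n => v n + v' n)%C (fun n => b n + b' n)).
 { intros v b v' b' [H1 H2] [H1' H2']. split; [apply (ex_series_plus b b'); assumption|]. intros n. via Cmod_triangle. apply Rplus_le_compat; auto. }
 rewrite (Csum_plus _ _ _ _ Hdw (Hp _ _ _ _ (Hdm _ _ (-(1))%C Hdq) (Hdm _ _ (- (w - q))%C Hd1))), (Csum_plus _ _ _ _ (Hdm _ _ (-(1))%C Hdq) (Hdm _ _ (- (w - q))%C Hd1)), (Csum_scal _ _ _ Hdq), (Csum_scal _ _ _ Hd1). ring. }
rewrite Eq.
set (h := Cmod (w - q)) in *.
assert (Hdf : cdom (fun n => RtoC (u n) * (w ^ n - q ^ n - (w - q) * dpow q n))%C (fun n => (h ^ 2 / r ^ 2) * Rabs (dn (dn u) n * r ^ n))).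
{ split; [apply (ex_series_scal_l (K := R_AbsRing) (V := R_NormedModule) (h ^ 2 / r ^ 2) (fun n => Rabs (dn (dn u) n * r ^ n))), HD2|].
 intros n. rewrite Cmod_mult, Cmod_R. pose proof (dpow_diff2 q w r n ltac:(lra) Hwr) as Hb. fold h in Hb.
 unfold dn. rewrite !Rabs_mult, (Rabs_right (INR n)), (Rabs_right (r ^ n)); [|apply Rle_ge, pow_le; lra|apply Rle_ge, pos_INR].
 apply Rmult_le_reg_r with (r ^ 2); auto.
 replace (h ^ 2 / r ^ 2 * (INR n * (INR n * Rabs (u n)) * r ^ n) * r ^ 2) with (Rabs (u n) * (INR n * INR n * h ^ 2 * r ^ n)) by (field; lra).
 rewrite Rmult_assoc. apply Rmult_le_compat_l; pos. }
eapply Rle_trans; [apply Csum_bound, Hdf|]. rewrite Series_scal_l. fold K.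
assert (Hh : 0 <= h) by pos.
assert (Hle : h * (2 * K + 1) <= eps * r ^ 2).
{ apply Rle_trans with (eps * r ^ 2 / (2 * K + 1) * (2 * K + 1)); [nra|right; field; lra]. }
apply Rmult_le_reg_r with (r ^ 2); auto. replace (2 * (h ^ 2 / r ^ 2 * K) * r ^ 2) with (h * (h * (2 * K))) by (field; lra). nra.
Qed.

Lemma Cpow_RtoC x n : (RtoC x ^ n)%C = RtoC (x ^ n).
Proof. induction n as [|n IH]; auto. simpl. rewrite IH, RtoC_mult. reflexivity. Qed.

Lemma Cps_real u x : Cps u (RtoC x) = RtoC (PSeries u x).
Proof.
change (RtoC (PSeries u x)) with ((PSeries u x, 0) : C). unfold Cps, Csum. f_equal.
- apply Series_ext. intros n. rewrite Cpow_RtoC. simpl. ring.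
- rewrite (Series_ext _ (fun n => 0 * 0)); [rewrite Series_scal_l; ring|]. intros n. rewrite Cpow_RtoC. simpl. ring.
Qed.

Lemma Cps_conj u q : Cps u (Cconj q) = Cconj (Cps u q).
Proof.
assert (Hc : forall n, (Cconj q ^ n)%C = Cconj (q ^ n)%C).
{ induction n as [|n IH]; simpl; [unfold Cconj; simpl; rewrite Ropp_0; reflexivity|rewrite IH]. Cring. }
change (Cconj (Cps u q)) with ((Series (fun n => Re (RtoC (u n) * q ^ n)), - Series (fun n => Im (RtoC (u n) * q ^ n))) : C). unfold Cps, Csum. f_equal.
- apply Series_ext. intros n. rewrite Hc. Cring.
- rewrite <- Series_opp. apply Series_ext. intros n. rewrite Hc. Cring.
Qed.

(** * The complex exponential and Fourier series in the half plane *)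

Definition cexp (z : C) : C := (exp (Re z) * cos (Im z), exp (Re z) * sin (Im z)).

Lemma cexp_plus z w : cexp (z + w) = (cexp z * cexp w)%C.
Proof. unfold cexp, Cmult; simpl. rewrite exp_plus, cos_plus, sin_plus. f_equal; unfold Re, Im; ring. Qed.

Lemma cexp_0 : cexp 0 = RtoC 1.
Proof. unfold cexp; simpl. rewrite exp_0, cos_0, sin_0. Cring. Qed.

Lemma Cmod_cexp z : Cmod (cexp z) = exp (Re z).
Proof.
unfold cexp, Cmod; simpl. rewrite !Rmult_1_r.
replace (exp (Re z) * cos (Im z) * (exp (Re z) * cos (Im z)) + exp (Re z) * sin (Im z) * (exp (Re z) * sin (Im z)))
 with (exp (Re z) * exp (Re z) * ((sin (Im z)) ^ 2 + (cos (Im z)) ^ 2)) by ring.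
pose proof (sin2_cos2 (Im z)) as H. unfold Rsqr in H. replace (sin (Im z) ^ 2 + cos (Im z) ^ 2) with 1 by lra.
rewrite Rmult_1_r. apply sqrt_square. left; apply exp_pos.
Qed.

Lemma cderiv_cexp_0 : cderiv cexp 0 1.
Proof.
intros eps Heps. set (e := Rmin 1 (eps / 8)).
assert (He : 0 < e <= 1) by (split; [apply Rmin_pos; lra|apply Rmin_l]).
assert (He8 : 8 * e <= eps) by (unfold e; pose proof (Rmin_r 1 (eps / 8)); lra).
assert (D : forall f l, derivable_pt_lim f 0 l -> exists d, 0 < d /\ forall x, Rabs x < d -> Rabs (f x - f 0 - l * x) <= e * Rabs x).
{ intros f l H. destruct (H e ltac:(lra)) as [d Hd]. exists d. split; [apply cond_pos|]. intros x Hx.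
 destruct (Req_dec x 0) as [->|Hx0].
 - replace (f 0 - f 0 - l * 0) with 0 by ring. rewrite Rabs_R0. lra.
 - specialize (Hd x Hx0 Hx). rewrite Rplus_0_l in Hd. replace (f x - f 0 - l * x) with (((f x - f 0) / x - l) * x) by (field; exact Hx0).
  rewrite Rabs_mult. apply Rmult_le_compat_r; pos. }
destruct (D exp 1) as [d1 [Hd1 H1]]; [rewrite <- exp_0; apply derivable_pt_lim_exp|].
destruct (D cos 0) as [d2 [Hd2 H2]]; [pose proof (derivable_pt_lim_cos 0) as Hc; rewrite sin_0, Ropp_0 in Hc; exact Hc|].
destruct (D sin 1) as [d3 [Hd3 H3]]; [rewrite <- cos_0; apply derivable_pt_lim_sin|].
exists (Rmin (Rmin d1 d2) (Rmin d3 e)). split; [repeat apply Rmin_pos; lra|]. intros w Hw.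
replace (w - 0)%C with w in * by ring. set (r := Cmod w) in *.
assert (Hr : r < d1 /\ r < d2 /\ r < d3 /\ r < e).
{ pose proof (Rmin_l (Rmin d1 d2) (Rmin d3 e)). pose proof (Rmin_r (Rmin d1 d2) (Rmin d3 e)). pose proof (Rmin_l d1 d2). pose proof (Rmin_r d1 d2).
 pose proof (Rmin_l d3 e). pose proof (Rmin_r d3 e). split; lra. }
destruct w as [x y]. pose proof (Cmod_ge_Re (x, y)) as Hx. pose proof (Cmod_ge_Im (x, y)) as Hy. simpl in Hx, Hy. fold r in Hx, Hy.
specialize (H1 x ltac:(lra)). specialize (H2 y ltac:(lra)). specialize (H3 y ltac:(lra)).
rewrite exp_0 in H1. rewrite cos_0 in H2. rewrite sin_0 in H3.
pose proof (Rabs_pos x).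
via Cmod_le_l1. rewrite cexp_0. simpl.
replace (exp x * cos y + - (1) + - (1 * x - 0 * y)) with ((exp x - 1 - 1 * x) * cos y + (1 + x) * (cos y - 1 - 0 * y)) by ring.
replace (exp x * sin y + - 0 + - (1 * y + 0 * x)) with ((exp x - 1) * sin y + (sin y - 0 - 1 * y)) by ring.
assert (A1 : Rabs ((exp x - 1 - 1 * x) * cos y + (1 + x) * (cos y - 1 - 0 * y)) <= e * r * 1 + 2 * (e * r)).
{ via Rabs_triang. rewrite !Rabs_mult. apply Rplus_le_compat; apply Rmult_le_compat; try apply Rabs_pos.
 - nra. - apply Rabs_le, COS_bound. - apply Rabs_le. apply Rabs_le_between in Hx. lra. - nra. }
assert (A2 : Rabs ((exp x - 1) * sin y + (sin y - 0 - 1 * y)) <= (2 * r) * (2 * r) + e * r).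
{ via Rabs_triang. rewrite Rabs_mult. apply Rplus_le_compat; [apply Rmult_le_compat; try apply Rabs_pos|nra].
 - replace (exp x - 1) with ((exp x - 1 - 1 * x) + x) by ring. via Rabs_triang. nra.
 - replace (sin y) with ((sin y - 0 - 1 * y) + y) by ring. via Rabs_triang. nra. } nra.
Qed.

Lemma cderiv_cexp z : cderiv cexp z (cexp z).
Proof.
assert (H : cderiv (fun w => cexp z * cexp (w + - z))%C z (0 * cexp (z + - z) + cexp z * (1 * (1 + 0)))).
{ apply (cderiv_mult (fun _ => cexp z) (fun w => cexp (w + - z))%C z 0 (1 * (1 + 0))%C); [apply cderiv_const|]. apply (cderiv_comp cexp (fun w => w + - z)%C).
 - apply cderiv_plus; [apply cderiv_id|apply cderiv_const].
 - replace (z + - z)%C with (RtoC 0) by ring. apply cderiv_cexp_0. }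
replace (0 * cexp (z + - z) + cexp z * (1 * (1 + 0)))%C with (cexp z) in H by ring.
apply (cderiv_ext_loc _ cexp z (cexp z) 1) in H; [pos|lra|]. intros w _. rewrite <- cexp_plus. f_equal. ring.
Qed.

Lemma holo_cexp z : holo cexp z.
Proof. eexists; apply cderiv_cexp. Qed.

Definition ee (z : C) : C := cexp (2 * PI * Ci * z).

Lemma ee_coord z : ee z = (exp (- (2 * PI * Im z)) * cos (2 * PI * Re z), exp (- (2 * PI * Im z)) * sin (2 * PI * Re z)).
Proof.
unfold ee, cexp. destruct z as [x y]. cbn [Re Im Cmult Ci RtoC fst snd].
match goal with |- (exp ?u * cos ?t, _) = _ => replace u with (- (2 * PI * y)) by ring; replace t with (2 * PI * x) by ring end.
reflexivity.
Qed.

Lemma Cmod_ee z : Cmod (ee z) = exp (- (2 * PI * Im z)).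
Proof.
unfold ee. rewrite Cmod_cexp. destruct z as [x y]. Cring.
Qed.

Lemma Cmod_ee_lt z : 0 < Im z -> Cmod (ee z) < 1.
Proof. intros H. rewrite Cmod_ee. apply exp_2PI_01, H. Qed.

Lemma ee_1 z : ee (z + 1) = ee z.
Proof.
rewrite !ee_coord. destruct z as [x y]. cbn [Re Im Cplus RtoC fst snd].
replace (2 * PI * (x + 1)) with (2 * PI * x + 2 * PI) by ring. rewrite Rplus_0_r, cos_plus, sin_plus, cos_2PI, sin_2PI. f_equal; ring.
Qed.

Lemma ee_axis y : ee (0, y) = RtoC (exp (- (2 * PI * y))).
Proof. rewrite ee_coord, Rmult_0_r, cos_0, sin_0. Cring. Qed.

Lemma ee_half y : ee (1 / 2, y) = RtoC (- exp (- (2 * PI * y))).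
Proof.
rewrite ee_coord. cbn [Re Im fst snd]. replace (2 * PI * (1 / 2)) with PI by lra. rewrite cos_PI, sin_PI. Cring.
Qed.

Lemma ee_conj z : ee (- Cconj z) = Cconj (ee z).
Proof.
rewrite !ee_coord. destruct z as [x y]. cbn [Re Im Cconj Copp fst snd]. rewrite Ropp_involutive.
replace (2 * PI * - x) with (- (2 * PI * x)) by ring. rewrite cos_neg, sin_neg. unfold Cconj; cbn [fst snd]; f_equal; ring.
Qed.

Lemma holo_ee z : holo ee z.
Proof. apply (holo_comp cexp); [|apply holo_cexp]. apply (holo_mult (fun _ => (2 * PI * Ci)%C)); [apply holo_const|apply holo_id]. Qed.

Definition fourier (u : nat -> R) (z : C) : C := Cps u (ee z).

Lemma fourier_holo u z : Rbar_le 1 (CV_radius u) -> 0 < Im z -> holo (fourier u) z.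
Proof. intros Hu Hz. apply (holo_comp (Cps u) ee); [apply holo_ee|apply Cps_holo; [pos|apply Cmod_ee_lt, Hz]]. Qed.

Lemma fourier_1 u z : fourier u (z + 1) = fourier u z.
Proof. unfold fourier. rewrite ee_1. reflexivity. Qed.

Lemma fourier_conj u z : fourier u (- Cconj z) = Cconj (fourier u z).
Proof. unfold fourier. rewrite ee_conj. apply Cps_conj. Qed.

Lemma zero_on_halfplane (F : C -> C) : (forall z, 0 < Im z -> holo F z) -> (forall y, 0 < y -> F (0, y) = RtoC 0) ->
 forall z, 0 < Im z -> F z = RtoC 0.
Proof.
intros Hh Hz [x y] Hy. simpl in Hy.
(* The centre is taken so high on the axis that the disc of radius [Y - y/2], which stays in the
   half plane, reaches [(x, y)]: the squared radius exceeds the squared distance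
   [x^2 + ((x^2 + 1)/y)^2] by [1 + y^2 / 4]. *)
set (Y := y + (x ^ 2 + 1) / y). set (R0 := Y - y / 2).
assert (HY : 0 < (x ^ 2 + 1) / y) by (apply Rdiv_lt_0_compat; nra).
assert (HR0 : 0 < R0) by (unfold R0, Y; lra).
apply (identity_theorem F (0, Y) Ci R0 1 HR0 Rlt_0_1).
- unfold Ci, Cmod; simpl. replace (0 * (0 * 1) + 1 * (1 * 1)) with 1 by ring. apply sqrt_1.
- intros [u v] Hre Him. apply Hh. simpl in Him |- *. apply Rabs_le_between in Him. unfold R0 in Him. lra.
- intros t Ht. replace ((0, Y) + t * Ci)%C with ((0, Y + t) : C); [apply Hz; unfold Y; lra|].
 Cring.
- unfold Cmod. simpl. rewrite <- (sqrt_square R0) by lra. apply sqrt_lt_1_alt.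
 assert (E : (x ^ 2 + 1) / y * y = x ^ 2 + 1) by (field; lra). unfold R0, Y. nra.
Qed.

Lemma Im_inv_opp c w : 0 < c -> 0 < Im w -> 0 < Im (- / (RtoC c * w)).
Proof.
intros Hc. destruct w as [x y]. simpl. intros Hy.
assert (Hd : 0 < (c * x - 0 * y) ^ 2 + (c * y + 0 * x) ^ 2).
{ replace ((c * x - 0 * y) ^ 2 + (c * y + 0 * x) ^ 2) with (c ^ 2 * (x ^ 2 + y ^ 2)) by ring.
 apply Rmult_lt_0_compat; [pos|]. nra. } set (D := (c * x - 0 * y) * ((c * x - 0 * y) * 1) + (c * y + 0 * x) * ((c * y + 0 * x) * 1)).
replace (- (- (c * y + 0 * x) / D)) with (c * y / D) by lra.
apply Rdiv_lt_0_compat; pos.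
Qed.

Lemma Im_pos_neq0 (w : C) : 0 < Im w -> w <> RtoC 0.
Proof. intros H E. rewrite E in H. simpl in H. lra. Qed.

Lemma RtoC_neq0 c : c <> 0 -> RtoC c <> RtoC 0.
Proof. intros H E. injection E. tauto. Qed.

Lemma inv_axis c y : 0 < c -> 0 < y -> (- / (RtoC c * (0, y)))%C = (0, / (c * y)).
Proof.
intros Hc Hy. unfold Copp; simpl. f_equal; field; nra.
Qed.

Lemma holo_inv_arg c w : 0 < c -> 0 < Im w -> holo (fun w => - / (RtoC c * w))%C w.
Proof.
intros Hc Hw. apply holo_opp, (holo_inv (fun w => RtoC c * w)%C).
- apply holo_mult; [apply holo_const|apply holo_id].
- apply Cmult_neq_0; [apply RtoC_neq0; lra|apply Im_pos_neq0, Hw].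
Qed.

(** At [w = i y] one has [w^2 = - y^2] and [- 1/(c w) = i / (c y)], which explains the signs. Both
    sides are holomorphic, so the relation on the half line extends to the half plane. *)
Lemma fourier_W u c G B x0 : Rbar_le 1 (CV_radius u) -> 0 < c ->
 (forall y, 0 < y -> (fourier u (x0, y) + RtoC (c * y ^ 2) * fourier u (x0, (/ (c * y))%R))%C = RtoC (G * (1 + c * y ^ 2) + B * y)) ->
 forall w, 0 < Im w -> (fourier u (RtoC x0 + w) - RtoC c * (w * w) * fourier u (RtoC x0 + - / (RtoC c * w)))%C = (RtoC G * (1 - RtoC c * (w * w)) - Ci * RtoC B * w)%C.
Proof.
intros Hu Hc Hax w Hw. apply Cminus_eq_0.
revert w Hw. apply (zero_on_halfplane (fun w => (fourier u (RtoC x0 + w) - RtoC c * (w * w) * fourier u (RtoC x0 + - / (RtoC c * w))) - (RtoC G * (1 - RtoC c * (w * w)) - Ci * RtoC B * w))%C).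
- intros w Hw.
 assert (Hx : forall z, 0 < Im z -> 0 < Im (RtoC x0 + z)%C) by (intros [u' v'] Hz; simpl in *; lra).
 assert (H1 : holo (fun w => fourier u (RtoC x0 + w))%C w).
 { apply (holo_comp (fourier u) (fun w => RtoC x0 + w)%C); [apply holo_plus; [apply holo_const|apply holo_id]|apply fourier_holo; auto]. }
 assert (H2 : holo (fun w => fourier u (RtoC x0 + - / (RtoC c * w)))%C w).
 { apply (holo_comp (fourier u) (fun w => RtoC x0 + - / (RtoC c * w))%C); [apply holo_plus; [apply holo_const|apply holo_inv_arg; assumption]|].
  apply fourier_holo; [pos|apply Hx, Im_inv_opp; assumption]. }
 assert (H3 : holo (fun w => RtoC c * (w * w))%C w) by (apply holo_mult; [apply holo_const|apply holo_mult; apply holo_id]).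
 apply holo_minus; [apply holo_minus; auto|apply holo_minus].
 + apply holo_mult; assumption.
 + apply holo_mult; [apply holo_const|]. apply holo_minus; [apply holo_const|pos].
 + apply holo_mult; [apply holo_const|apply holo_id].
- intros y Hy. rewrite inv_axis by assumption.
 assert (Ex : forall t, (RtoC x0 + (0, t))%C = (x0, t)) by (intros t; Cring).
 rewrite !Ex. specialize (Hax y Hy).
 assert (E2 : (RtoC c * ((0, y) * (0, y)))%C = (- RtoC (c * y ^ 2))%C) by Cring.
 rewrite E2.
 transitivity ((fourier u (x0, y) + RtoC (c * y ^ 2) * fourier u (x0, (/ (c * y))%R)) - (RtoC G * (1 + RtoC (c * y ^ 2)) - Ci * RtoC B * (0, y)))%C; [ring|].
 rewrite Hax. Cring.
Qed.

Definition Ei (z : C) : C := fourier ei z.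

Lemma Ei_W : exists G B, 0 < G /\ forall w, 0 < Im w ->
 (Ei w - 6 * (w * w) * Ei (- / (6 * w)))%C = (RtoC G * (1 - 6 * (w * w)) - Ci * RtoC B * w)%C.
Proof.
destruct ei_axis as [G [B [HG H]]]. exists G, B. split; auto. intros w Hw.
rewrite <- (fourier_W ei 6 G B 0 ei_radius ltac:(lra)); [|clear w Hw|lra].
- replace (0 + w)%C with w by ring. replace (0 + - / (6 * w))%C with (- / (6 * w))%C by ring. reflexivity.
- intros y Hy. unfold fourier. rewrite !ee_axis, !Cps_real, <- H by lra. Cring.
Qed.

Lemma Ei_half : exists G B, G < 0 /\ forall w, 0 < Im w ->
 (Ei (RtoC (1 / 2) + w) - 12 * (w * w) * Ei (RtoC (1 / 2) + - / (12 * w)))%C = (RtoC G * (1 - 12 * (w * w)) - Ci * RtoC B * w)%C.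
Proof.
destruct ei_half as [G [B [HG H]]]. exists G, B. split; auto. intros w Hw.
rewrite <- (fourier_W ei 12 G B (1 / 2) ei_radius ltac:(lra)); [tauto|clear w Hw|lra].
intros y Hy. unfold fourier. rewrite !ee_half, !Cps_real, <- H by lra. Cring.
Qed.

Lemma Ei_1 z : Ei (z + 1) = Ei z.
Proof. apply fourier_1. Qed.

(* [fourier beta] is [log (prod (1 + q^n))], so that [kappa z = Re (24 / (- 2 pi i) log (eta z / eta (2 z)))]. *)
Definition lc (k : nat) : R := match k with O => 0 | S j => (-1) ^ j / INR k end.

Lemma lc_le k : Rabs (lc k) <= 1.
Proof.
destruct k as [|j]; [simpl; rewrite Rabs_R0; lra|]. unfold lc, Rdiv. rewrite Rabs_mult, pow_1_abs, Rmult_1_l.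
assert (1 <= INR (S j)) by (rewrite S_INR; pose proof (pos_INR j); lra).
rewrite Rabs_right by (apply Rle_ge; left; apply Rinv_0_lt_compat; lra). rewrite <- Rinv_1. apply Rinv_le_contravar; lra.
Qed.

Lemma radius_poly (u : nat -> R) : (forall n, Rabs (u n) <= INR n + 1) -> Rbar_le 1 (CV_radius u).
Proof.
intros H. apply (radius_dom u (PS_derive (fun _ => 1))).
- intros n. unfold PS_derive. rewrite Rmult_1_r, S_INR, (Rabs_right (INR n + 1)); [easy|pose proof (pos_INR n); lra].
- rewrite CV_radius_derive. apply radius_ge_1. intros r Hr. exists 1. intros n. rewrite Rmult_1_l, <- RPow_abs, (Rabs_right r) by lra.
 rewrite <- (pow1 n). apply pow_incr. lra.
Qed.

Lemma lc_radius : Rbar_le 1 (CV_radius lc).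
Proof. apply radius_poly. intros n. pose proof (lc_le n). pose proof (pos_INR n). lra. Qed.

Lemma lc_ln t : 0 <= t < 1 -> PSeries lc t = ln (1 + t).
Proof.
intros Ht.
assert (Hd : forall x, -1 < x < 1 -> is_derive (fun x => PSeries lc x - ln (1 + x)) x 0).
{ intros x Hx. assert (Hx1 : Rabs x < 1) by (apply Rabs_def1; lra). evar_last.
 - apply (is_derive_minus (PSeries lc) (fun x => ln (1 + x))); [apply is_derive_PSeries, radius_lt; [apply lc_radius|lra]|].
  auto_derive; [lra|easy].
 - unfold minus, plus, opp; simpl. replace (PSeries (PS_derive lc) x) with (/ (1 - - x)).
  + field. lra.
  + symmetry. apply is_series_unique, is_series_ext with (fun n => (- x) ^ n).
   * intros n. change ((- x) ^ n = INR (S n) * ((-1) ^ n / INR (S n)) * x ^ n). assert (INR (S n) <> 0) by pos.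
    replace (- x) with (-1 * x) by ring. rewrite Rpow_mult_distr. field. assumption.
   * apply is_series_geom. rewrite Rabs_Ropp. exact Hx1. }
assert (E : PSeries lc t - ln (1 + t) = PSeries lc 0 - ln (1 + 0)).
{ destruct (MVT_gen (fun x => PSeries lc x - ln (1 + x)) 0 t (fun _ => 0)) as [c [_ Hc]].
 - intros x Hx. apply Hd. rewrite Rmin_left, Rmax_right in Hx; lra.
 - intros x Hx. apply continuity_pt_filterlim, (ex_derive_continuous (fun x => PSeries lc x - ln (1 + x)) x). exists 0. apply Hd.
  rewrite Rmin_left, Rmax_right in Hx; lra.
 - lra. }
rewrite PSeries_0, Rplus_0_r, ln_1 in E. simpl in E. lra.
Qed.

(** The substitution of [q^m] for the variable of a power series. *)
Definition sparse (m : nat) (g : nat -> R) (n : nat) : R := if Nat.eqb (n mod m) 0 then g (n / m)%nat else 0.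

Lemma sparse_sum m g n : (0 < m)%nat -> rsum (sparse m g) n = rsum g (n / m).
Proof.
intros Hm. induction n as [|n IH].
- rewrite Nat.Div0.div_0_l, !rsum_O. unfold sparse. rewrite Nat.Div0.mod_0_l, Nat.Div0.div_0_l. reflexivity.
- rewrite rsum_S, IH. unfold sparse. pose proof (Nat.div_mod_eq n m) as H1. pose proof (Nat.div_mod_eq (S n) m) as H2.
 pose proof (Nat.mod_upper_bound n m ltac:(lia)). pose proof (Nat.mod_upper_bound (S n) m ltac:(lia)).
 destruct (Nat.eqb_spec (S n mod m) 0) as [E|E].
 + assert (Hq : (S n / m = S (n / m))%nat) by nia. rewrite Hq, rsum_S. reflexivity.
 + assert (Hq : (S n / m = n / m)%nat) by nia. rewrite Hq. ring.
Qed.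

Lemma sparse_series m g l : (0 < m)%nat -> is_series g l -> is_series (sparse m g) l.
Proof.
intros Hm Hg.
assert (L' : is_lim_seq (sum_n (sparse m g)) l); auto.
apply is_lim_seq_ext with (fun n => sum_n g (n / m)%nat).
{ intros n. symmetry. exact (sparse_sum m g n Hm). }
apply (is_lim_seq_subseq (sum_n g) l (fun n => (n / m)%nat)); eauto.
intros P [N0 HP]. exists (N0 * m)%nat. intros n Hn. apply HP, Nat.div_le_lower_bound; lia.
Qed.

Fixpoint betaN (N n : nat) : R := match N with O => 0 | S M => betaN M n + sparse (S M) lc n end.
Definition beta (n : nat) : R := betaN n n.

Lemma sparse_lc_small m n : (n < m)%nat -> sparse m lc n = 0.
Proof.
intros H. unfold sparse. rewrite Nat.mod_small, Nat.div_small by pos. destruct (Nat.eqb n 0); reflexivity.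
Qed.

Lemma betaN_stable N n : (n <= N)%nat -> betaN N n = beta n.
Proof.
intros H. induction H as [|N H IH]; auto. simpl betaN. rewrite IH, sparse_lc_small by lia. ring.
Qed.

Lemma betaN_bound N n : Rabs (betaN N n) <= INR n.
Proof.
assert (H : forall N, Rabs (betaN N n) <= INR N).
{ clear N. induction N as [|N IH]; [simpl; rewrite Rabs_R0; lra|]. rewrite S_INR. simpl betaN. via Rabs_triang.
 assert (Rabs (sparse (S N) lc n) <= 1); [|lra]. unfold sparse. destruct (Nat.eqb _ 0); [apply lc_le|rewrite Rabs_R0; lra]. }
destruct (le_lt_dec n N) as [Hn|Hn]; [rewrite betaN_stable by lia; apply H|].
eapply Rle_trans; [easy|apply le_INR; lia].
Qed.

Lemma beta_radius : Rbar_le 1 (CV_radius beta).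
Proof. apply radius_poly. intros n. pose proof (betaN_bound n n). unfold beta. lra. Qed.

(** Rests on [prod (1 + x^n) = prod (1 - x^(2n)) / prod (1 - x^n)], one factor at a time. *)
Lemma betaN_series N x : 0 < x < 1 -> is_series (fun n => betaN N n * x ^ n) (ln (eprod (x ^ 2) N / eprod x N)).
Proof.
intros Hx. induction N as [|N IH].
- simpl. replace (1 / 1) with 1 by lra. rewrite ln_1. apply is_series_ext with (fun _ => 0); [symmetry; apply Rmult_0_l|auto].
 assert (L : is_lim_seq (sum_n (fun _ : nat => 0)) 0); auto. apply is_lim_seq_ext with (fun _ => 0); [|apply is_lim_seq_const].
 intros n. symmetry. apply (rsum_zero (fun _ => 0)). reflexivity.
- pose proof (eprod_pos x N Hx). pose proof (eprod_pos _ N (pow_01 x 2 Hx ltac:(lia))). pose proof (pow_lt_1' x N Hx).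
 replace (ln (eprod (x ^ 2) (S N) / eprod x (S N))) with (ln (eprod (x ^ 2) N / eprod x N) + ln (1 + x ^ S N)).
 2:{ rewrite <- ln_mult; [|pos|lra]. f_equal. cbn [eprod]. rewrite <- pow_mult, Nat.mul_comm, pow_mult.
   field. split; lra. }
 apply is_series_ext with (fun n => betaN N n * x ^ n + sparse (S N) (fun k => lc k * (x ^ S N) ^ k) n).
 { intros n. match goal with |- @eq _ ?s ?t => change (@eq R s t) end. simpl betaN. unfold sparse. destruct (Nat.eqb_spec (n mod S N) 0) as [E|E]; [|ring].
  rewrite <- pow_mult. pose proof (Nat.div_mod_eq n (S N)) as H2. rewrite E, Nat.add_0_r in H2. rewrite <- H2. ring. }
 apply (is_series_plus (fun n => betaN N n * x ^ n)); auto. apply sparse_series; [lia|].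
 rewrite <- lc_ln by lra. apply (Series_correct (fun k => lc k * (x ^ S N) ^ k)), (ex_series_Rabs (fun k => lc k * (x ^ S N) ^ k)), CV_disk_inside, radius_lt; [apply lc_radius|rewrite Rabs_right; lra].
Qed.

Lemma beta_series x : 0 < x < 1 -> PSeries beta x = ln (E (x ^ 2) / E x).
Proof.
intros Hx. apply (is_lim_seq_eq (fun N => Series (fun n => betaN N n * x ^ n))).
- apply (Tannery (fun N n => betaN N n * x ^ n) (fun n => beta n * x ^ n) (fun n => Rabs (dn (fun _ => 1) n * x ^ n))).
 + apply CV_disk_inside, radius_lt; [|rewrite Rabs_right; lra]. apply radius_poly. intros n. unfold dn. pose proof (pos_INR n). rewrite Rabs_right; lra.
 + intros N n. rewrite !Rabs_mult. apply Rmult_le_compat_r; [pos|]. unfold dn. pose proof (pos_INR n). rewrite Rmult_1_r, (Rabs_right (INR n)) by lra. apply betaN_bound.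
 + intros n. apply is_lim_seq_ext_loc with (fun _ => beta n * x ^ n); [|apply is_lim_seq_const].
  exists n. intros N HN. rewrite betaN_stable by lia. reflexivity.
- destruct (eprod_cv x Hx) as [H1 P1]. destruct (eprod_cv (x ^ 2) (pow_01 x 2 Hx ltac:(lia))) as [H2 P2].
 apply is_lim_seq_ext with (fun N => ln (eprod (x ^ 2) N / eprod x N)).
 { intros N. symmetry. apply is_series_unique, betaN_series, Hx. }
 assert (Hpos : 0 < E (x ^ 2) / E x) by pos.
 apply (is_lim_seq_continuous ln); [apply continuity_pt_filterlim, continuous_ln|apply is_lim_seq_div'; pos]; exact Hpos.
Qed.

Lemma beta_axis y : 0 < y -> PSeries beta (exp (- (2 * PI * y))) = PI * y / 12 + ln (eta (2 * y)) - ln (eta y).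
Proof.
intros Hy. pose proof (exp_2PI_01 y Hy) as Hx. rewrite beta_series by lra.
pose proof (eta_pos y Hy). pose proof (eta_pos (2 * y) ltac:(lra)).
rewrite E_eta by auto. rewrite <- (pow_1 (exp (- (2 * PI * y)))) at 1. rewrite E_eta by auto.
replace (INR 2) with 2 by easy. replace (INR 1 * y) with y by Cring.
replace (exp (PI * (2 * y) / 12)) with (exp (PI * y / 12) * exp (PI * y / 12)) by (rewrite <- exp_plus; f_equal; field).
pose proof (exp_pos (PI * y / 12)).
replace (exp (PI * y / 12) * exp (PI * y / 12) * eta (2 * y) / (exp (PI * y / 12) * eta y)) with (exp (PI * y / 12) * (eta (2 * y) / eta y)) by (field; split; lra).
rewrite ln_mult, ln_exp, ln_div; try lra. apply Rdiv_lt_0_compat; assumption.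
Qed.

Definition kappa (z : C) : R := Re z + 12 / PI * Im (fourier beta z).

Lemma kappa_1 z : kappa (z + 1) = kappa z + 1.
Proof. unfold kappa. rewrite fourier_1. change (Re (z + 1)%C) with (Re z + 1). ring. Qed.

Lemma kappa_conj z : kappa (- Cconj z) = - kappa z.
Proof. unfold kappa. rewrite fourier_conj. change (Re (- Cconj z)%C) with (- Re z). Cring. Qed.

(** The real part of a holomorphic identity which on the imaginary axis is the logarithm of the
    inversion formula for [eta y] and [eta (2 y)]. The constant [ln 2], left over from the square
    roots, carries a factor [i] and drops out. *)
Lemma kappa_W z : 0 < Im z -> kappa (- / (2 * z)) = - kappa z.
Proof.
intros Hz. assert (HPI := PI_RGT_0).
set (F := fun z : C => (z + - / (RtoC 2 * z) - RtoC (12 / PI) * Ci * (fourier beta z + fourier beta (- / (RtoC 2 * z))) - Ci * RtoC (6 / PI * ln 2))%C).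
assert (HF : forall z, 0 < Im z -> F z = RtoC 0).
{ apply zero_on_halfplane.
 - intros w Hw. apply holo_minus; [apply holo_minus|apply holo_const].
  + apply holo_plus; [apply holo_id|apply holo_inv_arg; lra].
  + apply holo_mult; [apply holo_const|]. apply holo_plus; [apply fourier_holo; [apply beta_radius|lra]|].
   apply (holo_comp (fourier beta)); [apply holo_inv_arg; lra|apply fourier_holo; [apply beta_radius|apply Im_inv_opp; lra]].
 - intros y Hy. unfold F. rewrite inv_axis by lra. unfold fourier. rewrite !ee_axis, !Cps_real.
  assert (Hy2 : 0 < / (2 * y)) by pos. rewrite !beta_axis by assumption.
  replace (2 * / (2 * y)) with (1 / y) by (field; lra). replace (eta (/ (2 * y))) with (eta ((/ 2) / y)) by (f_equal; field; lra).
  rewrite (eta_inv' 1 1), (eta_inv' 2 (/ 2)) by lra. rewrite !Rmult_1_l.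
  pose proof (eta_pos y Hy). pose proof (eta_pos (2 * y) ltac:(lra)).
  rewrite sqrt_mult, !ln_mult by (try lra; try assumption; try apply sqrt_lt_R0; try lra; apply Rmult_lt_0_compat; apply sqrt_lt_R0; lra).
  assert (Hs2 : ln (sqrt 2) = ln 2 / 2).
  { pose proof (sqrt_lt_R0 2 ltac:(lra)). rewrite <- (sqrt_sqrt 2) at 2 by lra. rewrite ln_mult by assumption. field. }
  rewrite Hs2. unfold Cminus, Cplus, Copp, Ci, RtoC; simpl. f_equal; field; lra. }
specialize (HF z Hz). unfold F in HF. apply (f_equal Re) in HF. unfold kappa.
set (m := (- / (RtoC 2 * z))%C) in *. set (p := fourier beta z) in *. set (q := fourier beta m) in *.
destruct z as [z1 z2], m as [m1 m2], p as [p1 p2], q as [q1 q2]. simpl in HF |- *. lra.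
Qed.

(** High in the half plane the Fourier part is small, uniformly in [x], because its majorant depends
    on the height only. All limits at cusps are reduced to this one. *)
Lemma kappa_lim eps : 0 < eps -> exists V, 0 < V /\ forall x v, V < v -> Rabs (kappa (x, v) - x) < eps.
Proof.
intros Heps. assert (HPI := PI_RGT_0).
assert (Hr : Rbar_le 1 (CV_radius (fun n => Rabs (beta n)))) by (apply (radius_dom _ beta); [intros; rewrite Rabs_Rabsolu; lra|apply beta_radius]).
pose proof (qs_lim (fun n => Rabs (beta n)) (2 * PI) 1 ltac:(auto) Hr ltac:(lra)) as HL.
assert (Hb0 : Rabs (beta 0) = 0) by (apply Rabs_R0).
apply is_lim_spec in HL. assert (Hd : 0 < eps * PI / 24) by pos.
destruct (HL (mkposreal _ Hd)) as [V HV]. exists (Rmax V 1). split; [apply Rlt_le_trans with 1; [lra|apply Rmax_r]|].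
intros x v Hv. pose proof (Rmax_l V 1). pose proof (Rmax_r V 1). specialize (HV v ltac:(lra)). simpl in HV.
unfold kappa. simpl Re. replace (x + 12 / PI * Im (fourier beta (x, v)) - x) with (12 / PI * Im (fourier beta (x, v))) by ring.
rewrite Rabs_mult, (Rabs_right (12 / PI)) by (apply Rle_ge; left; apply Rdiv_lt_0_compat; lra).
pose proof (Csum_bound _ _ (Cps_dom beta (ee (x, v)) beta_radius ltac:(apply Cmod_ee_lt; simpl; lra))) as Hb.
fold (Cps beta (ee (x, v))) in Hb. fold (fourier beta (x, v)) in Hb.
pose proof (Cmod_ge_Im (fourier beta (x, v))) as Hi.
assert (Es : Series (fun n => Rabs (beta n * Cmod (ee (x, v)) ^ n)) = PSeries (fun n => Rabs (beta n)) (1 * exp (- (2 * PI * v)))).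
{ apply Series_ext. intros n. rewrite Cmod_ee, Rmult_1_l, Rabs_mult. f_equal. apply Rabs_right, Rle_ge, pow_le. left; apply exp_pos. } apply Rabs_def2 in HV.
apply Rmult_lt_reg_r with (PI / 12); [lra|]. replace (12 / PI * Rabs (Im (fourier beta (x, v))) * (PI / 12)) with (Rabs (Im (fourier beta (x, v)))) by (field; lra). lra.
Qed.

(** * The cocycle of the Eichler integral *)

(* [K4] measures translations along the orbit of the group: it moves by [1] under [T], changes sign under [W] and is invariant under [e3]. *)
Definition K4 (z : C) : R := (kappa z + kappa (3 * z)) / 4.

Lemma Chalf : RtoC (1 / 2) = (/ 2)%C. Proof. rewrite <- RtoC_inv by lra. f_equal. field. Qed.

Ltac cfield := field; repeat split; cbv beta; try assumption; try (apply RtoC_neq0; lra).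

Lemma Im_scal c z : Im (RtoC c * z) = c * Im z.
Proof. unfold Im; simpl; ring. Qed.

Lemma kappa_m1 z : kappa (z - 1) = kappa z - 1.
Proof. pose proof (kappa_1 (z - 1)) as H. replace (z - 1 + 1)%C with z in H by ring. lra. Qed.

Lemma K4_1 z : K4 (z + 1) = K4 z + 1.
Proof.
unfold K4. replace (3 * (z + 1))%C with (3 * z + 1 + 1 + 1)%C by ring. rewrite !kappa_1. field.
Qed.

Lemma K4_W z : 0 < Im z -> K4 (- / (6 * z)) = - K4 z.
Proof.
intros Hz. pose proof (Im_pos_neq0 z Hz). unfold K4.
assert (H3 : 0 < Im (3 * z)) by (rewrite Im_scal; lra).
replace (- / (6 * z))%C with (- / (2 * (3 * z)))%C at 1 by cfield.
replace (3 * - / (6 * z))%C with (- / (2 * z))%C by cfield.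
rewrite !kappa_W by assumption. field.
Qed.

(** The map of the matrix [(3, -2; 6, -3)] written around [1/2], where it is the inversion
    [u -> - 1/(12 u)] in [u = z - 1/2]. *)
Definition e3 (z : C) : C := (RtoC (1 / 2) + - / (12 * (z - RtoC (1 / 2))))%C.

Lemma Im_minus_R z x : Im (z - RtoC x) = Im z.
Proof. unfold Im; simpl; ring. Qed.

Lemma Im_e3 z : 0 < Im z -> 0 < Im (e3 z).
Proof.
intros Hz. pose proof (Im_inv_opp 12 (z - RtoC (1 / 2)) ltac:(lra) ltac:(rewrite Im_minus_R; exact Hz)) as H.
change (0 < 0 + Im (- / (12 * (z - RtoC (1 / 2))))%C). lra.
Qed.

Lemma Im_minus_1 z : Im (z - 1) = Im z.
Proof. apply Im_minus_R. Qed.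

Lemma Im_W2 z : 0 < Im z -> 0 < Im (- / (2 * z)).
Proof. apply Im_inv_opp. lra. Qed.

(** Words in translations and [z -> - 1/(2z)] lead from [3 z] to [e3 z] and from [z] to [3 e3 z].
    They give [kappa (e3 z) = kappa (3 z) - 1] and [kappa (3 e3 z) = kappa z + 1]: the two summands
    of [K4] are exchanged and the shifts cancel. *)
Lemma K4_e3 z : 0 < Im z -> K4 (e3 z) = K4 z.
Proof.
intros Hz.
assert (W : forall z, 0 < Im z -> 0 < Im (z - 1)) by (intros u Hu; rewrite Im_minus_1; exact Hu).
assert (H3 : 0 < Im (3 * z)) by (rewrite Im_scal; lra).
set (u1 := (3 * z - 1 - 1)%C). assert (Hu1 : 0 < Im u1) by eauto.
set (u2 := (- / (2 * u1) - 1)%C). assert (Hu2 : 0 < Im u2) by (apply W, Im_W2, Hu1).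
set (v1 := (z - 1)%C). assert (Hv1 : 0 < Im v1) by eauto.
set (v2 := (- / (2 * v1) - 1)%C). assert (Hv2 : 0 < Im v2) by (apply W, Im_W2, Hv1).
assert (Hz2 : (z - RtoC (1 / 2))%C <> RtoC 0) by (apply Im_pos_neq0; rewrite Im_minus_R; exact Hz).
assert (Hzz : (2 * z - 1)%C <> RtoC 0).
{ intros E. apply Hz2. rewrite Chalf. apply (Cmult_0_r_inv 2); [rewrite <- E; cfield|apply RtoC_neq0; lra]. }
pose proof (Im_pos_neq0 _ Hu1) as Nu1. pose proof (Im_pos_neq0 _ Hv1) as Nv1.
assert (E2 : u2 = (- 3 * (2 * z - 1) / (2 * u1))%C) by (unfold u2; unfold u1 in *; cfield).
assert (F2 : v2 = (- (2 * z - 1) / (2 * v1))%C) by (unfold v2; unfold v1 in *; cfield).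
assert (E : e3 z = (- / (2 * u2))%C).
{ unfold e3. rewrite E2, Chalf. unfold u1 in *. cfield. }
assert (F : (3 * e3 z)%C = (- / (2 * v2) + 1)%C).
{ unfold e3. rewrite F2, Chalf. unfold v1 in *. cfield. }
unfold K4. rewrite F, E, kappa_1, !kappa_W by assumption. unfold u2, v2. rewrite !kappa_m1, !kappa_W by assumption.
unfold u1, v1. rewrite !kappa_m1. field.
Qed.

(** Subtracting [G] from [Ei] leaves the generator [W] with a purely imaginary linear term. The
    constant term [-om] and the shift of [Ei] by [om] under [e3] come from the constant on the line
    [Re z = 1/2] not being [G]; [B] and [B3] appear only with the factor [i]. *)
Definition periods (G om B B3 : R) : Prop := 0 < om /\
 (forall X, 0 < Im X -> Ei (- / (6 * X)) - G = (Ei X - G) / (6 * (X * X)) + Ci * B / (6 * X))%C /\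
 (forall X, 0 < Im X -> Ei (e3 X) - G = (Ei X - G + om) * (12 * ((e3 X - / 2) * (e3 X - / 2))) - om - Ci * B3 * (e3 X - / 2))%C.

Lemma C_neq0_minus z x : 0 < Im z -> (z - RtoC x)%C <> RtoC 0.
Proof. intros H. apply Im_pos_neq0. rewrite Im_minus_R. exact H. Qed.

Lemma periods_ex : exists G om B B3, periods G om B B3.
Proof.
destruct Ei_W as [G [B [HG H]]]. destruct Ei_half as [G3 [B3 [HG3 H3]]].
exists G, (G - G3), B, B3. split; [lra|]. split.
- intros X HX. specialize (H X HX). pose proof (Im_pos_neq0 X HX).
 assert (E : Ei (- / (6 * X)) = ((Ei X - (RtoC G * (1 - 6 * (X * X)) - Ci * RtoC B * X)) / (6 * (X * X)))%C).
 { rewrite <- H. cfield. }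
 rewrite E. cfield.
- intros X HX. pose proof (C_neq0_minus X (1 / 2) HX) as N. specialize (H3 (X - RtoC (1 / 2))%C ltac:(rewrite Im_minus_R; exact HX)).
 fold (e3 X) in H3. replace (RtoC (1 / 2) + (X - RtoC (1 / 2)))%C with X in H3 by ring.
 set (u := (X - RtoC (1 / 2))%C) in *.
 assert (Eu : (e3 X - / 2)%C = (- / (12 * u))%C) by (unfold e3; fold u; rewrite Chalf; ring).
 rewrite Eu, RtoC_minus.
 assert (E : Ei (e3 X) = ((Ei X - (RtoC G3 * (1 - 12 * (u * u)) - Ci * RtoC B3 * u)) / (12 * (u * u)))%C).
 { rewrite <- H3. cfield. }
 rewrite E. cfield.
Qed.

(* The matrix [(p, q; r, s)] acts on [Ei - G] with a cocycle of real part [- 2 om (6 a X^2 + 6 b X + c)] and on [K4] by [x |-> sg x + l]. *)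
Definition Geo (G om : R) (p q r s a b c l sg : R) : Prop := exists A2 A1 A0 : C,
 Re A2 = - 12 * om * a /\ Re A1 = - 12 * om * b /\ Re A0 = - 2 * om * c /\
 forall w, 0 < Im w -> exists X, 0 < Im X /\ (RtoC r * w + RtoC s)%C <> RtoC 0 /\ X = ((RtoC p * w + RtoC q) / (RtoC r * w + RtoC s))%C /\
  (Ei X - G)%C = ((Ei w - G) * (RtoC p * RtoC s - RtoC q * RtoC r) / ((RtoC r * w + RtoC s) * (RtoC r * w + RtoC s)) + (A2 * (X * X) + A1 * X + A0))%C /\
  K4 X = sg * K4 w + l.

Lemma Geo_scale G om t p q r s a b c l sg : t <> 0 -> Geo G om p q r s a b c l sg -> Geo G om (t * p) (t * q) (t * r) (t * s) a b c l sg.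
Proof.
intros Ht [A2 [A1 [A0 [H2 [H1 [H0 H]]]]]]. exists A2, A1, A0. repeat split; try assumption.
intros w Hw. destruct (H w Hw) as [X [HX [Hn [EX [HE HK]]]]]. exists X. pose proof (RtoC_neq0 t Ht) as Nt.
rewrite !RtoC_mult. assert (E : (RtoC t * RtoC r * w + RtoC t * RtoC s)%C = (RtoC t * (RtoC r * w + RtoC s))%C) by ring.
rewrite E. repeat split; [lra|apply Cmult_neq_0; assumption| | |lra].
- rewrite EX. cfield.
- rewrite HE. cfield.
Qed.

(** Substitution of [X - k] into the quadratic polynomial. In the normalisation
    [6 a X^2 + 6 b X + c] all generators act on [(a, b, c)] with integral coefficients. *)
Lemma Geo_T G om k p q r s a b c l sg : k = 1 \/ k = -1 -> Geo G om p q r s a b c l sg ->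
 Geo G om (p + k * r) (q + k * s) r s a (b - 2 * k * a) (6 * a * k ^ 2 - 6 * b * k + c) (l + k) sg.
Proof.
intros Hk [A2 [A1 [A0 [H2 [H1 [H0 H]]]]]]. exists A2, (A1 - 2 * RtoC k * A2)%C, (A0 - RtoC k * A1 + RtoC k * RtoC k * A2)%C.
split; auto. split; [|split].
- transitivity (Re A1 - 2 * k * Re A2); [unfold Re; simpl; ring|nra].
- transitivity (Re A0 - k * Re A1 + k * k * Re A2); [unfold Re; simpl; ring|nra].
- intros w Hw. destruct (H w Hw) as [X [HX [Hn [EX [HE HK]]]]]. exists (X + RtoC k)%C.
 assert (HE1 : Ei (X + RtoC k) = Ei X /\ K4 (X + RtoC k) = K4 X + k).
 { destruct Hk as [-> | ->]; [split; [apply Ei_1|apply K4_1]|].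
  assert (Em : (X + RtoC (-1) + 1)%C = X) by ring.
  split; [rewrite <- Ei_1, Em; reflexivity|]. pose proof (K4_1 (X + RtoC (-1))) as HH. rewrite Em in HH. lra. }
 destruct HE1 as [E1 E2]. split; [unfold Im in *; simpl; lra|]. split; auto.
 rewrite E1, E2, !RtoC_plus, !RtoC_mult. repeat split.
 + rewrite EX. cfield.
 + rewrite HE. Cring.
 + lra.
Qed.

(** In weight -2 the inversion [X -> - 1/(6X)] exchanges the outer coefficients and negates the
    middle one. The contribution of [W] itself, [i B], has no real part. *)
Lemma Geo_W G om B B3 p q r s a b c l sg : periods G om B B3 -> Geo G om p q r s a b c l sg ->
 Geo G om (- r) (- s) (6 * p) (6 * q) c (- b) a (- l) (- sg).
Proof.
intros [Hom [HW _]] [A2 [A1 [A0 [H2 [H1 [H0 H]]]]]]. exists (6 * A0)%C, (- A1 - Ci * RtoC B)%C, (/ 6 * A2)%C.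
split; [|split; [|split]].
- transitivity (6 * Re A0); [unfold Re; simpl; ring|lra].
- transitivity (- Re A1); [unfold Re; simpl; ring|lra].
- transitivity (/ 6 * Re A2); [rewrite <- RtoC_inv by lra; unfold Re; simpl; ring|lra].
- intros w Hw. destruct (H w Hw) as [X [HX [Hn [EX [HE HK]]]]]. exists (- / (6 * X))%C.
 pose proof (Im_pos_neq0 X HX) as NX. split; [apply Im_inv_opp; lra|].
 rewrite !RtoC_opp, !RtoC_mult.
 set (v := (RtoC r * w + RtoC s)%C) in *. set (n := (RtoC p * w + RtoC q)%C) in *.
 assert (En : n = (X * v)%C) by (rewrite EX; cfield).
 assert (E1 : (RtoC 6 * RtoC p * w + RtoC 6 * RtoC q)%C = (6 * (X * v))%C) by (rewrite <- En; unfold n; ring).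
 assert (E2 : (- RtoC r * w + - RtoC s)%C = (- v)%C) by Cring.
 rewrite E1, E2. split; [repeat apply Cmult_neq_0; try assumption; apply RtoC_neq0; lra|]. split; [cfield|]. split.
 + rewrite HW, HE by pos. cfield.
 + rewrite K4_W, HK by pos. ring.
Qed.

(** The constants [-1], [1], [-1] are the cocycle of [e3] itself. It is the only generator that adds
    a period; the others merely transport it. *)
Lemma Geo_e3 G om B B3 p q r s a b c l sg : periods G om B B3 -> Geo G om p q r s a b c l sg ->
 Geo G om (3 * p - 2 * r) (3 * q - 2 * s) (6 * p - 3 * r) (6 * q - 3 * s)
  (3 * a + 6 * b + 2 * c - 1) (- 4 * a - 7 * b - 2 * c + 1) (8 * a + 12 * b + 3 * c - 1) l sg.
Proof.
intros [Hom [_ HW]] [A2 [A1 [A0 [H2 [H1 [H0 H]]]]]].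
exists (3 * A2 + 6 * A1 + 12 * A0 + 12 * RtoC om)%C, (- (4 * A2 + 7 * A1 + 12 * A0 + 12 * RtoC om + Ci * RtoC B3))%C,
 (RtoC (/ 3) * (4 * A2 + 6 * A1 + 9 * A0) + 2 * RtoC om + Ci * RtoC (B3 / 2))%C.
split; [|split; [|split]].
- transitivity (3 * Re A2 + 6 * Re A1 + 12 * Re A0 + 12 * om); [unfold Re; simpl; ring|lra].
- transitivity (- (4 * Re A2 + 7 * Re A1 + 12 * Re A0 + 12 * om)); [unfold Re; simpl; ring|lra].
- transitivity (/ 3 * (4 * Re A2 + 6 * Re A1 + 9 * Re A0) + 2 * om); [unfold Re; simpl; ring|lra].
- intros w Hw. destruct (H w Hw) as [X [HX [Hn [EX [HE HK]]]]]. exists (e3 X).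
 split; [apply Im_e3, HX|].
 rewrite !RtoC_minus, !RtoC_mult.
 set (v := (RtoC r * w + RtoC s)%C) in *. set (n := (RtoC p * w + RtoC q)%C) in *.
 assert (En : n = (X * v)%C) by (rewrite EX; cfield).
 assert (E1 : ((RtoC 6 * RtoC p - RtoC 3 * RtoC r) * w + (RtoC 6 * RtoC q - RtoC 3 * RtoC s))%C = (3 * ((2 * X - 1) * v))%C).
 { transitivity (6 * n - 3 * v)%C; [Cring|rewrite En; ring]. }
 assert (E2 : ((RtoC 3 * RtoC p - RtoC 2 * RtoC r) * w + (RtoC 3 * RtoC q - RtoC 2 * RtoC s))%C = ((3 * X - 2) * v)%C).
 { transitivity (3 * n - 2 * v)%C; [Cring|rewrite En; ring]. }
 rewrite E1, E2.
 assert (NX : (2 * X - 1)%C <> RtoC 0).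
 { intros E0. apply (C_neq0_minus X (1 / 2) HX). rewrite Chalf. apply (Cmult_0_r_inv 2); [rewrite <- E0; cfield|apply RtoC_neq0; lra]. }
 assert (Ee : e3 X = ((3 * X - 2) / (3 * (2 * X - 1)))%C).
 { unfold e3. rewrite Chalf. cfield. }
 split; [repeat apply Cmult_neq_0; try assumption; apply RtoC_neq0; lra|]. split; [|split].
 + rewrite Ee. cfield.
 + rewrite HW, HE by pos. rewrite RtoC_div, RtoC_inv, Ee by lra.
  cfield.
 + rewrite K4_e3, HK by pos. ring.
Qed.

(** * The congruence modulo 8 along the group of level 6 *)

Open Scope Z_scope.

(* [sf Q] predicts [b + l] modulo 8 for the matrix [(Q A, B; 6 C, Q D)] of determinant [Q], [Q] dividing [6]: the formula depends only
   on the residues modulo 8 and 3, so its stability under the generators is a finite check. *)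
Definition sg3 (x : Z) : Z := if x mod 3 =? 2 then 4 else 0.
Definition sf1 (A B C D : Z) : Z := A * (B + C) + (A * A - 1) / 2 + 2 * (A - 1).
Definition sf6 (A B C D : Z) : Z := C * (A - D) + (C * C - 1) / 2 + 2 * (C - 1).
(* Classes 3 and 2 are moved to 1 and 6 by the involution [e3], whose cocycle shifts the value by [5] modulo [8]. *)
Definition sf8 (Q A B C D : Z) : Z :=
 if Q =? 1 then sf1 A B C D
 else if Q =? 6 then sf6 A B C D
 else if Q =? 3 then sf1 (3 * A - 4 * C) (B - 2 * D) (A - C) (2 * B - 3 * D) + 5
 else sf6 (A - 2 * C) (3 * B - 4 * D) (2 * A - 3 * C) (B - D) + 5.
Definition sf3 (Q A B C D : Z) : Z := if orb (Q =? 1) (Q =? 2) then sg3 A else sg3 C.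
(** Reducing the arguments first makes the value periodic by construction, which lets the checks run
    over a finite box of residues. *)
Definition red (N : Z) (F : Z -> Z -> Z -> Z -> Z -> Z) (Q A B C D : Z) : Z := F Q (A mod N) (B mod N) (C mod N) (D mod N).
Definition sf (Q A B C D : Z) : Z := red 8 sf8 Q A B C D + red 3 sf3 Q A B C D.

Definition rangeZ (N : Z) : list Z := List.map Z.of_nat (List.seq 0 (Z.to_nat N)).
Definition all4 (l : list Z) (f : Z -> Z -> Z -> Z -> bool) : bool :=
 List.forallb (fun A => List.forallb (fun B => List.forallb (fun C => List.forallb (f A B C) l) l) l) l.
Definition det1 (lev N Q A B C D : Z) : bool := (Q * A * D - (lev / Q) * B * C) mod N =? 1.

Lemma in_rangeZ N x : 0 < N -> List.In (x mod N) (rangeZ N).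
Proof.
intros HN. apply List.in_map_iff. exists (Z.to_nat (x mod N)). pose proof (Z.mod_pos_bound x N HN).
split; [lia|]. apply List.in_seq. lia.
Qed.

Lemma all4_spec N f : 0 < N -> all4 (rangeZ N) f = true -> forall A B C D, f (A mod N) (B mod N) (C mod N) (D mod N) = true.
Proof.
intros HN H A B C D. unfold all4 in H.
rewrite List.forallb_forall in H. specialize (H _ (in_rangeZ N A HN)).
rewrite List.forallb_forall in H. specialize (H _ (in_rangeZ N B HN)).
rewrite List.forallb_forall in H. specialize (H _ (in_rangeZ N C HN)).
rewrite List.forallb_forall in H. exact (H _ (in_rangeZ N D HN)).
Qed.

(** [N] is the modulus of the entries, while the congruence between the values is always modulo 8;
    for [N = 3] this is sensible because [sf3] takes the values 0 and 4 only. The pairs [l1] to [l4]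
    describe multiplication from the left by a generator, [e] and [k] its effect on the value. *)
Definition chk (lev N : Z) F (Q Q' : Z) (l1 l2 l3 l4 : Z * Z) (e k : Z) : bool :=
 all4 (rangeZ N) (fun A B C D => if det1 lev N Q A B C D then
  (red N F Q' (fst l1 * A + snd l1 * C) (fst l2 * B + snd l2 * D) (fst l3 * A + snd l3 * C) (fst l4 * B + snd l4 * D) - (e * F Q A B C D + k)) mod 8 =? 0
  else true).

Lemma lin_mod N x y A C : 0 < N -> (x * (A mod N) + y * (C mod N)) mod N = (x * A + y * C) mod N.
Proof.
intros HN. rewrite (Z.div_mod A N) at 2 by lia. rewrite (Z.div_mod C N) at 2 by lia.
replace (x * (N * (A / N) + A mod N) + y * (N * (C / N) + C mod N)) with (x * (A mod N) + y * (C mod N) + (x * (A / N) + y * (C / N)) * N) by ring.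
rewrite Z_mod_plus_full. reflexivity.
Qed.

Lemma chk_spec lev N F Q Q' l1 l2 l3 l4 e k : 1 < N -> chk lev N F Q Q' l1 l2 l3 l4 e k = true -> forall A B C D, Q * A * D - (lev / Q) * B * C = 1 ->
 exists j, red N F Q' (fst l1 * A + snd l1 * C) (fst l2 * B + snd l2 * D) (fst l3 * A + snd l3 * C) (fst l4 * B + snd l4 * D) = e * red N F Q A B C D + k + 8 * j.
Proof.
intros HN H A B C D Hd. assert (HN0 : 0 < N) by lia; pose proof (all4_spec N _ HN0 H A B C D) as H1. cbv beta in H1.
assert (E : det1 lev N Q (A mod N) (B mod N) (C mod N) (D mod N) = true).
{ apply Z.eqb_eq. set (q := lev / Q) in *.
 rewrite (Z.div_mod A N), (Z.div_mod B N), (Z.div_mod C N), (Z.div_mod D N) in Hd by lia.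
 set (a' := A mod N) in *. set (b' := B mod N) in *. set (c' := C mod N) in *. set (d' := D mod N) in *.
 replace (Q * a' * d' - q * b' * c') with (1 + (q * (N * (B / N) * (C / N) + (B / N) * c' + b' * (C / N)) - Q * (N * (A / N) * (D / N) + (A / N) * d' + a' * (D / N))) * N) by lia.
 rewrite Z_mod_plus_full. apply Z.mod_small. lia. }
rewrite E in H1. unfold red in H1. rewrite !lin_mod in H1 by lia.
apply Z.eqb_eq in H1. apply Z.mod_divide in H1; [|lia]. destruct H1 as [j Hj]. exists j. unfold red. lia.
Qed.

Definition chk2 (Q Q' : Z) (l1 l2 l3 l4 : Z * Z) (e k8 k3 : Z) : bool := (chk 6 8 sf8 Q Q' l1 l2 l3 l4 e k8 && chk 6 3 sf3 Q Q' l1 l2 l3 l4 e k3)%bool.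

Lemma chk2_spec Q Q' l1 l2 l3 l4 e k8 k3 : chk2 Q Q' l1 l2 l3 l4 e k8 k3 = true -> forall A B C D, Q * A * D - (6 / Q) * B * C = 1 ->
 exists j, sf Q' (fst l1 * A + snd l1 * C) (fst l2 * B + snd l2 * D) (fst l3 * A + snd l3 * C) (fst l4 * B + snd l4 * D) = e * sf Q A B C D + (k8 + k3) + 8 * j.
Proof.
intros H A B C D Hd. apply andb_prop in H. destruct H as [H8 H3].
destruct (chk_spec 6 8 _ _ _ _ _ _ _ _ _ eq_refl H8 A B C D Hd) as [j8 E8]. destruct (chk_spec 6 3 _ _ _ _ _ _ _ _ _ eq_refl H3 A B C D Hd) as [j3 E3].
exists (j8 + j3). unfold sf. lia.
Qed.

(** The parity of the number of letters [e3] in a word of class [Q]. It shows in the cocycle: [b]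
    has this parity, and [a] and [c] are [- mQ] modulo 4. *)
Definition mQ (Q : Z) : Z := if orb (Q =? 1) (Q =? 6) then 0 else 1.
Definition class (Q : Z) : Prop := Q = 1 \/ Q = 6 \/ Q = 2 \/ Q = 3.

(** A translation by [k = +-1] changes [b + l] by [k (1 - 2 a)]; since [a = - mQ] modulo 4, this is
    [k (1 + 2 mQ)] modulo 8. *)
Lemma chk_T_all : List.forallb (fun Q => chk2 Q Q (1, 6 / Q) (1, Q) (0, 1) (0, 1) 1 (1 + 2 * mQ Q) 0 && chk2 Q Q (1, - (6 / Q)) (1, - Q) (0, 1) (0, 1) 1 (- (1 + 2 * mQ Q)) 0)%bool
 (1 :: 6 :: 2 :: 3 :: nil)%list = true.
Proof. reflexivity. Qed.

(** [W] negates both [b] and [l]. The constants assigned to the moduli 8 and 3 are both 0 or both 4,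
    so that [sf] is negated modulo 8; likewise [sf] is unchanged when the matrix is replaced by its
    negative. *)
Lemma chk_W_all : List.forallb (fun Q => chk2 Q (6 / Q) (0, -1) (0, -1) (1, 0) (1, 0) (-1) (if orb (Q =? 1) (Q =? 2) then 0 else 4) (if orb (Q =? 1) (Q =? 2) then 0 else 4) && chk2 Q Q (-1, 0) (-1, 0) (0, -1) (0, -1) 1 4 4)%bool
 (1 :: 6 :: 2 :: 3 :: nil)%list = true.
Proof. reflexivity. Qed.

(** Under [e3] the shift [l] is fixed and [b] becomes [- 4 a - 7 b - 2 c + 1], which by the
    congruences for [a] and [c] is [b + 1 - 2 mQ] modulo 8. The constants add up to 1 in the classes
    1 and 6, and to 7 in the classes 2 and 3. *)
Lemma chk_e3_1 : chk2 1 3 (1, -4) (3, -2) (1, -3) (2, -1) 1 1 0 = true.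
Proof. easy. Qed.
Lemma chk_e3_3 : chk2 3 1 (3, -4) (1, -2) (1, -1) (2, -3) 1 3 4 = true.
Proof. easy. Qed.
Lemma chk_e3_2 : chk2 2 6 (1, -2) (3, -4) (2, -3) (1, -1) 1 3 4 = true.
Proof. easy. Qed.
Lemma chk_e3_6 : chk2 6 2 (3, -2) (1, -4) (2, -1) (1, -3) 1 1 0 = true.
Proof. easy. Qed.

Lemma class_in Q : class Q -> List.In Q (1 :: 6 :: 2 :: 3 :: nil)%list.
Proof. intros [-> | [-> | [-> | ->]]]; simpl; tauto. Qed.

(** The parity of the number of letters [W], each of which changes the sign of [K4]. *)
Definition sgn (Q : Z) : R := if orb (Q =? 1) (Q =? 3) then 1%R else (-1)%R.

(** The congruences for [a], [b] and [c] are carried along with the one for [b + l], because the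
    effect of a generator on [b] modulo 8 depends on them. *)
Definition Rel (G om : R) (Q A B C D : Z) : Prop := exists a b c l i j k n : Z,
 Geo G om (IZR (Q * A)) (IZR B) (IZR (6 * C)) (IZR (Q * D)) (IZR a) (IZR b) (IZR c) (IZR l) (sgn Q) /\
 a = 4 * i - mQ Q /\ c = 4 * j - mQ Q /\ b = 2 * k + mQ Q /\ b + l = sf Q A B C D + 8 * n.

Lemma Rel_T G om k Q A B C D : k = 1 \/ k = -1 -> class Q -> Q * A * D - 6 / Q * B * C = 1 -> Rel G om Q A B C D ->
 Rel G om Q (A + k * (6 / Q) * C) (B + k * Q * D) C D.
Proof.
intros Hk HQ Hd [a [b [c [l [i [j [m [n [H [Ha [Hc [Hb Hs]]]]]]]]]]]].
assert (Hchk : exists u, sf Q (A + k * (6 / Q) * C) (B + k * Q * D) C D = sf Q A B C D + k * (1 + 2 * mQ Q) + 8 * u).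
{ pose proof chk_T_all as HT. rewrite List.forallb_forall in HT. specialize (HT Q (class_in Q HQ)). apply andb_prop in HT. destruct HT as [H1 H2].
 destruct Hk as [-> | ->]; [destruct (chk2_spec _ _ _ _ _ _ _ _ _ H1 A B C D Hd) as [u Hu]|destruct (chk2_spec _ _ _ _ _ _ _ _ _ H2 A B C D Hd) as [u Hu]];
 exists u; cbn [fst snd] in Hu.
 - replace (A + 1 * (6 / Q) * C) with (1 * A + 6 / Q * C) by ring. replace (B + 1 * Q * D) with (1 * B + Q * D) by ring.
  replace C with (0 * A + 1 * C) at 2 by ring. replace D with (0 * B + 1 * D) at 2 by ring. lia.
 - replace (A + -1 * (6 / Q) * C) with (1 * A + - (6 / Q) * C) by ring. replace (B + -1 * Q * D) with (1 * B + - Q * D) by ring.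
  replace C with (0 * A + 1 * C) at 2 by ring. replace D with (0 * B + 1 * D) at 2 by ring. lia. }
destruct Hchk as [u Hu].
assert (Hk2 : k * k = 1) by lia.
assert (HQ6 : Q * (6 / Q) = 6) by (destruct HQ as [-> | [-> | [-> | ->]]]; reflexivity).
exists a, (b - 2 * k * a), (6 * a - 6 * b * k + c), (l + k), i.
(* [a] and [b] have the same parity, so [6 (a - b k)] is a multiple of 12 and [c] keeps its class
   modulo 4. *)
assert (Hpar : exists t, a - b * k = 2 * t).
{ destruct Hk as [-> | ->]; rewrite Ha, Hb; [exists (2 * i - m - mQ Q); ring|exists (2 * i + m); ring]. }
destruct Hpar as [t Ht].
exists (3 * t + j), (m - k * a), (n - u - k * i). split; [|split; [|split; [|split]]].
- apply (Geo_T G om (IZR k)) in H; [|destruct Hk as [-> | ->]; lra; reflexivity].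
 rewrite <- !mult_IZR, <- !plus_IZR in H.
 replace (IZR (Q * (A + k * (6 / Q) * C))) with (IZR (Q * A + k * (6 * C))) by (f_equal; transitivity (Q * A + k * (Q * (6 / Q)) * C); [rewrite HQ6; ring|ring]).
 replace (IZR (B + k * Q * D)) with (IZR (B + k * (Q * D))) by Cring.
 replace (IZR (b - 2 * k * a)) with (IZR b - IZR (2 * k * a))%R by (rewrite minus_IZR; reflexivity).
 replace (IZR (6 * a - 6 * b * k + c)) with (IZR (6 * a) * IZR k ^ 2 - IZR (6 * b * k) + IZR c)%R; auto.
 rewrite plus_IZR, minus_IZR, !mult_IZR. replace (IZR k ^ 2)%R with (IZR (k * k)) by (rewrite mult_IZR; ring). rewrite Hk2. ring.
- lia.
- lia.
- lia.
- lia.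
Qed.

Lemma Rel_scale G om t p q r s Q A B C D a b c l i j m n : (t <> 0)%Z -> p = t * (Q * A) -> q = t * B -> r = t * (6 * C) -> s = t * (Q * D) ->
 Geo G om (IZR p) (IZR q) (IZR r) (IZR s) (IZR a) (IZR b) (IZR c) (IZR l) (sgn Q) ->
 a = 4 * i - mQ Q -> c = 4 * j - mQ Q -> b = 2 * m + mQ Q -> b + l = sf Q A B C D + 8 * n -> Rel G om Q A B C D.
Proof.
intros Ht Ep Eq Er Es H Ha Hc Hb Hs. exists a, b, c, l, i, j, m, n. split; auto.
apply (Geo_scale G om (/ IZR t)) in H; [|apply Rinv_neq_0_compat, not_0_IZR; exact Ht].
rewrite Ep, Eq, Er, Es, !(mult_IZR t) in H. rewrite <- !Rmult_assoc, !Rinv_l, !Rmult_1_l in H by (apply not_0_IZR; exact Ht). exact H.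
Qed.

Lemma Rel_opp G om Q A B C D : class Q -> Q * A * D - 6 / Q * B * C = 1 -> Rel G om Q A B C D -> Rel G om Q (- A) (- B) (- C) (- D).
Proof.
intros HQ Hd [a [b [c [l [i [j [m [n [H [Ha [Hc [Hb Hs]]]]]]]]]]]].
pose proof chk_W_all as HT. rewrite List.forallb_forall in HT. specialize (HT Q (class_in Q HQ)). apply andb_prop in HT. destruct HT as [_ H2].
destruct (chk2_spec _ _ _ _ _ _ _ _ _ H2 A B C D Hd) as [u Hu]. cbn [fst snd] in Hu.
replace (-1 * A + 0 * C) with (- A) in Hu by ring. replace (-1 * B + 0 * D) with (- B) in Hu by ring.
replace (0 * A + -1 * C) with (- C) in Hu by ring. replace (0 * B + -1 * D) with (- D) in Hu by ring.
apply (Rel_scale G om (-1) _ _ _ _ Q _ _ _ _ a b c l i j m (n - u - 1) ltac:(lia)) with (5 := H); try assumption; try ring. lia.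
Qed.

Lemma Rel_W G om B0 B3 Q A B C D : periods G om B0 B3 -> class Q -> Q * A * D - 6 / Q * B * C = 1 -> Rel G om Q A B C D -> Rel G om (6 / Q) (- C) (- D) A B.
Proof.
intros Hper HQ Hd [a [b [c [l [i [j [m [n [H [Ha [Hc [Hb Hs]]]]]]]]]]]].
pose proof chk_W_all as HT. rewrite List.forallb_forall in HT. specialize (HT Q (class_in Q HQ)). apply andb_prop in HT. destruct HT as [H2 _].
destruct (chk2_spec _ _ _ _ _ _ _ _ _ H2 A B C D Hd) as [u Hu]. cbn [fst snd] in Hu.
replace (0 * A + -1 * C) with (- C) in Hu by ring. replace (0 * B + -1 * D) with (- D) in Hu by ring.
replace (1 * A + 0 * C) with A in Hu by ring. replace (1 * B + 0 * D) with B in Hu by ring.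
apply (Geo_W G om B0 B3 _ _ _ _ _ _ _ _ _ Hper) in H.
assert (Hm : mQ (6 / Q) = mQ Q) by (destruct HQ as [-> | [-> | [-> | ->]]]; reflexivity).
assert (Hsg : sgn (6 / Q) = (- sgn Q)%R) by (destruct HQ as [-> | [-> | [-> | ->]]]; unfold sgn; simpl; ring).
assert (HQ6 : Q * (6 / Q) = 6) by (destruct HQ as [-> | [-> | [-> | ->]]]; reflexivity).
assert (Hw : exists t, (if orb (Q =? 1) (Q =? 2) then 0 else 4) + (if orb (Q =? 1) (Q =? 2) then 0 else 4) = 8 * t).
{ destruct (orb (Q =? 1) (Q =? 2)); [exists 0|exists 1]; reflexivity. }
destruct Hw as [t Hw]. rewrite <- Hsg, <- !opp_IZR, <- !mult_IZR in H.
apply (Rel_scale G om Q (- (6 * C)) (- (Q * D)) (6 * (Q * A)) (6 * B) (6 / Q) (- C) (- D) A B c (- b) a (- l) j i (- m - mQ Q) (- n - u - t)).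
- lia.
- transitivity (- (Q * (6 / Q)) * C); [rewrite HQ6; ring|ring].
- ring.
- ring.
- transitivity (Q * (6 / Q) * B); [rewrite HQ6; ring|ring].
- pos.
- lia.
- lia.
- lia.
- lia.
Qed.

(** Multiplication by [e3] leads to a matrix with a common factor [t], which is 1 or 3 in the
    applications; dividing it out gives the normal form of the class [Q']. *)
Lemma Rel_e3_gen G om B0 B3 t Q Q' x1 y1 x2 y2 x3 y3 x4 y4 A B C D k8 k3 w : periods G om B0 B3 -> Q * A * D - 6 / Q * B * C = 1 ->
 chk2 Q Q' (x1, y1) (x2, y2) (x3, y3) (x4, y4) 1 k8 k3 = true -> k8 + k3 = 1 - 2 * mQ Q + 8 * w -> mQ Q' = 1 - mQ Q -> sgn Q' = sgn Q ->
 mQ Q = 0 \/ mQ Q = 1 -> t <> 0 ->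
 3 * (Q * A) - 2 * (6 * C) = t * (Q' * (x1 * A + y1 * C)) -> 3 * B - 2 * (Q * D) = t * (x2 * B + y2 * D) ->
 6 * (Q * A) - 3 * (6 * C) = t * (6 * (x3 * A + y3 * C)) -> 6 * B - 3 * (Q * D) = t * (Q' * (x4 * B + y4 * D)) ->
 Rel G om Q A B C D -> Rel G om Q' (x1 * A + y1 * C) (x2 * B + y2 * D) (x3 * A + y3 * C) (x4 * B + y4 * D).
Proof.
intros Hper Hd Hchk Hk Hm Hsg Hm01 Ht E1 E2 E3 E4 [a [b [c [l [i [j [m [n [H [Ha [Hc [Hb Hs]]]]]]]]]]]].
destruct (chk2_spec _ _ _ _ _ _ _ _ _ Hchk A B C D Hd) as [u Hu]. cbn [fst snd] in Hu.
apply (Geo_e3 G om B0 B3 _ _ _ _ _ _ _ _ _ Hper) in H. rewrite <- Hsg in H.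
replace (3 * IZR a + 6 * IZR b + 2 * IZR c - 1)%R with (IZR (3 * a + 6 * b + 2 * c - 1)) in H by (rewrite minus_IZR, !plus_IZR, !mult_IZR; reflexivity).
replace (- 4 * IZR a - 7 * IZR b - 2 * IZR c + 1)%R with (IZR (- 4 * a - 7 * b - 2 * c + 1)) in H by (rewrite plus_IZR, !minus_IZR, !mult_IZR; reflexivity).
replace (8 * IZR a + 12 * IZR b + 3 * IZR c - 1)%R with (IZR (8 * a + 12 * b + 3 * c - 1)) in H by (rewrite minus_IZR, !plus_IZR, !mult_IZR; reflexivity).
rewrite <- !mult_IZR, <- !minus_IZR in H.
apply (Rel_scale G om t _ _ _ _ Q' _ _ _ _ _ _ _ _ (3 * i + 3 * m + 2 * j) (8 * i + 6 * m + 3 * j) (- 8 * i - 7 * m - 4 * j)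
 (n - u - w - 2 * i - 2 * m - j) Ht E1 E2 E3 E4 H); rewrite ?Hm.
- lia.
- lia.
- lia.
- lia.
Qed.

Lemma Rel_eq G om Q A B C D A' B' C' D' : A = A' -> B = B' -> C = C' -> D = D' -> Rel G om Q A B C D -> Rel G om Q A' B' C' D'.
Proof. intros -> -> -> ->. tauto. Qed.

Lemma det_T Q A B C D k : class Q -> Q * A * D - 6 / Q * B * C = 1 -> Q * (A + k * (6 / Q) * C) * D - 6 / Q * (B + k * Q * D) * C = 1.
Proof. lia. Qed.

Lemma Rel_T_iter G om Q A B C D k : class Q -> Q * A * D - 6 / Q * B * C = 1 ->
 Rel G om Q (A + k * (6 / Q) * C) (B + k * Q * D) C D <-> Rel G om Q A B C D.
Proof.
intros HQ Hd.
assert (Step : forall k0, Rel G om Q (A + k0 * (6 / Q) * C) (B + k0 * Q * D) C D <-> Rel G om Q (A + (k0 + 1) * (6 / Q) * C) (B + (k0 + 1) * Q * D) C D).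
{ intros k0. split; intros H.
 - apply (Rel_T G om 1) in H; [|tauto|pos|lia]. eapply Rel_eq; [| | | |exact H]; ring.
 - apply (Rel_T G om (-1)) in H; [|tauto|pos|lia]. eapply Rel_eq; [| | | |eauto]; ring. }
assert (H0 : Rel G om Q (A + 0 * (6 / Q) * C) (B + 0 * Q * D) C D <-> Rel G om Q A B C D).
{ split; intros H; (eapply Rel_eq; [| | | |eauto]); ring. }
assert (Hpos : forall n : nat, (Rel G om Q (A + Z.of_nat n * (6 / Q) * C) (B + Z.of_nat n * Q * D) C D <-> Rel G om Q A B C D) /\
 (Rel G om Q (A + (- Z.of_nat n) * (6 / Q) * C) (B + (- Z.of_nat n) * Q * D) C D <-> Rel G om Q A B C D)).
{ induction n as [|n [IH1 IH2]]; auto. rewrite Nat2Z.inj_succ. unfold Z.succ. split.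
 - rewrite <- Step. exact IH1.
 - rewrite Step. replace (- (Z.of_nat n + 1) + 1) with (- Z.of_nat n) by ring. exact IH2. }
destruct (Z_le_dec 0 k) as [Hk|Hk].
- destruct (Hpos (Z.to_nat k)) as [H _]. rewrite Z2Nat.id in H by lia. exact H.
- destruct (Hpos (Z.to_nat (- k))) as [_ H]. rewrite Z2Nat.id in H by lia. rewrite Z.opp_involutive in H. exact H.
Qed.

Lemma Geo_id G om : Geo G om 1 0 0 1 0 0 0 0 1.
Proof.
exists (RtoC 0), (RtoC 0), (RtoC 0). repeat split; try (simpl; ring). intros w Hw. exists w.
assert (E : (RtoC 0 * w + RtoC 1)%C = RtoC 1) by ring. rewrite E.
repeat split; [lra|apply RtoC_neq0; lra|field|field|ring].
Qed.

Lemma Rel_id G om : Rel G om 1 1 0 0 1.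
Proof.
exists 0, 0, 0, 0, 0, 0, 0, 0. repeat split. apply Geo_id.
Qed.

Lemma Rel_opp_iff G om Q A B C D : class Q -> Q * A * D - 6 / Q * B * C = 1 -> Rel G om Q (- A) (- B) (- C) (- D) -> Rel G om Q A B C D.
Proof.
intros HQ Hd H. apply Rel_opp in H; [|pos|lia]. eapply Rel_eq; [| | | |eauto]; ring.
Qed.

Lemma class_dual Q : class Q -> class (6 / Q) /\ 6 / (6 / Q) = Q /\ Q * (6 / Q) = 6.
Proof. intros [-> | [-> | [-> | ->]]]; unfold class; tauto. Qed.

Lemma Rel_W_inv G om B0 B3 Q A B C D : periods G om B0 B3 -> class Q -> Q * A * D - 6 / Q * B * C = 1 ->
 Rel G om (6 / Q) (- C) (- D) A B -> Rel G om Q A B C D.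
Proof.
intros Hper HQ Hd H. destruct (class_dual Q HQ) as [HQ' [E _]].
apply (Rel_W G om B0 B3) in H; [|pos|pos|lia]. rewrite E in H.
apply Rel_opp_iff; assumption.
Qed.

Lemma Rel_e3_1 G om B0 B3 A B C D : periods G om B0 B3 -> 1 * A * D - 6 / 1 * B * C = 1 -> Rel G om 1 A B C D -> Rel G om 3 (1 * A + -4 * C) (3 * B + -2 * D) (1 * A + -3 * C) (2 * B + -1 * D).
Proof. intros Hper Hd. apply (Rel_e3_gen G om B0 B3 1 1 3 1 (-4) 3 (-2) 1 (-3) 2 (-1) A B C D 1 0 0 Hper Hd chk_e3_1); try reflexivity; try lia; left; reflexivity. Qed.
Lemma Rel_e3_3 G om B0 B3 A B C D : periods G om B0 B3 -> 3 * A * D - 6 / 3 * B * C = 1 -> Rel G om 3 A B C D -> Rel G om 1 (3 * A + -4 * C) (1 * B + -2 * D) (1 * A + -1 * C) (2 * B + -3 * D).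
Proof. intros Hper Hd. apply (Rel_e3_gen G om B0 B3 3 3 1 3 (-4) 1 (-2) 1 (-1) 2 (-3) A B C D 3 4 1 Hper Hd chk_e3_3); try reflexivity; try lia; right; reflexivity. Qed.
Lemma Rel_e3_2 G om B0 B3 A B C D : periods G om B0 B3 -> 2 * A * D - 6 / 2 * B * C = 1 -> Rel G om 2 A B C D -> Rel G om 6 (1 * A + -2 * C) (3 * B + -4 * D) (2 * A + -3 * C) (1 * B + -1 * D).
Proof. intros Hper Hd. apply (Rel_e3_gen G om B0 B3 1 2 6 1 (-2) 3 (-4) 2 (-3) 1 (-1) A B C D 3 4 1 Hper Hd chk_e3_2); try reflexivity; try lia; right; reflexivity. Qed.
Lemma Rel_e3_6 G om B0 B3 A B C D : periods G om B0 B3 -> 6 * A * D - 6 / 6 * B * C = 1 -> Rel G om 6 A B C D -> Rel G om 2 (3 * A + -2 * C) (1 * B + -4 * D) (2 * A + -1 * C) (1 * B + -3 * D).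
Proof. intros Hper Hd. apply (Rel_e3_gen G om B0 B3 3 6 2 3 (-2) 1 (-4) 2 (-1) 1 (-3) A B C D 1 0 0 Hper Hd chk_e3_6); try reflexivity; try lia; left; reflexivity. Qed.

Ltac q6 := change (6 / 1) with 6 in *; change (6 / 2) with 3 in *; change (6 / 3) with 2 in *; change (6 / 6) with 1 in *.
Ltac rel_eq H := eapply Rel_eq; [| | | |exact H]; ring.

(** Descent on [(6/Q) C^2]. Let [x = A / ((6/Q) C)] be the image of infinity, translated into
    [[0, 1)]. Then [W] multiplies the measure by [6 x^2] and [e3] multiplies it by [12 (x - 1/2)^2],
    so some generator always decreases it. *)
Theorem Rel_all G om B0 B3 : periods G om B0 B3 -> forall Q A B C D, class Q -> Q * A * D - 6 / Q * B * C = 1 -> Rel G om Q A B C D.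
Proof.
intros Hper.
assert (Main : forall n : nat, forall Q A B C D, class Q -> Q * A * D - 6 / Q * B * C = 1 -> (6 / Q) * (C * C) < Z.of_nat n -> Rel G om Q A B C D).
{ induction n as [|n IH]; intros Q A B C D HQ Hd Hn.
 { exfalso. destruct HQ as [-> | [-> | [-> | ->]]]; q6; nia. }
 assert (Pos : forall A B C D, Q * A * D - 6 / Q * B * C = 1 -> (6 / Q) * (C * C) < Z.of_nat (S n) -> 0 < C -> Rel G om Q A B C D).
 { clear A B C D Hd Hn. intros A B C D Hd Hn HC.
  set (q := 6 / Q) in *. assert (Hqpos : 0 < q * C) by (unfold q; destruct HQ as [-> | [-> | [-> | ->]]]; q6; lia).
  set (k := - (A / (q * C))).
  rewrite <- (Rel_T_iter G om Q A B C D k HQ Hd). fold q.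
  pose proof (det_T Q A B C D k HQ Hd) as Hd1. fold q in Hd1.
  set (A1 := A + k * q * C) in *. set (B1 := B + k * Q * D) in *.
  assert (HA1 : 0 <= A1 < q * C).
  { replace A1 with (A mod (q * C)); [apply Z.mod_pos_bound; lia|]. unfold A1, k. rewrite Z.mod_eq by lia. ring. }
  clearbody A1 B1. clear Hd k A B.
  (* The cut at 2/5 works since [6 (2/5)^2 = 24/25 < 1]. Beyond 3/5 the cusp is first moved by -1,
     and between the two [12 (1/10)^2 < 1]. *)
  destruct (Z_lt_dec (5 * A1) (2 * (q * C))) as [Hlo|Hlo].
  - apply (Rel_W_inv G om B0 B3); [exact Hper|exact HQ|exact Hd1|]. destruct (class_dual Q HQ) as [HQ' [E _]]. fold q in HQ', E |- *.
   apply IH; [exact HQ'|rewrite E; rewrite <- Hd1; ring|]. rewrite E.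
   unfold q in *. destruct HQ as [-> | [-> | [-> | ->]]]; q6; nia.
  - destruct (Z_lt_dec (3 * (q * C)) (5 * A1)) as [Hhi|Hhi].
   + rewrite <- (Rel_T_iter G om Q A1 B1 C D (-1) HQ Hd1). fold q.
    pose proof (det_T Q A1 B1 C D (-1) HQ Hd1) as Hd2. fold q in Hd2.
    apply (Rel_W_inv G om B0 B3); [exact Hper|exact HQ|exact Hd2|]. destruct (class_dual Q HQ) as [HQ' [E _]]. fold q in HQ', E |- *.
    apply IH; [exact HQ'|rewrite E; rewrite <- Hd2; ring|]. rewrite E.
    unfold q in *. destruct HQ as [-> | [-> | [-> | ->]]]; q6; nia.
   + apply Rel_opp_iff; [exact HQ|exact Hd1|]. unfold q in *. destruct HQ as [-> | [-> | [-> | ->]]]; q6.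
    * assert (H : Rel G om 3 (1 * A1 + -4 * C) (3 * B1 + -2 * D) (1 * A1 + -3 * C) (2 * B1 + -1 * D)).
     { apply IH; [unfold class; tauto|etransitivity; [|exact Hd1]; q6; ring|change (6 / 3) with 2; nia]. }
     apply (Rel_e3_3 G om B0 B3) in H; [|exact Hper|etransitivity; [|exact Hd1]; q6; ring]. rel_eq H.
    * assert (H : Rel G om 2 (3 * A1 + -2 * C) (1 * B1 + -4 * D) (2 * A1 + -1 * C) (1 * B1 + -3 * D)).
     { apply IH; [unfold class; tauto|etransitivity; [|exact Hd1]; q6; ring|change (6 / 2) with 3; nia]. }
     apply (Rel_e3_2 G om B0 B3) in H; [|exact Hper|etransitivity; [|exact Hd1]; q6; ring]. rel_eq H.
    * assert (H : Rel G om 6 (1 * A1 + -2 * C) (3 * B1 + -4 * D) (2 * A1 + -3 * C) (1 * B1 + -1 * D)).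
     { apply IH; [unfold class; tauto|etransitivity; [|exact Hd1]; q6; ring|change (6 / 6) with 1; nia]. }
     apply (Rel_e3_6 G om B0 B3) in H; [|exact Hper|etransitivity; [|exact Hd1]; q6; ring]. rel_eq H.
    * assert (H : Rel G om 1 (3 * A1 + -4 * C) (1 * B1 + -2 * D) (1 * A1 + -1 * C) (2 * B1 + -3 * D)).
     { apply IH; [unfold class; tauto|etransitivity; [|exact Hd1]; q6; ring|change (6 / 1) with 6; nia]. }
     apply (Rel_e3_1 G om B0 B3) in H; [|exact Hper|etransitivity; [|exact Hd1]; q6; ring]. rel_eq H. }
 destruct (Z.lt_total C 0) as [HC|[HC|HC]].
 - apply Rel_opp_iff; [exact HQ|exact Hd|]. apply Pos; [rewrite <- Hd; ring|rewrite Z.mul_opp_opp; exact Hn|lia].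
 (* The determinant now forces [Q = 1] and [A = D = +-1]: up to sign a translation. *)
 - subst C. assert (HQ1 : Q = 1) by (destruct HQ as [-> | [-> | [-> | ->]]]; lia).
  subst Q. assert (HA : (A = 1 /\ D = 1) \/ (A = -1 /\ D = -1)).
  { assert (HAD : A * D = 1) by (etransitivity; [|exact Hd]; ring). destruct (Z.eq_mul_1 A D HAD) as [-> | ->]; lia. }
  assert (Base : forall b, Rel G om 1 1 b 0 1).
  { intros b. pose proof (Rel_T_iter G om 1 1 0 0 1 b ltac:(left; reflexivity) ltac:(reflexivity)) as H.
   destruct H as [_ H]. specialize (H (Rel_id G om)). rel_eq H. }
  destruct HA as [[-> ->]|[-> ->]]; [apply Base|]. apply Rel_opp_iff; [left; reflexivity|exact Hd|]. pose proof (Base (- B)) as H. exact H.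
 - apply Pos; assumption. }
intros Q A B C D HQ Hd. apply (Main (S (Z.to_nat (6 / Q * (C * C))))); [exact HQ|exact Hd|].
assert (0 <= 6 / Q * (C * C)) by (destruct HQ as [-> | [-> | [-> | ->]]]; q6; nia). lia.
Qed.

(** * The shifts of [kappa] along the group of level 2 *)

Open Scope R_scope.

Definition GeoK (p q r s l sg : R) : Prop := forall w, 0 < Im w -> exists X, 0 < Im X /\ (RtoC r * w + RtoC s)%C <> RtoC 0 /\
 X = ((RtoC p * w + RtoC q) / (RtoC r * w + RtoC s))%C /\ kappa X = sg * kappa w + l.

Lemma GeoK_scale t p q r s l sg : t <> 0 -> GeoK p q r s l sg -> GeoK (t * p) (t * q) (t * r) (t * s) l sg.
Proof.
intros Ht H w Hw. destruct (H w Hw) as [X [HX [Hn [EX HK]]]]. exists X. pose proof (RtoC_neq0 t Ht) as Nt.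
rewrite !RtoC_mult. assert (E : (RtoC t * RtoC r * w + RtoC t * RtoC s)%C = (RtoC t * (RtoC r * w + RtoC s))%C) by ring.
rewrite E. repeat split; [lra|apply Cmult_neq_0; assumption| |lra]. rewrite EX. cfield.
Qed.

Lemma GeoK_T k p q r s l sg : k = 1 \/ k = -1 -> GeoK p q r s l sg -> GeoK (p + k * r) (q + k * s) r s (l + k) sg.
Proof.
intros Hk H w Hw. destruct (H w Hw) as [X [HX [Hn [EX HK]]]]. exists (X + RtoC k)%C.
assert (E2 : kappa (X + RtoC k) = kappa X + k).
{ destruct Hk as [-> | ->]; [apply kappa_1|].
 assert (Em : (X + RtoC (-1) + 1)%C = X) by ring.
 pose proof (kappa_1 (X + RtoC (-1))) as HH. rewrite Em in HH. lra. }
split; [unfold Im in *; simpl; lra|]. split; auto. rewrite E2, !RtoC_plus, !RtoC_mult. split.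
- rewrite EX. cfield.
- lra.
Qed.

Lemma GeoK_W p q r s l sg : GeoK p q r s l sg -> GeoK (- r) (- s) (2 * p) (2 * q) (- l) (- sg).
Proof.
intros H w Hw. destruct (H w Hw) as [X [HX [Hn [EX HK]]]]. exists (- / (2 * X))%C.
pose proof (Im_pos_neq0 X HX) as NX. split; [apply Im_inv_opp; lra|].
rewrite !RtoC_opp, !RtoC_mult.
set (v := (RtoC r * w + RtoC s)%C) in *. set (n := (RtoC p * w + RtoC q)%C) in *.
assert (En : n = (X * v)%C) by (rewrite EX; cfield).
assert (E1 : (RtoC 2 * RtoC p * w + RtoC 2 * RtoC q)%C = (2 * (X * v))%C) by (rewrite <- En; unfold n; ring).
assert (E2 : (- RtoC r * w + - RtoC s)%C = (- v)%C) by Cring.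
rewrite E1, E2. split; [repeat apply Cmult_neq_0; try assumption; apply RtoC_neq0; lra|]. split; [cfield|].
rewrite kappa_W, HK by pos. ring.
Qed.

Open Scope Z_scope.

(** The counterpart of [sf] for matrices [(Q A, B; 2 C, Q D)] with [Q] dividing 2. Here no condition
    modulo 3 enters. *)
Definition kf (Q A B C D : Z) : Z := if Q =? 1 then A * (B + C) + (A * A - 1) / 2 else C * (A - D) + (C * C - 1) / 2.

Lemma chk_kappa : (List.forallb (fun Q => chk 2 8 kf Q Q (1, 2 / Q) (1, Q) (0, 1) (0, 1) 1 1 && chk 2 8 kf Q Q (1, - (2 / Q)) (1, - Q) (0, 1) (0, 1) 1 (-1) &&
 chk 2 8 kf Q (2 / Q) (0, -1) (0, -1) (1, 0) (1, 0) (-1) 0 && chk 2 8 kf Q Q (-1, 0) (-1, 0) (0, -1) (0, -1) 1 0) (1 :: 2 :: nil)%list)%bool = true.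
Proof. reflexivity. Qed.

Definition sgK (Q : Z) : R := if Q =? 1 then 1%R else (-1)%R.
Definition classK (Q : Z) : Prop := Q = 1 \/ Q = 2.

Lemma chk_kappa_spec Q : classK Q -> chk 2 8 kf Q Q (1, 2 / Q) (1, Q) (0, 1) (0, 1) 1 1 = true /\ chk 2 8 kf Q Q (1, - (2 / Q)) (1, - Q) (0, 1) (0, 1) 1 (-1) = true /\
 chk 2 8 kf Q (2 / Q) (0, -1) (0, -1) (1, 0) (1, 0) (-1) 0 = true /\ chk 2 8 kf Q Q (-1, 0) (-1, 0) (0, -1) (0, -1) 1 0 = true.
Proof.
intros HQ. pose proof chk_kappa as H. rewrite List.forallb_forall in H.
assert (Hin : List.In Q (1 :: 2 :: nil)%list) by (destruct HQ as [-> | ->]; simpl; tauto).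
specialize (H Q Hin). rewrite !Bool.andb_true_iff in H. tauto.
Qed.

Definition RelK (Q A B C D : Z) : Prop := exists l n : Z,
 GeoK (IZR (Q * A)) (IZR B) (IZR (2 * C)) (IZR (Q * D)) (IZR l) (sgK Q) /\ l = red 8 kf Q A B C D + 8 * n.

Lemma RelK_eq Q A B C D A' B' C' D' : A = A' -> B = B' -> C = C' -> D = D' -> RelK Q A B C D -> RelK Q A' B' C' D'.
Proof. intros -> -> -> ->. tauto. Qed.

Ltac relK_eq H := eapply RelK_eq; [| | | |exact H]; ring.

Lemma classK_dual Q : classK Q -> classK (2 / Q) /\ 2 / (2 / Q) = Q /\ Q * (2 / Q) = 2.
Proof. intros [-> | ->]; unfold classK; tauto. Qed.

Lemma RelK_T k Q A B C D : k = 1 \/ k = -1 -> classK Q -> Q * A * D - 2 / Q * B * C = 1 -> RelK Q A B C D -> RelK Q (A + k * (2 / Q) * C) (B + k * Q * D) C D.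
Proof.
intros Hk HQ Hd [l [n [H Hl]]]. destruct (classK_dual Q HQ) as [_ [_ HQ2]].
assert (Hchk : exists u, red 8 kf Q (A + k * (2 / Q) * C) (B + k * Q * D) C D = red 8 kf Q A B C D + k + 8 * u).
{ destruct (chk_kappa_spec Q HQ) as [H1 [H2 _]].
 destruct Hk as [-> | ->]; [destruct (chk_spec 2 8 _ _ _ _ _ _ _ _ _ eq_refl H1 A B C D Hd) as [u Hu]|destruct (chk_spec 2 8 _ _ _ _ _ _ _ _ _ eq_refl H2 A B C D Hd) as [u Hu]];
 exists u; cbn [fst snd] in Hu.
 - replace (A + 1 * (2 / Q) * C) with (1 * A + 2 / Q * C) by ring. replace (B + 1 * Q * D) with (1 * B + Q * D) by ring.
  replace C with (0 * A + 1 * C) at 2 by ring. replace D with (0 * B + 1 * D) at 2 by ring. lia.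
 - replace (A + -1 * (2 / Q) * C) with (1 * A + - (2 / Q) * C) by ring. replace (B + -1 * Q * D) with (1 * B + - Q * D) by ring.
  replace C with (0 * A + 1 * C) at 2 by ring. replace D with (0 * B + 1 * D) at 2 by ring. lia. }
destruct Hchk as [u Hu]. exists (l + k), (n - u). split.
- apply (GeoK_T (IZR k)) in H; [|destruct Hk as [-> | ->]; lra; reflexivity].
 rewrite <- !mult_IZR, <- !plus_IZR in H.
 replace (Q * (A + k * (2 / Q) * C)) with (Q * A + k * (2 * C)) by (transitivity (Q * A + k * (Q * (2 / Q)) * C); [rewrite HQ2; ring|ring]).
 replace (B + k * Q * D) with (B + k * (Q * D)) by ring. exact H.
- lia.
Qed.

Lemma RelK_opp Q A B C D : classK Q -> Q * A * D - 2 / Q * B * C = 1 -> RelK Q (- A) (- B) (- C) (- D) -> RelK Q A B C D.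
Proof.
intros HQ Hd [l [n [H Hl]]]. destruct (chk_kappa_spec Q HQ) as [_ [_ [_ H2]]].
destruct (chk_spec 2 8 _ _ _ _ _ _ _ _ _ eq_refl H2 A B C D Hd) as [u Hu]. cbn [fst snd] in Hu.
replace (-1 * A + 0 * C) with (- A) in Hu by ring. replace (-1 * B + 0 * D) with (- B) in Hu by ring.
replace (0 * A + -1 * C) with (- C) in Hu by ring. replace (0 * B + -1 * D) with (- D) in Hu by ring.
exists l, (n + u). split; [|lia].
apply (GeoK_scale (-1)) in H; [|lra]. rewrite <- !mult_IZR in H.
replace (Q * A) with (-1 * (Q * - A)) by ring. replace B with (-1 * - B) by ring.
replace (2 * C) with (-1 * (2 * - C)) by ring. replace (Q * D) with (-1 * (Q * - D)) by ring. exact H.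
Qed.

Lemma RelK_W Q A B C D : classK Q -> Q * A * D - 2 / Q * B * C = 1 -> RelK (2 / Q) (- C) (- D) A B -> RelK Q A B C D.
Proof.
intros HQ Hd [l [n [H Hl]]]. apply RelK_opp; auto.
destruct (classK_dual Q HQ) as [HQ' [E HQ2]]. destruct (chk_kappa_spec _ HQ') as [_ [_ [H2 _]]]. rewrite E in H2.
assert (Hd' : 2 / Q * - C * B - 2 / (2 / Q) * - D * A = 1) by lia.
destruct (chk_spec 2 8 _ _ _ _ _ _ _ _ _ eq_refl H2 _ _ _ _ Hd') as [u Hu]. cbn [fst snd] in Hu.
replace (0 * - C + -1 * A) with (- A) in Hu by ring. replace (0 * - D + -1 * B) with (- B) in Hu by ring.
replace (1 * - C + 0 * A) with (- C) in Hu by ring. replace (1 * - D + 0 * B) with (- D) in Hu by ring.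
exists (- l), (- n - u). split; [|lia].
apply GeoK_W in H. apply (GeoK_scale (IZR Q / 2)) in H; [|destruct HQ as [-> | ->]; lra].
rewrite <- !opp_IZR, <- !mult_IZR in H.
assert (Hs : (- sgK (2 / Q))%R = sgK Q) by (destruct HQ as [-> | ->]; unfold sgK; simpl; ring). rewrite Hs in H.
replace (IZR Q / 2 * IZR (- (2 * A)))%R with (IZR (Q * - A)) in H by (rewrite opp_IZR, !mult_IZR, opp_IZR; field).
replace (IZR Q / 2 * IZR (- (2 / Q * B)))%R with (IZR (- B)) in H.
2:{ transitivity (- (IZR (Q * (2 / Q)) / 2) * IZR B)%R; [rewrite HQ2, opp_IZR; field|rewrite opp_IZR, !mult_IZR; field]. }
replace (IZR Q / 2 * IZR (2 * (2 / Q * - C)))%R with (IZR (2 * - C)) in H.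
2:{ transitivity (IZR (Q * (2 / Q)) * IZR (- C))%R; [rewrite HQ2, mult_IZR; reflexivity|rewrite !mult_IZR; field]. }
replace (IZR Q / 2 * IZR (2 * - D))%R with (IZR (Q * - D)) in H by (rewrite !mult_IZR; field).
exact H.
Qed.

Lemma RelK_T_iter Q A B C D k : classK Q -> Q * A * D - 2 / Q * B * C = 1 -> RelK Q (A + k * (2 / Q) * C) (B + k * Q * D) C D <-> RelK Q A B C D.
Proof.
intros HQ Hd.
assert (Dt : forall k, Q * (A + k * (2 / Q) * C) * D - 2 / Q * (B + k * Q * D) * C = 1) by lia.
assert (Step : forall k0, RelK Q (A + k0 * (2 / Q) * C) (B + k0 * Q * D) C D <-> RelK Q (A + (k0 + 1) * (2 / Q) * C) (B + (k0 + 1) * Q * D) C D).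
{ intros k0. split; intros H.
 - apply (RelK_T 1) in H; auto. relK_eq H.
 - apply (RelK_T (-1)) in H; auto. relK_eq H. }
assert (H0 : RelK Q (A + 0 * (2 / Q) * C) (B + 0 * Q * D) C D <-> RelK Q A B C D) by (split; intros H; relK_eq H).
assert (Hpos : forall n : nat, (RelK Q (A + Z.of_nat n * (2 / Q) * C) (B + Z.of_nat n * Q * D) C D <-> RelK Q A B C D) /\
 (RelK Q (A + (- Z.of_nat n) * (2 / Q) * C) (B + (- Z.of_nat n) * Q * D) C D <-> RelK Q A B C D)).
{ induction n as [|n [IH1 IH2]]; auto. rewrite Nat2Z.inj_succ. unfold Z.succ. split.
 - rewrite <- Step. exact IH1.
 - rewrite Step. replace (- (Z.of_nat n + 1) + 1) with (- Z.of_nat n) by ring. exact IH2. }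
destruct (Z_le_dec 0 k) as [Hk|Hk].
- destruct (Hpos (Z.to_nat k)) as [H _]. rewrite Z2Nat.id in H by lia. exact H.
- destruct (Hpos (Z.to_nat (- k))) as [_ H]. rewrite Z2Nat.id in H by lia. rewrite Z.opp_involutive in H. exact H.
Qed.

Lemma RelK_id : RelK 1 1 0 0 1.
Proof.
exists 0, 0. split; auto. intros w Hw. exists w. simpl Z.mul.
assert (E : (RtoC 0 * w + RtoC 1)%C = RtoC 1) by ring. rewrite E. unfold sgK; simpl.
repeat split; [lra|apply RtoC_neq0; lra|field|ring].
Qed.

Ltac q2 := change (2 / 1) with 2 in *; change (2 / 2) with 1 in *.

(** The cusp [x = A / ((2/Q) C)] can be translated into [[-1/2, 1/2]], and [z -> - 1/(2z)]
    multiplies [(2/Q) C^2] by [2 x^2 <= 1/2]. Two generators thus suffice for the descent. *)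
Theorem RelK_all Q A B C D : classK Q -> Q * A * D - 2 / Q * B * C = 1 -> RelK Q A B C D.
Proof.
assert (Main : forall n : nat, forall Q A B C D, classK Q -> Q * A * D - 2 / Q * B * C = 1 -> (2 / Q) * (C * C) < Z.of_nat n -> RelK Q A B C D).
{ clear. induction n as [|n IH]; intros Q A B C D HQ Hd Hn.
 { destruct HQ as [-> | ->]; q2; nia. }
 assert (Pos : forall A B C D, Q * A * D - 2 / Q * B * C = 1 -> (2 / Q) * (C * C) < Z.of_nat (S n) -> 0 < C -> RelK Q A B C D).
 { clear A B C D Hd Hn. intros A B C D Hd Hn HC.
  set (q := 2 / Q) in *. assert (Hqpos : 0 < q * C) by (destruct HQ as [-> | ->]; q2; lia).
  set (k := - ((2 * A + q * C) / (2 * (q * C)))).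
  rewrite <- (RelK_T_iter Q A B C D k HQ Hd).
  set (A1 := A + k * q * C).
  assert (HA1 : - (q * C) <= 2 * A1 <= q * C).
  { assert (E : 2 * A1 + q * C = (2 * A + q * C) mod (2 * (q * C))) by (unfold A1, k; rewrite Z.mod_eq by lia; ring).
   pose proof (Z.mod_pos_bound (2 * A + q * C) (2 * (q * C)) ltac:(lia)). lia. }
  apply RelK_W; [pos|lia|]. destruct (classK_dual Q HQ) as [HQ' [E _]].
  apply IH; [pos|lia|]. destruct HQ as [-> | ->]; q2; nia. }
 destruct (Z.lt_total C 0) as [HC|[HC|HC]].
 - apply RelK_opp; auto. apply Pos; lia.
 - subst C. assert (HQ1 : Q = 1) by (destruct HQ as [-> | ->]; q2; lia).
  subst Q. assert (HA : (A = 1 /\ D = 1) \/ (A = -1 /\ D = -1)).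
  { assert (HAD : A * D = 1) by lia. destruct (Z.eq_mul_1 A D HAD) as [-> | ->]; lia. }
  assert (Base : forall b, RelK 1 1 b 0 1).
  { intros b. destruct (RelK_T_iter 1 1 0 0 1 b ltac:(left; reflexivity) ltac:(reflexivity)) as [_ H]. specialize (H RelK_id). relK_eq H. }
  destruct HA as [[-> ->]|[-> ->]]; auto. apply RelK_opp; easy.
 - auto. }
intros HQ Hd. apply (Main (S (Z.to_nat (2 / Q * (C * C))))); auto. lia.
Qed.

Open Scope R_scope.

(** * Radial limits at the cusps *)

Definition rl (F : C -> R) (x L : R) : Prop := forall eps, 0 < eps -> exists d, 0 < d /\ forall y, 0 < y < d -> Rabs (F (x, y) - L) < eps.

Lemma rl_unique F x L M : rl F x L -> rl F x M -> L = M.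
Proof.
intros HL HM. destruct (Req_dec L M) as [|Hne]; [assumption|exfalso].
assert (He : 0 < Rabs (L - M) / 2) by (pose proof (Rabs_pos_lt (L - M) ltac:(lra)); lra).
destruct (HL _ He) as [d1 [Hd1 H1]]. destruct (HM _ He) as [d2 [Hd2 H2]].
set (y := Rmin d1 d2 / 2). assert (Hm := Rmin_pos d1 d2 Hd1 Hd2). pose proof (Rmin_l d1 d2). pose proof (Rmin_r d1 d2).
specialize (H1 y ltac:(unfold y; lra)). specialize (H2 y ltac:(unfold y; lra)).
pose proof (Rabs_triang (F (x, y) - M) (- (F (x, y) - L))) as Ht. rewrite Rabs_Ropp in Ht.
replace (F (x, y) - M + - (F (x, y) - L)) with (L - M) in Ht by ring. lra.
Qed.

(** The vertical line over the pole [- s/r] goes to the vertical line over [p/r], the image of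
    infinity, with the height inverted up to a factor. *)
Lemma mobius_at p q r s v : 0 < r -> 0 < v ->
 ((RtoC p * ((- (s / r))%R, v) + RtoC q) / (RtoC r * ((- (s / r))%R, v) + RtoC s))%C = (p / r, (p * s - q * r) / (r ^ 2 * v)) /\
 (RtoC r * ((- (s / r))%R, v) + RtoC s)%C = (0, r * v).
Proof.
intros Hr Hv.
assert (E : (RtoC r * ((- (s / r))%R, v) + RtoC s)%C = (0, r * v)) by (unfold Cplus, Cmult, RtoC; simpl; f_equal; field; lra).
split; auto. rewrite E. unfold Cdiv, Cmult; simpl. f_equal; field; nra.
Qed.

Lemma GeoK_at p q r s l sg : 0 < r -> GeoK p q r s l sg -> forall v, 0 < v ->
 kappa (p / r, (p * s - q * r) / (r ^ 2 * v)) = sg * kappa (- (s / r), v) + l.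
Proof.
intros Hr H v Hv. destruct (H (- (s / r), v) Hv) as [X [_ [_ [EX HK]]]]. destruct (mobius_at p q r s v Hr Hv) as [E _].
rewrite E in EX. rewrite <- EX. exact HK.
Qed.

(** Descending to [x] corresponds to ascending over [x0], where [F] is asymptotic to the
    abscissa. *)
Lemma cusp_limit F x0 x c sg l : 0 < c -> sg = -1 ->
 (forall eps, 0 < eps -> exists V, 0 < V /\ forall v, V < v -> Rabs (F (x0, v) - x0) < eps) ->
 (forall v, 0 < v -> F (x, c / v) = sg * F (x0, v) + l) -> rl F x (l - x0).
Proof.
intros Hc -> HF H eps Heps. destruct (HF eps Heps) as [V [HV H1]]. exists (c / V). split; [pos|].
intros y Hy. assert (Hv : V < c / y).
{ apply Rmult_lt_reg_r with y; [lra|]. replace (c / y * y) with c by (field; lra).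
 replace c with (c / V * V) by (field; lra). nra. }
replace y with (c / (c / y)) by (field; lra). rewrite H by lra.
replace (-1 * F (x0, c / y) + l - (l - x0)) with (- (F (x0, c / y) - x0)) by ring. rewrite Rabs_Ropp. apply H1, Hv.
Qed.

Lemma bezout_pos (u p : Z) : rel_prime u p -> exists D B, (u * D - p * B = 1)%Z.
Proof.
intros H. destruct (rel_prime_bezout _ _ H) as [x y E]. exists x, (- y)%Z. lia.
Qed.

(** A matrix of class 2 with lower row [(2p, 2D)] sends infinity to [A/p]. The limit is [l + D/p],
    and [t = p l + D - A] is the excess of its numerator over [A]. For [p = 3] modulo 8 the formula
    [kf] gives [t = 3 (3 (A - D) + 4) + D - A = 4] modulo 8. *)
Lemma kappa_cusp (p A : Z) : (0 < p)%Z -> rel_prime (2 * A) p ->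
 exists t : Z, rl kappa (IZR A / IZR p) (IZR (t + A) / IZR p) /\ ((p mod 8 = 3)%Z -> exists k : Z, t = (4 + 8 * k)%Z).
Proof.
intros Hp Hrel. destruct (bezout_pos _ _ Hrel) as [D [B E]].
destruct (RelK_all 2 A B p D) as [l [n [H Hl]]]; [right; reflexivity|change (2 / 2)%Z with 1%Z; lia|].
assert (Hpp : 0 < IZR p) by (apply (IZR_lt 0), Hp).
exists (p * l + D - A)%Z. split.
- replace (IZR (p * l + D - A + A) / IZR p) with (IZR l - - (IZR (2 * D) / IZR (2 * p))).
 2:{ replace (p * l + D - A + A)%Z with (p * l + D)%Z by ring. rewrite plus_IZR, !mult_IZR. field. lra. }
 replace (IZR A / IZR p) with (IZR (2 * A) / IZR (2 * p)) by (rewrite !mult_IZR; field; lra).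
 apply (cusp_limit kappa (- (IZR (2 * D) / IZR (2 * p))) _ ((IZR (2 * A) * IZR (2 * D) - IZR B * IZR (2 * p)) / (IZR (2 * p)) ^ 2) (-1)).
 + rewrite <- !mult_IZR, <- minus_IZR. apply Rdiv_lt_0_compat; [apply (IZR_lt 0); lia|apply pow_lt, (IZR_lt 0); lia].
 + lra.
 + intros eps Heps. destruct (kappa_lim eps Heps) as [V [HV H1]]. eauto.
 + intros v Hv. assert (Hr2 : 0 < IZR (2 * p)) by (apply (IZR_lt 0); lia). etransitivity; [|exact (GeoK_at _ _ _ _ _ _ Hr2 H v Hv)]. f_equal. f_equal. field. lra.
- intros Hp8. unfold red, kf in Hl. change (2 =? 1)%Z with false in Hl. rewrite Hp8 in Hl. change ((3 * 3 - 1) / 2)%Z with 4%Z in Hl.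
 pose proof (Z.div_mod A 8 ltac:(lia)) as EA. pose proof (Z.div_mod D 8 ltac:(lia)) as ED. pose proof (Z.div_mod p 8 ltac:(lia)) as Ep.
 set (a8 := (A mod 8)%Z) in *. set (d8 := (D mod 8)%Z) in *. set (p8 := (p / 8)%Z) in *.
 exists (p8 * l + 3 * n + (a8 - d8) + 1 + D / 8 - A / 8)%Z. lia.
Qed.

Lemma rl_K4 x L1 L2 : rl kappa x L1 -> rl kappa (3 * x) L2 -> rl K4 x ((L1 + L2) / 4).
Proof.
intros H1 H2 eps Heps. destruct (H1 eps Heps) as [d1 [Hd1 E1]]. destruct (H2 eps Heps) as [d2 [Hd2 E2]].
exists (Rmin d1 (d2 / 3)). split; [apply Rmin_pos; lra|]. intros y Hy. pose proof (Rmin_l d1 (d2 / 3)). pose proof (Rmin_r d1 (d2 / 3)).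
specialize (E1 y ltac:(lra)). specialize (E2 (3 * y) ltac:(lra)). unfold K4.
replace (3 * (x, y))%C with ((3 * x, 3 * y) : C) by Cring.
apply Rabs_def2 in E1. apply Rabs_def2 in E2. apply Rabs_def1; lra.
Qed.

Lemma K4_lim eps : 0 < eps -> exists V, 0 < V /\ forall x v, V < v -> Rabs (K4 (x, v) - x) < eps.
Proof.
intros Heps. destruct (kappa_lim eps Heps) as [V [HV H]]. exists V. split; auto. intros x v Hv. unfold K4.
replace (3 * (x, v))%C with ((3 * x, 3 * v) : C) by Cring.
pose proof (H x v Hv) as E1. pose proof (H (3 * x) (3 * v) ltac:(lra)) as E2.
apply Rabs_def2 in E1. apply Rabs_def2 in E2. apply Rabs_def1; lra.
Qed.

(** On a vertical line the coefficient of [y] in the imaginary part of [A2 X^2 + A1 X + A0] involves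
    only the real parts of [A2] and [A1]. The unknown imaginary parts are confined to [q0] and [q2];
    this is why integrality of the real parts is enough. *)
Lemma Geo_at G om p q r s a b c l sg : 0 < r -> Geo G om p q r s a b c l sg -> exists q0 q2, forall v, 0 < v ->
 let y := (p * s - q * r) / (r ^ 2 * v) in
 Im (Ei (p / r, y)) + (p * s - q * r) / (r * v) ^ 2 * Im (Ei (- (s / r), v)) = q0 - 12 * om * (2 * a * (p / r) + b) * y + q2 * y ^ 2 /\
 K4 (p / r, y) = sg * K4 (- (s / r), v) + l.
Proof.
intros Hr [A2 [A1 [A0 [H2 [H1 [H0 H]]]]]].
exists (Im A2 * (p / r) ^ 2 + Im A1 * (p / r) + Im A0), (- Im A2). intros v Hv y.
destruct (H (- (s / r), v) Hv) as [X [_ [_ [EX [HE HK]]]]]. destruct (mobius_at p q r s v Hr Hv) as [E E'].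
rewrite E in EX. fold y in EX. rewrite EX in HE, HK. rewrite E' in HE.
apply (f_equal Im) in HE. set (e1 := Ei (p / r, y)) in *. set (e0 := Ei (- (s / r), v)) in *.
assert (Ed : ((e0 - G) * (RtoC p * RtoC s - RtoC q * RtoC r) / ((0, (r * v)%R) * (0, (r * v)%R)))%C = (RtoC (- ((p * s - q * r) / (r * v) ^ 2)) * (e0 - G))%C).
{ replace ((0, (r * v)%R) * (0, (r * v)%R))%C with (RtoC (- (r * v) ^ 2)) by Cring.
 rewrite <- !RtoC_mult, <- RtoC_minus. unfold Cdiv. rewrite <- RtoC_inv by (apply Rlt_not_eq; assert (0 < (r * v) ^ 2) by pos; lra).
 replace (RtoC (- ((p * s - q * r) / (r * v) ^ 2))) with (RtoC (p * s - q * r) * RtoC (/ - (r * v) ^ 2))%C by (rewrite <- RtoC_mult; f_equal; field; split; lra).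
 ring. }
rewrite Ed in HE. destruct A2 as [x2 y2], A1 as [x1 y1], A0 as [x0 y0], e0 as [u0 v0], e1 as [u1 v1].
simpl in HE, H1, H2 |- *. nra.
Qed.

(** A matrix of class 6 with lower row [(6p, 6D)]. As [a] is a multiple of 4, [H = 2 a A + b p] is
    [b p] modulo 8, so [H + t] is [p (b + l) + D - A], which [sf] evaluates to 4 modulo 8 in the two
    residue classes of interest. *)
Lemma Ei_cusp G om B0 B3 (p A D B : Z) : periods G om B0 B3 -> (0 < p)%Z -> (6 * A * D - B * p = 1)%Z -> exists (H t : Z) (q0 q2 : R),
 (forall y, 0 < y -> Im (Ei (IZR A / IZR p, y)) + 6 * IZR p ^ 2 * y ^ 2 * Im (Ei (- (IZR D / IZR p), / (6 * IZR p ^ 2 * y)))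
   = q0 - 12 * om / IZR p * IZR H * y + q2 * y ^ 2) /\
 rl K4 (IZR A / IZR p) (IZR (t + A) / IZR p) /\ ((p mod 24 = 7 \/ p mod 24 = 11)%Z -> exists k : Z, H = (4 - t + 8 * k)%Z).
Proof.
intros Hper Hp E.
destruct (Rel_all G om B0 B3 Hper 6 A B p D) as [a [b [c [l [i [j [m [n [H [Ha [Hc [Hb Hs]]]]]]]]]]]]; [right; left; reflexivity|change (6 / 6)%Z with 1%Z; lia|].
assert (Hpp : 0 < IZR p) by (apply (IZR_lt 0), Hp).
exists (2 * a * A + b * p)%Z, (p * l + D - A)%Z.
assert (Hr : 0 < IZR (6 * p)) by (apply (IZR_lt 0); lia).
destruct (Geo_at _ _ _ _ _ _ _ _ _ _ _ Hr H) as [q0 [q2 Hat]]. exists q0, q2.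
assert (Edet : IZR (6 * A) * IZR (6 * D) - IZR B * IZR (6 * p) = 6).
{ rewrite <- !mult_IZR, <- minus_IZR. f_equal. lia. }
assert (EA : IZR (6 * A) / IZR (6 * p) = IZR A / IZR p) by (rewrite !mult_IZR; field; lra).
assert (ED : IZR (6 * D) / IZR (6 * p) = IZR D / IZR p) by (rewrite !mult_IZR; field; lra). rewrite Edet, EA, ED, (mult_IZR 6 p) in Hat.
split; [|split].
- intros y Hy. assert (Hv : 0 < / (6 * IZR p ^ 2 * y)) by pos.
 destruct (Hat _ Hv) as [E1 _]. replace (6 / ((6 * IZR p) ^ 2 * / (6 * IZR p ^ 2 * y))) with y in E1 by (field; split; lra).
 replace (6 / (6 * IZR p * / (6 * IZR p ^ 2 * y)) ^ 2) with (6 * IZR p ^ 2 * y ^ 2) in E1 by (field; split; lra).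
 rewrite E1. rewrite plus_IZR, !mult_IZR. field. lra.
- replace (IZR (p * l + D - A + A) / IZR p) with (IZR l - - (IZR D / IZR p)).
 2:{ replace (p * l + D - A + A)%Z with (p * l + D)%Z by ring. rewrite plus_IZR, !mult_IZR. field. lra. }
 apply (cusp_limit K4 (- (IZR D / IZR p)) _ (6 / (6 * IZR p) ^ 2) (-1)).
 + pos.
 + lra.
 + intros eps Heps. destruct (K4_lim eps Heps) as [V [HV H1]]. exists V. split; [lra|]. intros v Hv. apply H1, Hv.
 + intros v Hv. destruct (Hat v Hv) as [_ E2]. unfold sgn in E2. simpl in E2. rewrite <- E2. f_equal. f_equal. field. split; lra.
- intros Hp24. change (mQ 6) with 0%Z in Ha.
 assert (Es : exists k, (p * sf 6 A B p D + D - A = 4 + 8 * k)%Z).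
 { unfold sf, red, sf8, sf3, sf6, sg3. change (6 =? 1)%Z with false. change (6 =? 2)%Z with false. change (6 =? 6)%Z with true. cbv beta iota delta [orb].
  pose proof (Z.div_mod A 8 ltac:(lia)) as EA8. pose proof (Z.div_mod D 8 ltac:(lia)) as ED8. pose proof (Z.div_mod p 24 ltac:(lia)) as Ep.
  set (a8 := (A mod 8)%Z) in *. set (d8 := (D mod 8)%Z) in *. set (p24 := (p / 24)%Z) in *.
  destruct Hp24 as [Hp24|Hp24]; rewrite Hp24 in Ep.
  - assert (E8 : (p mod 8 = 7)%Z) by (rewrite Ep; replace (24 * p24 + 7)%Z with (7 + (3 * p24) * 8)%Z by ring; apply Z_mod_plus_full).
   assert (E3 : (p mod 3 = 1)%Z) by (rewrite Ep; replace (24 * p24 + 7)%Z with (1 + (8 * p24 + 2) * 3)%Z by ring; apply Z_mod_plus_full).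
   rewrite E8, E3. change ((7 * 7 - 1) / 2)%Z with 24%Z. change (1 mod 3 =? 2)%Z with false.
   exists (3 * p24 * (7 * (a8 - d8) + 36) + 6 * (a8 - d8) + 31 + D / 8 - A / 8)%Z. lia.
  - assert (E8 : (p mod 8 = 3)%Z) by (rewrite Ep; replace (24 * p24 + 11)%Z with (3 + (3 * p24 + 1) * 8)%Z by ring; apply Z_mod_plus_full).
   assert (E3 : (p mod 3 = 2)%Z) by (rewrite Ep; replace (24 * p24 + 11)%Z with (2 + (8 * p24 + 3) * 3)%Z by ring; apply Z_mod_plus_full).
   rewrite E8, E3. change ((3 * 3 - 1) / 2)%Z with 4%Z. change (2 mod 3 =? 2)%Z with true.
   exists (3 * p24 * (3 * (a8 - d8) + 12) + 4 * (a8 - d8) + 16 + D / 8 - A / 8)%Z. lia. }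
 destruct Es as [k Hk]. exists (k + p * n + i * A)%Z. lia.
Qed.

(** * Mellin transforms *)

Lemma cexp_ray_derive u t : is_derive (V := C_R_NormedModule) (fun s : R => cexp (RtoC s * u)) t (u * cexp (RtoC t * u))%C.
Proof.
apply is_derive_C_eps. intros eps Heps.
assert (H : cderiv (fun w => cexp (w * u)) (RtoC t) (cexp (RtoC t * u) * (1 * u + RtoC t * 0))).
{ apply (cderiv_comp cexp (fun w => w * u)%C); [|apply cderiv_cexp]. apply (cderiv_mult (fun w => w) (fun _ => u)); [apply cderiv_id|apply cderiv_const]. }
destruct (H eps Heps) as [d [Hd H1]]. exists d. split; auto. intros s Hs.
specialize (H1 (RtoC s)). rewrite <- RtoC_minus, Cmod_R in H1. specialize (H1 Hs).
replace (RtoC (s - t) * (u * cexp (RtoC t * u)))%C with (cexp (RtoC t * u) * (1 * u + RtoC t * 0) * RtoC (s - t))%C by ring. exact H1.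
Qed.

Lemma holo_real_cont (F : C -> C) a b : (forall z, holo F z) -> ccont (fun s => F (RtoC s)) a b.
Proof.
intros H t _. apply continuous_C_eps. intros eps Heps. destruct (H (RtoC t)) as [l Hl].
destruct (cderiv_cont F _ l Hl eps Heps) as [d [Hd H1]]. exists d. split; eauto. intros s Hs. apply H1.
rewrite <- RtoC_minus, Cmod_R. exact Hs.
Qed.

Lemma ray_cont u a b : ccont (fun s => u * cexp (RtoC s * u))%C a b.
Proof.
apply (holo_real_cont (fun w => u * cexp (w * u))%C). intros z. apply holo_mult; [apply holo_const|].
apply (holo_comp cexp (fun w => w * u)%C); [apply holo_mult; [apply holo_id|apply holo_const]|apply holo_cexp].
Qed.

Lemma cexp_bound u t : 0 <= t <= 1 -> Cmod (cexp (RtoC t * u)) <= exp (Cmod u).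
Proof.
intros Ht. rewrite Cmod_cexp. apply exp_le. pose proof (Cmod_ge_Re u) as H. pose proof (Rle_abs (Re u)).
replace (Re (RtoC t * u)) with (t * Re u) by (unfold Re; simpl; ring). pose proof (Cmod_ge_0 u). nra.
Qed.

Lemma cexp_1 u t : 0 <= t <= 1 -> Cmod (cexp (RtoC t * u) - 1) <= Cmod u * exp (Cmod u).
Proof.
intros Ht. pose proof (cexp_ray_derive u) as Hd.
pose proof (ray_cont u) as Hc.
replace (cexp (RtoC t * u) - 1)%C with (cexp (RtoC t * u) - cexp (RtoC 0 * u))%C.
2:{ replace (RtoC 0 * u)%C with (RtoC 0) by ring. rewrite cexp_0. reflexivity. }
rewrite <- (CInt_prim (fun s => cexp (RtoC s * u)) (fun s => u * cexp (RtoC s * u))%C 0 t); [|lra|easy|easy].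
eapply Rle_trans; [apply (CInt_norm _ 0 t (Cmod u * exp (Cmod u)))|]; [lra|easy| |].
- intros s Hs. rewrite Cmod_mult. apply Rmult_le_compat_l; [pos|apply cexp_bound; lra].
- assert (0 <= Cmod u * exp (Cmod u)) by pos. nra.
Qed.

Lemma cexp_2 u : Cmod (cexp u - 1 - u) <= Cmod u ^ 2 * exp (Cmod u).
Proof.
pose proof (cexp_ray_derive u) as Hd.
pose proof (ray_cont u 0 1) as Hc.
assert (Hk : ccont (fun _ => u) 0 1) by (intros t _; apply continuous_const).
assert (E : (cexp u - 1 - u)%C = CInt (fun s => u * cexp (RtoC s * u) - u)%C 0 1).
{ rewrite CInt_minus by assumption.
 rewrite (CInt_prim (fun s => cexp (RtoC s * u)) (fun s => u * cexp (RtoC s * u))%C 0 1); [|lra|easy|pos].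
 replace (RtoC 1 * u)%C with u by ring. replace (RtoC 0 * u)%C with (RtoC 0) by ring. rewrite cexp_0.
 assert (Ik : CInt (fun _ => u) 0 1 = u).
 { destruct u as [u1 u2]. apply is_CInt_pair; (evar_last; [apply (is_RInt_const (V := R_NormedModule))|unfold scal; simpl; unfold mult; simpl; ring]). }
 rewrite Ik. reflexivity. }
rewrite E. eapply Rle_trans; [apply (CInt_norm _ 0 1 (Cmod u * (Cmod u * exp (Cmod u))))|]; [lra| | |].
- intros t Ht. apply (continuous_minus (V := C_R_NormedModule) (fun s => u * cexp (RtoC s * u))%C (fun _ => u)); [apply Hc, Ht|apply Hk, Ht].
- intros t Ht. replace (u * cexp (RtoC t * u) - u)%C with (u * (cexp (RtoC t * u) - 1))%C by ring. rewrite Cmod_mult.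
 apply Rmult_le_compat_l; [pos|apply cexp_1; lra].
- lra.
Qed.

(** The value 0 for [y <= 0] makes [g y] times the power continuous on all of [[0, 1]] when
    [Re z > 0] and [g] is bounded, so that Mellin integrals are proper Riemann integrals. *)
Definition ypow (y : R) (z : C) : C := if Rle_dec y 0 then RtoC 0 else cexp (z * RtoC (ln y)).
Definition mi (g : R -> R) (z : C) (y : R) : C := (RtoC (g y) * ypow y z)%C.
(* The Mellin transform over [(0, 1]]; the part over [(1, oo)] is always folded back by [y |-> 1/y]. *)
Definition MI (g : R -> R) (z : C) : C := CInt (mi g z) 0 1.
Definition bdd (g : R -> R) (K : R) : Prop := (forall y, 0 < y -> continuous g y) /\ forall y, 0 < y <= 1 -> Rabs (g y) <= K.

Lemma ypow_pos y z : 0 < y -> ypow y z = cexp (z * RtoC (ln y)).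
Proof. intros Hy. unfold ypow. destruct (Rle_dec y 0); [lra|easy]. Qed.

Lemma Cmod_ypow y z : 0 < y -> Cmod (ypow y z) = exp (Re z * ln y).
Proof. intros Hy. rewrite ypow_pos, Cmod_cexp by pos. f_equal. unfold Re; simpl. ring. Qed.

Lemma continuous_pair_C (f h : R -> R) t : continuous f t -> continuous h t -> continuous (U := C_UniformSpace) (fun s => (f s, h s) : C) t.
Proof.
intros Hf Hh. apply continuous_C_eps. intros eps Heps.
assert (H2 : 0 < eps / 2) by lra.
destruct (proj1 (filterlim_locally f (f t)) Hf (mkposreal _ H2)) as [d1 H1].
destruct (proj1 (filterlim_locally h (h t)) Hh (mkposreal _ H2)) as [d2 H3].
exists (Rmin d1 d2). split; [apply Rmin_pos; apply cond_pos|]. intros s Hs. pose proof (Rmin_l d1 d2). pose proof (Rmin_r d1 d2).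
assert (E1 : Rabs (f s - f t) < eps / 2) by (apply (H1 s); change (Rabs (s - t) < d1); lra).
assert (E2 : Rabs (h s - h t) < eps / 2) by (apply (H3 s); change (Rabs (s - t) < d2); lra).
eapply Rle_lt_trans; [apply Cmod_le_l1|]. simpl. unfold Rminus in *. lra.
Qed.

Lemma mi_cont g K z : bdd g K -> 0 < Re z -> ccont (mi g z) 0 1.
Proof.
intros [Hg HK] Hz t Ht. rewrite Rmin_left, Rmax_right in Ht by lra.
destruct (Rle_lt_or_eq_dec 0 t ltac:(lra)) as [Hpos|<-].
- assert (Hc : continuous (fun y => (g y * (exp (Re z * ln y) * cos (Im z * ln y)), g y * (exp (Re z * ln y) * sin (Im z * ln y))) : C) t).
 { apply continuous_pair_C; apply (continuous_mult g); try (apply Hg, Hpos);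
  (apply (ex_derive_continuous (V := R_NormedModule)); auto_derive; tauto). }
 apply (continuous_ext_loc _ (fun y => (g y * (exp (Re z * ln y) * cos (Im z * ln y)), g y * (exp (Re z * ln y) * sin (Im z * ln y))) : C)); auto.
 exists (mkposreal t Hpos). intros y Hy. change (Rabs (y - t) < t) in Hy. apply Rabs_def2 in Hy.
 unfold mi. rewrite ypow_pos by lra. destruct z as [x v]. unfold Cmult; simpl.
 replace (x * ln y - v * 0) with (x * ln y) by ring. replace (x * 0 + v * ln y) with (v * ln y) by ring. f_equal; ring.
- apply continuous_C_eps. intros eps Heps.
 assert (HK0 : 0 <= K) by (eapply Rle_trans; [apply Rabs_pos|apply (HK 1); lra]).
 exists (Rmin 1 (exp (ln (eps / (K + 1)) / Re z))). split; [apply Rmin_pos; pos|].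
 intros s Hs. pose proof (Rmin_l 1 (exp (ln (eps / (K + 1)) / Re z))). pose proof (Rmin_r 1 (exp (ln (eps / (K + 1)) / Re z))).
 assert (E0 : mi g z 0 = RtoC 0) by (unfold mi, ypow; destruct (Rle_dec 0 0); [ring|lra]). rewrite E0.
 replace (mi g z s - 0)%C with (mi g z s) by ring.
 destruct (Rle_dec s 0) as [Hs0|Hs0].
 + unfold mi, ypow. destruct (Rle_dec s 0); [|lra]. rewrite Cmult_0_r, Cmod_0. exact Heps.
 + rewrite Rabs_right in Hs by lra. unfold mi. rewrite Cmod_mult, Cmod_R, Cmod_ypow by lra.
  assert (Hlt : exp (Re z * ln s) < eps / (K + 1)).
  { assert (Hp : 0 < eps / (K + 1)) by pos.
   rewrite <- (exp_ln (eps / (K + 1))) by lra. apply exp_increasing.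
   assert (ln s < ln (eps / (K + 1)) / Re z) by (rewrite <- (ln_exp (ln (eps / (K + 1)) / Re z)); apply ln_increasing; lra).
   apply Rmult_lt_compat_l with (r := Re z) in H1; auto. replace (Re z * (ln (eps / (K + 1)) / Re z)) with (ln (eps / (K + 1))) in H1 by (field; lra). exact H1. }
  pose proof (HK s ltac:(lra)) as Hgs. pose proof (exp_pos (Re z * ln s)).
  apply Rle_lt_trans with (K * (eps / (K + 1))); [nra|].
  apply Rmult_lt_reg_r with (K + 1); [lra|]. replace (K * (eps / (K + 1)) * (K + 1)) with (K * eps) by (field; lra). nra.
Qed.

Lemma t_exp_bound (x t : R) : 0 < x -> 0 <= t -> t * exp (- (t * x)) <= / x /\ t ^ 2 * exp (- (t * x)) <= 4 / x ^ 2.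
Proof.
intros Hx Ht.
assert (H1 : forall s, 0 <= s -> s * exp (- s) <= 1).
{ intros s Hs. pose proof (exp_ineq1_le s). rewrite exp_Ropp. apply Rmult_le_reg_r with (exp s); [lra|].
 rewrite Rmult_assoc, Rinv_l by lra. lra. }
split.
- apply Rmult_le_reg_r with x; auto. rewrite Rinv_l by lra. pose proof (H1 (t * x) ltac:(apply Rmult_le_pos; lra)). lra.
- assert (Hx2 : 0 < x ^ 2) by pos. pose proof (H1 (t * x / 2) ltac:(apply Rmult_le_pos; [apply Rmult_le_pos; lra|lra])) as H2. replace (- (t * x)) with (- (t * x / 2) + - (t * x / 2)) by lra. rewrite exp_plus.
 apply Rmult_le_reg_r with (x ^ 2); auto. replace (4 / x ^ 2 * x ^ 2) with 4 by (field; lra).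
 assert (H0 : 0 <= t * x / 2 * exp (- (t * x / 2))) by pos. nra.
Qed.

Lemma ypow_plus y z w : ypow y (z + w) = (ypow y z * ypow y w)%C.
Proof.
unfold ypow. destruct (Rle_dec y 0); [ring|]. rewrite <- cexp_plus. f_equal. ring.
Qed.

Lemma ln_neg y : 0 < y <= 1 -> ln y <= 0.
Proof. intros Hy. rewrite <- ln_1. destruct (Req_dec y 1) as [->|]; [lra|]. left. apply ln_increasing; lra. Qed.

(** The derivative contains the factor [ln y], unbounded at 0. Half of the exponent, [y^(x/2)], is
    moved into the function, where it dominates the logarithm; the derivative is then again a
    transform [MI g1 z1] of the same kind. *)
Lemma MI_holo g K z : bdd g K -> 0 < Re z -> holo (MI g) z.
Proof.
intros Hg Hz. pose proof Hg as [Hgc HK]. set (x := Re z) in *.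
assert (HK0 : 0 <= K) by (eapply Rle_trans; [apply Rabs_pos|apply (HK 1); lra]).
set (g1 := fun y => g y * ln y * exp (x / 2 * ln y)). set (z1 := (z - RtoC (x / 2))%C).
assert (Hz1 : 0 < Re z1) by (change (0 < Re z + - (x / 2)); fold x; lra).
assert (Hg1 : bdd g1 (K * (2 / x))).
{ split.
 - intros y Hy. apply (continuous_mult (fun y => g y * ln y)); [apply (continuous_mult g)|]; try (apply Hgc, Hy);
  (apply (ex_derive_continuous (V := R_NormedModule)); auto_derive; tauto).
 - intros y Hy. unfold g1. rewrite Rmult_assoc, Rabs_mult. pose proof (ln_neg y Hy).
  destruct (t_exp_bound (x / 2) (- ln y) ltac:(lra) ltac:(lra)) as [H1 _].
  replace (- (- ln y * (x / 2))) with (x / 2 * ln y) in H1 by ring. replace (/ (x / 2)) with (2 / x) in H1 by (field; lra).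
  apply Rmult_le_compat; try apply Rabs_pos; auto. rewrite Rabs_mult, (Rabs_left1 (ln y)), (Rabs_right (exp _)) by (lra || (left; apply exp_pos)). exact H1. }
exists (MI g1 z1). intros eps Heps.
set (Cst := K * (16 / x ^ 2)).
assert (HC : 0 <= Cst) by pos.
exists (Rmin (x / 2) (eps / (Cst + 1))). split; [apply Rmin_pos; pos|].
intros w Hw. pose proof (Rmin_l (x / 2) (eps / (Cst + 1))). pose proof (Rmin_r (x / 2) (eps / (Cst + 1))).
set (h := (w - z)%C) in *. pose proof (Cmod_ge_0 h) as Hh0.
assert (Hwz : w = (z + h)%C) by (unfold h; ring).
assert (Hwr : 0 < Re w) by (rewrite Hwz; change (0 < Re z + Re h); pose proof (Cmod_ge_Re h) as H1; apply Rabs_le_between in H1; fold x; lra).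
pose proof (mi_cont g K w Hg Hwr) as C1. pose proof (mi_cont g K z Hg Hz) as C2. pose proof (mi_cont g1 _ z1 Hg1 Hz1) as C3.
assert (C4 : ccont (fun y => h * mi g1 z1 y)%C 0 1).
{ intros t Ht. specialize (C3 t Ht). apply continuous_C_eps. intros e He.
 assert (He' : 0 < e / (Cmod h + 1)) by pos.
 destruct (proj1 (filterlim_locally (mi g1 z1) (mi g1 z1 t)) C3 (mkposreal _ (Rlt_mult_inv_pos _ 2 He' Rlt_0_2))) as [d Hd].
 exists d. split; [apply cond_pos|]. intros s Hs. specialize (Hd s Hs). destruct Hd as [Hd1 Hd2].
 replace (h * mi g1 z1 s - h * mi g1 z1 t)%C with (h * (mi g1 z1 s - mi g1 z1 t))%C by ring. rewrite Cmod_mult.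
 change (Rabs (Re (mi g1 z1 s) - Re (mi g1 z1 t)) < e / (Cmod h + 1) / 2) in Hd1. change (Rabs (Im (mi g1 z1 s) - Im (mi g1 z1 t)) < e / (Cmod h + 1) / 2) in Hd2.
 assert (Hm : Cmod (mi g1 z1 s - mi g1 z1 t) < e / (Cmod h + 1)).
 { eapply Rle_lt_trans; [apply Cmod_le_l1|]. change (Rabs (Re (mi g1 z1 s) - Re (mi g1 z1 t)) + Rabs (Im (mi g1 z1 s) - Im (mi g1 z1 t)) < e / (Cmod h + 1)). lra. }
 apply Rle_lt_trans with (Cmod h * (e / (Cmod h + 1))); [nra|].
 apply Rmult_lt_reg_r with (Cmod h + 1); [lra|]. replace (Cmod h * (e / (Cmod h + 1)) * (Cmod h + 1)) with (Cmod h * e) by (field; lra). nra. }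
assert (C12 : ccont (fun y => mi g w y - mi g z y)%C 0 1) by (intros t Ht; apply (continuous_minus (V := C_R_NormedModule)); auto).
assert (C124 : ccont (fun y => mi g w y - mi g z y - h * mi g1 z1 y)%C 0 1) by (intros t Ht; apply (continuous_minus (V := C_R_NormedModule)); auto).
assert (E : (MI g w - MI g z - MI g1 z1 * h)%C = CInt (fun y => mi g w y - mi g z y - h * mi g1 z1 y)%C 0 1).
{ rewrite CInt_minus, CInt_minus, CInt_scal by assumption. Cring. }
rewrite E. eapply Rle_trans; [apply (CInt_norm _ 0 1 (Cst * Cmod h ^ 2))|]; [lra|pos| |].
- intros y Hy. destruct (Rle_lt_or_eq_dec 0 y ltac:(lra)) as [Hpos|<-].
 2:{ unfold mi, ypow. destruct (Rle_dec 0 0); [|lra]. replace (RtoC (g 0) * 0 - RtoC (g 0) * 0 - h * (RtoC (g1 0) * 0))%C with (RtoC 0) by ring.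
   rewrite Cmod_0. apply Rmult_le_pos; nra. }
 pose proof (ln_neg y ltac:(lra)) as Hln. set (u := (h * RtoC (ln y))%C).
 assert (Eq : (mi g w y - mi g z y - h * mi g1 z1 y)%C = (RtoC (g y) * ypow y z * (cexp u - 1 - u))%C).
 { unfold mi. rewrite Hwz, ypow_plus, (ypow_pos y h) by lra.
  assert (E1 : (RtoC (g1 y) * ypow y z1)%C = (RtoC (g y) * RtoC (ln y) * ypow y z)%C).
  { assert (Ez : ypow y z = (ypow y z1 * RtoC (exp (x / 2 * ln y)))%C).
   { replace z with (z1 + RtoC (x / 2))%C at 1 by (unfold z1; ring). rewrite ypow_plus. f_equal. rewrite ypow_pos by lra.
    unfold cexp, RtoC; simpl. replace (x / 2 * ln y - 0 * 0) with (x / 2 * ln y) by ring. replace (x / 2 * 0 + 0 * ln y) with 0 by ring.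
    rewrite cos_0, sin_0. f_equal; ring. }
   rewrite Ez. unfold g1. Cring. }
  rewrite E1. Cring. }
 rewrite Eq, !Cmod_mult, Cmod_R, Cmod_ypow by lra.
 assert (Hu : Cmod u = Cmod h * - ln y) by (unfold u; rewrite Cmod_mult, Cmod_R, Rabs_left1 by lra; reflexivity).
 pose proof (cexp_2 u) as H2. rewrite Hu in H2.
 assert (H3 : exp (Cmod h * - ln y) <= exp (x / 2 * - ln y)) by (apply exp_le; apply Rmult_le_compat_r; lra).
 destruct (t_exp_bound (x / 2) (- ln y) ltac:(lra) ltac:(lra)) as [_ H4]. replace (4 / (x / 2) ^ 2) with (16 / x ^ 2) in H4 by (field; lra).
 assert (E5 : exp (x * ln y) * exp (x / 2 * - ln y) = exp (- (- ln y * (x / 2)))) by (rewrite <- exp_plus; f_equal; field).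
 pose proof (HK y ltac:(lra)) as Hgy. pose proof (Rabs_pos (g y)). pose proof (exp_pos (x * ln y)).
 assert (H6 : exp (x * ln y) * Cmod (cexp u - 1 - u) <= 16 / x ^ 2 * Cmod h ^ 2).
 { apply Rle_trans with (exp (x * ln y) * ((Cmod h * - ln y) ^ 2 * exp (x / 2 * - ln y))).
  - apply Rmult_le_compat_l; [lra|]. eapply Rle_trans; eauto. apply Rmult_le_compat_l; pos.
  - replace (exp (x * ln y) * ((Cmod h * - ln y) ^ 2 * exp (x / 2 * - ln y))) with ((- ln y) ^ 2 * (exp (x * ln y) * exp (x / 2 * - ln y)) * Cmod h ^ 2) by ring.
   rewrite E5. apply Rmult_le_compat_r; pos. }
 rewrite Rmult_assoc. unfold Cst. rewrite Rmult_assoc. apply Rmult_le_compat; try assumption. apply Rmult_le_pos; pos.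
- assert (Hle : Cmod h * (Cst + 1) <= eps).
 { apply Rle_trans with (eps / (Cst + 1) * (Cst + 1)); [nra|right; field; lra]. } nra.
Qed.

Definition rpow (y x : R) : R := if Rle_dec y 0 then 0 else exp (x * ln y).

Lemma ypow_real y x : ypow y (RtoC x) = RtoC (rpow y x).
Proof.
unfold ypow, rpow. destruct (Rle_dec y 0); auto. unfold cexp, RtoC; simpl.
replace (x * ln y - 0 * 0) with (x * ln y) by ring. replace (x * 0 + 0 * ln y) with 0 by ring. rewrite cos_0, sin_0. f_equal; ring.
Qed.

Lemma MI_real g K x : bdd g K -> 0 < x -> is_RInt (fun y => g y * rpow y x) 0 1 (Re (MI g (RtoC x))) /\ Im (MI g (RtoC x)) = 0.
Proof.
intros Hg Hx. destruct (CInt_parts _ 0 1 (mi_cont g K (RtoC x) Hg Hx)) as [H1 H2]. fold (MI g (RtoC x)) in H1, H2. split.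
- apply (is_RInt_ext (fun y => Re (mi g (RtoC x) y))); auto. intros y _. unfold mi. rewrite ypow_real. unfold Re; simpl. ring.
- assert (H3 : is_RInt (fun t => Im (mi g (RtoC x) t)) 0 1 0).
 { apply (is_RInt_ext (fun _ => 0)); [intros y _; unfold mi; rewrite ypow_real; simpl; ring|].
  evar_last; [apply (is_RInt_const (V := R_NormedModule) 0 1 0)|]. unfold scal; simpl; unfold mult; simpl. ring. }
 apply (is_RInt_unique (V := R_CompleteNormedModule)) in H2. apply (is_RInt_unique (V := R_CompleteNormedModule)) in H3. lra.
Qed.

Lemma PS_small c r : c 0%nat = 0 -> Rbar_le 1 (CV_radius c) -> 0 < r < 1 -> exists K, 0 <= K /\ forall x, 0 <= x <= r -> Rabs (PSeries c x) <= K * x.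
Proof.
intros H0 Hc Hr. set (d := PS_decr_1 c).
assert (Hd : Rbar_le 1 (CV_radius d)) by (unfold d; rewrite CV_radius_decr_1; exact Hc).
assert (He : forall x, 0 <= x <= r -> ex_series (fun n => Rabs (d n * x ^ n))).
{ intros x Hx. apply CV_disk_inside, radius_lt; [pos|rewrite Rabs_right; lra]. }
exists (Series (fun n => Rabs (d n * r ^ n))). split.
- via (Rabs_pos (d 0%nat * r ^ 0)). apply (Series_term_le (fun n => Rabs (d n * r ^ n)) 0); [intros; apply Rabs_pos|apply He; lra].
- intros x Hx. assert (E : PSeries c x = x * PSeries d x).
 { rewrite (PSeries_decr_1 c x); [rewrite H0; fold d; ring|]. apply CV_radius_inside, radius_lt; [pos|rewrite Rabs_right; lra]. }
 rewrite E, Rabs_mult, (Rabs_right x), Rmult_comm by lra. apply Rmult_le_compat_r; [lra|].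
 eapply Rle_trans; [apply Series_Rabs, He, Hx|]. apply Series_le; [|apply He; lra]. intros n. split; [pos|].
 rewrite !Rabs_mult. apply Rmult_le_compat_l; [pos|]. rewrite !Rabs_right by (apply Rle_ge, pow_le; lra). apply pow_incr. lra.
Qed.

Lemma exp_neg_pow (k : nat) u : 0 < u -> exp (- u) * u ^ k <= INR (fact k).
Proof.
intros Hu. revert u Hu.
assert (Hx : forall u, 0 <= u -> u ^ k / INR (fact k) <= exp u).
{ intros u Hu. pose proof (is_exp_Reals u) as He. apply is_pseries_R in He.
 assert (Ex : ex_series (fun n => / INR (fact n) * u ^ n)) by (exists (exp u); exact He).
 rewrite <- (is_series_unique _ _ He). unfold Rdiv. rewrite Rmult_comm.
 apply (Series_term_le (fun n => / INR (fact n) * u ^ n)); auto.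
 intros n. apply Rmult_le_pos; pos. }
intros u Hu. specialize (Hx u ltac:(lra)). rewrite exp_Ropp. pose proof (exp_pos u). pose proof (INR_fact_lt_0 k).
apply Rmult_le_reg_r with (exp u / INR (fact k)); [pos|].
replace (/ exp u * u ^ k * (exp u / INR (fact k))) with (u ^ k / INR (fact k)) by (field; split; lra).
replace (INR (fact k) * (exp u / INR (fact k))) with (exp u) by (field; lra). exact Hx.
Qed.

Lemma rpow_pos y x : 0 < y -> rpow y x = exp (x * ln y).
Proof. intros Hy. unfold rpow. destruct (Rle_dec y 0); lra. Qed.

Lemma rpow_nat y n x : 0 < y -> y ^ n * rpow y x = rpow y (INR n + x).
Proof.
intros Hy. rewrite !rpow_pos by pos. rewrite <- (exp_ln y) at 1 by lra. rewrite exp_pow_INR, <- exp_plus. Cring.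
Qed.

Lemma rpow_le1 y x : 0 < y <= 1 -> 0 <= x -> 0 < rpow y x <= 1.
Proof.
intros Hy Hx. rewrite rpow_pos by lra. split; [pos|]. rewrite <- exp_0. apply exp_le. pose proof (ln_neg y Hy). nra.
Qed.

Lemma rpow_cont x t : 0 < x -> continuous (fun y => rpow y x) t.
Proof.
intros Hx. destruct (Rtotal_order t 0) as [Ht|[->|Ht]].
- apply (continuous_ext_loc _ (fun _ => 0)); [|apply continuous_const]. exists (mkposreal (- t) ltac:(lra)). intros y Hy.
 change (Rabs (y - t) < - t) in Hy. apply Rabs_def2 in Hy. unfold rpow. destruct (Rle_dec y 0); lra.
- apply filterlim_locally. intros eps. exists (mkposreal _ (exp_pos (ln eps / x))). intros y Hy.
 change (Rabs (y - 0) < exp (ln eps / x)) in Hy. change (Rabs (rpow y x - rpow 0 x) < eps).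
 unfold rpow at 2. destruct (Rle_dec 0 0); [|lra]. rewrite Rminus_0_r. pose proof (cond_pos eps) as He.
 destruct (Rle_dec y 0) as [Hy0|Hy0]; [unfold rpow; destruct (Rle_dec y 0); [rewrite Rabs_R0; exact He|lra]|].
 rewrite rpow_pos by lra. rewrite Rabs_right in Hy by lra. rewrite Rabs_right by (left; apply exp_pos).
 rewrite <- (exp_ln eps) by lra. apply exp_increasing.
 assert (ln y < ln eps / x) by (rewrite <- (ln_exp (ln eps / x)); apply ln_increasing; lra).
 apply Rmult_lt_compat_l with (r := x) in H; auto. replace (x * (ln eps / x)) with (ln eps) in H by (field; lra). exact H.
- apply (continuous_ext_loc _ (fun y => exp (x * ln y))).
 + exists (mkposreal t Ht). intros y Hy. change (Rabs (y - t) < t) in Hy. apply Rabs_def2 in Hy. symmetry. apply rpow_pos. lra.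
 + apply (ex_derive_continuous (V := R_NormedModule)). auto_derive. exact Ht.
Qed.

(** * The Gamma integral cut at y = 1 *)

Definition gA (l y : R) : R := exp (- (l * y)).
Definition gB (l y : R) : R := exp (- (l / y)) / y ^ 16.

Lemma gA_bdd l : 0 <= l -> bdd (gA l) 1.
Proof.
intros Hl. split.
- intros y _. unfold gA. apply (ex_derive_continuous (V := R_NormedModule)). auto_derive. exact I.
- intros y Hy. rewrite Rabs_right by (left; apply exp_pos). rewrite <- exp_0. apply exp_le. nra.
Qed.

Lemma gB_bound k l y : 0 < l -> 0 < y <= 1 -> exp (- (l / y)) <= INR (fact k) / l ^ k * y ^ k.
Proof.
intros Hl Hy. assert (Hly : 0 < l / y) by pos. pose proof (exp_neg_pow k (l / y) Hly) as H.
assert (0 < l ^ k) by pos. assert (0 < y ^ k) by pos.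
unfold Rdiv in H at 2. rewrite Rpow_mult_distr, pow_inv in H.
apply Rmult_le_reg_r with (l ^ k * / y ^ k); [pos|].
replace (INR (fact k) / l ^ k * y ^ k * (l ^ k * / y ^ k)) with (INR (fact k)) by (field; split; lra). exact H.
Qed.

Lemma gB_bdd l : 0 < l -> bdd (gB l) (INR (fact 16) / l ^ 16).
Proof.
intros Hl. split.
- intros y Hy. unfold gB. apply (ex_derive_continuous (V := R_NormedModule)). auto_derive. split; [lra|]. split; auto. pos.
- intros y Hy. unfold gB. assert (Hy16 : 0 < y ^ 16) by pos.
 rewrite Rabs_right by (left; apply Rdiv_lt_0_compat; pos).
 pose proof (gB_bound 16 l y Hl Hy) as H. apply Rmult_le_reg_r with (y ^ 16); auto.
 unfold Rdiv at 1. rewrite Rmult_assoc, Rinv_l, Rmult_1_r by lra. exact H.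
Qed.

(** Together with [IB] this is the integral of [exp (- l y) y^(w-1)] over the half line, the part
    beyond 1 being folded by [y -> 1/y] into [exp (- l / y) y^(-w-1)]. *)
Definition IA (l w : R) : R := Re (MI (gA l) (RtoC (w - 1))).
Definition IB (l w : R) : R := Re (MI (gB l) (RtoC (15 - w))).

Lemma IA_int l w : 0 < l -> 1 < w -> is_RInt (fun y => gA l y * rpow y (w - 1)) 0 1 (IA l w).
Proof. intros Hl Hw. apply (MI_real (gA l) 1); [apply gA_bdd; lra|lra]. Qed.

Lemma IB_int l w : 0 < l -> w < 15 -> is_RInt (fun y => gB l y * rpow y (15 - w)) 0 1 (IB l w).
Proof. intros Hl Hw. eapply MI_real; [apply gB_bdd, Hl|lra]. Qed.

Definition hg (w u : R) : R := exp (- u) * rpow u (w - 1).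
Definition gam (w x : R) : R := RInt (hg w) 0 x.

Lemma hg_cont w u : 1 < w -> continuous (hg w) u.
Proof.
intros Hw. apply (continuous_mult (fun u => exp (- u))); [apply (ex_derive_continuous (V := R_NormedModule)); auto_derive; exact I|apply rpow_cont; lra].
Qed.

Lemma gam_derive w x : 1 < w -> is_derive (gam w) x (hg w x).
Proof.
intros Hw. apply (is_derive_RInt (hg w) (gam w) 0 x); [|apply hg_cont, Hw].
exists (mkposreal 1 Rlt_0_1). intros y _. apply (RInt_correct (V := R_CompleteNormedModule)), (ex_RInt_continuous (V := R_CompleteNormedModule)). intros z _. apply hg_cont, Hw.
Qed.

Lemma rpow_mult l y x : 0 < l -> rpow (l * y) x = exp (x * ln l) * rpow y x.
Proof.
intros Hl. unfold rpow. destruct (Rle_dec y 0) as [H|H].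
- destruct (Rle_dec (l * y) 0) as [H1|H1]; [ring|nra].
- destruct (Rle_dec (l * y) 0) as [H1|H1]; [nra|]. rewrite ln_mult, <- exp_plus by lra. Cring.
Qed.

Lemma IA_gam l w : 0 < l -> 1 < w -> exp (w * ln l) * IA l w = gam w l.
Proof.
intros Hl Hw.
assert (H : is_RInt (hg w) (l * 0 + 0) (l * 1 + 0) (gam w l)).
{ replace (l * 0 + 0) with 0 by ring. replace (l * 1 + 0) with l by ring. apply (RInt_correct (V := R_CompleteNormedModule)), (ex_RInt_continuous (V := R_CompleteNormedModule)). intros z _. apply hg_cont, Hw. }
apply (is_RInt_comp_lin (hg w) l 0 0 1) in H. pose proof (IA_int l w Hl Hw) as H2.
apply (is_RInt_scal _ 0 1 (exp (w * ln l))) in H2.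
assert (H3 : is_RInt (fun y => scal (exp (w * ln l)) (gA l y * rpow y (w - 1))) 0 1 (gam w l)).
{ apply (is_RInt_ext (fun y => scal l (hg w (l * y + 0)))); auto. intros y _. unfold scal; simpl; unfold mult; simpl. unfold hg, gA.
 rewrite Rplus_0_r, rpow_mult by lra. replace (exp (w * ln l)) with (l * exp ((w - 1) * ln l)); [ring|].
 rewrite <- (exp_ln l) at 1 by lra. rewrite <- exp_plus. Cring. }
apply (is_RInt_unique (V := R_CompleteNormedModule)) in H2. apply (is_RInt_unique (V := R_CompleteNormedModule)) in H3. rewrite <- H3. easy.
Qed.

(** The substitution [u = l / y] turns the folded integral over [[l/x, 1]] into the incomplete Gamma
    integral from [l] to [x]. The piece over [[0, l/x]] is of order [1/x] because the integrand is
    bounded. *)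
Lemma IB_gam l w : 0 < l -> 1 < w < 15 -> exists K, 0 <= K /\ forall x, l < x -> Rabs (gam w x - gam w l - exp (w * ln l) * IB l w) <= K / x.
Proof.
intros Hl Hw. set (KB := INR (fact 16) / l ^ 16). destruct (gB_bdd l Hl) as [_ HK]. fold KB in HK.
assert (HK0 : 0 <= KB) by (eapply Rle_trans; [apply Rabs_pos|apply (HK 1); lra]).
pose proof (exp_pos (w * ln l)) as Hexp.
exists (exp (w * ln l) * (KB * l)). split; [pos|]. intros x Hx.
set (d := l / x). assert (Hd : 0 < d < 1).
{ unfold d. split; [pos|]. apply Rmult_lt_reg_r with x; [lra|]. unfold Rdiv. rewrite Rmult_assoc, Rinv_l by lra. lra. }
set (k := fun y => gB l y * rpow y (15 - w)).
assert (Hprim : is_RInt (fun y => exp (w * ln l) * k y) d 1 (gam w x - gam w l)).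
{ replace (gam w x - gam w l) with (minus (- gam w (l / 1)) (- gam w (l / d))).
 2:{ unfold d. replace (l / (l / x)) with x by (field; split; lra). replace (l / 1) with l by lra. unfold minus, plus, opp; simpl. ring. }
 apply (is_RInt_derive (V := R_CompleteNormedModule) (fun y => - gam w (l / y))).
 - intros y Hy. rewrite Rmin_left, Rmax_right in Hy by lra.
  assert (Hly : 0 < l / y) by pos.
  evar_last.
  + apply (is_derive_opp (fun y => gam w (l / y))), (is_derive_comp (gam w) (fun y => l / y)); [apply gam_derive; lra|].
   auto_derive; [lra|easy].
  + unfold opp, scal; simpl; unfold mult; simpl. unfold k, gB, hg.
   rewrite !rpow_pos by lra. unfold Rdiv at 2. rewrite ln_mult, ln_Rinv by (try apply Rinv_0_lt_compat; lra).
   replace (exp ((w - 1) * (ln l + - ln y))) with (exp (w * ln l) * exp ((15 - w) * ln y) * / l * / y ^ 14).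
   * field. split; lra.
   * rewrite <- (exp_ln l) at 2 by lra. rewrite <- (exp_ln y) at 2 by lra. rewrite exp_pow_INR, <- !exp_Ropp, <- !exp_plus. Cring.
 - intros y Hy. rewrite Rmin_left, Rmax_right in Hy by lra. apply (continuous_mult (fun _ => exp (w * ln l))); [apply continuous_const|].
  apply (continuous_mult (gB l)); [apply gB_bdd; lra|apply rpow_cont; lra]. }
pose proof (IB_int l w Hl ltac:(lra)) as Hall.
assert (Hex : ex_RInt k 0 d).
{ apply (ex_RInt_Chasles_1 (V := R_CompleteNormedModule) k 0 d 1); [lra|exists (IB l w); exact Hall]. }
destruct Hex as [v Hv].
assert (Hex2 : is_RInt (fun y => exp (w * ln l) * k y) 0 1 (exp (w * ln l) * v + (gam w x - gam w l))).
{ apply (is_RInt_Chasles (V := R_NormedModule) _ 0 d 1 (exp (w * ln l) * v) (gam w x - gam w l)); auto. apply (is_RInt_scal k 0 d (exp (w * ln l)) v Hv). }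
apply (is_RInt_scal k 0 1 (exp (w * ln l))) in Hall.
assert (E : exp (w * ln l) * IB l w = exp (w * ln l) * v + (gam w x - gam w l)).
{ apply (is_RInt_unique (V := R_CompleteNormedModule)) in Hall. apply (is_RInt_unique (V := R_CompleteNormedModule)) in Hex2. rewrite <- Hex2. easy. }
replace (gam w x - gam w l - exp (w * ln l) * IB l w) with (- (exp (w * ln l) * v)) by lra.
rewrite Rabs_Ropp, Rabs_mult, (Rabs_right (exp _)) by lra. unfold Rdiv. rewrite !Rmult_assoc. apply Rmult_le_compat_l; [lra|].
assert (Hn : Rabs v <= (d - 0) * KB).
{ apply (norm_RInt_le_const (V := R_NormedModule) k 0 d v KB); [lra| |pos]. intros y Hy.
 change (Rabs (k y) <= KB). destruct (Rle_lt_or_eq_dec 0 y ltac:(lra)) as [Hp|<-].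
 - unfold k. rewrite Rabs_mult. pose proof (HK y ltac:(lra)). pose proof (rpow_le1 y (15 - w) ltac:(lra) ltac:(lra)) as Hr.
  rewrite (Rabs_right (rpow _ _)) by lra. nra.
 - unfold k, rpow. destruct (Rle_dec 0 0); [|lra]. rewrite Rmult_0_r, Rabs_R0. exact HK0. }
eapply Rle_trans; eauto. unfold d. lra.
Qed.

(** Both sides are the limit of [gam w x] as [x] grows, and [gam] does not involve [l]. This scaling
    is all that termwise integration of the theta series requires of the Gamma function. *)
Lemma gamma_scale l w : 0 < l -> 1 < w < 15 -> exp (w * ln l) * (IA l w + IB l w) = IA 1 w + IB 1 w.
Proof.
intros Hl Hw.
destruct (IB_gam l w Hl Hw) as [K1 [HK1 H1]]. destruct (IB_gam 1 w Rlt_0_1 Hw) as [K2 [HK2 H2]].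
assert (E1 : exp (w * ln 1) = 1) by (rewrite ln_1, Rmult_0_r; apply exp_0). rewrite E1 in H2.
pose proof (IA_gam l w Hl ltac:(lra)) as G1. pose proof (IA_gam 1 w Rlt_0_1 ltac:(lra)) as G2. rewrite E1 in G2.
set (L1 := exp (w * ln l) * (IA l w + IB l w)). set (L2 := IA 1 w + IB 1 w).
destruct (Req_dec L1 L2) as [|Hne]; [assumption|exfalso].
assert (He : 0 < Rabs (L1 - L2)) by (apply Rabs_pos_lt; lra).
set (x := l + 1 + (K1 + K2) / Rabs (L1 - L2)).
assert (Hq : 0 <= (K1 + K2) / Rabs (L1 - L2)) by pos.
specialize (H1 x ltac:(unfold x; lra)). specialize (H2 x ltac:(unfold x; lra)).
assert (Hx : 0 < x) by (unfold x; lra).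
assert (Ht : Rabs (L1 - L2) <= (K1 + K2) / x).
{ replace (L1 - L2) with (- (gam w x - gam w l - exp (w * ln l) * IB l w) + (gam w x - gam w 1 - 1 * IB 1 w)) by (unfold L1, L2; lra).
 via Rabs_triang. rewrite Rabs_Ropp. lra. }
assert (Hc : Rabs (L1 - L2) * x <= K1 + K2).
{ apply Rle_trans with ((K1 + K2) / x * x); [nra|right; field; lra]. }
assert (Hc2 : Rabs (L1 - L2) * x = Rabs (L1 - L2) * (l + 1) + (K1 + K2)) by (unfold x; field; lra). nra.
Qed.

Lemma is_RInt_rsum (f : nat -> R -> R) (v : nat -> R) N : (forall n, is_RInt (f n) 0 1 (v n)) -> is_RInt (fun y => rsum (fun n => f n y) N) 0 1 (rsum v N).
Proof.
intros H. induction N as [|N IH].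
- rewrite rsum_O. apply (is_RInt_ext (f 0%nat)); [symmetry; apply rsum_O|easy].
- rewrite rsum_S. apply (is_RInt_ext (fun y => rsum (fun n => f n y) N + f (S N) y)); [intros y _; symmetry; apply (rsum_S (fun n => f n y))|].
 apply (is_RInt_plus (fun y => rsum (fun n => f n y) N) (f (S N)) 0 1 _ _ IH (H (S N))).
Qed.

Lemma series_tail (u b : nat -> R) l N : ex_series b -> (forall n, Rabs (u n) <= b n) -> is_series u l -> Rabs (l - rsum u N) <= Series b - rsum b N.
Proof.
intros Hb Hu Hl.
assert (L1 : is_lim_seq (sum_n u) l) by pos.
assert (L2 : is_lim_seq (sum_n b) (Series b)) by exact (Series_correct _ Hb).
assert (Hle : forall n, Rabs (rsum u (n + N) - rsum u N) <= rsum b (n + N) - rsum b N).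
{ induction n as [|n IH]; [rewrite !Rminus_diag, Rabs_R0; lra|]. change (S n + N)%nat with (S (n + N)). rewrite !rsum_S.
 replace (rsum u (n + N) + u (S (n + N)) - rsum u N) with ((rsum u (n + N) - rsum u N) + u (S (n + N))) by ring.
 via Rabs_triang. specialize (Hu (S (n + N))). lra. }
assert (HR : Rbar_le (Rabs (l - rsum u N)) (Series b - rsum b N)); auto.
apply (is_lim_seq_le (fun n => Rabs (rsum u (n + N) - rsum u N)) (fun n => rsum b (n + N) - rsum b N)); [pos| |].
- apply (is_lim_seq_abs (fun n => rsum u (n + N) - rsum u N) (l - rsum u N)), is_lim_seq_minus'; [|apply is_lim_seq_const].
 apply (proj1 (is_lim_seq_incr_n (sum_n u) N l)), L1.
- apply is_lim_seq_minus'; [|apply is_lim_seq_const]. apply (proj1 (is_lim_seq_incr_n (sum_n b) N (Series b))), L2.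
Qed.

Lemma sum_int (f : nat -> R -> R) (F : R -> R) (b v : nat -> R) V : ex_series b -> (forall n, is_RInt (f n) 0 1 (v n)) -> is_RInt F 0 1 V ->
 (forall n y, 0 <= y <= 1 -> Rabs (f n y) <= b n) -> (forall y, 0 <= y <= 1 -> is_series (fun n => f n y) (F y)) -> is_series v V.
Proof.
intros Hb Hf HF Hfb Hs.
assert (L : is_lim_seq (sum_n v) V); auto.
assert (L2 : is_lim_seq (sum_n b) (Series b)) by exact (Series_correct _ Hb).
apply is_lim_seq_spec in L2. apply is_lim_seq_spec. intros eps. destruct (L2 eps) as [N HN]. exists N. intros n Hn. specialize (HN n Hn). change (Rabs (rsum b n - Series b) < eps) in HN. rewrite Rabs_minus_sym in HN |- *. apply Rabs_def2 in HN.
assert (Hi : is_RInt (fun y => F y - rsum (fun n => f n y) n) 0 1 (V - rsum v n)).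
{ apply (is_RInt_minus F (fun y => rsum (fun n => f n y) n)); [pos|apply is_RInt_rsum, Hf]. }
apply Rle_lt_trans with ((1 - 0) * (Series b - rsum b n)); [|lra].
apply (norm_RInt_le_const (V := R_NormedModule) (fun y => F y - rsum (fun n => f n y) n) 0 1 (V - rsum v n)); [lra| |pos].
intros y Hy. apply series_tail; auto.
Qed.

(** * The Mellin transform of the twisted form *)

Definition Phi (c : nat -> R) (kap y : R) : R := PSeries c (exp (- (kap * y))).
(* The factor [y^16], compensated in the exponent, keeps the argument of [MI] in the half plane [Re z > 0] on the relevant strip. *)
Definition gP (c : nat -> R) (kap y : R) : R := Phi c kap y / y ^ 16.

Definition theta_data (c : nat -> R) (kap eps : R) : Prop := c 0%nat = 0 /\ Rbar_le 1 (CV_radius c) /\ 0 < kap /\ (eps = 1 \/ eps = -1) /\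
 forall y, 0 < y -> Phi c kap (/ y) = eps * y ^ 4 * Phi c kap y.

(** The series is kept only for real [s], where it is a real series; holomorphy does the rest. The
    exponent [s + 3/2] undoes the analytic normalisation. *)
Definition dirichlet (c : nat -> R) (F : C -> C) : Prop := (forall z, holo F z) /\
 forall s : R, 1 < s -> is_series (fun n => c n * rpow (INR n) (- (s + 3 / 2))) (Re (F (RtoC s))) /\ Im (F (RtoC s)) = 0.

Lemma PS_exp_decay c kap (k : nat) : c 0%nat = 0 -> Rbar_le 1 (CV_radius c) -> 0 < kap -> exists K, 0 <= K /\
 forall y, 0 < y <= 1 -> Rabs (Phi c kap (/ y)) <= K * y ^ k.
Proof.
intros H0 Hc Hk. destruct (PS_small c (exp (- kap)) H0 Hc) as [K [HK H]].
{ split; [apply exp_pos|]. rewrite <- exp_0. apply exp_increasing. lra. }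
exists (K * (INR (fact k) / kap ^ k)). split; [pos|].
intros y Hy. via H.
- split; [pos|]. apply exp_le. assert (1 <= / y) by (rewrite <- Rinv_1; apply Rinv_le_contravar; lra). nra.
- rewrite Rmult_assoc. apply Rmult_le_compat_l; auto. apply (gB_bound k kap y Hk Hy).
Qed.

Lemma Phi_cont c kap y : Rbar_le 1 (CV_radius c) -> 0 < kap -> 0 < y -> continuous (Phi c kap) y.
Proof.
intros Hc Hk Hy. apply (ex_derive_continuous (V := R_NormedModule)). eexists.
apply (is_derive_ext (fun y => PSeries c (1 * exp (- (kap * y))))); [intros t; rewrite Rmult_1_l; reflexivity|].
apply qs_deriv; auto.
Qed.

(** Boundedness near 0 comes from the decay at infinity through the theta relation. Order 20 of
    decay covers the 16 in [gP] and the 4 of the weight. *)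
Lemma theta_bdd c kap eps : theta_data c kap eps -> exists K, bdd (Phi c kap) K /\ bdd (gP c kap) K.
Proof.
intros [H0 [Hc [Hk [Heps Hth]]]]. destruct (PS_exp_decay c kap 20 H0 Hc Hk) as [K [HK H]].
assert (Hb : forall y, 0 < y <= 1 -> Rabs (Phi c kap y) <= K * y ^ 16).
{ intros y Hy. specialize (H y Hy). rewrite Hth in H by lra. assert (H4 : 0 < y ^ 4) by pos.
 rewrite !Rabs_mult, (Rabs_right (y ^ 4)) in H by lra. replace (Rabs eps) with 1 in H by (destruct Heps as [-> | ->]; [rewrite Rabs_right|rewrite Rabs_left]; lra). nra. }
exists K. split; split.
- intros y Hy. apply Phi_cont; assumption.
- intros y Hy. eapply Rle_trans; auto. assert (y ^ 16 <= 1) by (rewrite <- (pow1 16); apply pow_incr; lra). nra.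
- intros y Hy. apply (continuous_mult (Phi c kap)); [apply Phi_cont; assumption|].
 apply (ex_derive_continuous (V := R_NormedModule)). auto_derive. pos.
- intros y Hy. assert (H16 : 0 < y ^ 16) by pos. unfold gP, Rdiv. rewrite Rabs_mult, Rabs_inv, (Rabs_right (y ^ 16)) by lra.
 apply Rmult_le_reg_r with (y ^ 16); auto. rewrite Rmult_assoc, Rinv_l, Rmult_1_r by lra. apply Hb, Hy.
Qed.

(** The transform of [Phi] over the half line: folding the part beyond 1 by the theta relation gives
    the exponent [3 - w], which the division by [y^16] raises to [19 - w]. *)
Definition MM (c : nat -> R) (kap eps : R) (w : C) : C := (MI (Phi c kap) (w - 1) + RtoC eps * MI (gP c kap) (19 - w))%C.
Definition GA (w : C) : C := (MI (gA 1) (w - 1) + MI (gB 1) (15 - w))%C.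

Lemma ex_series_quad : ex_series (fun n => / ((INR n + 1) * (INR n + 2))).
Proof.
exists 1. assert (L : is_lim_seq (sum_n (fun n => / ((INR n + 1) * (INR n + 2)))) 1); auto.
apply is_lim_seq_ext with (fun n => 1 - / INR (S (S n))).
- intros n. change (1 - / INR (S (S n)) = rsum (fun n => / ((INR n + 1) * (INR n + 2))) n). induction n as [|n IH].
 + rewrite rsum_O. simpl. field.
 + rewrite rsum_S, <- IH, !S_INR. pose proof (pos_INR n). field. repeat split; lra.
- replace (Finite 1) with (Finite (1 - 0)) by Cring. apply is_lim_seq_minus'; [apply is_lim_seq_const|].
 apply (proj1 (is_lim_seq_incr_1 (fun n => / INR (S n)) 0)), (proj1 (is_lim_seq_incr_1 (fun n => / INR n) 0)), is_lim_seq_inv_n.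
Qed.

(** The terms of the convergent series at [s = 2] are bounded, so the coefficients grow at most like
    [n^(7/2)]. No estimate specific to modular forms enters. *)
Lemma coef_bound c F : c 0%nat = 0 -> dirichlet c F -> exists B, 0 <= B /\ forall n, (0 < n)%nat -> Rabs (c n) <= B * INR n ^ 4.
Proof.
intros H0 [_ HF]. destruct (HF 2 ltac:(lra)) as [Hs _].
assert (L : is_lim_seq (fun n => c n * rpow (INR n) (- (2 + 3 / 2))) 0) by (apply ex_series_lim_0; eexists; exact Hs).
assert (Hb : exists B, forall n, Rabs (c n * rpow (INR n) (- (2 + 3 / 2))) <= B).
{ destruct (filterlim_bounded (fun n => c n * rpow (INR n) (- (2 + 3 / 2)))) as [M HM].
 - exists 0. exact L.
 - eauto. }
destruct Hb as [B HB]. exists B. split; [eapply Rle_trans; [apply Rabs_pos|apply (HB 0%nat)]|].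
intros n Hn. specialize (HB n). assert (Hn1 : 1 <= INR n) by (change 1 with (INR 1); apply le_INR; lia).
rewrite Rabs_mult in HB. pose proof (Rabs_pos (c n)).
assert (Hr : 1 <= INR n ^ 4 * rpow (INR n) (- (2 + 3 / 2))).
{ rewrite rpow_nat, rpow_pos by lra. rewrite <- exp_0. apply exp_le. assert (0 <= ln (INR n)) by (rewrite <- ln_1; destruct (Req_dec (INR n) 1) as [->|]; [lra|left; apply ln_increasing; lra]).
 simpl INR. nra. }
rewrite (Rabs_right (rpow _ _)) in HB by (rewrite rpow_pos by lra; left; apply exp_pos).
assert (H4 : 0 < INR n ^ 4) by pos. nra.
Qed.

(** At [n = 0] the frequency is replaced by [kap] to keep it positive; this is harmless because
    [c 0 = 0]. *)
Definition lam (kap : R) (n : nat) : R := match n with O => kap | S _ => kap * INR n end.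

Lemma lam_pos kap n : 0 < kap -> 0 < lam kap n.
Proof. intros Hk. destruct n as [|n]; auto. apply Rmult_lt_0_compat; pos. Qed.

Lemma coef_lam c kap B (k : nat) : c 0%nat = 0 -> 0 < kap -> 0 <= B -> (forall n, (0 < n)%nat -> Rabs (c n) <= B * INR n ^ 4) -> (7 <= k)%nat ->
 forall n, Rabs (c n) * / lam kap n ^ k <= (6 * B / kap ^ k) * / ((INR n + 1) * (INR n + 2)).
Proof.
intros H0 Hk HB H Hk7 n. pose proof (pow_lt kap k Hk) as Hkk. pose proof (pos_INR n) as Hn0.
destruct n as [|n].
- rewrite H0, Rabs_R0, Rmult_0_l. pos.
- unfold lam. set (N := INR (S n)) in *. assert (HN : 1 <= N) by (unfold N; rewrite S_INR; pose proof (pos_INR n); lra).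
 specialize (H (S n) ltac:(lia)). rewrite Rpow_mult_distr, Rinv_mult.
 replace k with (4 + 3 + (k - 7))%nat at 2 by lia. rewrite !pow_add. assert (Hj : 1 <= N ^ (k - 7)) by (apply pow_R1_Rle, HN).
 apply Rle_trans with (B * N ^ 4 * (/ kap ^ k * / (N ^ 4 * N ^ 3 * N ^ (k - 7)))).
 + apply Rmult_le_compat_r; auto. pos.
 + replace (B * N ^ 4 * (/ kap ^ k * / (N ^ 4 * N ^ 3 * N ^ (k - 7)))) with (B / kap ^ k * (/ N ^ 3 * / N ^ (k - 7))) by (field; split; lra).
  replace (6 * B / kap ^ k * / ((N + 1) * (N + 2))) with (B / kap ^ k * (6 * / ((N + 1) * (N + 2)))) by lra.
  apply Rmult_le_compat_l; [pos|].
  assert (Hi : 0 < / N ^ (k - 7) <= 1) by (split; [pos|rewrite <- Rinv_1; apply Rinv_le_contravar; lra]).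
  assert (Hi3 : 0 < / N ^ 3) by pos.
  apply Rle_trans with (/ N ^ 3); [nra|].
  apply Rmult_le_reg_r with (N ^ 3 * ((N + 1) * (N + 2))); [pos|].
  replace (/ N ^ 3 * (N ^ 3 * ((N + 1) * (N + 2)))) with ((N + 1) * (N + 2)) by (field; lra).
  replace (6 * / ((N + 1) * (N + 2)) * (N ^ 3 * ((N + 1) * (N + 2)))) with (6 * N ^ 3) by (field; split; lra). nra.
Qed.

Lemma Phi_series c kap y : c 0%nat = 0 -> Rbar_le 1 (CV_radius c) -> 0 < kap -> 0 < y -> is_series (fun n => c n * gA (lam kap n) y) (Phi c kap y).
Proof.
intros H0 Hc Hk Hy. apply (is_series_ext (fun n => c n * exp (- (kap * y)) ^ n)).
- intros n. destruct n as [|n]; [nra|]. f_equal. unfold gA, lam. rewrite exp_pow_INR. Cring.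
- apply (Series_correct (fun n => c n * exp (- (kap * y)) ^ n)), (ex_series_Rabs (fun n => c n * exp (- (kap * y)) ^ n)), CV_disk_inside, radius_lt; auto. pose proof (exp_neg_01 kap y Hk Hy). lra.
Qed.

(** In the narrow range [8 < w < 9] the integrands still contain [y^7] and [y^6]. This gives
    termwise bounds of order [lam^-7] and [lam^-10], summable against coefficients of growth [n^4]
    and uniform in [y], so that termwise integration is legitimate. *)
Lemma mellin_real c kap eps F w : theta_data c kap eps -> dirichlet c F -> 8 < w < 9 ->
 (cexp (- (RtoC w) * RtoC (ln kap)) * GA (RtoC w) * F (RtoC w - RtoC (3 / 2)))%C = MM c kap eps (RtoC w).
Proof.
intros Hth HF Hw. destruct (theta_bdd c kap eps Hth) as [K [Hb1 Hb2]]. pose proof Hth as [H0 [Hc [Hk [Heps Hsym]]]].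
destruct (coef_bound c F H0 HF) as [B [HB Hcb]].
destruct (MI_real (Phi c kap) K (w - 1) Hb1 ltac:(lra)) as [R1 I1]. destruct (MI_real (gP c kap) K (19 - w) Hb2 ltac:(lra)) as [R2 I2].
assert (Hquad : forall k, ex_series (fun n => k * / ((INR n + 1) * (INR n + 2)))).
{ intros k. apply (ex_series_scal_l (K := R_AbsRing) (V := R_NormedModule) k (fun n => / ((INR n + 1) * (INR n + 2)))), ex_series_quad. }
assert (S1 : is_series (fun n => c n * IA (lam kap n) w) (Re (MI (Phi c kap) (RtoC (w - 1))))).
{ apply (sum_int (fun n y => c n * (gA (lam kap n) y * rpow y (w - 1))) (fun y => Phi c kap y * rpow y (w - 1))
  (fun n => INR (fact 7) * (6 * B / kap ^ 7) * / ((INR n + 1) * (INR n + 2)))).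
 - easy.
 - intros n. apply (is_RInt_scal (V := R_NormedModule) (fun y => gA (lam kap n) y * rpow y (w - 1)) 0 1 (c n) (IA (lam kap n) w)), IA_int; [apply lam_pos, Hk|lra].
 - pos.
 - intros n y Hy. pose proof (lam_pos kap n Hk) as Hl. pose proof (coef_lam c kap B 7 H0 Hk HB Hcb ltac:(lia) n) as Hcl.
  pose proof (INR_fact_lt_0 7) as Hf. assert (Hl7 : 0 < lam kap n ^ 7) by pos.
  rewrite Rabs_mult. apply Rle_trans with (Rabs (c n) * (INR (fact 7) * / lam kap n ^ 7)).
  + apply Rmult_le_compat_l; [pos|]. destruct (Rle_lt_or_eq_dec 0 y ltac:(lra)) as [Hp|<-].
   * replace (w - 1) with (INR 7 + (w - 8)) by (simpl; ring). rewrite <- rpow_nat by easy. unfold gA.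
    pose proof (rpow_le1 y (w - 8) ltac:(lra) ltac:(lra)) as Hr. pose proof (exp_neg_pow 7 (lam kap n * y) ltac:(apply Rmult_lt_0_compat; lra)) as He. pose proof (exp_pos (- (lam kap n * y))).
    rewrite Rabs_right by (apply Rle_ge; repeat apply Rmult_le_pos; lra).
    apply Rmult_le_reg_r with (lam kap n ^ 7); auto. rewrite (Rmult_assoc (INR (fact 7))), Rinv_l, Rmult_1_r by lra. nra.
   * unfold rpow. destruct (Rle_dec 0 0); [|lra]. rewrite Rmult_0_r, Rabs_R0. apply Rmult_le_pos; [lra|left; apply Rinv_0_lt_compat, Hl7].
  + nra.
 - intros y Hy. destruct (Rle_lt_or_eq_dec 0 y ltac:(lra)) as [Hp|<-].
  + apply (is_series_ext (fun n => (c n * gA (lam kap n) y) * rpow y (w - 1))); [intros n; apply Rmult_assoc|].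
   apply (is_series_scal_r (rpow y (w - 1)) (fun n => c n * gA (lam kap n) y)), Phi_series; assumption.
  + assert (Z0 : rpow 0 (w - 1) = 0) by (unfold rpow; destruct (Rle_dec 0 0); lra). rewrite Z0, Rmult_0_r.
   assert (L : is_lim_seq (sum_n (fun n => c n * (gA (lam kap n) 0 * 0))) 0); auto.
   apply is_lim_seq_ext with (fun _ => 0); [|apply is_lim_seq_const]. intros n. symmetry. apply (rsum_zero (fun n => c n * (gA (lam kap n) 0 * 0))). intros; ring. }
assert (S2 : is_series (fun n => c n * IB (lam kap n) w) (eps * Re (MI (gP c kap) (RtoC (19 - w))))).
{ apply (sum_int (fun n y => c n * (gB (lam kap n) y * rpow y (15 - w))) (fun y => eps * (gP c kap y * rpow y (19 - w)))
  (fun n => INR (fact 10) * (6 * B / kap ^ 10) * / ((INR n + 1) * (INR n + 2)))).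
 - easy.
 - intros n. apply (is_RInt_scal (V := R_NormedModule) (fun y => gB (lam kap n) y * rpow y (15 - w)) 0 1 (c n) (IB (lam kap n) w)), IB_int; [apply lam_pos, Hk|lra].
 - apply (is_RInt_scal (V := R_NormedModule) (fun y => gP c kap y * rpow y (19 - w)) 0 1 eps (Re (MI (gP c kap) (RtoC (19 - w))))). exact R2.
 - intros n y Hy. pose proof (lam_pos kap n Hk) as Hl. pose proof (coef_lam c kap B 10 H0 Hk HB Hcb ltac:(lia) n) as Hcl.
  pose proof (INR_fact_lt_0 10) as Hf.
  rewrite Rabs_mult. apply Rle_trans with (Rabs (c n) * (INR (fact 10) * / lam kap n ^ 10)).
  + apply Rmult_le_compat_l; [pos|]. destruct (Rle_lt_or_eq_dec 0 y ltac:(lra)) as [Hp|<-].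
   * replace (15 - w) with (INR 6 + (9 - w)) by (simpl; ring). rewrite <- rpow_nat by pos. unfold gB.
    pose proof (rpow_le1 y (9 - w) ltac:(lra) ltac:(lra)) as Hr. pose proof (gB_bound 10 (lam kap n) y Hl ltac:(lra)) as He.
    pose proof (exp_pos (- (lam kap n / y))). assert (H10 : 0 < y ^ 10) by pos.
    replace (exp (- (lam kap n / y)) / y ^ 16 * (y ^ 6 * rpow y (9 - w))) with (exp (- (lam kap n / y)) * / y ^ 10 * rpow y (9 - w)) by (field; lra).
    assert (Hi10 : 0 < / y ^ 10) by pos.
    rewrite Rabs_right by (apply Rle_ge; repeat apply Rmult_le_pos; lra).
    apply Rle_trans with (exp (- (lam kap n / y)) * / y ^ 10 * 1); [apply Rmult_le_compat_l; pos|]. rewrite Rmult_1_r.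
    apply Rmult_le_reg_r with (y ^ 10); auto. rewrite (Rmult_assoc _ (/ y ^ 10)), Rinv_l, Rmult_1_r by lra. exact He.
   * unfold rpow. destruct (Rle_dec 0 0); [|lra]. rewrite Rmult_0_r, Rabs_R0. apply Rmult_le_pos; [lra|pos].
  + nra.
 - intros y Hy. destruct (Rle_lt_or_eq_dec 0 y ltac:(lra)) as [Hp|<-].
  + assert (Hiy : 0 < / y) by pos.
   replace (eps * (gP c kap y * rpow y (19 - w))) with (Phi c kap (/ y) * (/ y ^ 16 * rpow y (15 - w))).
   2:{ rewrite Hsym by lra. replace (19 - w) with (INR 4 + (15 - w)) by (simpl; ring). rewrite <- rpow_nat by lra. unfold gP. lra. }
   apply (is_series_ext (fun n => (c n * gA (lam kap n) (/ y)) * (/ y ^ 16 * rpow y (15 - w)))).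
   * intros n. match goal with |- @eq _ ?s ?t => change (@eq R s t) end. unfold gA, gB, Rdiv. ring.
   * apply (is_series_scal_r (/ y ^ 16 * rpow y (15 - w)) (fun n => c n * gA (lam kap n) (/ y))), Phi_series; assumption.
  + assert (Z0 : forall x, rpow 0 x = 0) by (intros; unfold rpow; destruct (Rle_dec 0 0); lra). rewrite !Z0, !Rmult_0_r.
   assert (L : is_lim_seq (sum_n (fun n => c n * (gB (lam kap n) 0 * 0))) 0); auto.
   apply is_lim_seq_ext with (fun _ => 0); [|apply is_lim_seq_const]. intros n. symmetry. apply (rsum_zero (fun n => c n * (gB (lam kap n) 0 * 0))). intros; ring. }
destruct HF as [_ HF]. destruct (HF (w - 3 / 2) ltac:(lra)) as [SF IF].
set (G := IA 1 w + IB 1 w).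
assert (S3 : is_series (fun n => c n * rpow (INR n) (- (w - 3 / 2 + 3 / 2)) * (exp (- w * ln kap) * G)) (Re (F (RtoC (w - 3 / 2))) * (exp (- w * ln kap) * G))).
{ apply (is_series_scal_r (exp (- w * ln kap) * G) (fun n => c n * rpow (INR n) (- (w - 3 / 2 + 3 / 2)))). exact SF. }
assert (S4 : is_series (fun n => c n * IA (lam kap n) w + c n * IB (lam kap n) w) (Re (F (RtoC (w - 3 / 2))) * (exp (- w * ln kap) * G))).
{ apply (is_series_ext (fun n => c n * rpow (INR n) (- (w - 3 / 2 + 3 / 2)) * (exp (- w * ln kap) * G))); auto.
 intros n. match goal with |- @eq _ ?s ?t => change (@eq R s t) end. destruct n as [|n]; [nra|].
 pose proof (gamma_scale (lam kap (S n)) w (lam_pos kap (S n) Hk) ltac:(lra)) as Hg. fold G in Hg. rewrite <- Hg.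
 assert (HN : 0 < INR (S n)) by pos. rewrite rpow_pos by lra. unfold lam at 1. rewrite (ln_mult kap) by assumption.
 replace (exp (- (w - 3 / 2 + 3 / 2) * ln (INR (S n)))) with (/ exp (w * ln (INR (S n)))) by (rewrite <- exp_Ropp; f_equal; ring).
 replace (exp (- w * ln kap)) with (/ exp (w * ln kap)) by (rewrite <- exp_Ropp; f_equal; ring).
 replace (w * (ln kap + ln (INR (S n)))) with (w * ln kap + w * ln (INR (S n))) by ring. rewrite exp_plus.
 pose proof (exp_pos (w * ln (INR (S n)))). pose proof (exp_pos (w * ln kap)). field. split; lra. }
pose proof (is_series_plus _ _ _ _ S1 S2) as S5.
apply is_series_unique in S4. apply is_series_unique in S5.
assert (E : Re (F (RtoC (w - 3 / 2))) * (exp (- w * ln kap) * G) = Re (MI (Phi c kap) (RtoC (w - 1))) + eps * Re (MI (gP c kap) (RtoC (19 - w)))) by (rewrite <- S4; exact S5).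
assert (EF : F (RtoC w - RtoC (3 / 2))%C = RtoC (Re (F (RtoC (w - 3 / 2))))).
{ rewrite <- RtoC_minus. destruct (F (RtoC (w - 3 / 2))) as [u v]. simpl in IF |- *. rewrite IF. reflexivity. }
assert (EG : GA (RtoC w) = RtoC G).
{ unfold GA. rewrite <- !RtoC_minus. destruct (MI_real (gA 1) 1 (w - 1) (gA_bdd 1 ltac:(lra)) ltac:(lra)) as [_ J1].
 destruct (MI_real (gB 1) _ (15 - w) (gB_bdd 1 Rlt_0_1) ltac:(lra)) as [_ J2]. unfold G, IA, IB. rewrite RtoC_plus.
 destruct (MI (gA 1) (RtoC (w - 1))) as [u v]. destruct (MI (gB 1) (RtoC (15 - w))) as [u' v']. simpl in J1, J2 |- *. rewrite J1, J2. reflexivity. }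
assert (EM : MM c kap eps (RtoC w) = RtoC (Re (MI (Phi c kap) (RtoC (w - 1))) + eps * Re (MI (gP c kap) (RtoC (19 - w))))).
{ unfold MM. rewrite <- !RtoC_minus, RtoC_plus, RtoC_mult.
 destruct (MI (Phi c kap) (RtoC (w - 1))) as [u v]. destruct (MI (gP c kap) (RtoC (19 - w))) as [u' v']. simpl in I1, I2 |- *. rewrite I1, I2. reflexivity. }
assert (EC : cexp (- (RtoC w) * RtoC (ln kap)) = RtoC (exp (- w * ln kap))).
{ unfold cexp, RtoC; simpl. replace (- w * ln kap - - 0 * 0) with (- w * ln kap) by ring. replace (- w * 0 + - 0 * ln kap) with 0 by ring. rewrite cos_0, sin_0. f_equal; ring. }
rewrite EF, EG, EM, EC, <- E, !RtoC_mult. ring.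
Qed.

Lemma MI_holo_comp g K (f : C -> C) z : bdd g K -> holo f z -> 0 < Re (f z) -> holo (fun w => MI g (f w)) z.
Proof. intros Hg Hf Hr. apply (holo_comp (MI g) f); [pos|apply (MI_holo g K); assumption]. Qed.

(** Continuation from the segment between 8 and 9. The radius 13/2 keeps [Re w] between 3/2 and
    29/2, where all four Mellin arguments have positive real part, and the disc contains [w = 2],
    which is the centre [s = 1/2]. *)
Theorem mellin c kap eps F w : theta_data c kap eps -> dirichlet c F -> Cmod (w - 8) < 13 / 2 ->
 (cexp (- w * RtoC (ln kap)) * GA w * F (w - RtoC (3 / 2)))%C = MM c kap eps w.
Proof.
intros Hth HF Hw. destruct (theta_bdd c kap eps Hth) as [K [Hb1 Hb2]]. apply Cminus_eq_0, (identity_theorem (fun w => cexp (- w * RtoC (ln kap)) * GA w * F (w - RtoC (3 / 2)) - MM c kap eps w)%C 8 1 (13 / 2) 1); [lra|lra|apply Cmod_1| | |lra].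
- intros z Hre _. simpl in Hre. apply Rabs_le_between in Hre.
 assert (Hc1 : forall k, holo (fun w => w - RtoC k)%C z) by (intros k; apply holo_minus; [apply holo_id|apply holo_const]).
 assert (Hc2 : forall k, holo (fun w => RtoC k - w)%C z) by (intros k; apply holo_minus; [apply holo_const|apply holo_id]).
 assert (R1 : 0 < Re (z - 1)) by (change (0 < Re z + - (1)); lra).
 assert (R15 : 0 < Re (15 - z)) by (change (0 < 15 + - Re z); lra).
 assert (R19 : 0 < Re (19 - z)) by (change (0 < 19 + - Re z); lra).
 apply holo_minus; [apply holo_mult; [apply holo_mult|]|].
 + apply (holo_comp cexp); [apply holo_mult; [apply holo_opp, holo_id|apply holo_const]|apply holo_cexp].
 + apply holo_plus; [apply (MI_holo_comp _ 1 (fun w => w - 1)%C); [apply gA_bdd; lra|easy|lra]|].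
  eapply (MI_holo_comp _ _ (fun w => 15 - w)%C); [apply gB_bdd; lra|easy|lra].
 + apply (holo_comp F (fun w => w - RtoC (3 / 2))%C); [easy|apply HF].
 + apply holo_plus; [apply (MI_holo_comp _ K (fun w => w - 1)%C); easy|].
  apply holo_mult; [apply holo_const|]. apply (MI_holo_comp _ K (fun w => 19 - w)%C); [exact Hb2|apply Hc2|exact R19].
- intros t Ht. replace (8 + t * 1)%C with (RtoC (8 + t)) by Cring.
 rewrite (mellin_real c kap eps F (8 + t) Hth HF) by lra. ring.
Qed.

(** * Central value and sign in terms of the quadratic polynomial *)

Definition eicher (e c : nat -> R) (kap : R) : Prop := e 0%nat = 0 /\ Rbar_le 1 (CV_radius e) /\ 0 < kap /\ forall n, c n = kap ^ 3 * dn (dn (dn e)) n.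
Definition qexp (e : nat -> R) (kap y : R) : R := PSeries e (1 * exp (- (kap * y))).

Lemma Phi_eicher e c kap y : eicher e c kap -> Phi c kap y = kap ^ 3 * PSeries (dn (dn (dn e))) (1 * exp (- (kap * y))).
Proof.
intros [_ [_ [_ H]]]. unfold Phi. rewrite Rmult_1_l, (PSeries_ext c (PS_scal (kap ^ 3) (dn (dn (dn e))))); [apply PSeries_scal|pos].
Qed.

(** For [eps = 1] the first two derivatives at the fixed point [y = 1] give [q1 = hh1 1 - hh2 1], in
    which the terms with [e0] cancel. *)
Lemma eicher_hh e c kap eps q0 q1 q2 : eicher e c kap -> eps = 1 \/ eps = -1 ->
 (forall y, 0 < y -> hh eps 1 (qexp e kap) y = q0 + q1 * y + q2 * y ^ 2) ->
 theta_data c kap eps /\ (eps = 1 -> q1 = - 2 * (kap ^ 2 * PSeries (dn (dn e)) (1 * exp (- (kap * 1))) + kap * PSeries (dn e) (1 * exp (- (kap * 1))))).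
Proof.
intros He Heps Hq. pose proof He as [H0 [Hr [Hk Hc]]].
pose proof (hh_quadratic_rev kap eps 1 _ _ _ _ Rlt_0_1 (qs_tower e kap 1 ltac:(auto) Hr Hk) q0 q1 q2 Hq) as Hrev.
split; [split; [|split; [|split; [pos|split; auto]]]|].
- rewrite Hc. unfold dn. nra.
- rewrite (CV_radius_ext c (PS_scal (kap ^ 3) (dn (dn (dn e)))) Hc), CV_radius_scal by pos. repeat apply dn_radius. exact Hr.
- intros y Hy. rewrite !(Phi_eicher e c kap _ He). destruct (Hrev y Hy) as [_ [_ H3]]. unfold hh3 in H3.
 replace (/ (1 * y)) with (/ y) in H3 by Cring.
 set (u := PSeries (dn (dn (dn e))) (1 * exp (- (kap * y)))) in *. set (v := PSeries (dn (dn (dn e))) (1 * exp (- (kap * / y)))) in *.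
 assert (Hk3 : 0 < kap ^ 3) by pos.
 assert (E : u = eps / y ^ 4 * v).
 { apply Rmult_integral in H3. destruct H3 as [H3|H3]; [lra|]. replace (1 ^ 3 * y ^ 4) with (y ^ 4) in H3 by ring. lra. }
 rewrite E. destruct Heps as [-> | ->]; field; lra.
- intros ->. destruct (Hrev 1 Rlt_0_1) as [H1 [H2 _]]. unfold hh1, hh2 in H1, H2. replace (/ (1 * 1)) with 1 in H1, H2 by lra. pos.
Qed.

Lemma small_eq (x C : R) : (forall d, 0 < d < 1 -> Rabs x <= C * d) -> x = 0.
Proof.
intros H. destruct (Req_dec x 0) as [|Hx]; [assumption|exfalso]. pose proof (Rabs_pos_lt x Hx) as Hp.
set (d := Rmin (1 / 2) (Rabs x / (2 * (Rabs C + 1)))). pose proof (Rabs_pos C). pose proof (Rle_abs C).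
assert (Hd : 0 < d < 1).
{ split; [apply Rmin_pos; pos|eapply Rle_lt_trans; [apply Rmin_l|lra]]. }
specialize (H d Hd). assert (Hd2 : d <= Rabs x / (2 * (Rabs C + 1))) by apply Rmin_r.
assert (C * d <= (Rabs C + 1) * (Rabs x / (2 * (Rabs C + 1)))) by nra.
replace ((Rabs C + 1) * (Rabs x / (2 * (Rabs C + 1)))) with (Rabs x / 2) in H2 by (field; lra). lra.
Qed.

(** Integration by parts of [u Phi u] over the half line beyond 1, brought to [(0, 1]] by the theta
    relation. The primitive [H] is written in [1/y] because in this form it decays at 0. *)
Lemma moment e c kap : eicher e c kap -> theta_data c kap 1 ->
 Re (MI (Phi c kap) 1) = kap ^ 2 * PSeries (dn (dn e)) (1 * exp (- (kap * 1))) + kap * PSeries (dn e) (1 * exp (- (kap * 1))).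
Proof.
intros He Hth. pose proof He as [H0 [Hr [Hk Hc]]]. destruct (theta_bdd c kap 1 Hth) as [K [Hb _]]. pose proof Hth as [_ [_ [_ [_ Hsym]]]].
destruct (MI_real (Phi c kap) K 1 Hb Rlt_0_1) as [HI _].
set (x2 := fun u => PSeries (dn (dn e)) (1 * exp (- (kap * u)))). set (x1 := fun u => PSeries (dn e) (1 * exp (- (kap * u)))).
set (H := fun y => kap ^ 2 * (/ y * x2 (/ y)) + kap * x1 (/ y)).
assert (K0 : 0 <= K) by (destruct Hb as [_ Hb]; eapply Rle_trans; [apply Rabs_pos|apply (Hb 1); lra]).
assert (Hdec : forall e', e' 0%nat = 0 -> Rbar_le 1 (CV_radius e') -> exists K, 0 <= K /\ forall y, 0 < y <= 1 -> Rabs (PSeries e' (1 * exp (- (kap * / y)))) <= K * y ^ 2).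
{ intros e' Z Re'. destruct (PS_exp_decay e' kap 2 Z Re' Hk) as [K' [HK' HH]]. exists K'. split; auto. intros y Hy. rewrite Rmult_1_l. apply HH, Hy. }
destruct (Hdec (dn (dn e))) as [K2 [HK2 D2]]; [unfold dn; simpl; ring|repeat apply dn_radius; exact Hr|].
destruct (Hdec (dn e)) as [K1 [HK1 D1]]; [unfold dn; simpl; ring|apply dn_radius; exact Hr|].
(* The integral over [[d, 1]] is exact; the piece near 0 and the value [H d] are at most linear in
   [d]. *)
assert (Main : Re (MI (Phi c kap) 1) - H 1 = 0).
{ apply (small_eq _ (K + kap ^ 2 * K2 + kap * K1)). intros d Hd.
 assert (Hp : is_RInt (fun y => Phi c kap y * rpow y 1) d 1 (H 1 - H d)).
 { apply (is_RInt_derive (V := R_CompleteNormedModule) H).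
  - intros y Hy. rewrite Rmin_left, Rmax_right in Hy by lra.
   assert (Hiy : 0 < / y) by pos.
   pose proof (qs_deriv (dn (dn e)) kap 1 (/ y) ltac:(auto) ltac:(repeat apply dn_radius; exact Hr) Hk Hiy) as E2.
   pose proof (qs_deriv (dn e) kap 1 (/ y) ltac:(auto) ltac:(apply dn_radius; exact Hr) Hk Hiy) as E1.
   assert (Di : is_derive (fun y => / y) y (- / y ^ 2)) by (auto_derive; [lra|field; lra]).
   evar_last.
   + apply (is_derive_plus (fun y => kap ^ 2 * (/ y * x2 (/ y))) (fun y => kap * x1 (/ y))).
    * apply (is_derive_scal (fun y => / y * x2 (/ y)) y (kap ^ 2)), (is_derive_mult (fun y => / y) (fun y => x2 (/ y))); [eauto| |apply Rmult_comm].
     apply (is_derive_comp x2 (fun y => / y)); [exact E2|exact Di].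
    * apply (is_derive_scal (fun y => x1 (/ y)) y kap), (is_derive_comp x1 (fun y => / y)); [exact E1|exact Di].
   + assert (Er : rpow y 1 = y) by (rewrite rpow_pos by lra; rewrite Rmult_1_l; apply exp_ln; lra). rewrite Er.
    replace (Phi c kap y) with (Phi c kap (/ y) / y ^ 4) by (rewrite Hsym by lra; field; lra).
    rewrite (Phi_eicher e c kap _ He). unfold plus, scal; simpl; unfold mult; simpl. fold (x2 (/ y)). field. lra.
  - intros y Hy. rewrite Rmin_left, Rmax_right in Hy by lra. apply (continuous_mult (Phi c kap)); [apply Hb; lra|apply rpow_cont; lra]. }
 assert (Hex : ex_RInt (fun y => Phi c kap y * rpow y 1) 0 d).
 { apply (ex_RInt_Chasles_1 (V := R_CompleteNormedModule) _ 0 d 1); [lra|eexists; exact HI]. }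
 destruct Hex as [v Hv].
 pose proof (is_RInt_Chasles (V := R_NormedModule) _ 0 d 1 v (H 1 - H d) Hv Hp) as Hall.
 assert (E : Re (MI (Phi c kap) 1) = v + (H 1 - H d)).
 { apply (is_RInt_unique (V := R_CompleteNormedModule)) in HI. apply (is_RInt_unique (V := R_CompleteNormedModule)) in Hall. rewrite <- HI. exact Hall. }
 rewrite E. replace (v + (H 1 - H d) - H 1) with (v + - H d) by ring.
 assert (Hnv : Rabs v <= (d - 0) * K).
 { apply (norm_RInt_le_const (V := R_NormedModule) (fun y => Phi c kap y * rpow y 1) 0 d v K); [lra| |pos]. intros y Hy.
  change (Rabs (Phi c kap y * rpow y 1) <= K). destruct (Rle_lt_or_eq_dec 0 y ltac:(lra)) as [Hpos|<-].
  - rewrite Rabs_mult. destruct Hb as [_ Hb]. pose proof (Hb y ltac:(lra)). pose proof (rpow_le1 y 1 ltac:(lra) ltac:(lra)).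
   rewrite (Rabs_right (rpow _ _)) by lra. nra.
  - unfold rpow. destruct (Rle_dec 0 0); [|lra]. rewrite Rmult_0_r, Rabs_R0. exact K0. }
 assert (HH : Rabs (H d) <= (kap ^ 2 * K2 + kap * K1) * d).
 { specialize (D2 d ltac:(lra)). specialize (D1 d ltac:(lra)). fold (x2 (/ d)) in D2. fold (x1 (/ d)) in D1.
  assert (Hid : 0 < / d) by pos. assert (Hk2 : 0 < kap ^ 2) by pos.
  via Rabs_triang. rewrite !Rabs_mult, (Rabs_right (kap ^ 2)), (Rabs_right (/ d)), (Rabs_right kap) by lra.
  assert (A1 : / d * Rabs (x2 (/ d)) <= K2 * d).
  { apply Rle_trans with (/ d * (K2 * d ^ 2)); [nra|right; field; lra]. }
  assert (A2 : Rabs (x1 (/ d)) <= K1 * d) by (assert (d ^ 2 <= d) by nra; nra). nra. }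
 via Rabs_triang. rewrite Rabs_Ropp. lra. }
assert (E1 : H 1 = kap ^ 2 * PSeries (dn (dn e)) (1 * exp (- (kap * 1))) + kap * PSeries (dn e) (1 * exp (- (kap * 1)))).
{ unfold H, x2, x1. rewrite Rinv_1. ring. }
lra.
Qed.

Lemma MI_shift g K z : bdd g K -> 0 < Re z -> MI (fun y => g y / y ^ 16) (z + 16) = MI g z.
Proof.
intros _ Hz. apply CInt_ext; [lra|]. intros y Hy. unfold mi. rewrite ypow_plus.
destruct (Rle_lt_or_eq_dec 0 y ltac:(lra)) as [Hp|<-].
- rewrite (ypow_real y 16). replace (rpow y 16) with (y ^ 16).
 + assert (0 < y ^ 16) by pos. unfold Rdiv. rewrite RtoC_mult, RtoC_inv by lra. field. apply RtoC_neq0. lra.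
 + rewrite rpow_pos by lra. replace 16 with (INR 16) by Cring. rewrite <- exp_pow_INR, exp_ln by lra. reflexivity.
- unfold ypow. destruct (Rle_dec 0 0); [ring|lra].
Qed.

(** At [w = 2] the two halves of [MM] coincide. A vanishing central value therefore makes the moment
    of [Phi] vanish, and [q1] is -2 times that moment. *)
Theorem central_zero e c kap q0 q1 q2 F : eicher e c kap -> (forall y, 0 < y -> hh 1 1 (qexp e kap) y = q0 + q1 * y + q2 * y ^ 2) ->
 dirichlet c F -> F (RtoC (1 / 2)) = RtoC 0 -> q1 = 0.
Proof.
intros He Hq HF HF0. destruct (eicher_hh e c kap 1 q0 q1 q2 He ltac:(auto) Hq) as [Hth Hq1].
destruct (theta_bdd c kap 1 Hth) as [K [Hb Hb2]].
pose proof (mellin c kap 1 F 2 Hth HF) as HM.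
assert (H28 : Cmod (2 - 8) < 13 / 2).
{ rewrite <- RtoC_minus, Cmod_R, Rabs_left; lra. }
specialize (HM H28). replace (2 - RtoC (3 / 2))%C with (RtoC (1 / 2)) in HM by (rewrite <- RtoC_minus; f_equal; field).
rewrite HF0, Cmult_0_r in HM. unfold MM in HM.
replace (2 - 1)%C with (RtoC 1) in HM by ring.
replace (19 - 2)%C with (RtoC 1 + 16)%C in HM by ring. rewrite (MI_shift (Phi c kap) K) in HM by (simpl; try exact Hb; lra).
apply (f_equal Re) in HM. pose proof (moment e c kap He Hth) as Hm.
destruct (MI (Phi c kap) (RtoC 1)) as [u v]. simpl in HM, Hm. lra.
Qed.

Lemma GA_pos w : 1 < w < 15 -> exists g, 0 < g /\ GA (RtoC w) = RtoC g.
Proof.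
intros Hw. exists (IA 1 w + IB 1 w). split.
- assert (P1 : 0 < IA 1 w).
 { pose proof (IA_int 1 w Rlt_0_1 ltac:(lra)) as H. apply (is_RInt_unique (V := R_CompleteNormedModule)) in H. rewrite <- H. apply RInt_gt_0; [lra| |].
  - intros y Hy. apply Rmult_lt_0_compat; [pos|apply rpow_le1; lra].
  - intros y Hy. apply (continuous_mult (gA 1)); [|apply rpow_cont; lra]. unfold gA. apply (ex_derive_continuous (V := R_NormedModule)). auto_derive. exact I. }
 assert (P2 : 0 <= IB 1 w).
 { apply (is_RInt_le (fun _ => 0) (fun y => gB 1 y * rpow y (15 - w)) 0 1); [lra| |apply IB_int; lra|].
  - evar_last; [apply (is_RInt_const (V := R_NormedModule) 0 1 0)|]. unfold scal; simpl; unfold mult; simpl. ring.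
  - intros y Hy. apply Rmult_le_pos; [|left; apply rpow_le1; lra]. pos. }
 lra.
- unfold GA. rewrite <- !RtoC_minus. destruct (MI_real (gA 1) 1 (w - 1) (gA_bdd 1 ltac:(lra)) ltac:(lra)) as [_ J1].
 destruct (MI_real (gB 1) _ (15 - w) (gB_bdd 1 Rlt_0_1) ltac:(lra)) as [_ J2]. unfold IA, IB. rewrite RtoC_plus.
 destruct (MI (gA 1) (RtoC (w - 1))) as [u v]. destruct (MI (gB 1) (RtoC (15 - w))) as [u' v']. simpl in J1, J2 |- *. rewrite J1, J2. reflexivity.
Qed.

Lemma cexp_real x : cexp (RtoC x) = RtoC (exp x).
Proof. unfold cexp, RtoC; simpl. rewrite cos_0, sin_0. f_equal; ring. Qed.

(** For the sign -1 the Mellin side is negated by [w -> 4 - w]. The factor [r] is a quotient of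
    positive gamma factors, and only its positivity will matter. *)
Theorem antisym c kap F w : theta_data c kap (-1) -> dirichlet c F -> 8 / 5 < w < 12 / 5 ->
 exists r, 0 < r /\ F (RtoC (w - 3 / 2)) = (- RtoC r * F (RtoC (5 / 2 - w)))%C.
Proof.
intros Hth HF Hw. destruct (theta_bdd c kap (-1) Hth) as [K [Hb Hb2]].
assert (Hm : forall w, 8 / 5 < w < 12 / 5 -> exists g, 0 < g /\ (RtoC g * F (RtoC (w - 3 / 2)))%C = (MI (Phi c kap) (RtoC (w - 1)) - MI (Phi c kap) (RtoC (3 - w)))%C).
{ clear w Hw. intros w Hw. assert (H8 : Cmod (RtoC w - 8) < 13 / 2) by (rewrite <- RtoC_minus, Cmod_R, Rabs_left; lra).
 pose proof (mellin c kap (-1) F (RtoC w) Hth HF H8) as HM. destruct (GA_pos w ltac:(lra)) as [g [Hg EG]].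
 rewrite EG, <- RtoC_opp, <- RtoC_mult, cexp_real, <- RtoC_minus, <- RtoC_mult in HM.
 exists (exp (- w * ln kap) * g). split; [pos|]. rewrite HM. unfold MM.
 replace (19 - RtoC w)%C with (RtoC (3 - w) + 16)%C by Cring. rewrite (MI_shift (Phi c kap) K) by (simpl; try exact Hb; lra). rewrite <- RtoC_minus. ring. }
destruct (Hm w Hw) as [g [Hg E1]]. destruct (Hm (4 - w) ltac:(lra)) as [g' [Hg' E2]].
replace (4 - w - 3 / 2) with (5 / 2 - w) in E2 by lra. replace (4 - w - 1) with (3 - w) in E2 by ring. replace (3 - (4 - w)) with (w - 1) in E2 by ring.
exists (g' / g). split; [pos|].
assert (E : (RtoC g * F (RtoC (w - 3 / 2)))%C = (- (RtoC g' * F (RtoC (5 / 2 - w))))%C) by (rewrite E1, E2; ring).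
rewrite RtoC_div by lra. unfold Cdiv. pose proof (RtoC_neq0 g ltac:(lra)) as Ng.
set (u := F (RtoC (w - 3 / 2))) in *.
transitivity (/ RtoC g * (RtoC g * u))%C; [rewrite Cmult_assoc, Cinv_l by pos; ring|]. rewrite E. ring.
Qed.

(** Zeros on a segment spread along the real axis, and far to the right a Dirichlet series tends to
    its first coefficient. *)
Theorem zero_contra c F : c 0%nat = 0 -> dirichlet c F -> (forall s : R, 1 / 10 < s < 9 / 10 -> F (RtoC s) = RtoC 0) -> c 1%nat = 0.
Proof.
intros H0 HF Hz. destruct (coef_bound c F H0 HF) as [B [HB Hcb]]. pose proof HF as [Hh Hs].
assert (Hall : forall s : R, F (RtoC s) = RtoC 0).
{ intros s. apply (identity_theorem F (RtoC (1 / 2)) 1 (Rabs s + 1) (1 / 4)); [pose proof (Rabs_pos s); lra|lra|apply Cmod_1|easy| |].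
 - intros t Ht. replace (RtoC (1 / 2) + t * 1)%C with (RtoC (1 / 2 + t)) by Cring. apply Hz. lra.
 - rewrite <- RtoC_minus, Cmod_R. unfold Rabs. destruct (Rcase_abs (s - 1 / 2)), (Rcase_abs s); lra. }
set (l := fun n => if Nat.eqb n 1 then c 1%nat else 0).
assert (L : is_lim_seq (fun k => Series (fun n => c n * rpow (INR n) (- (INR k + 8)))) (Series l)).
{ apply (Tannery (fun k n => c n * rpow (INR n) (- (INR k + 8))) l (fun n => (6 * B / 1 ^ 8) * / ((INR n + 1) * (INR n + 2)))).
 - apply (ex_series_scal_l (K := R_AbsRing) (V := R_NormedModule) (6 * B / 1 ^ 8) (fun n => / ((INR n + 1) * (INR n + 2)))), ex_series_quad.
 - intros k n. pose proof (coef_lam c 1 B 8 H0 Rlt_0_1 HB Hcb ltac:(lia) n) as Hc. eapply Rle_trans; eauto.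
  rewrite Rabs_mult. apply Rmult_le_compat_l; [pos|]. destruct n as [|n].
  + unfold rpow. simpl INR. destruct (Rle_dec 0 0); [|lra]. rewrite Rabs_R0. simpl. lra.
  + unfold lam. rewrite Rmult_1_l. assert (HN : 1 <= INR (S n)) by (rewrite S_INR; pose proof (pos_INR n); lra).
   rewrite rpow_pos by lra. rewrite Rabs_right by (left; apply exp_pos).
   rewrite <- (exp_ln (INR (S n))) at 2 by lra. rewrite exp_pow_INR, <- exp_Ropp. apply exp_le.
   assert (0 <= ln (INR (S n))) by (rewrite <- ln_1; destruct (Req_dec (INR (S n)) 1) as [->|]; [lra|left; apply ln_increasing; lra]).
   pose proof (pos_INR k). replace (INR 8) with 8 by Cring. nra.
 - intros n. unfold l. destruct n as [|[|n]].
  + apply is_lim_seq_ext with (fun _ => 0); [intros k; rewrite H0; ring|apply is_lim_seq_const].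
  + apply is_lim_seq_ext with (fun _ => c 1%nat); [|apply is_lim_seq_const]. intros k. simpl INR. rewrite rpow_pos, ln_1, Rmult_0_r, exp_0 by lra. ring.
  + simpl Nat.eqb. set (N := INR (S (S n))). assert (HN : 2 <= N) by (unfold N; rewrite !S_INR; pose proof (pos_INR n); lra).
   apply is_lim_seq_ext with (fun k => c (S (S n)) * exp (- (8 * ln N)) * (/ N) ^ k).
   * intros k. rewrite rpow_pos by lra. replace (- (INR k + 8) * ln N) with (- (8 * ln N) + INR k * - ln N) by ring.
    rewrite exp_plus, <- exp_pow_INR, exp_Ropp, exp_Ropp, exp_ln by lra. ring.
   * replace (Finite 0) with (Rbar_mult (c (S (S n)) * exp (- (8 * ln N))) 0) by Cring. apply is_lim_seq_scal_l, is_lim_seq_geom. rewrite Rabs_right by (left; apply Rinv_0_lt_compat; lra). rewrite <- Rinv_1. apply Rinv_lt_contravar; lra. }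
assert (El : Series l = c 1%nat).
{ rewrite (Series_finite l 1); [rewrite rsum_S, rsum_O; unfold l; simpl; ring|]. intros i Hi. unfold l. destruct (Nat.eqb_spec i 1); [lia|lra]. }
rewrite El in L. apply (is_lim_seq_eq (fun k => Series (fun n => c n * rpow (INR n) (- (INR k + 8))))); auto.
apply is_lim_seq_ext with (fun _ => 0); [|apply is_lim_seq_const]. intros k.
destruct (Hs (INR k + 13 / 2) ltac:(pose proof (pos_INR k); lra)) as [H1 _]. rewrite Hall in H1. apply is_series_unique in H1.
rewrite <- H1 at 1. apply Series_ext. intros n. f_equal. f_equal. field.
Qed.

(** * Gauss sums *)

Definition lsum {A : Type} (f : A -> R) (l : list A) : R := fold_right (fun x s => f x + s) 0 l.

Lemma lsum_ext {A} (f g : A -> R) l : (forall x, In x l -> f x = g x) -> lsum f l = lsum g l.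
Proof.
induction l as [|x l IH]; intros H; auto. simpl. rewrite H by (left; reflexivity). f_equal. apply IH. intros y Hy. apply H. right. exact Hy.
Qed.
Lemma lsum_plus {A} (f g : A -> R) l : lsum (fun x => f x + g x) l = lsum f l + lsum g l.
Proof. induction l as [|x l IH]; simpl; [ring|]. lra. Qed.
Lemma lsum_scal {A} c (f : A -> R) l : lsum (fun x => c * f x) l = c * lsum f l.
Proof. induction l as [|x l IH]; simpl; [ring|]. lra. Qed.
Lemma lsum_perm {A} (f : A -> R) l l' : Permutation l l' -> lsum f l = lsum f l'.
Proof. intros H. induction H; simpl; lra. Qed.
Lemma lsum_map {A B} (f : B -> R) (g : A -> B) l : lsum f (map g l) = lsum (fun x => f (g x)) l.
Proof. induction l as [|x l IH]; simpl; auto. lra. Qed.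
Lemma lsum_app {A} (f : A -> R) l l' : lsum f (l ++ l')%list = lsum f l + lsum f l'.
Proof. induction l as [|x l IH]; simpl; [ring|]. lra. Qed.
Lemma lsum_swap {A B} (f : A -> B -> R) l l' : lsum (fun x => lsum (f x) l') l = lsum (fun y => lsum (fun x => f x y) l) l'.
Proof.
induction l as [|x l IH]; simpl.
- induction l' as [|y l' IH']; simpl; [lra|lra].
- rewrite IH, <- lsum_plus. reflexivity.
Qed.
Lemma lsum_reindex {A} (f : A -> R) (g : A -> A) l : NoDup l -> (forall x, In x l -> In (g x) l) -> (forall x y, In x l -> In y l -> g x = g y -> x = y) ->
 lsum (fun x => f (g x)) l = lsum f l.
Proof.
intros Hn Hin Hinj. rewrite <- lsum_map. apply lsum_perm, NoDup_Permutation_bis.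
- clear Hin. induction Hn as [|x l Hx Hn IH]; simpl; constructor.
 + intros H. apply in_map_iff in H. destruct H as [y [E Hy]]. apply Hinj in E; [subst y; contradiction|right; exact Hy|left; reflexivity].
 + apply IH. intros u v Hu Hv. apply Hinj; right; assumption.
- rewrite length_map. lia.
- intros y Hy. apply in_map_iff in Hy. destruct Hy as [x [<- Hx]]. apply Hin, Hx.
Qed.

Section Character.
Variables (p : nat) (chi : nat -> Z).
Hypothesis Hp : Znumtheory.prime (Z.of_nat p).
Hypothesis Hp4 : (p mod 4 = 3)%nat.
Hypothesis Hchi : character p chi.

Definition cR (n : nat) : R := IZR (chi n).
Definition residues : list nat := List.seq 0 p.

Lemma p_ge3 : (3 <= p)%nat.
Proof. pose proof (Nat.Div0.mod_le p 4). lia. Qed.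

Lemma p_mod a : (a mod p < p)%nat.
Proof. apply Nat.mod_upper_bound. pose proof p_ge3. lia. Qed.

Lemma cR_mult a b : cR (a * b) = cR a * cR b.
Proof. destruct Hchi as [H _]. unfold cR. rewrite H, mult_IZR. reflexivity. Qed.

Lemma chi_mod a : chi (a mod p) = chi a.
Proof. destruct Hchi as [_ [H _]]. apply H, Nat.Div0.mod_mod. Qed.

Lemma chi_0 a : (a mod p = 0)%nat -> chi a = 0%Z.
Proof. destruct Hchi as [_ [_ [_ [_ [H _]]]]]. apply H. Qed.

Lemma chi_pm a : (a mod p <> 0)%nat -> chi a = 1%Z \/ chi a = (-1)%Z.
Proof. destruct Hchi as [_ [_ [_ [_ [_ [H _]]]]]]. apply H. Qed.

Lemma chi_opp a b k : (a + b = k * p)%nat -> chi b = (- chi a)%Z.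
Proof. destruct Hchi as [_ [_ [_ [H _]]]]. intros E. eauto. Qed.

Lemma chi_1 : chi 1 = 1%Z.
Proof. destruct Hchi as [_ [_ [H _]]]. exact H. Qed.

Lemma Euclid a b : (a * b mod p = 0 -> a mod p = 0 \/ b mod p = 0)%nat.
Proof.
intros H. apply Nat.Div0.mod_divides in H. destruct H as [k H].
assert (Hd : (Z.of_nat p | Z.of_nat a * Z.of_nat b)%Z) by (exists (Z.of_nat k); rewrite <- !Nat2Z.inj_mul; f_equal; lia).
apply (prime_mult _ Hp) in Hd.
assert (G : forall x, (Z.of_nat p | Z.of_nat x)%Z -> (x mod p = 0)%nat).
{ intros x [m Hm]. apply Nat.Div0.mod_divides. exists (Z.to_nat m). nia. }
destruct Hd as [Hd|Hd]; auto; apply G.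
Qed.

Lemma mul_inj n A B : (n mod p <> 0 -> A < p -> B < p -> (n * A) mod p = (n * B) mod p -> A = B)%nat.
Proof.
assert (Gen : forall A B, (n mod p <> 0 -> A < B -> B < p -> (n * A) mod p = (n * B) mod p -> False)%nat).
{ clear A B. intros A B Hn HAB HB E.
 assert (H0 : (n * (B - A) mod p = 0)%nat).
 { pose proof (Nat.div_mod_eq (n * A) p). pose proof (Nat.div_mod_eq (n * B) p). apply Nat.Div0.mod_divides.
  exists ((n * B) / p - (n * A) / p)%nat. nia. }
 apply Euclid in H0. destruct H0 as [H0|H0]; auto. rewrite Nat.mod_small in H0 by lia. lia. }
intros Hn HA HB E. destruct (lt_eq_lt_dec A B) as [[H|H]|H]; [exfalso; apply (Gen A B); assumption|lia|exfalso; apply (Gen B A); congruence].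
Qed.

Lemma in_residues a : In a residues <-> (a < p)%nat.
Proof. clear. unfold residues. rewrite in_seq. lia. Qed.

Lemma sum_mul (f : nat -> R) n : (n mod p <> 0)%nat -> (forall k, f (k mod p)%nat = f k) -> lsum (fun A => f (n * A)%nat) residues = lsum f residues.
Proof.
intros Hn Hf. rewrite (lsum_ext _ (fun A => f ((fun A => (n * A) mod p)%nat A))) by easy.
apply lsum_reindex; [apply seq_NoDup| |].
- intros x _. apply in_residues, p_mod.
- intros x y Hx Hy E. apply in_residues in Hx. apply in_residues in Hy. apply (mul_inj n); assumption.
Qed.

Definition ang (k : nat) : R := 2 * PI * INR k / INR p.

Lemma INR_p : 0 < INR p.
Proof. apply lt_0_INR. pose proof p_ge3. lia. Qed.

Lemma ang_mod k : ang k = ang (k mod p) + 2 * INR (k / p) * PI.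
Proof.
pose proof INR_p. unfold ang. rewrite (Nat.div_mod_eq k p) at 1. rewrite plus_INR, mult_INR. field. lra.
Qed.

Lemma sin_ang_mod k : sin (ang (k mod p)) = sin (ang k).
Proof. rewrite (ang_mod k). symmetry. apply sin_period. Qed.
Lemma cos_ang_mod k : cos (ang (k mod p)) = cos (ang k).
Proof. rewrite (ang_mod k). symmetry. apply cos_period. Qed.

(** As [chi] is odd, the cosine part of the Gauss sum cancels; only the sines are kept, and
    everything stays real. *)
Definition gauss (n : nat) : R := lsum (fun A => cR A * sin (ang (A * n))) residues.

Lemma gauss_mul n : gauss n = cR n * gauss 1.
Proof.
destruct (Nat.eq_dec (n mod p) 0) as [Hn|Hn].
- unfold cR. rewrite chi_0 by lia. unfold gauss. rewrite (lsum_ext _ (fun _ => 0 * 0)); [rewrite lsum_scal; ring|].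
 intros A _. rewrite <- sin_ang_mod. replace ((A * n) mod p)%nat with 0%nat by (rewrite <- Nat.Div0.mul_mod_idemp_r, Hn, Nat.mul_0_r; symmetry; apply Nat.Div0.mod_0_l).
 unfold ang. simpl. replace (2 * PI * 0 / INR p) with 0 by lra. rewrite sin_0. ring.
- assert (E : cR n * gauss n = gauss 1).
 { unfold gauss. rewrite <- lsum_scal, <- (sum_mul (fun A => cR A * sin (ang (A * 1))) n Hn).
  - apply lsum_ext. intros A _. rewrite cR_mult, Nat.mul_1_r, (Nat.mul_comm A n). ring.
  - intros k. rewrite !Nat.mul_1_r. unfold cR. rewrite chi_mod, sin_ang_mod. reflexivity. }
 rewrite <- E. unfold cR. destruct (chi_pm n Hn) as [-> | ->]; ring.
Qed.

Lemma cos_sum k : (k mod p <> 0)%nat -> lsum (fun n => cos (ang (n * k))) residues = 0.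
Proof.
intros Hk. pose proof INR_p. pose proof PI_RGT_0. set (th := ang k).
assert (Hs : sin (th / 2) <> 0).
{ intros Hs. apply sin_eq_0_0 in Hs. destruct Hs as [z Hz]. apply Hk. unfold th, ang in Hz.
 assert (E : INR k = IZR z * INR p).
 { apply Rmult_eq_reg_l with (PI / INR p); [|pos].
  transitivity (2 * PI * INR k / INR p / 2); [lra|]. rewrite Hz. field. lra. }
 rewrite !INR_IZR_INZ, <- mult_IZR in E. apply eq_IZR in E. apply Nat.Div0.mod_divides. exists (Z.to_nat z). nia. }
assert (G : forall m, 2 * sin (th / 2) * lsum (fun n => cos (ang (n * k))) (List.seq 0 m) = sin ((INR m - 1 / 2) * th) + sin (th / 2)).
{ induction m as [|m IH].
 - simpl. replace ((0 - 1 / 2) * th) with (- (th / 2)) by field. rewrite sin_neg. ring.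
 - rewrite seq_S, lsum_app, Rmult_plus_distr_l, IH. simpl lsum. replace (ang (m * k)) with (INR m * th) by (unfold th, ang; rewrite mult_INR; field; lra).
  rewrite S_INR. replace ((INR m + 1 - 1 / 2) * th) with (INR m * th + th / 2) by field. replace ((INR m - 1 / 2) * th) with (INR m * th - th / 2) by field.
  rewrite sin_plus, sin_minus. ring. }
specialize (G p). fold residues in G.
replace ((INR p - 1 / 2) * th) with (- (th / 2) + 2 * INR k * PI) in G by (unfold th, ang; field; lra).
rewrite sin_period, sin_neg in G. nra.
Qed.

Lemma cos_sum_0 k : (k mod p = 0)%nat -> lsum (fun n => cos (ang (n * k))) residues = INR p.
Proof.
intros Hk. rewrite (lsum_ext _ (fun _ => 1)).
- assert (G : forall m s, lsum (fun _ : nat => 1) (List.seq s m) = INR m); eauto.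
 induction m as [|m IH]; intros s; auto. simpl lsum. rewrite IH, S_INR. ring.
- intros n _. rewrite <- cos_ang_mod. replace ((n * k) mod p)%nat with 0%nat by (rewrite <- Nat.Div0.mul_mod_idemp_r, Hk, Nat.mul_0_r; symmetry; apply Nat.Div0.mod_0_l).
 unfold ang. simpl. replace (2 * PI * 0 / INR p) with 0 by lra. apply cos_0.
Qed.

(** If it were zero, every [gauss n] would be. But by orthogonality the pairing with [sin (ang n)]
    equals [p], half of it from [A = 1] and half from [A = p - 1], where [chi] is 1 and -1. In the
    cosines [A + (p - 1)] stands for [A - 1]. *)
Lemma gauss_nz : gauss 1 <> 0.
Proof.
intros H0. pose proof INR_p as Hpp. pose proof p_ge3 as H3.
assert (E1 : lsum (fun n => gauss n * sin (ang n)) residues = 0).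
{ rewrite (lsum_ext _ (fun _ => 0 * 0)); [rewrite lsum_scal; ring|]. intros n _. rewrite gauss_mul, H0. ring. }
assert (E2 : lsum (fun n => gauss n * sin (ang n)) residues =
 lsum (fun A => cR A * (/ 2 * lsum (fun n => cos (ang (n * (A + (p - 1))))) residues) + cR A * (- / 2 * lsum (fun n => cos (ang (n * (A + 1)))) residues)) residues).
{ rewrite (lsum_ext _ (fun n => lsum (fun A => cR A * sin (ang (A * n)) * sin (ang n)) residues)).
 2:{ intros n _. unfold gauss. rewrite Rmult_comm, <- lsum_scal. apply lsum_ext. intros; ring. }
 rewrite lsum_swap. apply lsum_ext. intros A _. rewrite <- !lsum_scal, <- lsum_plus. apply lsum_ext. intros n _.
 replace (ang (n * (A + 1))) with (ang (A * n) + ang n) by (unfold ang; rewrite !mult_INR, plus_INR; simpl INR; field; lra).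
 replace (ang (n * (A + (p - 1)))) with (ang (A * n) - ang n + 2 * INR n * PI) by (unfold ang; rewrite !mult_INR, plus_INR, minus_INR by lia; simpl INR; field; lra).
 rewrite cos_period, cos_plus, cos_minus. field. }
assert (E3 : lsum (fun A => cR A * (/ 2 * lsum (fun n => cos (ang (n * (A + (p - 1))))) residues) + cR A * (- / 2 * lsum (fun n => cos (ang (n * (A + 1)))) residues)) residues
 = lsum (fun A => (if Nat.eqb A 1 then INR p / 2 else 0) + (if Nat.eqb A (p - 1) then INR p / 2 else 0)) residues).
{ apply lsum_ext. intros A HA. apply in_residues in HA. f_equal.
 - destruct (Nat.eqb_spec A 1) as [->|Hn].
  + rewrite cos_sum_0 by (replace (1 + (p - 1))%nat with p by lia; apply Nat.Div0.mod_same). unfold cR. rewrite chi_1. field.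
  + rewrite cos_sum; [ring|]. intros Hm. apply Nat.Div0.mod_divides in Hm. destruct Hm as [c Hc]. assert (c = 1 \/ c = 0 \/ 2 <= c)%nat by lia. nia.
 - destruct (Nat.eqb_spec A (p - 1)) as [->|Hn].
  + rewrite cos_sum_0 by (replace (p - 1 + 1)%nat with p by lia; apply Nat.Div0.mod_same). unfold cR. rewrite (chi_opp 1 (p - 1) 1) by lia. rewrite chi_1. simpl. field.
  + rewrite cos_sum; [ring|]. intros Hm. apply Nat.Div0.mod_divides in Hm. destruct Hm as [c Hc]. assert (c = 1 \/ c = 0 \/ 2 <= c)%nat by lia. nia. }
rewrite E3 in E2.
assert (E4 : forall b, (b < p)%nat -> lsum (fun A => if Nat.eqb A b then INR p / 2 else 0) residues = INR p / 2).
{ intros b Hb. unfold residues.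
 assert (G : forall m s, lsum (fun A => if Nat.eqb A b then INR p / 2 else 0) (List.seq s m) = if andb (Nat.leb s b) (Nat.ltb b (s + m)) then INR p / 2 else 0).
 { induction m as [|m IH]; intros s; simpl List.seq; simpl lsum.
  - destruct (Nat.leb_spec s b), (Nat.ltb_spec b (s + 0)); simpl; try reflexivity; lia.
  - rewrite IH. destruct (Nat.eqb_spec s b), (Nat.leb_spec s b), (Nat.leb_spec (S s) b), (Nat.ltb_spec b (s + S m)), (Nat.ltb_spec b (S s + m)); simpl; try lia; ring. }
 rewrite G. destruct (Nat.leb_spec 0 b), (Nat.ltb_spec b (0 + p)); try reflexivity; lia. }
rewrite lsum_plus, !E4 in E2 by lia. lra.
Qed.
End Character.

Lemma cexp_pow u n : (cexp u ^ n)%C = cexp (RtoC (INR n) * u).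
Proof.
induction n as [|n IH].
- simpl. replace (RtoC 0 * u)%C with (RtoC 0) by ring. symmetry. apply cexp_0.
- change ((cexp u ^ S n)%C) with (cexp u * cexp u ^ n)%C. rewrite IH, <- cexp_plus. f_equal. rewrite S_INR, RtoC_plus. ring.
Qed.

Lemma ee_pow x y n : (ee (x, y) ^ n)%C = ee (INR n * x, INR n * y).
Proof.
unfold ee. rewrite cexp_pow. f_equal. Cring.
Qed.

Lemma Im_Ei x y : 0 < y -> Im (Ei (x, y)) = Series (fun n => ei n * exp (- (2 * PI * y)) ^ n * sin (2 * PI * (INR n * x))) /\
 ex_series (fun n => ei n * exp (- (2 * PI * y)) ^ n * sin (2 * PI * (INR n * x))).
Proof.
intros Hy.
assert (E : forall n, Im (RtoC (ei n) * ee (x, y) ^ n) = ei n * exp (- (2 * PI * y)) ^ n * sin (2 * PI * (INR n * x))).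
{ intros n. rewrite ee_pow, ee_coord. unfold Im; simpl. rewrite exp_pow_INR.
 replace (INR n * - (2 * PI * y)) with (- (2 * PI * (INR n * y))) by ring. ring. }
split.
- apply Series_ext, E.
- apply ex_series_ext with (fun n => Im (RtoC (ei n) * ee (x, y) ^ n)); auto.
 apply (cdom_ex _ _ (Cps_dom ei (ee (x, y)) ei_radius (Cmod_ee_lt (x, y) Hy))).
Qed.

Lemma lsum_Series {A} (f : A -> nat -> R) l : (forall x, ex_series (f x)) -> lsum (fun x => Series (f x)) l = Series (fun n => lsum (fun x => f x n) l) /\ ex_series (fun n => lsum (fun x => f x n) l).
Proof.
intros H. induction l as [|x l [IH1 IH2]]; simpl.
- split; [symmetry; rewrite (Series_finite (fun _ => 0) 0 ltac:(easy)); apply rsum_O|].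
 exists 0. assert (L : is_lim_seq (sum_n (fun _ : nat => 0)) 0); auto. apply is_lim_seq_ext with (fun _ => 0); [|apply is_lim_seq_const].
 intros n. symmetry. apply (rsum_zero (fun _ => 0)). reflexivity.
- split; [rewrite IH1, Series_plus by easy; reflexivity|apply (ex_series_plus (f x)); easy].
Qed.

(** Interchanging the sums leaves, for each [n], the Gauss sum at [n], that is [chi n] times a
    constant: the twist of the Eichler integral is a combination of its values over the points
    [A/p]. *)
Theorem twisted_sum p chi y : Znumtheory.prime (Z.of_nat p) -> (p mod 4 = 3)%nat -> character p chi -> 0 < y ->
 lsum (fun A => IZR (chi A) * Im (Ei (INR A / INR p, y))) (residues p) = gauss p chi 1 * PSeries (fun n => ei n * IZR (chi n)) (exp (- (2 * PI * y))).
Proof.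
intros Hp Hp4 Hchi Hy.
set (f := fun (A n : nat) => IZR (chi A) * (ei n * exp (- (2 * PI * y)) ^ n * sin (2 * PI * (INR n * (INR A / INR p))))).
rewrite (lsum_ext _ (fun A => Series (f A))).
2:{ intros A _. unfold f. rewrite Series_scal_l. f_equal. apply (Im_Ei _ _ Hy). }
destruct (lsum_Series f (residues p)) as [E _].
{ intros A. apply (ex_series_scal_l (K := R_AbsRing) (V := R_NormedModule) (IZR (chi A)) (fun n => ei n * exp (- (2 * PI * y)) ^ n * sin (2 * PI * (INR n * (INR A / INR p))))), (Im_Ei _ _ Hy). }
rewrite E. unfold PSeries. rewrite <- Series_scal_l. apply Series_ext. intros n.
rewrite (lsum_ext _ (fun A => (ei n * exp (- (2 * PI * y)) ^ n) * (cR chi A * sin (ang p (A * n))))).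
- rewrite lsum_scal. fold (gauss p chi n). rewrite (gauss_mul p chi Hp Hp4 Hchi n). unfold cR. ring.
- intros A _. unfold f, cR, ang. rewrite mult_INR. replace (2 * PI * (INR n * (INR A / INR p))) with (2 * PI * (INR A * INR n) / INR p) by lra. ring.
Qed.

(** * Summation over the residues *)

Lemma choice_fun {A B : Type} (R0 : A -> B -> Prop) : (forall x, exists y, R0 x y) -> exists f, forall x, R0 x (f x).
Proof.
intros H. exists (fun x => proj1_sig (constructive_indefinite_description _ (H x))). intros x. apply proj2_sig.
Qed.

Lemma lsum_filter {A} (f : A -> R) (P : A -> bool) l : lsum f (List.filter P l) = lsum (fun x => if P x then f x else 0) l.
Proof. induction l as [|x l IH]; simpl; auto. destruct (P x); simpl; rewrite IH; ring. Qed.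

Definition zsum {A} (f : A -> Z) (l : list A) : Z := fold_right (fun x s => (f x + s)%Z) 0%Z l.
Lemma zsum_IZR {A} (f : A -> Z) l : IZR (zsum f l) = lsum (fun x => IZR (f x)) l.
Proof. induction l as [|x l IH]; simpl; auto. rewrite plus_IZR, IH. reflexivity. Qed.

Definition Wp (p A : nat) (y : R) : R := Im (Ei (INR A / INR p, y)).

Lemma Ei_per k x y : Ei (x + INR k, y) = Ei (x, y).
Proof.
induction k as [|k IH]; [rewrite Rplus_0_r; reflexivity|]. rewrite <- IH, <- (Ei_1 (x + INR k, y)). f_equal.
rewrite S_INR. Cring.
Qed.

Lemma kappa_per k x y : kappa (x + INR k, y) = kappa (x, y) + INR k.
Proof.
induction k as [|k IH]; [rewrite !Rplus_0_r; reflexivity|]. rewrite S_INR.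
replace (kappa (x, y) + (INR k + 1)) with (kappa (x, y) + INR k + 1) by ring. rewrite <- IH, <- kappa_1. f_equal.
Cring.
Qed.

Lemma Ei_neg x y : Im (Ei (- x, y)) = - Im (Ei (x, y)).
Proof.
replace ((- x, y) : C) with (- Cconj (x, y))%C by Cring.
unfold Ei. rewrite fourier_conj. reflexivity.
Qed.

Lemma kappa_neg x y : kappa (- x, y) = - kappa (x, y).
Proof.
replace ((- x, y) : C) with (- Cconj (x, y))%C by Cring. apply kappa_conj.
Qed.

Lemma Zmod_of_nat n m r : (n mod m = r)%nat -> (Z.of_nat n mod Z.of_nat m = Z.of_nat r)%Z.
Proof. intros <-. symmetry. apply Nat2Z.inj_mod. Qed.

Section Residues.
Variables (p : nat) (chi : nat -> Z).
Hypothesis Hp : Znumtheory.prime (Z.of_nat p).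
Hypothesis Hp4 : (p mod 4 = 3)%nat.
Hypothesis Hchi : character p chi.

Lemma Wp_opp A B k y : (A + B = k * p)%nat -> Wp p B y = - Wp p A y.
Proof.
intros E. pose proof (INR_p p Hp4) as Hpp. unfold Wp. rewrite <- Ei_neg, <- (Ei_per k (- (INR A / INR p))). f_equal. f_equal. f_equal.
apply (f_equal INR) in E. rewrite plus_INR, mult_INR in E. apply Rmult_eq_reg_r with (INR p); [|lra]. field_simplify; lra.
Qed.

(* The reduced representative of [- A]; note that [negr 0 = 0]. *)
Definition negr (A : nat) : nat := ((p - A) mod p)%nat.

Lemma negr_spec A : (A < p)%nat -> (A = 0%nat /\ negr A = 0%nat) \/ (0 < A /\ negr A = p - A)%nat.
Proof.
intros H. unfold negr. destruct A as [|A]; [left; split; [reflexivity|rewrite Nat.sub_0_r; apply Nat.Div0.mod_same]|right].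
split; [lia|apply Nat.mod_small; lia].
Qed.

Lemma sum_negr (f : nat -> R) : lsum (fun A => f (negr A)) (residues p) = lsum f (residues p).
Proof.
apply lsum_reindex; [apply seq_NoDup| |].
- intros x Hx. apply in_residues. exact (p_mod p Hp4 _).
- intros x y Hx Hy E. apply in_residues in Hx. apply in_residues in Hy.
 destruct (negr_spec x Hx) as [[? ?]|[? ?]], (negr_spec y Hy) as [[? ?]|[? ?]]; lia.
Qed.

Definition is1 (A : nat) : bool := Z.eqb (chi A) 1.
Definition L1 : list nat := List.filter is1 (residues p).

Lemma in_L1 A : In A L1 <-> (A < p)%nat /\ chi A = 1%Z.
Proof. unfold L1. rewrite filter_In, (in_residues p). unfold is1. lia. Qed.

Lemma chi_negr A : (A < p)%nat -> chi (negr A) = (- chi A)%Z.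
Proof.
intros H. destruct (negr_spec A H) as [[-> E]|[H0 E]]; rewrite E.
- rewrite (chi_0 p chi Hchi 0); [lia|apply Nat.Div0.mod_0_l].
- apply (chi_opp p chi Hchi A _ 1). lia.
Qed.

(** [chi] and [f] are both odd, so [A] and [- A] contribute equally and the representative with
    [chi = 1] may be chosen from each pair. *)
Lemma half_sum (f : nat -> R) : (forall A, (A < p)%nat -> f (negr A) = - f A) -> lsum (fun A => IZR (chi A) * f A) (residues p) = 2 * lsum f L1.
Proof.
intros Hf. unfold L1. rewrite lsum_filter, (lsum_ext _ (fun A => (if is1 A then f A else 0) + (if is1 (negr A) then f (negr A) else 0))).
- rewrite lsum_plus, (sum_negr (fun A => if is1 A then f A else 0)). ring.
- intros A HA. apply (in_residues p) in HA. unfold is1. rewrite chi_negr, Hf by pos.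
 destruct (Nat.eq_dec (A mod p) 0) as [H0|H0]; [rewrite (chi_0 p chi Hchi A H0); simpl; ring|].
 destruct (chi_pm p chi Hchi A H0) as [-> | ->]; simpl; ring.
Qed.

(** There are [(p-1)/2] such residues. This number being odd is what finally keeps the integer [S]
    away from 0. *)
Lemma L1_length : exists q, Z.of_nat (List.length L1) = (2 * q + 1)%Z.
Proof.
assert (Hl : forall l : list nat, lsum (fun _ => 1) l = INR (List.length l)).
{ induction l as [|x l IH]; auto. change (1 + lsum (fun _ => 1) l = INR (S (List.length l))). rewrite IH, S_INR. ring. }
assert (E : 2 * INR (List.length L1) + 1 = INR p).
{ rewrite <- Hl. unfold L1. rewrite lsum_filter.
 assert (E0 : lsum (fun A => if Nat.eqb A 0 then 1 else 0) (residues p) = 1).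
 { pose proof (p_ge3 p Hp4). destruct p as [|m]; [lia|]. simpl lsum.
  rewrite (lsum_ext _ (fun _ => 0 * 0)); [rewrite lsum_scal; ring|]. intros x Hx. apply in_seq in Hx. destruct x; [lia|Cring]. }
 assert (Ep : lsum (fun _ : nat => 1) (residues p) = INR p) by (rewrite Hl; unfold residues; rewrite length_seq; reflexivity).
 rewrite <- Ep, (lsum_ext (fun _ : nat => 1) (fun A => ((if is1 A then 1 else 0) + (if is1 (negr A) then 1 else 0)) + (if Nat.eqb A 0 then 1 else 0))).
 - rewrite !lsum_plus, E0, (sum_negr (fun A => if is1 A then 1 else 0)). ring.
 - intros A HA. apply (in_residues p) in HA. unfold is1. rewrite chi_negr by lia.
  destruct (Nat.eqb_spec A 0) as [->|HA0].
  + rewrite (chi_0 p chi Hchi 0) by apply Nat.Div0.mod_0_l. Cring.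
  + destruct (chi_pm p chi Hchi A) as [-> | ->]; [rewrite Nat.mod_small by lia; exact HA0|Cring|Cring]. }
replace 2 with (INR 2) in E by easy. rewrite <- mult_INR in E. change 1 with (INR 1) in E. rewrite <- plus_INR in E. apply INR_eq in E.
exists (Z.of_nat (p / 4)). pose proof (Nat.div_mod_eq p 4). lia.
Qed.

Lemma perm_L1 (f : nat -> R) (g : nat -> nat) : (forall A, In A L1 -> In (g A) L1) -> (forall A B, In A L1 -> In B L1 -> g A = g B -> A = B) ->
 lsum (fun A => f (g A)) L1 = lsum f L1.
Proof. intros H1 H2. apply lsum_reindex; [apply NoDup_filter, seq_NoDup|pos|pos]. Qed.

Lemma L1_unit A : In A L1 -> (A mod p <> 0)%nat.
Proof.
intros H. apply in_L1 in H. destruct H as [_ H]. intros H0. rewrite (chi_0 p chi Hchi A H0) in H. discriminate.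
Qed.

Lemma unit_rel_prime A : (A mod p <> 0)%nat -> rel_prime (Z.of_nat A) (Z.of_nat p).
Proof.
intros H. apply rel_prime_sym, prime_rel_prime; eauto. intros [k Hk]. apply H, Nat.Div0.mod_divides. exists (Z.to_nat k). nia.
Qed.

Lemma small_unit d : (0 < d < p)%nat -> (d mod p <> 0)%nat.
Proof. intros H. rewrite Nat.mod_small; lia. Qed.

Lemma unit_mul a b : (a mod p <> 0 -> b mod p <> 0 -> (a * b) mod p <> 0)%nat.
Proof. intros Ha Hb H. apply (Euclid p Hp Hp4) in H. tauto. Qed.

(** * The sum over the cusps A/p for primes other than 3 *)

Section Large.
Hypothesis Hp3 : p <> 3%nat.
Variables (G om B0 B3 : R).
Hypothesis Hper : periods G om B0 B3.

Lemma p_ge7 : (7 <= p)%nat.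
Proof. pose proof (p_ge3 p Hp4). destruct (Nat.eq_dec p 4); [subst; discriminate|]. destruct (Nat.eq_dec p 5); [subst; discriminate|]. destruct (Nat.eq_dec p 6); [subst; discriminate|]. lia. Qed.

(** [K A] is the inverse of [- 6 A] modulo [p]: a matrix of class 6 connects the neighbourhoods of
    [A/p] and [K A / p]. Outside [L1] the functions take dummy values. *)
Lemma cusp_choice : exists (K : nat -> nat) (H t : nat -> Z) (q0 q2 : nat -> R), forall A, In A L1 ->
 (K A < p)%nat /\ (exists m, (6 * A * K A + 1 = m * p)%nat) /\
 (forall y, 0 < y -> Wp p A y + 6 * INR p ^ 2 * y ^ 2 * Wp p (K A) (/ (6 * INR p ^ 2 * y)) = q0 A - 12 * om / INR p * IZR (H A) * y + q2 A * y ^ 2) /\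
 rl K4 (INR A / INR p) ((IZR (t A) + INR A) / INR p) /\ ((p mod 24 = 7 \/ p mod 24 = 11)%nat -> exists k : Z, H A = (4 - t A + 8 * k)%Z).
Proof.
pose proof p_ge7 as H7.
assert (Hex : forall A, exists r : (nat * (Z * Z)) * (R * R), In A L1 -> (fst (fst r) < p)%nat /\ (exists m, (6 * A * fst (fst r) + 1 = m * p)%nat) /\
 (forall y, 0 < y -> Wp p A y + 6 * INR p ^ 2 * y ^ 2 * Wp p (fst (fst r)) (/ (6 * INR p ^ 2 * y)) = fst (snd r) - 12 * om / INR p * IZR (fst (snd (fst r))) * y + snd (snd r) * y ^ 2) /\
 rl K4 (INR A / INR p) ((IZR (snd (snd (fst r))) + INR A) / INR p) /\ ((p mod 24 = 7 \/ p mod 24 = 11)%nat -> exists k : Z, fst (snd (fst r)) = (4 - snd (snd (fst r)) + 8 * k)%Z)).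
{ intros A. destruct (classic (In A L1)) as [HA|HA]; [|exists ((0%nat, (0%Z, 0%Z)), (0, 0)); tauto].
 pose proof (L1_unit A HA) as HAu.
 assert (Hu : ((6 * A) mod p <> 0)%nat) by (apply unit_mul; [apply small_unit; lia|lia]).
 destruct (bezout_pos _ _ (unit_rel_prime _ Hu)) as [D [B E]].
 set (k := Z.to_nat ((- D) mod Z.of_nat p)). pose proof (Z.mod_pos_bound (- D) (Z.of_nat p) ltac:(lia)) as Hk.
 assert (Ek : Z.of_nat k = ((- D) mod Z.of_nat p)%Z) by lia.
 pose proof (Z.div_mod (- D) (Z.of_nat p) ltac:(lia)) as Edm.
 set (d := ((- D) / Z.of_nat p)%Z) in *.
 (* The Bezout coefficient [D] is replaced by [- k] in its class modulo [p], and [B] is adjusted to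
    keep the determinant. *)
 destruct (Ei_cusp G om B0 B3 (Z.of_nat p) (Z.of_nat A) (- Z.of_nat k) (- (- B - Z.of_nat (6 * A) * d)) Hper ltac:(lia)) as [H [t [q0 [q2 [H1 [H2 H3]]]]]].
 { lia. }
 exists ((k, (H, t)), (q0, q2)). intros _. simpl fst. rewrite opp_IZR, <- !INR_IZR_INZ in H1. rewrite plus_IZR, <- !INR_IZR_INZ in H2.
 split; [lia|]. split; [|split; [|split; auto]].
 - exists (Z.to_nat (- B - Z.of_nat (6 * A) * d)). nia.
 - intros y Hy. specialize (H1 y Hy). replace (- (- INR k / INR p)) with (INR k / INR p) in H1 by lra. exact H1.
 - intros Hm. apply H3. destruct Hm as [Hm|Hm]; [left|right]; exact (Zmod_of_nat p 24 _ Hm). }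
destruct (choice_fun _ Hex) as [r Hr]. exists (fun A => fst (fst (r A))), (fun A => fst (snd (fst (r A)))), (fun A => snd (snd (fst (r A)))), (fun A => fst (snd (r A))), (fun A => snd (snd (r A))).
exact Hr.
Qed.

Lemma T_choice : exists T : nat -> Z, forall A, (A mod p <> 0)%nat -> rl kappa (INR A / INR p) ((IZR (T A) + INR A) / INR p) /\ ((p mod 8 = 3)%nat -> exists k, T A = (4 + 8 * k)%Z).
Proof.
pose proof p_ge7 as H7. apply (choice_fun (fun A T => (A mod p <> 0)%nat -> rl kappa (INR A / INR p) ((IZR T + INR A) / INR p) /\ ((p mod 8 = 3)%nat -> exists k, T = (4 + 8 * k)%Z))).
intros A. destruct (classic (A mod p <> 0)%nat) as [HA|HA]; [|exists 0%Z; tauto].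
destruct (kappa_cusp (Z.of_nat p) (Z.of_nat A) ltac:(lia)) as [t [H1 H2]].
{ replace (2 * Z.of_nat A)%Z with (Z.of_nat (2 * A)) by lia. apply unit_rel_prime, unit_mul; [apply small_unit; lia|lia]. }
exists t. intros _. rewrite plus_IZR, <- !INR_IZR_INZ in H1. split; auto. intros Hm. apply H2. exact (Zmod_of_nat p 8 _ Hm).
Qed.

Section Tsum.
Variable T : nat -> Z.
Hypothesis HT : forall A, (A mod p <> 0)%nat -> rl kappa (INR A / INR p) ((IZR (T A) + INR A) / INR p) /\ ((p mod 8 = 3)%nat -> exists k, T A = (4 + 8 * k)%Z).

(** [kappa] is odd under reflection in the imaginary axis and shifts by 1 under translation;
    uniqueness of radial limits carries both properties over to [T]. *)
Lemma T_opp A B k : (A mod p <> 0)%nat -> (A + B = k * p)%nat -> IZR (T B) = - IZR (T A).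
Proof.
intros HA E. pose proof (INR_p p Hp4) as Hpp.
assert (HB : (B mod p <> 0)%nat).
{ intros HB. apply HA. apply Nat.Div0.mod_divides in HB. destruct HB as [c Hc]. apply Nat.Div0.mod_divides. exists (k - c)%nat. nia. }
destruct (HT A HA) as [H1 _]. destruct (HT B HB) as [H2 _].
apply (f_equal INR) in E. rewrite plus_INR, mult_INR in E.
assert (Ex : INR B / INR p = - (INR A / INR p) + INR k) by (apply Rmult_eq_reg_r with (INR p); [|lra]; field_simplify; lra).
assert (H3 : rl kappa (INR B / INR p) (- ((IZR (T A) + INR A) / INR p) + INR k)).
{ intros eps Heps. destruct (H1 eps Heps) as [d [Hd Hy]]. exists d. split; auto. intros y Hy0. specialize (Hy y Hy0).
 rewrite Ex, kappa_per, kappa_neg. replace (- kappa (INR A / INR p, y) + INR k - (- ((IZR (T A) + INR A) / INR p) + INR k)) with (- (kappa (INR A / INR p, y) - (IZR (T A) + INR A) / INR p)) by ring.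
 rewrite Rabs_Ropp. exact Hy. }
pose proof (rl_unique _ _ _ _ H2 H3) as Eu. apply (f_equal (fun x => x * INR p)) in Eu. field_simplify in Eu; lra.
Qed.

Lemma T_mod A : (A mod p <> 0)%nat -> IZR (T (A mod p)) = IZR (T A).
Proof.
intros HA. set (B := (p - A mod p)%nat). pose proof (p_mod p Hp4 A).
pose proof (Nat.div_mod_eq A p).
assert (HAm : ((A mod p) mod p <> 0)%nat) by (rewrite Nat.Div0.mod_mod; exact HA).
pose proof (T_opp (A mod p) B 1 HAm ltac:(lia)) as E1. pose proof (T_opp A B (A / p + 1) HA ltac:(lia)) as E2. lra.
Qed.

(** Multiplication by 3 permutes the residues with [chi = 1] if [chi 3 = 1], and permutes them after
    a change of sign if [chi 3 = -1]; [T] is odd and depends on the class modulo [p] only. *)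
Lemma T3_sum : lsum (fun A => IZR (T (3 * A))) L1 = IZR (chi 3) * lsum (fun A => IZR (T A)) L1.
Proof.
pose proof p_ge7 as H7.
assert (H3u : (3 mod p <> 0)%nat) by (apply small_unit; lia).
assert (Hm : forall A, In A L1 -> (((3 * A) mod p) mod p <> 0)%nat).
{ intros A HA. rewrite Nat.Div0.mod_mod. apply unit_mul; [lia|apply L1_unit, HA]. }
assert (Hc : forall A, In A L1 -> chi ((3 * A) mod p) = chi 3).
{ intros A HA. rewrite (chi_mod p chi Hchi). destruct Hchi as [Hmul _]. rewrite Hmul. apply in_L1 in HA. lia. }
destruct (chi_pm p chi Hchi 3 H3u) as [E3|E3]; rewrite E3.
- rewrite Rmult_1_l, <- (perm_L1 (fun A => IZR (T A)) (fun A => (3 * A) mod p)%nat).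
 + apply lsum_ext. intros A HA. symmetry. apply T_mod. specialize (Hm A HA). rewrite Nat.Div0.mod_mod in Hm. exact Hm.
 + intros A HA. apply in_L1. split; [exact (p_mod p Hp4 _)|]. rewrite Hc, E3 by pos. reflexivity.
 + intros A B HA HB E. apply in_L1 in HA. apply in_L1 in HB. apply (mul_inj p Hp Hp4 3); tauto.
- rewrite <- lsum_scal, <- (perm_L1 (fun A => -1 * IZR (T A)) (fun A => negr ((3 * A) mod p))).
 + apply lsum_ext. intros A HA. pose proof (p_mod p Hp4 (3 * A)) as Hlt. destruct (negr_spec _ Hlt) as [[E0 _]|[H0 E]].
  * exfalso. apply (Hm A HA). rewrite E0. apply Nat.Div0.mod_0_l.
  * rewrite (T_opp ((3 * A) mod p) (negr ((3 * A) mod p)) 1 (Hm A HA)) by lia. rewrite T_mod; [ring|]. lia.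
 + intros A HA. apply in_L1. split; [exact (p_mod p Hp4 _)|]. rewrite chi_negr, Hc, E3 by (try apply p_mod; assumption). reflexivity.
 + intros A B HA HB E. apply in_L1 in HA. apply in_L1 in HB. apply (mul_inj p Hp Hp4 3); try tauto.
  pose proof (p_mod p Hp4 (3 * A)) as HlA. pose proof (p_mod p Hp4 (3 * B)) as HlB.
  destruct (negr_spec _ HlA) as [[? ?]|[? ?]], (negr_spec _ HlB) as [[? ?]|[? ?]]; lia.
Qed.
End Tsum.

(** The relations at the single cusps are added up. The sign [- chi 6] arises because
    [chi (K A) = - chi 6] for [A] in [L1]. *)
Theorem half_equation : exists (eps q0 q2 : R) (S : Z), (eps = 1 \/ eps = -1) /\ eps = - IZR (chi 6) /\
 (forall y, 0 < y -> lsum (fun A => Wp p A y) L1 + eps * (6 * INR p ^ 2) * y ^ 2 * lsum (fun A => Wp p A (/ (6 * INR p ^ 2 * y))) L1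
   = q0 - 12 * om / INR p * IZR S * y + q2 * y ^ 2) /\
 ((p mod 24 = 7 \/ p mod 24 = 11)%nat -> S <> 0%Z).
Proof.
pose proof p_ge7 as H7. destruct cusp_choice as [K [H [t [q0 [q2 Hc]]]]]. destruct T_choice as [T HT].
assert (H6u : (6 mod p <> 0)%nat) by (apply small_unit; lia).
pose proof (chi_pm p chi Hchi 6 H6u) as Hc6.
assert (HchiK : forall A, In A L1 -> chi (K A) = (- chi 6)%Z).
{ intros A HA. destruct (Hc A HA) as [_ [[m Hm] _]]. pose proof (chi_opp p chi Hchi _ _ _ Hm) as E. rewrite (chi_1 p chi Hchi) in E.
 destruct Hchi as [Hmul _]. rewrite !Hmul in E. apply in_L1 in HA. lia. }
assert (HKinj : forall A B, In A L1 -> In B L1 -> K A = K B -> A = B).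
{ intros A B HA HB E. destruct (Hc A HA) as [_ [[m Hm] _]]. destruct (Hc B HB) as [_ [[m' Hm'] _]]. rewrite <- E in Hm'.
 apply in_L1 in HA. apply in_L1 in HB. apply (mul_inj p Hp Hp4 (6 * K A)); try tauto.
 - intros H0. apply Nat.Div0.mod_divides in H0. destruct H0 as [c H0].
  assert (E2 : ((m - A * c) * p = 1)%nat) by nia. nia.
 - assert (G0 : forall X j, (6 * X * K A + 1 = j * p)%nat -> ((6 * K A * X) mod p = p - 1)%nat).
  { intros X j Hj. symmetry. apply (Nat.mod_unique _ _ (j - 1)); [lia|]. destruct j; [lia|]. nia. }
  rewrite (G0 A m Hm), (G0 B m' Hm'). reflexivity. }
assert (Hneg : forall A y, In A L1 -> Wp p (negr (K A)) y = - Wp p (K A) y /\ chi (negr (K A)) = chi 6).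
{ intros A y HA. destruct (Hc A HA) as [HK _]. split; [|rewrite chi_negr, HchiK by assumption; ring].
 destruct (negr_spec _ HK) as [[E0 E1]|[H0 E1]].
 - pose proof (HchiK A HA) as HcK. rewrite E0, (chi_0 p chi Hchi 0) in HcK by apply Nat.Div0.mod_0_l. lia.
 - apply (Wp_opp _ _ 1). lia. }
(* [K] permutes [L1] if [chi 6 = -1]; otherwise [- K] does, and [Wp] is odd. *)
assert (Hstar : forall y, lsum (fun A => Wp p (K A) y) L1 = - IZR (chi 6) * lsum (fun A => Wp p A y) L1).
{ intros y. destruct Hc6 as [Hc6|Hc6]; rewrite Hc6.
 - rewrite <- (perm_L1 (fun A => Wp p A y) (fun A => negr (K A))).
  + rewrite <- lsum_scal. apply lsum_ext. intros A HA. destruct (Hneg A y HA) as [-> _]. lra.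
  + intros A HA. apply in_L1. split; [exact (p_mod p Hp4 _)|]. destruct (Hneg A y HA) as [_ ->]. exact Hc6.
  + intros A B HA HB E. apply HKinj; try assumption. destruct (Hc A HA) as [HKA _]. destruct (Hc B HB) as [HKB _].
   destruct (negr_spec _ HKA) as [[? ?]|[? ?]], (negr_spec _ HKB) as [[? ?]|[? ?]]; lia.
 - rewrite <- (perm_L1 (fun A => Wp p A y) K).
  + lra.
  + intros A HA. apply in_L1. split; [apply (Hc A HA)|]. rewrite HchiK by pos. lia.
  + pos. }
exists (- IZR (chi 6)), (lsum q0 L1), (lsum q2 L1), (zsum H L1). split; [destruct Hc6 as [-> | ->]; lra; ring|]. split; auto. split.
- intros y Hy. rewrite zsum_IZR.
 transitivity (lsum (fun A => Wp p A y + 6 * INR p ^ 2 * y ^ 2 * Wp p (K A) (/ (6 * INR p ^ 2 * y))) L1).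
 + rewrite lsum_plus, lsum_scal, Hstar. ring.
 + rewrite (lsum_ext _ (fun A => q0 A + ((- (12 * om / INR p) * y) * IZR (H A) + y ^ 2 * q2 A))).
  * rewrite !lsum_plus, !lsum_scal. ring.
  * intros A HA. destruct (Hc A HA) as [_ [_ [E _]]]. rewrite (E y Hy). ring.
(* Modulo 8, [S] is [4 |L1|] minus the sum of the [t A], with [|L1|] odd, and 4 times that sum is
   [1 + chi 3] times the sum of the [T A]. For [p = 7] modulo 24 the sum of the [t A] is 0 and
   [S = 4] modulo 8. For [p = 11] every [T A] is 4 modulo 8, so the sum of the [t A], half the sum
   of the [T A], is 2 modulo 4, and so is [S]. *)
- intros Hmod.
 assert (HH : exists m, zsum H L1 = (4 * Z.of_nat (List.length L1) - zsum t L1 + 8 * m)%Z).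
 { assert (Gen : forall l, (forall A, In A l -> In A L1) -> exists m, zsum H l = (4 * Z.of_nat (List.length l) - zsum t l + 8 * m)%Z).
  { induction l as [|A l IH]; intros Hl; [exists 0%Z; reflexivity|]. destruct IH as [m Hm]; [intros; apply Hl; right; assumption|].
   destruct (Hc A) as [_ [_ [_ [_ Hk]]]]; [apply Hl; left; reflexivity|]. destruct (Hk Hmod) as [k Ek]. exists (m + k)%Z. cbn [zsum fold_right List.length]. unfold zsum in Hm. lia. } auto. }
 destruct HH as [m Hm]. destruct L1_length as [q Hq].
 (* The radial limit of [K4] at [A/p] is known directly and also through [kappa] at [A/p] and
    [3A/p]; comparison gives [4 t A = T A + T (3 A)]. *)
 assert (H4t : 4 * lsum (fun A => IZR (t A)) L1 = lsum (fun A => IZR (T A)) L1 + IZR (chi 3) * lsum (fun A => IZR (T A)) L1).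
 { rewrite <- (T3_sum T HT), <- lsum_scal, <- lsum_plus. apply lsum_ext. intros A HA. pose proof (INR_p p Hp4) as Hpp.
  destruct (Hc A HA) as [_ [_ [_ [Hr _]]]]. pose proof (L1_unit A HA) as HAu.
  destruct (HT A HAu) as [R1 _]. destruct (HT (3 * A)%nat) as [R2 _]; [apply unit_mul; [apply small_unit; lia|lia]|].
  replace (INR (3 * A) / INR p) with (3 * (INR A / INR p)) in R2 by (rewrite mult_INR; simpl INR; field; lra).
  pose proof (rl_unique _ _ _ _ Hr (rl_K4 _ _ _ R1 R2)) as E. apply (f_equal (fun x => x * INR p)) in E. rewrite mult_INR in E. simpl INR in E. field_simplify in E; lra. }
 rewrite <- !zsum_IZR in H4t. destruct Hchi as [_ [_ [_ [_ [_ [_ [_ [_ [_ [C1 C2]]]]]]]]]].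
 pose proof (Nat.div_mod_eq p 24) as E24.
 destruct Hmod as [Hmod|Hmod]; rewrite Hmod in E24.
 + rewrite C2 in H4t; [|lia|symmetry; apply (Nat.mod_unique _ _ (8 * (p / 24) + 2)); lia].
  assert (Et : zsum t L1 = 0%Z) by (apply eq_IZR; lra). lia.
 + rewrite C1 in H4t; [|lia|symmetry; apply (Nat.mod_unique _ _ (8 * (p / 24) + 3)); lia].
  assert (Et : (4 * zsum t L1 = 2 * zsum T L1)%Z) by (apply eq_IZR; rewrite !mult_IZR; lra).
  assert (H8 : (p mod 8 = 3)%nat) by (symmetry; apply (Nat.mod_unique _ _ (3 * (p / 24) + 1)); lia).
  assert (HTs : exists k, zsum T L1 = (4 * Z.of_nat (List.length L1) + 8 * k)%Z).
  { assert (Gen : forall l, (forall A, In A l -> In A L1) -> exists k, zsum T l = (4 * Z.of_nat (List.length l) + 8 * k)%Z).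
   { induction l as [|A l IH]; intros Hl; [exists 0%Z; reflexivity|]. destruct IH as [k Hk]; [intros; apply Hl; right; assumption|].
    destruct (HT A) as [_ HT8]; [apply L1_unit, Hl; left; reflexivity|]. destruct (HT8 H8) as [j Ej]. exists (k + j)%Z. cbn [zsum fold_right List.length]. unfold zsum in Hk. lia. } auto. }
  destruct HTs as [k Hk]. lia.
Qed.
End Large.
End Residues.

(** Since 3 divides the level, the cusp 1/3 needs its own matrix [e3 T W T = (6, 3; 18, 12)], and 18
    takes the place of [6 p^2]. Its cocycle has [a = -1] and [b = 1], so that [2 a / 3 + b = 1/3]
    gives the linear coefficient [- 4 om], nonzero without any congruence. *)
Lemma half_equation_3 chi G om B0 B3 : Znumtheory.prime (Z.of_nat 3) -> character 3 chi -> periods G om B0 B3 -> exists q0 q2, forall y, 0 < y ->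
 lsum (fun A => Wp 3 A y) (L1 3 chi) + 18 * y ^ 2 * lsum (fun A => Wp 3 A (/ (18 * y))) (L1 3 chi) = q0 - 4 * om * y + q2 * y ^ 2.
Proof.
intros Hp Hchi Hper.
assert (EL : L1 3 chi = 1%nat :: nil).
{ unfold L1, residues. simpl. unfold is1. rewrite (chi_0 3 chi Hchi 0), (chi_1 3 chi Hchi), (chi_opp 3 chi Hchi 1 2 1), (chi_1 3 chi Hchi) by tauto. reflexivity. }
pose proof (Geo_e3 G om B0 B3 _ _ _ _ _ _ _ _ _ Hper (Geo_T G om 1 _ _ _ _ _ _ _ _ _ (or_introl eq_refl)
 (Geo_W G om B0 B3 _ _ _ _ _ _ _ _ _ Hper (Geo_T G om 1 _ _ _ _ _ _ _ _ _ (or_introl eq_refl) (Geo_id G om))))) as HG.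
match type of HG with Geo _ _ ?p ?q ?r ?s ?a ?b ?c _ _ =>
 replace p with 6 in HG by ring; replace q with 3 in HG by ring; replace r with 18 in HG by ring; replace s with 12 in HG by ring;
 replace a with (-1) in HG by ring; replace b with 1 in HG by ring end.
apply Geo_at in HG; [|lra]. destruct HG as [q0 [q2 H]]. exists q0, q2. intros y Hy.
assert (Hv : 0 < / (18 * y)) by pos.
destruct (H _ Hv) as [H1 _]. rewrite EL. unfold lsum, fold_right, Wp.
replace ((6 * 12 - 3 * 18) / (18 ^ 2 * / (18 * y))) with y in H1 by (field; lra).
replace ((6 * 12 - 3 * 18) / (18 * / (18 * y)) ^ 2) with (18 * y ^ 2) in H1 by (field; lra).
rewrite <- (Ei_per 1) in H1 at 1. rewrite <- (Ei_per 1 (- (12 / 18))), Ei_per in H1. replace (6 / 18) with (INR 1 / INR 3) in H1 by (simpl; field). replace (- (12 / 18) + INR 1) with (INR 1 / INR 3) in H1 by (simpl; field).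
rewrite !Rplus_0_r, H1. simpl. field.
Qed.

Lemma Wp_negr p A y : (p mod 4 = 3)%nat -> (A < p)%nat -> Wp p (negr p A) y = - Wp p A y.
Proof.
intros Hp4 H. destruct (negr_spec p Hp4 A H) as [[-> E]|[H0 E]]; rewrite E.
- apply (Wp_opp p Hp4 0 0 0). lia.
- apply (Wp_opp p Hp4 _ _ 1). lia.
Qed.

(** The values at 2 and 3 multiply to -1 only in the classes 7 and 11 modulo 24; they multiply to 1
    in the classes 19 and 23, and the classes 3 and 15 are excluded by divisibility by 3. *)
Lemma sign_plus p chi : Znumtheory.prime (Z.of_nat p) -> (p mod 4 = 3)%nat -> character p chi -> p <> 3%nat -> - IZR (chi 6%nat) = 1 ->
 (p mod 24 = 7 \/ p mod 24 = 11)%nat.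
Proof.
intros Hp Hp4 Hchi H3 E. assert (E6 : chi 6%nat = (-1)%Z) by (apply eq_IZR; lra).
destruct Hchi as [Hmul [_ [_ [_ [_ [_ [_ [C2p [C2m [C3p C3m]]]]]]]]]]. change 6%nat with (2 * 3)%nat in E6. rewrite Hmul in E6.
pose proof (Nat.div_mod_eq p 24) as Ed. pose proof (Nat.mod_upper_bound p 24 ltac:(lia)) as Hb. pose proof (Nat.div_mod_eq p 4) as Ed4.
set (r := (p mod 24)%nat) in *. set (k := (p / 24)%nat) in *.
assert (H8 : forall j, (r = 8 * (r / 8) + j -> j < 8 -> p mod 8 = j)%nat) by (intros j Hr Hj; symmetry; apply (Nat.mod_unique _ _ (3 * k + r / 8)); lia).
assert (Hm3 : forall j, (r = 3 * (r / 3) + j -> j < 3 -> p mod 3 = j)%nat) by (intros j Hr Hj; symmetry; apply (Nat.mod_unique _ _ (8 * k + r / 3)); lia).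
assert (Hr : (r = 3 \/ r = 7 \/ r = 11 \/ r = 15 \/ r = 19 \/ r = 23)%nat) by lia. clearbody r.
assert (H03 : (r = 3 \/ r = 15 -> False)%nat).
{ intros Hr3. destruct (prime_divisors _ Hp 3) as [D|[D|[D|D]]]; try lia. exists (Z.of_nat (8 * k + r / 3)).
 destruct Hr3 as [-> | ->]; [change (3 / 3)%nat with 1%nat|change (15 / 3)%nat with 5%nat]; lia. }
destruct Hr as [Hr|[Hr|[Hr|[Hr|[Hr|Hr]]]]]; try tauto.
- rewrite C2m, C3m in E6; [lia|lia|apply Hm3; subst r; reflexivity || (lia)|apply H8; subst r; reflexivity || (lia)].
- rewrite C2p, C3p in E6; [lia|lia|apply Hm3; subst r; reflexivity || (lia)|apply H8; subst r; reflexivity || (lia)].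
Qed.

(** Up to the factor [2 / g] the sum over [L1] is the twisted series. For [p = 3] the sign is 1 and
    [q1] is visibly nonzero; for other primes with sign 1 it is nonzero because [S] is. *)
Lemma functional_equation p chi : Znumtheory.prime (Z.of_nat p) -> (p mod 4 = 3)%nat -> character p chi ->
 exists N eps q0 q1 q2 : R, 0 < N /\ (eps = 1 /\ q1 <> 0 \/ eps = -1) /\
 forall y, 0 < y -> hh (eps * N) N (fun y => PSeries (fun n => ei n * IZR (chi n)) (exp (- (2 * PI * y)))) y = q0 + q1 * y + q2 * y ^ 2.
Proof.
intros Hp Hp4 Hchi. destruct periods_ex as [G [om [B0 [B3 Hper]]]]. pose proof (proj1 Hper) as Hom.
pose proof (gauss_nz p chi Hp Hp4 Hchi) as Hg. set (g := gauss p chi 1) in *. pose proof (INR_p p Hp4) as Hpp.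
assert (HY : forall y, 0 < y -> PSeries (fun n => ei n * IZR (chi n)) (exp (- (2 * PI * y))) = 2 / g * lsum (fun A => Wp p A y) (L1 p chi)).
{ intros y Hy. pose proof (twisted_sum p chi y Hp Hp4 Hchi Hy) as E.
 change (lsum (fun A => IZR (chi A) * Wp p A y) (residues p) = g * PSeries (fun n => ei n * IZR (chi n)) (exp (- (2 * PI * y)))) in E.
 rewrite (half_sum p chi Hp4 Hchi (fun A => Wp p A y)) in E by (intros; apply Wp_negr; assumption).
 apply Rmult_eq_reg_l with g; auto. rewrite <- E. field. exact Hg. }
assert (HN : forall N eps q0 q1 q2 : R, 0 < N -> (forall y, 0 < y -> lsum (fun A => Wp p A y) (L1 p chi) + eps * N * y ^ 2 * lsum (fun A => Wp p A (/ (N * y))) (L1 p chi) = q0 + q1 * y + q2 * y ^ 2) ->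
 forall y, 0 < y -> hh (eps * N) N (fun y => PSeries (fun n => ei n * IZR (chi n)) (exp (- (2 * PI * y)))) y = 2 / g * q0 + 2 / g * q1 * y + 2 / g * q2 * y ^ 2).
{ intros N eps q0 q1 q2 HN H y Hy. unfold hh. rewrite !HY by pos.
 transitivity (2 / g * (q0 + q1 * y + q2 * y ^ 2)); [|ring]. rewrite <- H by lra. ring. }
assert (Hg2 : 2 / g <> 0) by (apply Rmult_integral_contrapositive_currified; [lra|apply Rinv_neq_0_compat, Hg]).
destruct (Nat.eq_dec p 3) as [E3|E3].
- assert (H3 : exists q0 q2, forall y, 0 < y -> lsum (fun A => Wp p A y) (L1 p chi) + 18 * y ^ 2 * lsum (fun A => Wp p A (/ (18 * y))) (L1 p chi) = q0 - 4 * om * y + q2 * y ^ 2).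
 { subst p. apply (half_equation_3 chi G om B0 B3); assumption. }
 destruct H3 as [q0 [q2 H]]. exists 18, 1, (2 / g * q0), (2 / g * (- 4 * om)), (2 / g * q2). split; [lra|]. split.
 + nra.
 + apply HN; [lra|]. intros y Hy. specialize (H y Hy). lra.
- destruct (half_equation p chi Hp Hp4 Hchi E3 G om B0 B3 Hper) as [eps [q0 [q2 [S [He [Hc [H HS]]]]]]].
 assert (HN0 : 0 < 6 * INR p ^ 2) by pos.
 exists (6 * INR p ^ 2), eps, (2 / g * q0), (2 / g * (- (12 * om / INR p * IZR S))), (2 / g * q2). split; eauto. split.
 + destruct He as [He|He]; [left|lra]. split; auto.
  assert (Hm : (p mod 24 = 7 \/ p mod 24 = 11)%nat) by exact (sign_plus p chi Hp Hp4 Hchi E3 ltac:(lra)).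
  apply Rmult_integral_contrapositive_currified; [lra|]. apply Ropp_neq_0_compat, Rmult_integral_contrapositive_currified; [|apply not_0_IZR, HS, Hm].
  apply Rmult_integral_contrapositive_currified; [lra|pos].
 + apply HN; auto. intros y Hy. rewrite (H y Hy). ring.
Qed.

(** * Gamma factors and the root number *)

(** The variable is scaled by [sqrt N], which turns the involution into [y -> 1/y]. The factor
    [kap^-3] compensates for the three derivatives, so that the coefficients become exactly those of
    the twist of [f]. *)
Lemma twist_hh p chi : Znumtheory.prime (Z.of_nat p) -> (p mod 4 = 3)%nat -> character p chi ->
 exists e kap eps q0 q1 q2, eicher e (fun n => a n * IZR (chi n)) kap /\ (eps = 1 /\ q1 <> 0 \/ eps = -1) /\
 forall y, 0 < y -> hh eps 1 (qexp e kap) y = q0 + q1 * y + q2 * y ^ 2.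
Proof.
intros Hp Hp4 Hchi. destruct (functional_equation p chi Hp Hp4 Hchi) as [N [eps [q0 [q1 [q2 [HN [He H]]]]]]].
pose proof (sqrt_lt_R0 N HN) as Hs. pose proof (sqrt_sqrt N (Rlt_le _ _ HN)) as Hss. pose proof PI_RGT_0 as Hpi.
set (r := sqrt N) in *. set (kap := 2 * PI / r).
assert (Hk : 0 < kap) by pos.
assert (Hk3 : 0 < kap ^ 3) by pos.
set (u := fun n => ei n * IZR (chi n)) in *.
exists (PS_scal (/ kap ^ 3) u), kap, eps, (/ kap ^ 3 * q0), (/ kap ^ 3 * (q1 / r)), (/ kap ^ 3 * (q2 / r ^ 2)). split; [|split].
- split; [|split; [|split; auto]].
 + unfold PS_scal, u. rewrite (chi_0 p chi Hchi 0) by apply Nat.Div0.mod_0_l. unfold scal; simpl; unfold mult; simpl. ring.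
 + rewrite CV_radius_scal by pos. apply (radius_dom u ei); [|apply ei_radius].
  intros n. unfold u. rewrite Rabs_mult. rewrite <- (Rmult_1_r (Rabs (ei n))) at 2. apply Rmult_le_compat_l; [pos|].
  destruct (Nat.eq_dec (n mod p) 0) as [E|E]; [rewrite (chi_0 p chi Hchi n E), Rabs_R0; lra|].
  destruct (chi_pm p chi Hchi n E) as [-> | ->]; [rewrite Rabs_R1; lra|]. rewrite Rabs_left; lra.
 + intros n. rewrite <- dn3_ei. unfold dn, PS_scal, u, scal; simpl; unfold mult; simpl. field. lra.
- destruct He as [[He Hq]|He]; [left|lra]. split; auto.
 repeat apply Rmult_integral_contrapositive_currified; try apply Rinv_neq_0_compat; lra.
- intros y Hy. assert (Hq : forall t, qexp (PS_scal (/ kap ^ 3) u) kap t = / kap ^ 3 * PSeries u (exp (- (2 * PI * (t / r))))).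
 { intros t. unfold qexp. rewrite PSeries_scal. f_equal. rewrite Rmult_1_l. f_equal. f_equal. unfold kap. lra. }
 unfold hh. rewrite !Hq. specialize (H (y / r) ltac:(apply Rdiv_lt_0_compat; lra)). unfold hh in H.
 replace (/ (N * (y / r))) with (/ (1 * y) / r) in H by (rewrite <- Hss; field; lra).
 replace (eps * N * (y / r) ^ 2) with (eps * y ^ 2) in H by (rewrite <- Hss; field; lra).
 transitivity (/ kap ^ 3 * (q0 + q1 * (y / r) + q2 * (y / r) ^ 2)); [nra|field; lra].
Qed.

Lemma is_series_Re_Im (u : nat -> C) (l : C) : is_series u l -> is_series (fun n => Re (u n)) (Re l) /\ is_series (fun n => Im (u n)) (Im l).
Proof.
intros H. assert (E : forall n, sum_n u n = (sum_n (fun n => Re (u n)) n, sum_n (fun n => Im (u n)) n)).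
{ induction n as [|n IH]; auto. rewrite !sum_Sn, IH. reflexivity. }
destruct l as [x y]. split.
- apply (filterlim_ext (fun n => fst (sum_n u n))); [intros n; rewrite E; reflexivity|]. eapply filterlim_comp; [eauto|]. apply (continuous_fst (U := R_UniformSpace) (V := R_UniformSpace) x y).
- apply (filterlim_ext (fun n => snd (sum_n u n))); [intros n; rewrite E; reflexivity|]. eapply filterlim_comp; eauto. apply (continuous_snd (U := R_UniformSpace) (V := R_UniformSpace) x y).
Qed.

Lemma cpow_real x s : cpow x (RtoC s) = RtoC (exp (s * ln x)).
Proof. unfold cpow, RtoC. simpl. rewrite Rmult_0_l, cos_0, sin_0. f_equal; ring. Qed.

Lemma twisted_dirichlet p chi F : character p chi -> is_twisted_L (- Z.of_nat p) F -> dirichlet (fun n => a n * IZR (chi n)) F.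
Proof.
intros Hchi [HF HL]. split; [intros z; apply entire_holo, HF|]. intros s Hs. specialize (HL (RtoC s) ltac:(simpl; exact Hs)).
destruct (is_series_Re_Im _ _ HL) as [H1 H2].
assert (E : forall n, Lterm (- Z.of_nat p) (RtoC s) n = RtoC (a n * IZR (chi n) * rpow (INR n) (- (s + 3 / 2)))).
{ intros [|n]; [unfold Lterm, a; simpl f_coef; f_equal; ring|]. unfold Lterm. rewrite <- RtoC_opp, cpow_real, <- RtoC_mult. f_equal.
 assert (Hn : 0 < INR (S n)) by pos. unfold rpow. destruct (Rle_dec (INR (S n)) 0) as [Hc|_]; [lra|].
 destruct Hchi as [_ [_ [_ [_ [_ [_ [He _]]]]]]]. rewrite He by lia. unfold a, Rpower.
 replace (- (s + 3 / 2) * ln (INR (S n))) with (- s * ln (INR (S n)) + - (3 / 2 * ln (INR (S n)))) by ring. rewrite exp_plus, exp_Ropp. lra. }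
split.
- apply (is_series_ext (fun n => Re (Lterm (- Z.of_nat p) (RtoC s) n))); [intros n; rewrite E; reflexivity|pos].
- assert (H0 : is_series (fun n : nat => Im (Lterm (- Z.of_nat p) (RtoC s) n)) 0).
 { apply (is_series_ext (fun n : nat => 0)); [intros n; rewrite E; reflexivity|].
  apply (filterlim_ext (fun _ : nat => 0)); [intros n; rewrite sum_n_const; ring|apply filterlim_const]. }
 rewrite <- (is_series_unique _ _ H2). exact (is_series_unique _ _ H0).
Qed.

(** * Gauss' product for the Gamma function at real arguments *)

Fixpoint rising (w : R) (n : nat) : R := match n with O => w | S m => rising w m * (w + INR n) end.

Lemma rising_pos w n : 0 < w -> 0 < rising w n.
Proof. intros Hw. induction n as [|n IH]; simpl; auto. pose proof (pos_INR (S n)) as H. simpl in H. apply Rmult_lt_0_compat; lra. Qed.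

Definition gseq (w : R) (n : nat) : R := INR (fact n) * exp (w * ln (INR n)) / rising w n.

Lemma foldr_fold_right {A B} (f : A -> B -> B) c l : seq.foldr f c l = fold_right f c l.
Proof. induction l as [|x l IH]; easy. Qed.

Lemma iota_seq m n : seq.iota m n = List.seq m n.
Proof. easy. Qed.

Lemma gauss_seq_real w n : 0 < w -> gauss_seq (RtoC w) n = RtoC (gseq w n).
Proof.
intros Hw. unfold gauss_seq, gseq. rewrite cpow_real, foldr_fold_right, iota_seq.
assert (Hl : forall l c, fold_right (fun (k : nat) acc => ((RtoC w + RtoC (INR k)) * acc)%C) c l = (fold_right (fun (k : nat) acc => ((RtoC w + RtoC (INR k)) * acc)%C) (RtoC 1) l * c)%C).
{ induction l as [|x l IH]; intros c; simpl fold_right; [ring|]. rewrite IH. ring. }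
assert (Hr : forall m, fold_right (fun (k : nat) acc => ((RtoC w + RtoC (INR k)) * acc)%C) (RtoC 1) (List.seq 0 (S m)) = RtoC (rising w m)).
{ induction m as [|m IH]; [Cring|].
 rewrite seq_S, fold_right_app, Hl, IH. Cring. }
rewrite Hr, <- RtoC_mult, <- RtoC_div by (apply Rgt_not_eq, rising_pos, Hw). reflexivity.
Qed.

(* Convexity of [exp]; it yields Bernoulli's inequality with real exponent, by which [gtop] decreases. *)
Lemma exp_convex l u : 0 <= l <= 1 -> exp (l * u) <= l * exp u + (1 - l).
Proof.
intros Hl. pose proof (exp_ineq1_le (u - l * u)) as H1. pose proof (exp_ineq1_le (- (l * u))) as H2. pose proof (exp_pos (l * u)) as Ht.
assert (E1 : exp u = exp (l * u) * exp (u - l * u)) by (rewrite <- exp_plus; f_equal; ring).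
assert (E2 : 1 = exp (l * u) * exp (- (l * u))) by (rewrite <- exp_plus, <- exp_0; f_equal; ring). set (x := exp (u - l * u)) in *. set (y := exp (- (l * u))) in *.
assert (G1 : l * (1 + (u - l * u)) <= l * x) by nra.
assert (G2 : (1 - l) * (1 + - (l * u)) <= (1 - l) * y) by nra. nra.
Qed.

Lemma ratio_step (f r e e' b m : R) : 0 < f -> 0 < r -> 0 < b -> e * b <= m * e' -> f * e / r <= m * f * e' / (r * b).
Proof.
intros Hf Hr Hb H. apply (Rmult_le_reg_r (r * b)); [pos|].
replace (f * e / r * (r * b)) with (f * (e * b)) by (field; lra). replace (m * f * e' / (r * b) * (r * b)) with (f * (m * e')) by (field; lra).
apply Rmult_le_compat_l; lra.
Qed.

(** With [x = n + 1] the claim is [1 + w / (x+1) <= ((x+1)/x)^w], which follows from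
    [ln ((x+1)/x) >= 1/(x+1)] and [1 + v <= exp v]. *)
Lemma gseq_incr w n : 0 < w -> gseq w (S n) <= gseq w (S (S n)).
Proof.
intros Hw. unfold gseq. pose proof (lt_0_INR (S n) ltac:(lia)) as Hn. set (m := S n) in *.
change (fact (S m)) with ((S m) * fact m)%nat. change (rising w (S m)) with (rising w m * (w + INR (S m))). rewrite mult_INR, S_INR. apply ratio_step; [pos|apply rising_pos, Hw|lra|].
set (x := INR m) in *.
assert (H1 : / (x + 1) <= ln ((x + 1) / x)).
{ rewrite <- (ln_exp (/ (x + 1))). apply ln_le; [pos|].
 pose proof (exp_ineq1_le (- / (x + 1))) as H. apply Rle_trans with (/ exp (- / (x + 1))); [rewrite exp_Ropp, Rinv_inv; lra|].
 replace ((x + 1) / x) with (/ (1 + - / (x + 1))) by (field; lra). apply Rinv_le_contravar; auto.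
 replace (1 + - / (x + 1)) with (x / (x + 1)) by (field; lra). apply Rdiv_lt_0_compat; lra. }
unfold Rdiv in H1. rewrite ln_mult, ln_Rinv in H1 by (try apply Rinv_0_lt_compat; lra).
pose proof (exp_ineq1_le (w * / (x + 1))) as H2.
replace (w * ln (x + 1)) with (w * ln x + w * (ln (x + 1) + - ln x)) by ring. rewrite exp_plus.
assert (H3 : exp (w * / (x + 1)) <= exp (w * (ln (x + 1) + - ln x))).
{ apply exp_le, Rmult_le_compat_l; lra. }
assert (H4 : w + (x + 1) = (x + 1) * (1 + w * / (x + 1))) by (field; lra). rewrite H4. set (X := exp (w * ln x)). set (Y := exp (w * (ln (x + 1) + - ln x))) in *.
replace (X * ((x + 1) * (1 + w * / (x + 1)))) with ((x + 1) * X * (1 + w * / (x + 1))) by ring.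
replace ((x + 1) * (X * Y)) with ((x + 1) * X * Y) by ring. apply Rmult_le_compat_l; pos.
Qed.

(* An upper bound for the increasing sequence [gseq]. *)
Definition gtop (w : R) (n : nat) : R := INR (fact n) * exp (w * ln (INR n + w)) / rising w n.

Lemma gtop_decr w n : 1 <= w -> gtop w (S n) <= gtop w n.
Proof.
intros Hw. unfold gtop. pose proof (pos_INR n) as Hn.
change (fact (S n)) with ((S n) * fact n)%nat. change (rising w (S n)) with (rising w n * (w + INR (S n))). rewrite mult_INR, S_INR.
set (x := INR n) in *. pose proof (rising_pos w n ltac:(lra)) as Hr. pose proof (INR_fact_lt_0 n) as Hf.
set (m := x + 1 + w).
assert (Hb : (x + 1) * exp (w * ln m) <= m * exp (w * ln (x + w))).
(* The weights [1/w] and [1 - 1/w] are made so that the mean of [(x+1)/m] and 1 is exactly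
   [(x+w)/m]; hence [((x+1)/m)^(1/w) <= (x+w)/m]. *)
{ pose proof (exp_convex (/ w) (ln (x + 1) - ln m)) as Hc.
 assert (Hw1 : 0 <= / w <= 1) by (split; [pos|rewrite <- Rinv_1; apply Rinv_le_contravar; lra]). unfold Rminus at 2 in Hc. rewrite exp_plus, exp_Ropp, !exp_ln in Hc by (unfold m; lra).
 assert (E : / w * ((x + 1) * / m) + (1 - / w) = (x + w) / m) by (unfold m; field; split; lra).
 assert (Hl : / w * (ln (x + 1) - ln m) <= ln (x + w) - ln m).
 { rewrite <- (ln_exp (/ w * (ln (x + 1) - ln m))). replace (ln (x + w) - ln m) with (ln ((x + w) / m)); [apply ln_le; pos|].
  unfold Rdiv. rewrite ln_mult, ln_Rinv; pos. }
 assert (Hl2 : ln (x + 1) - ln m <= w * (ln (x + w) - ln m)).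
 { apply (Rmult_le_compat_l w) in Hl; [|lra]. rewrite <- Rmult_assoc, Rinv_r, Rmult_1_l in Hl by lra. exact Hl. }
 rewrite <- (exp_ln (x + 1)) at 1 by lra. rewrite <- (exp_ln m) at 2 by pos. rewrite <- !exp_plus. apply exp_le. lra. } replace (w + (x + 1)) with m by (unfold m; ring).
apply (Rmult_le_reg_r (rising w n * m)); [pos|].
assert (Hm : m <> 0) by pos.
replace ((x + 1) * INR (fact n) * exp (w * ln m) / (rising w n * m) * (rising w n * m)) with (INR (fact n) * ((x + 1) * exp (w * ln m))) by (field; split; lra).
replace (INR (fact n) * exp (w * ln (x + w)) / rising w n * (rising w n * m)) with (INR (fact n) * (m * exp (w * ln (x + w)))) by (field; lra).
apply Rmult_le_compat_l; lra.
Qed.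

(** The root number condition speaks of Gamma values through the limit of Gauss' product, so limits
    must be exhibited before it can be applied, and their positivity is what decides the comparison
    of signs. *)
Lemma is_Gamma_pos w : 1 <= w -> exists g, 0 < g /\ is_Gamma (RtoC w) (RtoC g).
Proof.
intros Hw.
assert (Hb : forall n, gseq w (S n) <= gtop w 0).
{ intros n. apply Rle_trans with (gtop w (S n)).
 - apply Rmult_le_compat_r; [apply Rlt_le, Rinv_0_lt_compat, rising_pos; lra|]. apply Rmult_le_compat_l; [pos|].
  apply exp_le, Rmult_le_compat_l; [lra|]. apply ln_le; [pos|lra].
 - induction n as [|n IH]; [apply gtop_decr, Hw|]. eapply Rle_trans; [apply gtop_decr, Hw|lra]. }
destruct (ex_finite_lim_seq_incr (fun n => gseq w (S n)) (gtop w 0) (fun n => gseq_incr w n ltac:(lra)) Hb) as [g Hg].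
exists g. split.
- apply Rlt_le_trans with (gseq w 1); [pos|].
 apply (is_lim_seq_incr_compare (fun n => gseq w (S n)) g Hg (fun n => gseq_incr w n ltac:(lra)) 0).
- apply is_lim_seq_incr_1 in Hg. apply filterlim_locally. intros eps. apply is_lim_seq_spec in Hg. specialize (Hg eps). destruct Hg as [M HM]. exists M.
 intros n Hn. rewrite gauss_seq_real by lra. split; [exact (HM n Hn)|]. apply ball_center.
Qed.

(** A discriminant of the form [4 m] is excluded because 4 cannot divide the prime [- D]; the other
    form gives [p = 3] modulo 4. *)
Lemma prime_fund_disc D : fund_disc D -> (D < 0)%Z -> Znumtheory.prime (- D) -> exists p : nat, D = (- Z.of_nat p)%Z /\ (p mod 4 = 3)%nat.
Proof.
intros [_ HD] Hneg Hp. exists (Z.to_nat (- D)). assert (E : D = (- Z.of_nat (Z.to_nat (- D)))%Z) by lia. split; auto. destruct HD as [[H4 _]|[m [Hm _]]].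
- apply Nat2Z.inj. rewrite Nat2Z.inj_mod. Z.to_euclidean_division_equations. lia.
- destruct (prime_divisors _ Hp 2) as [H|[H|[H|H]]]; try lia. exists (- (2 * m))%Z. lia.
Qed.

Lemma GammaC_of_real w g : exists r, r = 2 * exp (- w * ln (2 * PI)) /\ GammaC_of (RtoC w) (RtoC g) = RtoC (r * g).
Proof. eexists. split; eauto. unfold GammaC_of. rewrite <- RtoC_opp, cpow_real, <- !RtoC_mult. Cring. Qed.

Theorem theorem1p3 :
 forall D : Z,
  fund_disc D -> (D < 0)%Z -> Znumtheory.prime (- D)%Z ->
  root_number_plus D ->
  central_value_nonzero D.
Proof.
intros D HD Hneg Hp Hroot F HF H0. destruct (prime_fund_disc D HD Hneg Hp) as [p [-> Hp4]].
rewrite Z.opp_involutive in Hp. pose proof (@character_J p Hp Hp4) as Hchi. set (chi := Residue.J p) in *.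
pose proof (twisted_dirichlet p chi F Hchi HF) as HF'.
destruct (twist_hh p chi Hp Hp4 Hchi) as [e [kap [eps [q0 [q1 [q2 [He [[[E Hq]|E] H]]]]]]]]; subst eps.
- apply Hq. exact (central_zero e _ kap q0 q1 q2 F He H HF' H0).
- assert (Hth : theta_data (fun n => a n * IZR (chi n)) kap (-1)) by exact (proj1 (eicher_hh _ _ _ (-1) _ _ _ He (or_intror eq_refl) H)).
 assert (Hz : forall s : R, 1 / 10 < s < 9 / 10 -> F (RtoC s) = RtoC 0).
 { intros s Hs. destruct (antisym _ _ _ (s + 3 / 2) Hth HF' ltac:(lra)) as [r [Hr Ea]].
  replace (s + 3 / 2 - 3 / 2) with s in Ea by ring. replace (5 / 2 - (s + 3 / 2)) with (1 - s) in Ea by field.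
  destruct Hroot as [N [HN HR]]. destruct (is_Gamma_pos (s + 3 / 2) ltac:(lra)) as [g1 [Hg1 G1]]. destruct (is_Gamma_pos (1 - s + 3 / 2) ltac:(lra)) as [g2 [Hg2 G2]].
  specialize (HR F HF (RtoC s) (RtoC g1) (RtoC g2)). rewrite <- !RtoC_minus, <- !RtoC_plus in HR. specialize (HR ltac:(simpl; lra) G1 G2).
  destruct (GammaC_of_real (s + 3 / 2) g1) as [r1 [R1 ->]] in HR. destruct (GammaC_of_real (1 - s + 3 / 2) g2) as [r2 [R2 E2]]. rewrite E2, cpow_real in HR.
  assert (P1 : 0 < r1 * g1) by (apply Rmult_lt_0_compat; [rewrite R1; apply Rmult_lt_0_compat; pos|lra]).
  assert (P2 : 0 < r2 * g2) by (apply Rmult_lt_0_compat; [rewrite R2; apply Rmult_lt_0_compat; pos|lra]).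
  set (x := exp ((1 / 2 - s) * ln N)) in *.
  (* Eliminating [F s] from the symmetric and the antisymmetric relation leaves [F (1 - s)] with
     this coefficient, a sum of two positive numbers. *)
  assert (Pos : 0 < r1 * g1 * r + x * (r2 * g2)) by pos.
  assert (Z0 : F (RtoC (1 - s)) = RtoC 0).
  { apply (Cmult_0_r_inv (RtoC (r1 * g1 * r + x * (r2 * g2)))); [|apply RtoC_neq0; lra].
   rewrite Ea in HR. rewrite RtoC_plus, (RtoC_mult (r1 * g1)), (RtoC_mult x).
   transitivity (RtoC x * (RtoC (r2 * g2) * F (RtoC (1 - s))) - RtoC (r1 * g1) * (- RtoC r * F (RtoC (1 - s))))%C; [ring|]. rewrite <- HR. ring. }
  rewrite Ea, Z0. ring. }
 pose proof (zero_contra _ F (proj1 Hth) HF' Hz) as E1. cbv beta in E1. rewrite (chi_1 p chi Hchi) in E1.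
 assert (E2 : a 1 = 1) by easy. lra.
Qed.
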